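(* Let $N\ge 1$ be an integer and $N<p<\infty$. Let $a\in L^\infty(\mathbb{R}^N)$ with $a_-=\operatorname{ess\,inf}_{\mathbb{R}^N} a>0$, let $f:\mathbb{R}^N\times\mathbb{R}\to\mathbb{R}$ be an $L^1$-Carathéodory function, and let $F(x,t)=\int_0^t f(x,\xi)\,d\xi$. Assume that there exist $x_0\in\mathbb{R}^N$, $R>0$ and two constants $c,d$ such that, with $S=B(x_0,R)\setminus B(x_0,\frac R2)$: (i) $0<c<d$; (ii) $F(x,t)\ge 0$ for a.e. $x\in S$ and for all $t\in[0,d]$; (iii) $\displaystyle \frac{\int_{\mathbb{R}^N}\max_{|t|\le c}F(x,t)\,dx}{c^p}<K_R\,\frac{\int_{B(x_0,\frac R2)}F(x,d)\,dx}{d^p}$; (iv) $\displaystyle\lim_{|t|\to+\infty}\frac{F(x,t)}{|t|^p}=0$ for a.e. $x\in\mathbb{R}^N$, uniformly with respect to $x$. Moreover, suppose that (v) $f(x,0)\ge 0$ for a.e. $x\in\mathbb{R}^N$. Then, for every $\lambda\in(\lambda_1,\lambda_2)$, where $$\lambda_1=\frac{1}{p\,k_a^p\,K_R}\,\frac{d^p}{\int_{B(x_0,\frac R2)}F(x,d)\,dx},\qquad \lambda_2=\frac{1}{p\,k_a^p}\,\frac{c^p}{\int_{\mathbb{R}^N}\max_{|t|\le c}F(x,t)\,dx},$$ the problem $$-\Delta_p u+a(x)|u|^{p-2}u=\lambda f(x,u)\ \text{ in }\mathbb{R}^N,\qquad u\in W^{1,p}(\mathbb{R}^N),$$ admits at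 least three (distinct) nonnegative weak solutions.
   Context: $\Delta_p u=\operatorname{div}(|\nabla u|^{p-2}\nabla u)$. $B(x_0,\rho)$ is the ball of $\mathbb{R}^N$ with centre $x_0$ and radius $\rho$. $f$ is $L^1$-Carathéodory means: $f(\cdot,t)$ is measurable for all $t\in\mathbb{R}$, $f(x,\cdot)$ is continuous for a.e. $x\in\mathbb{R}^N$, and $\sup_{|t|\le\sigma}|f(\cdot,t)|\in L^1(\mathbb{R}^N)$ for all $\sigma>0$. A function $u\in W^{1,p}(\mathbb{R}^N)$ is a weak solution of the problem if $$\int_{\mathbb{R}^N}\left(|\nabla u|^{p-2}\nabla u\cdot\nabla v+a(x)|u|^{p-2}uv\right)dx=\lambda\int_{\mathbb{R}^N}f(x,u)\,v\,dx\quad\text{for all }v\in W^{1,p}(\mathbb{R}^N).$$ Constants: $$k_a=\left(\frac1{a_-}\right)^{\frac{p-N}{p^2}}2^{\frac{p-1}{p}}\left(\frac{\Gamma(1+\frac N2)}{\pi^{N/2}}\right)^{\frac1p}\frac{1}{N^{\frac{N}{p^2}}}\left(\frac{p-1}{p-N}\right)^{\frac{N(p-1)}{p^2}},$$ $$K_R=\frac{1}{k_a^p}\,\frac{\Gamma(1+\frac N2)}{\pi^{N/2}}\left(\frac{R^{p-N}}{2^p-2^{p-N}+R^p\|a\|_\infty}\right),$$ where $\Gamma$ is the Gamma function. The uniform limit in (iv) means: for every $\varepsilon>0$ there is $\delta>0$ such that $|F(x,t)|\le\varepsilon|t|^p$ for a.e. $x\in\mathbb{R}^N$ and all $|t|>\delta$.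 Convention: if $\int_{\mathbb{R}^N}\max_{|t|\le c}F(x,t)\,dx=0$, then $\lambda_2=+\infty$. *)

(* Defs.v *)
From HB Require Import structures.
From mathcomp Require Import all_boot all_order all_algebra.
From mathcomp Require Import all_classical all_reals all_analysis.

Set Implicit Arguments.
Unset Strict Implicit.
Unset Printing Implicit Defensive.

Import Order.TTheory GRing.Theory Num.Theory.
Import numFieldNormedType.Exports.

Local Open Scope classical_set_scope.
Local Open Scope ring_scope.

Definition rV_display : measure_display -> measure_display.
Proof. exact. Qed.

(* Borel sigma-algebra of R^n, generated by the coordinate maps, as the
   library does for n.-tuple *)
Section rV_measurable.
Context (R : realType) (n : nat).

Let coors (i : 'I_n) (x : 'rV[R]_n) : measurableTypeR R := x ord0 i.

Let rV_set0 : g_sigma_preimage coors set0.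
Proof. exact: sigma_algebra0. Qed.

Let rV_setC A : g_sigma_preimage coors A -> g_sigma_preimage coors (~` A).
Proof. exact: sigma_algebraC. Qed.

Let rV_bigcup (F : (set 'rV[R]_n)^nat) : (forall i, g_sigma_preimage coors (F i)) ->
  g_sigma_preimage coors (\bigcup_i (F i)).
Proof. exact: sigma_algebra_bigcup. Qed.

HB.instance Definition _ := @isMeasurable.Build
  (rV_display (measure_tuple_display default_measure_display)) 'rV[R]_n
  (g_sigma_preimage coors) rV_set0 rV_setC rV_bigcup.

Lemma measurable_coor (i : 'I_n) :
  measurable_fun [set: 'rV[R]_n] (fun x : 'rV[R]_n => x ord0 i).
Proof.
move=> _ Y mY; rewrite setTI; apply: sub_sigma_algebra => /=.
rewrite -bigcup_seq/=; exists i => /=; first by rewrite mem_index_enum.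
by exists Y => //; rewrite setTI.
Qed.

Lemma measurable_fun_rVP d (T : measurableType d) (g : T -> 'rV[R]_n) :
  (forall i, measurable_fun setT (fun t => g t ord0 i)) ->
  measurable_fun setT g.
Proof.
move=> mg; suff : g_sigma_preimage (fun i => coors i \o g) `<=` measurable.
  rewrite g_sigma_preimage_comp => sub _ A mA.
  by apply: sub; exists A.
apply: smallest_sub; first exact: sigma_algebra_measurable.
rewrite -bigcup_seq; apply: bigcup_sub => i _.
by move=> A [B mB <-]; exact: mg.
Qed.

End rV_measurable.

Section lebesgue_borel.
Context (R : realType).

Definition rV_cons n (x : measurableTypeR R * 'rV[R]_n) : 'rV[R]_n.+1 :=
  row_mx (x.1%:M : 'rV[R]_1) x.2.

Lemma measurable_rV_cons n : measurable_fun setT (@rV_cons n).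
Proof.
apply: measurable_fun_rVP => i.
case: (split_ordP (i : 'I_(1 + n))) => j ->.
- rewrite (_ : (fun _ => _) = fst); first exact: measurable_fst.
  by apply/funext => x; rewrite /rV_cons; rewrite (@row_mxEl _ 1 1 n) mxE [j]ord1 eqxx.
- rewrite (_ : (fun _ => _) = (fun y : 'rV[R]_n => y ord0 j) \o snd).
    apply: measurableT_comp; [exact: measurable_coor|exact: measurable_snd].
  by apply/funext => x; rewrite /rV_cons (@row_mxEr _ 1 1 n).
Qed.

Section step.
Context (n : nat) (m : {sigma_finite_measure set 'rV[R]_n -> \bar R}).

Definition rV_measure_step : set 'rV[R]_n.+1 -> \bar R :=
  pushforward (lebesgue_measure \x m)%E (@rV_cons n).

Let step0 : rV_measure_step set0 = 0%E.
Proof. by rewrite /rV_measure_step /pushforward preimage_set0 measure0. Qed.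

Let step_ge0 A : (0 <= rV_measure_step A)%E.
Proof. by rewrite /rV_measure_step /pushforward measure_ge0. Qed.

Let step_sigma_additive : semi_sigma_additive rV_measure_step.
Proof.
have mc := @measurable_rV_cons n.
move=> F mF tF mUF; rewrite /rV_measure_step /pushforward preimage_bigcup.
apply: measure_semi_sigma_additive.
- by move=> k; rewrite -[X in measurable X]setTI; exact: mc.
- apply/trivIsetP => /= i j _ _ ij; rewrite -preimage_setI.
  by move/trivIsetP : tF => /(_ _ _ _ _ ij) ->//; rewrite preimage_set0.
- by rewrite -preimage_bigcup -[X in measurable X]setTI; exact: mc.
Qed.

HB.instance Definition _ := isMeasure.Build _ _ _ rV_measure_step
  step0 step_ge0 step_sigma_additive.

Let sf : sigma_finite setT rV_measure_step.
Proof.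
pose g (y : 'rV[R]_n.+1) : measurableTypeR R * 'rV[R]_n :=
  (y ord0 ord0, @rsubmx R 1 1 n y).
have gK : cancel (@rV_cons n) g.
  move=> [x y]; rewrite /g /rV_cons row_mxKr; congr pair.
  rewrite (_ : ord0 = lshift n ord0 :> 'I_(1 + n)); last exact/val_inj.
  by rewrite (@row_mxEl _ 1 1 n) mxE eqxx.
have mg : measurable_fun setT g.
  apply/measurable_fun_pairP; split; first exact: measurable_coor.
  apply: measurable_fun_rVP => i /=.
  rewrite (_ : (fun _ => _) = fun y : 'rV[R]_n.+1 => y ord0 (rshift 1 i)).
    exact: measurable_coor.
  by apply/funext => y; rewrite mxE.
have /sigma_finiteP[F [TF ndF Foo]] := sigma_finiteT (@lebesgue_measure R).
have /sigma_finiteP[G [TG ndG Goo]] := sigma_finiteT m.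
exists (fun k => g @^-1` (F k `*` G k)).
  rewrite -preimage_bigcup; apply/esym/seteqP; split=> // y _.
  have [k _ Fk] : (\bigcup_k F k) (g y).1 by rewrite -TF.
  have [l _ Gl] : (\bigcup_k G k) (g y).2 by rewrite -TG.
  exists (maxn k l) => //; split.
  - by move: Fk; exact/subsetPset/ndF/leq_maxl.
  - by move: Gl; exact/subsetPset/ndG/leq_maxr.
move=> k; have [mF Fltoo] := Foo k; have [mG Gltoo] := Goo k; split.
  by rewrite -[X in measurable X]setTI; apply: mg => //; exact: measurableX.
rewrite /rV_measure_step /pushforward -comp_preimage.
rewrite (_ : g \o _ = id); last by apply/funext => x; exact: gK.
by rewrite preimage_id product_measure1E// lte_mul_pinfty// ge0_fin_numE.
Qed.

HB.instance Definition _ := Measure_isSigmaFinite.Build _ _ _ rV_measure_step sf.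

End step.

Definition dirac_rV0 : {sigma_finite_measure set 'rV[R]_0 -> \bar R} :=
  \d_(0 : 'rV[R]_0).

Fixpoint lebesgue_borel n : {sigma_finite_measure set 'rV[R]_n -> \bar R} :=
  match n with
  | 0 => dirac_rV0
  | n'.+1 => rV_measure_step (lebesgue_borel n')
  end.

End lebesgue_borel.

(* Lebesgue measure on R^n: the completion of the Borel one, on the
   sigma-algebra of Caratheodory-measurable sets *)
Notation lebesgue_type R n := (caratheodory_type (mu_ext (@lebesgue_borel R n))).

Definition lebesgue_rV (R : realType) (n : nat) :=
  @completed_measure_extension _ 'rV[R]_n R (@lebesgue_borel R n).
HB.instance Definition _ (R : realType) (n : nat) :=
  Measure.on (@lebesgue_rV R n).
Arguments lebesgue_rV R n : clear implicits.

Section euclidean.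
Context (R : realType) (n : nat).
Implicit Types x y : 'rV[R]_n.

Definition dotv x y : R := \sum_(i < n) x ord0 i * y ord0 i.

(* The norm `| x | of the library on 'rV is the sup norm. *)
Definition enorm x : R := Num.sqrt (dotv x x).

Definition eball x (r : R) : set 'rV[R]_n := [set y | enorm (y - x) < r].

End euclidean.

Section sobolev.
Context (R : realType) (n : nat).
Local Notation mu := (lebesgue_rV R n).
Implicit Types (p : R) (u v phi : 'rV[R]_n -> R) (G H : 'rV[R]_n -> 'rV[R]_n).

Definition basis_rV (i : 'I_n) : 'rV[R]_n := delta_mx ord0 i.

Fixpoint class_C (k : nat) phi : Prop :=
  continuous phi /\
  if k is k'.+1 then
    forall i, (forall x, derivable phi x (basis_rV i)) /\
              class_C k' (fun x => 'D_(basis_rV i) phi x)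
  else True.

Definition test_function phi : Prop :=
  (forall k, class_C k phi) /\ compact (closure [set x | phi x != 0]).

Definition weak_gradient u G : Prop :=
  forall phi, test_function phi -> forall i,
    \int[mu]_x (u x * 'D_(basis_rV i) phi x) =
    - \int[mu]_x (G x ord0 i * phi x).

(* [sobolev p u G]: u is in W^{1,p}(R^n) and G represents its gradient, which
   is unique up to almost-everywhere equality. *)
Definition sobolev p u G : Prop :=
  [/\ u \in Lfun mu p%:E,
      forall i, (fun x => G x ord0 i) \in Lfun mu p%:E
    & weak_gradient u G].

(* Weak solutions in W^{1,p} of
     - Delta_p u + a |u|^(p-2) u = lambda f(x, u).
   With p < 2 the exponent is negative: powR has 0 `^ s = 0 for s != 0, so the
   integrand is 0 where the gradient or u vanishes, as intended. *)
Definition weak_solution p (a : 'rV[R]_n -> R) (f : 'rV[R]_n -> R -> R)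
    (lambda : R) u : Prop :=
  exists2 G, sobolev p u G &
  forall v H, sobolev p v H ->
    \int[mu]_x (enorm (G x) `^ (p - 2) * dotv (G x) (H x)
               + a x * `|u x| `^ (p - 2) * u x * v x) =
    lambda * \int[mu]_x (f x (u x) * v x).

End sobolev.

Section nonlinearity.
Context (R : realType) (n : nat) (f : 'rV[R]_n -> R -> R).
Local Notation mu := (lebesgue_rV R n).

Definition L1_caratheodory : Prop :=
  [/\ forall t, measurable_fun [set: lebesgue_type R n] (fun x => f x t),
      {ae mu, forall x, continuous (f x)}
    & forall s : R, 0 < s ->
        mu.-integrable setT
          (fun x => ereal_sup [set `|f x t|%:E | t in [set t | `|t| <= s]])].

Definition primitive (x : 'rV[R]_n) (t : R) : R :=
  if 0 <= t then \int[lebesgue_measure]_(xi in `[0, t]) f x xi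
  else - \int[lebesgue_measure]_(xi in `[t, 0]) f x xi.

(* max of F(x, t) over |t| <= c, attained whenever f(x, .) is continuous *)
Definition max_primitive (c : R) (x : 'rV[R]_n) : R :=
  sup [set primitive x t | t in [set t | `|t| <= c]].

End nonlinearity.

Section constants.
Context (R : realType).

Definition Gamma (s : R) : R :=
  \int[lebesgue_measure]_(t in `]0, +oo[) (t `^ (s - 1) * expR (- t)).

Definition gamma_ratio (n : nat) : R :=
  Gamma (1 + n%:R / 2) / pi `^ (n%:R / 2).

(* [am] stands for the essential infimum of a, [an] for its sup norm. *)
Definition const_k (n : nat) (p am : R) : R :=
  (1 / am) `^ ((p - n%:R) / p ^+ 2) * 2 `^ ((p - 1) / p)
  * gamma_ratio n `^ (1 / p) * (1 / n%:R `^ (n%:R / p ^+ 2))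
  * ((p - 1) / (p - n%:R)) `^ (n%:R * (p - 1) / p ^+ 2).

Definition const_K (n : nat) (p am an r : R) : R :=
  1 / const_k n p am `^ p * gamma_ratio n
  * (r `^ (p - n%:R) / (2 `^ p - 2 `^ (p - n%:R) + r `^ p * an)).

Definition lambda1 (n : nat) (p am an r d I : R) : R :=
  1 / (p * const_k n p am `^ p * const_K n p am an r) * (d `^ p / I).

Definition lambda2 (n : nat) (p am c I : R) : \bar R :=
  if I == 0 then +oo%E else (1 / (p * const_k n p am `^ p) * (c `^ p / I))%:E.

End constants.

(* Main.v *)
(* Weak solutions are the critical points of J = Phi - Psi on W^{1,p}, where
   p Phi(u) = int |grad u|^p + a |u|^p and Psi(u) = lambda int F(x, u), after f has been
   replaced by f(x, max(t, 0)).  Morrey's inequality on balls, with the radius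
   optimized, gives |u|^p <= k_a^p p Phi(u) almost everywhere.  Hence Phi(u) <= r
   with r = c^p / (p k_a^p) forces |u| <= c, and lambda < lambda2 makes J bounded
   below by a positive constant on the level set Phi = r, while J(0) = 0 inside and
   J < 0 outside at the cone function of height d, because lambda > lambda1.  By (iv)
   J is coercive, so it has a minimizer inside the level set and one outside.  A
   third critical point, with J > 0, exists because otherwise a descent flow
   would push the segment between these two below the barrier.  The minimax value is
   never computed: u is moved towards the minimizer T u of the convex functional
   v |-> Phi(v) - Psi'(u) v, which decreases J by a definite amount as long as
   no critical point is near.  Testing the equation of a solution with
   min(u, 0)^2 shows u >= 0. *)
Require Import Defs.
From HB Require Import structures.
From mathcomp Require Import all_boot all_order all_algebra.
From mathcomp Require Import all_classical all_reals all_analysis.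
From mathcomp Require Import measurable_realfun ess_sup_inf hoelder.
From mathcomp Require Import ring lra.

Set Implicit Arguments.
Unset Strict Implicit.
Unset Printing Implicit Defensive.

Import Order.TTheory GRing.Theory Num.Theory.
Import numFieldNormedType.Exports.

Local Open Scope classical_set_scope.
Local Open Scope ring_scope.

(** * Inequalities for real powers *)

Section powR_inequalities.
Context (R : realType).
Implicit Types p s t x y : R.

(** For p different from 2 there is no Hilbert structure. Uniform convexity of Phi, as a bound on
    Phi(x - y) by the midpoint defect (Phi(x) + Phi(y))/2 - Phi((x + y)/2), takes the place of weak
    compactness: it makes minimizing sequences Cauchy in norm. On all of R^N the embedding into
    bounded functions is not compact; compactness enters through the nonlinear term alone. Averages
    over rational balls and Morrey's estimate give a subsequence converging almost everywhere, and
    as f(x, u) is dominated by an integrable function for bounded u, Psi and its derivative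
    converge. Morrey's inequality comes straight from the weak gradient: testing with bumps gives
    the fundamental theorem of calculus, for each shift, along almost every segment, and integrating
    over the shifts in a ball produces the kernel |y|^(1-N). The constant K_R records the energy of
    the cone: a gradient 2d/R on the annulus and values at most d on the ball. Iterated integrals
    are taken for the Borel product structure, so the work is done on Borel representatives and the
    completed measure appears only at entry and exit. *)

Lemma powR_bernoulli_strict p t : 1 < p -> 0 <= t -> t != 1 ->
  1 + p * (t - 1) < t `^ p.
Proof.
move=> p1 t0 t1; have [->|tn0] := eqVneq t 0.
  by rewrite powR0 ?gt_eqF//; lra.
have tp : 0 < t by rewrite lt_neqAle eq_sym tn0.
pose l := ln t.
have l0 : l != 0 by rewrite /l ln_eq0.
have et : t = expR l by rewrite lnK.
have -> : t `^ p = expR (p * l) by rewrite et -expRM_natl_or || by rewrite /powR gt_eqF.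
(* With t = e^l, adding e^l times this bound to (p - 1) e^l times the bound for [1 - l] cancels the
   terms in l and leaves p e^l - (p - 1) < e^(p l). *)
have h1 : 1 + (p - 1) * l < expR ((p - 1) * l).
  by rewrite expR_gt1Dx// mulf_neq0// subr_eq0 gt_eqF.
have h2 : 1 - l < expR (- l) by rewrite expR_gt1Dx// oppr_eq0.
have e1 : expR (p * l) = expR l * expR ((p - 1) * l).
  by rewrite -expRD; congr expR; ring.
have e2 : 1 = expR l * expR (- l) by rewrite -expRD subrr expR0.
have el := expR_gt0 l.
have h3 : expR l * (1 + (p - 1) * l) < expR l * expR ((p - 1) * l) by rewrite ltr_pM2l.
have h4 : (p - 1) * (expR l * (1 - l)) < (p - 1) * (expR l * expR (- l)).
  by rewrite ltr_pM2l ?subr_gt0// ltr_pM2l.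
rewrite -e2 in h4.
by rewrite e1 et; lra.
Qed.

Lemma powR_bernoulli p t : 1 <= p -> 0 <= t -> 1 + p * (t - 1) <= t `^ p.
Proof.
rewrite le_eqVlt => /predU1P[<- t0|p1 t0]; first by rewrite powRr1//; lra.
have [->|t1] := eqVneq t 1; first by rewrite subrr mulr0 addr0 powR1.
by apply/ltW/powR_bernoulli_strict.
Qed.

(** Bernoulli's inequality at t / s, multiplied by s^p. At s = 0 the slope is 0 for p > 1, while for
    p = 1 the convention 0^0 = 1 makes it 1. *)
Lemma powR_tangent p s t : 1 <= p -> 0 <= s -> 0 <= t ->
  s `^ p + p * s `^ (p - 1) * (t - s) <= t `^ p.
Proof.
move=> p1 s0 t0; have [->|sn0] := eqVneq s 0.
  rewrite powR0 ?gt_eqF ?(lt_le_trans ltr01)//.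
  have [->|pn1] := eqVneq p 1; first by rewrite subrr powRr0 powRr1//; lra.
  by rewrite powR0 ?subr_eq0// mulr0 mul0r addr0 powR_ge0.
have sp : 0 < s by rewrite lt_neqAle eq_sym sn0.
have := powR_bernoulli p1 (divr_ge0 t0 s0).
move=> /(ler_wpM2l (powR_ge0 s p)).
rewrite -powRM ?divr_ge0// mulrCA divff ?gt_eqF// mulr1; apply: le_trans.
rewrite -(@mulr_powRB1 _ s p)// ?(lt_le_trans ltr01)//.
have -> : s * s `^ (p - 1) * (1 + p * (t / s - 1)) =
  s * s `^ (p - 1) + p * s `^ (p - 1) * (s * (t / s) - s) by ring.
by rewrite mulrCA divff// mulr1.
Qed.

Lemma powR_lipschitz p M s t : 1 <= p -> 0 <= s <= M -> 0 <= t <= M ->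
  `|s `^ p - t `^ p| <= p * M `^ (p - 1) * `|s - t|.
Proof.
move=> p1; wlog st : s t / t <= s => [hw sM tM|/andP[s0 sM] /andP[t0 tM]].
  have [/hw|/ltW/hw] := leP t s; first exact.
  by rewrite distrC (distrC s); exact.
rewrite !ger0_norm ?subr_ge0// ?ge0_ler_powR ?nnegrE// ?(le_trans ler01)//.
have := powR_tangent p1 s0 t0.
have : s `^ (p - 1) <= M `^ (p - 1).
  by rewrite ge0_ler_powR ?nnegrE ?subr_ge0// (le_trans s0).
set a := s `^ (p - 1); set b := M `^ _ => ab h.
have : p * a * (s - t) <= p * b * (s - t).
  by rewrite ler_wpM2r ?subr_ge0// ler_wpM2l// (le_trans ler01).
by lra.
Qed.

Lemma linear_le_powR p C : 1 < p -> 0 <= C ->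
  exists2 K, 0 <= K & forall s, 0 <= s -> C * s <= s `^ p / 2 + K.
Proof.
(* s0 solves s^(p-1) = 2 C: above it C s is at most s^p / 2, below it at most C s0. *)
move=> p1 C0; pose s0 := (2 * C) `^ (p - 1)^-1.
have s00 : 0 <= s0 by exact: powR_ge0.
exists (C * s0) => [|s sge0]; first exact: mulr_ge0.
have [ss0|/ltW ss0] := leP s s0.
  rewrite ler_wpDl ?ler_wpM2l// divr_ge0 ?powR_ge0//.
have h : 2 * C <= s `^ (p - 1).
  have -> : 2 * C = s0 `^ (p - 1).
    by rewrite -powRrM mulVf ?subr_eq0 ?gt_eqF// powRr1// mulr_ge0.
  by rewrite ge0_ler_powR ?nnegrE// subr_ge0 ltW.
rewrite -(@mulr_powRB1 _ s p)// ?(lt_trans ltr01)//.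
have := mulr_ge0 C0 s00; nra.
Qed.

(* The excess h t = t^p - 1 - p (t - 1) of Bernoulli's inequality satisfies
   h t / t^p >= h t0 / t0^p for t >= t0 > 1. *)
Lemma powR_bernoulli_far p t0 : 1 < p -> 1 < t0 ->
  exists2 k, 0 < k & forall t, t0 <= t -> k * t `^ p <= t `^ p - 1 - p * (t - 1).
Proof.
move=> p1 t01; have t00 : 0 < t0 by rewrite (lt_trans ltr01).
have tp0 : 0 < t0 `^ p by exact: powR_gt0.
exists ((t0 `^ p - (1 + p * (t0 - 1))) / t0 `^ p).
  by rewrite divr_gt0// subr_gt0 powR_bernoulli_strict ?ltW// gt_eqF.
move=> t tt0; pose s := t / t0.
have tE : t = s * t0 by rewrite /s divfK// gt_eqF.
have s1 : 1 <= s by rewrite /s ler_pdivlMr// mul1r.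
have s0 : 0 <= s by rewrite (le_trans ler01).
have tpE : t `^ p = s `^ p * t0 `^ p by rewrite tE powRM// ltW.
set T0 := t0 `^ p in tp0 tpE *; set S := s `^ p in tpE *.
have -> : (T0 - (1 + p * (t0 - 1))) / T0 * t `^ p = S * (T0 - (1 + p * (t0 - 1))).
  by rewrite tpE; field; rewrite gt_eqF.
rewrite tpE.
have hs := powR_bernoulli (ltW p1) s0.
have : (1 + p * (s - 1)) * (1 + p * (t0 - 1)) <= S * (1 + p * (t0 - 1)).
  by rewrite ler_wpM2r//; nra.
(* For t = s t0 the product of the two Bernoulli bounds exceeds the bound for t by p (p - 1) (s - 1)
   (t0 - 1), which is nonnegative. *)
suff : 1 + p * (t - 1) <= (1 + p * (s - 1)) * (1 + p * (t0 - 1)).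
  by lra.
rewrite tE.
have : 0 <= (p - 1) * (p * ((s - 1) * (t0 - 1))).
  by rewrite !mulr_ge0//; lra.
by lra.
Qed.

Lemma powR_gap_ge0 p x al be : 1 < p -> 0 <= x -> 0 <= al -> 0 <= be ->
  2 * x <= al + be -> 0 <= (al `^ p + be `^ p) / 2 - x `^ p.
Proof.
move=> p1 x0 al0 be0 h.
have := powR_tangent (ltW p1) x0 al0; have := powR_tangent (ltW p1) x0 be0.
have : 0 <= p * x `^ (p - 1) * (al + be - 2 * x).
  by rewrite !mulr_ge0 ?powR_ge0 ?subr_ge0// ltW// (lt_trans ltr01).
by lra.
Qed.

(* With al = |m + e|, be = |m - e|, x = |m| and y = |e| this is the uniform
   convexity of the p-th power of a Euclidean norm, for all p > 1 at once. *)
Lemma powR_parallelogram p tau : 1 < p -> 0 < tau -> exists2 K, 0 <= K &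
  forall x y al be, 0 <= x -> 0 <= y -> 0 <= al -> 0 <= be ->
    al ^+ 2 + be ^+ 2 = 2 * x ^+ 2 + 2 * y ^+ 2 -> 2 * x <= al + be ->
    y `^ p <= tau * x `^ p + K * ((al `^ p + be `^ p) / 2 - x `^ p).
Proof.
move=> p1 tau0; have p0 : 0 < p by rewrite (lt_trans ltr01).
pose s := tau `^ p^-1.
have s0 : 0 < s by exact: powR_gt0.
have sp : s `^ p = tau by rewrite -powRrM mulVf ?gt_eqF// powRr1// ltW.
(* If y > s x and be <= al, the parallelogram identity gives al^2 >= x^2 + y^2 >= (1 + s^2) x^2, so
   al / x lies in the range t >= t0 where the Bernoulli excess controls t^p. For y <= s x the term
   tau x^p alone suffices. *)
pose t0 := Num.sqrt (1 + s ^+ 2).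
have t01 : 1 < t0.
  by rewrite -[ltLHS]sqrtr1 ltr_sqrt; [rewrite ltrDl exprn_gt0|rewrite addr_gt0 ?exprn_gt0].
have [k k0 hk] := powR_bernoulli_far p1 t01.
have K0 : 0 <= 2 / k + 2 by rewrite addr_ge0// divr_ge0// ltW.
exists (2 / k + 2) => // x y al be x0 y0 al0 be0.
wlog albe : al be al0 be0 / be <= al => [hw|].
  have [/hw|/ltW/hw] := leP be al; first exact.
  by move=> hw' /[1!addrC] e2 /[1!addrC] le2; rewrite (addrC (al `^ p)); exact: hw'.
move=> e2 le2; have gap0 := powR_gap_ge0 p1 x0 al0 be0 le2.
set gap := _ - _ in gap0 *.
have yal : y <= al by rewrite -(@ler_pXn2r _ 2%N)//; nra.
have yalp : y `^ p <= al `^ p by rewrite ge0_ler_powR ?nnegrE// ltW.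
have [xe0|xn0] := eqVneq x 0.
  have hg : gap = (al `^ p + be `^ p) / 2.
    by rewrite /gap xe0 powR0 ?gt_eqF// subr0.
  have : 0 <= 2 / k * gap by rewrite mulr_ge0// divr_ge0// ltW.
  have := powR_ge0 be p; have := mulr_ge0 (ltW tau0) (powR_ge0 x p); lra.
have xp : 0 < x by rewrite lt_neqAle eq_sym xn0.
have [ysx|sxy] := leP y (s * x).
  have : y `^ p <= tau * x `^ p.
    by rewrite -sp -powRM// ?ge0_ler_powR ?nnegrE ?mulr_ge0// ltW.
  by have := mulr_ge0 K0 gap0; lra.
pose t := al / x; pose u := be / x.
have t0t : t0 <= t.
  rewrite -[leRHS](ger0_norm (divr_ge0 al0 x0)) -sqrtr_sqr ler_wsqrtr//.
  rewrite expr_div_n ler_pdivlMr ?exprn_gt0// .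
  have : (s * x) ^+ 2 <= y ^+ 2 by rewrite ler_pXn2r ?nnegrE ?mulr_ge0// ltW.
  have : be ^+ 2 <= al ^+ 2 by rewrite ler_pXn2r ?nnegrE.
  by rewrite exprMn; lra.
have h1 := hk _ t0t.
have h2 := powR_bernoulli (ltW p1) (divr_ge0 be0 x0).
have tu2 : 2 <= t + u by rewrite -mulrDl ler_pdivlMr.
have alE : al `^ p = t `^ p * x `^ p.
  by rewrite -powRM ?divr_ge0// /t divfK ?gt_eqF.
have beE : be `^ p = u `^ p * x `^ p.
  by rewrite -powRM ?divr_ge0// /u divfK ?gt_eqF.
have h3 : k * t `^ p <= t `^ p + u `^ p - 2.
  by have : 0 <= p * (t + u - 2) by [rewrite mulr_ge0 ?subr_ge0// ltW]; rewrite -/u in h2; lra.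
have h4 : k * al `^ p <= 2 * gap.
  have := ler_wpM2r (powR_ge0 x p) h3.
  by rewrite /gap alE beE; lra.
have : y `^ p <= 2 / k * gap.
  rewrite (le_trans yalp)// mulrAC ler_pdivlMr// mulrC//.
have := mulr_ge0 (ltW tau0) (powR_ge0 x p); lra.
Qed.

End powR_inequalities.

(** * Three critical points *)

Section three_critical_points.
Context (R : realType) (V : lmodType R) (p : R).
Variables (Phi Psi : V -> R) (B : V -> V -> R).

(** Homogeneity and convexity make this root of Phi a seminorm. It may vanish off 0, so uniqueness
    below is understood up to [nm] equal to 0. *)
Let nm x := Phi x `^ p^-1.
Let J x := Phi x - Psi x.

(* [B u] plays the role of the derivative of Psi at u; since Phi is convex,
   u is a critical point of Phi - Psi iff it minimizes the convex functional
   Phi - B u.  No differentiability of Phi is needed. *)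
Definition critical u := forall v, Phi u - B u u <= Phi v - B u v.

Hypothesis p1 : 1 < p.
Hypothesis Phi_ge0 : forall x, 0 <= Phi x.
Hypothesis PhiZ : forall t x, Phi (t *: x) = `|t| `^ p * Phi x.
Hypothesis Phi_convex : forall t x y, 0 <= t <= 1 ->
  Phi ((1 - t) *: x + t *: y) <= (1 - t) * Phi x + t * Phi y.
Hypothesis Phi_uniformly_convex : forall e, 0 < e ->
  exists2 C, 0 <= C & forall x y, Phi (x - y) <=
    e * (Phi x + Phi y) + C * ((Phi x + Phi y) / 2 - Phi (2^-1 *: (x + y))).
Hypothesis Phi_complete : forall w : nat -> V,
  (forall e, 0 < e -> exists n0, forall m n, (n0 <= m)%N -> (n0 <= n)%N ->
     Phi (w m - w n) <= e) ->
  exists v, forall e, 0 < e -> exists n0, forall n, (n0 <= n)%N ->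
     Phi (w n - v) <= e.
Hypothesis BD : forall u x y, B u (x + y) = B u x + B u y.
Hypothesis BZ : forall u t x, B u (t *: x) = t * B u x.
Hypothesis B_bounded : forall M, exists2 C, 0 <= C &
  forall u h, nm u <= M -> `|B u h| <= C * nm h.
Hypothesis B_continuous : forall M e, 0 < e -> exists2 dl, 0 < dl &
  forall u v h, nm u <= M -> nm v <= M -> nm (u - v) <= dl ->
    `|B u h - B v h| <= e * nm h.
Hypothesis Psi_derivative : forall M e, 0 < e -> exists2 dl, 0 < dl &
  forall u h, nm u <= M -> nm h <= dl ->
    `|Psi (u + h) - Psi u - B u h| <= e * nm h.
(** The midpoint clause is what minimization of J uses: along a minimizing sequence the midpoint
    defect of Phi is bounded, up to small errors, by that of Psi, which this clause sends to 0. *)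
Hypothesis compactness : forall (w : nat -> V) M, (forall n, nm (w n) <= M) ->
  exists2 s : nat -> nat, (forall n, (n <= s n)%N) &
    forall e, 0 < e -> exists n0, forall m n, (n0 <= m)%N -> (n0 <= n)%N ->
      (forall h, `|B (w (s m)) h - B (w (s n)) h| <= e * nm h) /\
      `|Psi (w (s m)) - Psi (2^-1 *: (w (s m) + w (s n)))| <= e.
Hypothesis coercive : forall j, exists M, forall u, J u <= j -> nm u <= M.

Let p0 : 0 < p. Proof. by rewrite (lt_trans ltr01). Qed.

Lemma nm_ge0 x : 0 <= nm x. Proof. exact: powR_ge0. Qed.

Lemma nmP x : nm x `^ p = Phi x.
Proof. by rewrite /nm -powRrM mulVf ?gt_eqF// powRr1. Qed.

Lemma nmZ t x : nm (t *: x) = `|t| * nm x.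
Proof.
by rewrite /nm PhiZ powRM ?powR_ge0// -powRrM mulfV ?gt_eqF// powRr1.
Qed.

Lemma nmN x : nm (- x) = nm x.
Proof. by rewrite -scaleN1r nmZ normrN1 mul1r. Qed.

Lemma nmBC x y : nm (x - y) = nm (y - x).
Proof. by rewrite -nmN opprB. Qed.

Lemma nm_le x b : 0 <= b -> (Phi x <= b `^ p) = (nm x <= b).
Proof.
move=> b0; rewrite -nmP; apply/idP/idP => h.
  by rewrite leNgt; apply/negP => bx; move: h; rewrite leNgt gt0_ltr_powR ?nnegrE ?nm_ge0.
by rewrite ge0_ler_powR ?nnegrE ?nm_ge0// ltW.
Qed.

(** x + y is a + b times a convex combination of x / a and y / b, where a and b exceed the norms of
    x and y by e / 2 so as to be positive; convexity of Phi on its unit ball concludes. *)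
Lemma nmD x y : nm (x + y) <= nm x + nm y.
Proof.
apply/ler_addgt0Pr => e e0.
pose a := nm x + e / 2; pose b := nm y + e / 2.
have a0 : 0 < a by rewrite ltr_wpDl ?nm_ge0// divr_gt0.
have b0 : 0 < b by rewrite ltr_wpDl ?nm_ge0// divr_gt0.
have -> : nm x + nm y + e = a + b by rewrite /a /b; lra.
have ab0 : 0 < a + b by exact: addr_gt0.
rewrite -nm_le ?(ltW ab0)//.
pose t := b / (a + b).
have t01 : 0 <= t <= 1.
  apply/andP; split; first by rewrite divr_ge0 ?ltW.
  by rewrite ler_pdivrMr// mul1r lerDr ltW.
have tE : 1 - t = a / (a + b) by rewrite /t; field; rewrite gt_eqF.
have -> : x + y = (a + b) *: ((1 - t) *: (a^-1 *: x) + t *: (b^-1 *: y)).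
  rewrite scalerDr !scalerA tE /t; congr (_ + _).
    by rewrite (_ : _ * _ = 1) ?scale1r//; field; rewrite !gt_eqF.
  by rewrite (_ : _ * _ = 1) ?scale1r//; field; rewrite !gt_eqF.
rewrite PhiZ gtr0_norm// ger_pMr ?powR_gt0//.
rewrite (le_trans (Phi_convex _ _ t01))//.
have h1 z b' : 0 < b' -> nm z <= b' -> Phi (b'^-1 *: z) <= 1.
  move=> b'0 zb; have -> : 1 = 1 `^ p :> R by rewrite powR1.
  by rewrite nm_le// nmZ gtr0_norm ?invr_gt0// mulrC ler_pdivrMr// mul1r.
have hx := h1 x a a0; have hy := h1 y b b0.
have {}hx : Phi (a^-1 *: x) <= 1 by apply: hx; rewrite lerDl divr_ge0// ltW.
have {}hy : Phi (b^-1 *: y) <= 1 by apply: hy; rewrite lerDl divr_ge0// ltW.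
by case/andP: t01 => t0 t1; nra.
Qed.

Lemma nm_dist x y z : nm (x - z) <= nm (x - y) + nm (y - z).
Proof. by have := nmD (x - y) (y - z); rewrite addrA subrK. Qed.

Lemma nm0 : nm 0 = 0.
Proof. by rewrite -(scale0r 0) nmZ normr0 mul0r. Qed.

Lemma B0 u : B u 0 = 0.
Proof. by rewrite -(scale0r 0) BZ mul0r. Qed.

Lemma BN u x : B u (- x) = - B u x.
Proof. by rewrite -scaleN1r BZ mulN1r. Qed.

Lemma Phi_continuous M e : 0 < e -> exists2 dl, 0 < dl &
  forall x y, nm x <= M -> nm (x - y) <= dl -> `|Phi x - Phi y| <= e.
Proof.
move=> e0; pose C := p * (`|M| + 1) `^ (p - 1) + 1.
have C0 : 0 < C by rewrite ltr_wpDl// mulr_ge0 ?powR_ge0// ltW.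
exists (Num.min 1 (e / C)) => [|x y xM]; first by rewrite lt_min ltr01 divr_gt0.
rewrite le_min => /andP[d1 de].
have h1 : nm x <= nm (x - y) + nm y by have := nmD (x - y) y; rewrite subrK.
have h2 : nm y <= nm (x - y) + nm x.
  by have := nmD (y - x) x; rewrite subrK nmBC.
have M1 := ler_norm M.
rewrite -!nmP (le_trans (powR_lipschitz (ltW p1) (M := `|M| + 1) _ _))//.
- by rewrite nm_ge0/=; lra.
- by rewrite nm_ge0/=; lra.
have : `|nm x - nm y| <= nm (x - y) by rewrite ler_norml; lra.
move=> h3; rewrite ler_pdivlMr// in de.
have h4 : p * (`|M| + 1) `^ (p - 1) <= C by rewrite /C lerDl.
rewrite (le_trans _ de)// mulrC; apply: ler_pM => //.
by rewrite mulr_ge0 ?powR_ge0// ltW.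
Qed.

Lemma Psi_continuous M e : 0 < e -> exists2 dl, 0 < dl &
  forall x y, nm x <= M -> nm (x - y) <= dl -> `|Psi x - Psi y| <= e.
Proof.
move=> e0; have [C C0 hC] := B_bounded M; have [d d0 hd] := Psi_derivative M ltr01.
exists (Num.min d (e / (C + 1))) => [|x y xM].
  by rewrite lt_min d0 divr_gt0// ltr_wpDl.
rewrite le_min ler_pdivlMr ?ltr_wpDl// => /andP[dd de].
have /(hd x (y - x) xM) : nm (y - x) <= d by rewrite nmBC.
rewrite (addrC x) subrK nmBC => h1; have h2 := hC x (y - x) xM.
rewrite nmBC in h2; rewrite distrC.
by move: h1 h2; rewrite !ler_norml; lra.
Qed.

Lemma J_continuous M e : 0 < e -> exists2 dl, 0 < dl &
  forall x y, nm x <= M -> nm (x - y) <= dl -> `|J x - J y| <= e.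
Proof.
move=> e0; have e20 : 0 < e / 2 by rewrite divr_gt0.
have [d1 d10 h1] := Phi_continuous M e20.
have [d2 d20 h2] := Psi_continuous M e20.
exists (Num.min d1 d2) => [|x y xM]; first by rewrite lt_min d10.
rewrite le_min => /andP[/(h1 _ _ xM) + /(h2 _ _ xM)].
by rewrite /J !ler_norml; lra.
Qed.

Definition ncauchy (w : nat -> V) := forall e, 0 < e -> exists n0,
  forall m n, (n0 <= m)%N -> (n0 <= n)%N -> nm (w m - w n) <= e.
Definition ncvg (w : nat -> V) v := forall e, 0 < e -> exists n0,
  forall n, (n0 <= n)%N -> nm (w n - v) <= e.

Lemma nm_complete w : ncauchy w -> exists v, ncvg w v.
Proof.
move=> cw; have [|v hv] := @Phi_complete w.
  move=> e e0; have [n0 h] := cw _ (powR_gt0 p^-1 e0).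
  exists n0 => m n m0 n0'; have := h _ _ m0 n0'.
  by rewrite -nm_le ?powR_ge0// -powRrM mulVf ?gt_eqF// powRr1// ltW.
exists v => e e0; have [n0 h] := hv _ (powR_gt0 p e0).
by exists n0 => n /h; rewrite nm_le// ltW.
Qed.

Let gap x y := (Phi x + Phi y) / 2 - Phi (2^-1 *: (x + y)).

(** Uniform convexity read backwards. Half of e^p is spent on the term with Phi x + Phi y, which M
    bounds, and half on the defect. Norm limits below are obtained from vanishing defects by this
    lemma. *)
Lemma gap_small M e : 0 < e -> exists2 dl, 0 < dl & forall x y,
  nm x <= M -> nm y <= M -> gap x y <= dl -> nm (x - y) <= e.
Proof.
move=> e0; have ep0 : 0 < e `^ p by exact: powR_gt0.
pose m := `|M| `^ p; have m0 : 0 <= m by exact: powR_ge0.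
have [|C C0 hC] := @Phi_uniformly_convex (e `^ p / 2 / (2 * m + 1)).
  by rewrite !divr_gt0// ltr_wpDl// mulr_ge0.
exists (e `^ p / 2 / (C + 1)) => [|x y xM yM gxy].
  by rewrite !divr_gt0// ltr_wpDl.
have Phim z : nm z <= M -> Phi z <= m.
  by move=> zM; rewrite nm_le// (le_trans zM)// ler_norm.
suff: Phi (x - y) <= e `^ p by rewrite nm_le// ltW.
rewrite (le_trans (hC x y))// -/(gap x y).
rewrite [leRHS](splitr (e `^ p)); apply: lerD.
  rewrite mulrAC ler_pdivrMr ?ltr_wpDl ?mulr_ge0// ler_wpM2l ?divr_ge0 ?ltW//.
  by have := Phim _ xM; have := Phim _ yM; lra.
have := ler_wpM2l C0 gxy; move=> /le_trans; apply.
rewrite mulrCA ger_pMr ?divr_gt0// ler_pdivrMr ?ltr_wpDl//; lra.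
Qed.

Lemma gap_cauchy w M : (forall n, nm (w n) <= M) ->
  (forall e, 0 < e -> exists n0, forall m n, (n0 <= m)%N -> (n0 <= n)%N ->
     gap (w m) (w n) <= e) -> exists v, ncvg w v.
Proof.
move=> wM gw; apply: nm_complete => e e0.
have [d d0 hd] := gap_small M e0; have [n0 h] := gw _ d0.
by exists n0 => m n m0 n0'; apply: hd => //; exact: h.
Qed.

Lemma ncvg_le w v M : (forall n, nm (w n) <= M) -> ncvg w v -> nm v <= M.
Proof.
move=> wM wv; apply/ler_addgt0Pr => e e0; have [n0 /(_ _ (leqnn _)) h] := wv _ e0.
have := nmD (v - w n0) (w n0); rewrite subrK nmBC; have := wM n0; lra.
Qed.

Lemma minimizing_cvg (E : V -> R) (K : R) (w : nat -> V) M :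
  (forall M e, 0 < e -> exists2 dl, 0 < dl &
    forall x y, nm x <= M -> nm (x - y) <= dl -> `|E x - E y| <= e) ->
  (forall n, nm (w n) <= M) ->
  (forall e, 0 < e -> exists n0, forall n, (n0 <= n)%N -> `|E (w n) - K| <= e) ->
  (forall e, 0 < e -> exists n0, forall m n, (n0 <= m)%N -> (n0 <= n)%N ->
     gap (w m) (w n) <= e) -> exists2 v, ncvg w v & E v = K.
Proof.
move=> cE wM wK gw; have [v wv] := gap_cauchy wM gw; exists v => //.
apply/eqP; rewrite -subr_eq0 -normr_le0; apply/ler_addgt0Pr => e e0.
have e20 : 0 < e / 2 by rewrite divr_gt0.
have [d d0 hd] := cE M _ e20; have [n1 h1] := wv _ d0; have [n2 h2] := wK _ e20.
have /hd - /(_ (wM _)) := h1 _ (leq_maxl n1 n2).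
have := h2 _ (leq_maxr n1 n2).
by rewrite !ler_norml; lra.
Qed.

Lemma inv_small e : 0 < e -> exists n0, forall n, (n0 <= n)%N ->
  n.+1%:R^-1 <= e :> R.
Proof.
move=> e0; exists (Num.truncn e^-1) => n nn.
rewrite -[leRHS]invrK lef_pV2 ?posrE ?invr_gt0// ?ltr0n//.
rewrite ltW// (lt_le_trans (truncnS_gt _))// ler_nat ltnS//.
Qed.

Lemma inf_seq (P : set V) (E : V -> R) (x0 : V) b : P x0 ->
  (forall x, P x -> b <= E x) -> exists K, exists2 w : nat -> V,
    (forall n, P (w n) /\ E (w n) <= K + 1) /\ (forall x, P x -> K <= E x) &
    forall e, 0 < e -> exists n0, forall n, (n0 <= n)%N -> E (w n) <= K + e.
Proof.
move=> Px0 Pb; exists (inf (E @` P)).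
have hi : has_inf (E @` P).
  by split; [exists (E x0), x0|exists b => _ [x Px <-]; exact: Pb].
have : forall n : nat, exists x, P x /\ E x <= inf (E @` P) + n.+1%:R^-1.
  move=> n; have n0 : 0 < n.+1%:R^-1 :> R by rewrite invr_gt0.
  have [_ [x Px <-] /ltW h] := inf_adherent n0 hi.
  by exists x.
move=> /choice[w hw]; exists w.
  split=> [n|x Px]; last by apply: ge_inf; [exact: hi.2|exists x].
  split; first exact: (hw n).1.
  by rewrite (le_trans (hw n).2)// lerD2l invf_le1// ler1n.
move=> e /inv_small[n0 h]; exists n0 => n /h hn.
by rewrite (le_trans (hw n).2)// lerD2l.
Qed.

Let E w v := Phi v - B w v.

Lemma E_bounded M : exists K, forall w v, nm w <= M -> Phi v / 2 - K <= E w v.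
Proof.
have [C C0 hC] := B_bounded M; have [K K0 hK] := linear_le_powR p1 C0.
exists K => w v wM; have := hC w v wM; have := hK _ (nm_ge0 v).
by rewrite nmP /E ler_norml; lra.
Qed.

Lemma E_continuous w : forall M e, 0 < e -> exists2 dl, 0 < dl &
    forall x y, nm x <= M -> nm (x - y) <= dl -> `|E w x - E w y| <= e.
Proof.
move=> M e e0; have e20 : 0 < e / 2 by rewrite divr_gt0.
have [d1 d10 h1] := Phi_continuous M e20.
have [C C0 hC] := B_bounded (nm w).
exists (Num.min d1 (e / 2 / (C + 1))) => [|x y xM].
  by rewrite lt_min d10 divr_gt0// ltr_wpDl.
rewrite le_min ler_pdivlMr ?ltr_wpDl// => /andP[/(h1 _ _ xM) + hd].
have := hC w (x - y) (lexx _); rewrite BD BN /E.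
have := nm_ge0 (x - y).
by rewrite !ler_norml; lra.
Qed.

Lemma nm_le_Phi x K : Phi x <= K -> nm x <= K + 1.
Proof.
move=> xK; have K0 := le_trans (Phi_ge0 x) xK.
have [x1|/ltW x1] := leP (nm x) 1; first by rewrite (le_trans x1)// lerDr.
rewrite (@le_trans _ _ (Phi x))//; last by rewrite (le_trans xK)// lerDl.
by rewrite -nmP le1r_powR// ltW.
Qed.

(** B w is linear and drops out of the midpoint defect; since the midpoint cannot go below the
    infimum, the defect along a minimizing sequence tends to 0 and the sequence is Cauchy. *)
Lemma E_min w : exists u, forall v, E w u <= E w v.
Proof.
have [K hK] := E_bounded (nm w).
have [|I [v [hv1 vI] hv]] := @inf_seq setT (E w) 0 (- K) Logic.I.
  by move=> x _; have := hK w x (lexx _); have := Phi_ge0 x; lra.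
have vM n : nm (v n) <= 2 * (I + 1 + K) + 1.
  apply: nm_le_Phi; have := hK w (v n) (lexx _); have := (hv1 n).2.
  by lra.
have [||u _ uI] := minimizing_cvg (E_continuous w) vM (K := I).
- move=> e /hv[n0 h]; exists n0 => n /h.
  by have := vI (v n) Logic.I; rewrite ler_norml; lra.
- move=> e /hv[n0 h]; exists n0 => m n /h hm /h hn.
  have := vI (2^-1 *: (v m + v n)) Logic.I.
  by move: hm hn; rewrite /E BZ BD /gap; lra.
by exists u => x; rewrite uI; exact: vI.
Qed.

Let T w := projT1 (cid (E_min w)).
Lemma T_min w v : E w (T w) <= E w v.
Proof. by rewrite /T; case: cid => u /= h. Qed.

Lemma T_bounded M : exists M', forall w, nm w <= M -> nm (T w) <= M'.
Proof.
have [K hK] := E_bounded M; exists (2 * K + 1) => w wM; apply: nm_le_Phi.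
have := hK w (T w) wM; have := T_min w 0.
have -> : E w 0 = 0.
  by rewrite /E B0 subr0 -nmP nm0 powR0 ?gt_eqF.
by lra.
Qed.

(** Adding the minimality of T w and of T w' against their midpoint bounds the defect by a quarter
    of (B w - B w') applied to T w - T w'. *)
Lemma T_close M e : 0 < e -> exists2 dl, 0 < dl & forall w w',
  nm w <= M -> nm w' <= M -> (forall h, `|B w h - B w' h| <= dl * nm h) ->
  nm (T w - T w') <= e.
Proof.
move=> e0; have [M' hM'] := T_bounded M; have [d d0 hd] := gap_small M' e0.
have M'0 : 0 <= `|M'| by [].
exists (d / (2 * `|M'| + 1)) => [|w w' wM w'M h].
  by rewrite divr_gt0// ltr_wpDl// mulr_ge0.
apply: hd; [exact: hM'|exact: hM'|].
have h1 := T_min w (2^-1 *: (T w + T w')).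
have h2 := T_min w' (2^-1 *: (T w + T w')).
have h3 := h (T w - T w').
have h4 : nm (T w - T w') <= 2 * `|M'| + 1.
  rewrite (le_trans (nmD _ _))// nmN; have := hM' _ wM; have := hM' _ w'M.
  by have := ler_norm M'; lra.
have h5 : d / (2 * `|M'| + 1) * nm (T w - T w') <= d.
  by rewrite mulrAC ler_pdivrMr ?ltr_wpDl ?mulr_ge0// ler_wpM2l// ltW.
have := le_trans h3 h5.
rewrite /E !BZ !BD !BN in h1 h2 *; rewrite ler_norml /gap.
lra.
Qed.

(** The excess of w over the minimum of its own convex functional. It vanishes exactly at critical
    points and plays the part of the norm of the derivative of J. *)
Let dlt w := E w w - E w (T w).

Lemma dlt_critical w : dlt w <= 0 -> critical w.
Proof. by move=> d0 v; have := T_min w v; rewrite /dlt /E in d0 *; lra. Qed.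

Lemma dlt_small M e : 0 < e -> exists2 dl, 0 < dl & forall w,
  nm w <= M -> dlt w <= dl -> nm (w - T w) <= e.
Proof.
move=> e0; have [M' hM'] := T_bounded M.
have [d d0 hd] := gap_small (Num.max M M') e0.
exists d => // w wM dw; apply: hd.
- by rewrite le_max wM.
- by rewrite le_max hM' ?orbT.
have := T_min w (2^-1 *: (w + T w)).
by rewrite /dlt /E /gap BZ BD in dw *; lra.
Qed.

Lemma nm_eq0_B u h : nm h <= 0 -> B u h = 0.
Proof.
have [C C0 hC] := B_bounded (nm u) => h0.
apply/eqP; rewrite -normr_le0 (le_trans (hC _ _ (lexx _)))//.
by rewrite mulr_ge0_le0.
Qed.

Lemma eps0 (x : R) : (forall e, 0 < e -> x <= e) -> x <= 0.
Proof. by move=> h; apply/ler_addgt0Pr => e /h; rewrite add0r. Qed.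

(** Compactness acts on the forms B (w n), hence on the minimizers T (w n) by [T_close]; a small
    [dlt] keeps w n close to T (w n), so a subsequence of w converges too. The limit is a fixed
    point of T up to [nm] 0, hence critical. *)
Lemma palais_smale w M : (forall n, nm (w n) <= M) ->
  (forall n, dlt (w n) <= n.+1%:R^-1) ->
  exists2 v, critical v & forall e, 0 < e -> exists n, nm (w n - v) <= e.
Proof.
move=> wM dw; have [s sn hs] := compactness wM.
have [|v Tv] := @nm_complete (fun n => T (w (s n))).
  move=> e e0; have [d d0 hd] := T_close M e0; have [n0 h] := hs _ d0.
  by exists n0 => m n m0 n0'; apply: hd => //; exact: (h _ _ m0 n0').1.
have wv : ncvg (w \o s) v.
  move=> e e0; have e20 : 0 < e / 2 by rewrite divr_gt0.
  have [n1 h1] := Tv _ e20; have [d d0 hd] := dlt_small M e20.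
  have [n2 h2] := inv_small d0.
  exists (maxn n1 n2) => n; rewrite geq_max => /andP[/h1 n1n n2n].
  have := nm_dist (w (s n)) (T (w (s n))) v.
  have : nm (w (s n) - T (w (s n))) <= e / 2.
    by apply: hd => //; apply: (le_trans (dw _)); apply: h2; rewrite (leq_trans n2n).
  by move=> /=; lra.
have vM : nm v <= M by apply: (ncvg_le _ wv) => n; exact: wM.
exists v; last first.
  by move=> e /wv[n0 /(_ _ (leqnn _)) h]; exists (s n0).
apply: dlt_critical; suff vT : nm (v - T v) <= 0.
  rewrite /dlt /E; have PE : Phi v = Phi (T v).
    apply/eqP; rewrite -subr_eq0 -normr_le0; apply/eps0 => e e0.
    have [d d0 hd] := Phi_continuous (nm v) e0.
    by apply: hd => //; exact: (le_trans vT (ltW d0)).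
  by have := nm_eq0_B v vT; rewrite BD BN; lra.
apply/eps0 => e e0; have e20 : 0 < e / 2 by rewrite divr_gt0.
have [d d0 hd] := T_close M e20.
have [d' d'0 hd'] := B_continuous M d0.
have m0 : 0 < Num.min d' (e / 2) by rewrite lt_min d'0.
have [n1 h1] := wv _ m0; have [n2 h2] := Tv _ e20.
have := h2 _ (leq_maxr n1 n2); have := h1 _ (leq_maxl n1 n2).
set n := maxn _ _; rewrite le_min /= => /andP[k1 k1'] k2.
have := nm_dist v (T (w (s n))) (T v).
have : nm (T (w (s n)) - T v) <= e / 2.
  by apply: hd => // h; exact: hd'.
by rewrite (nmBC v (T (w (s n)))); lra.
Qed.

(** Convexity bounds Phi on the segment by its chord, and Psi is linearized uniformly on bounded
    sets; the two linear parts add up to - s [dlt u], with an error proportional to s. *)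
Lemma descent_step M e : 0 < e -> exists2 s0, 0 < s0 <= 1 & forall u s,
  nm u <= M -> 0 <= s <= s0 ->
  J (u + s *: (T u - u)) <= J u - s * dlt u + s * e.
Proof.
move=> e0; have [M' hM'] := T_bounded M; pose N := `|M'| + `|M| + 1.
have N0 : 0 < N by rewrite ltr_wpDl// addr_ge0.
have [d d0 hd] := Psi_derivative M (divr_gt0 e0 N0).
exists (Num.min 1 (d / N)) => [|u s uM].
  by rewrite lt_min ltr01/= divr_gt0// ge_min lexx.
rewrite le_min ler_pdivlMr// => /and3P[s0 s1 sd].
have hN : nm (T u - u) <= N.
  rewrite (le_trans (nmD _ _))// nmN; have := hM' _ uM.
  by have := ler_norm M'; have := ler_norm M; rewrite /N; lra.
have hs : nm (s *: (T u - u)) <= s * N.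
  by rewrite nmZ ger0_norm// ler_wpM2l.
have := hd u _ uM (le_trans hs sd); rewrite BZ BD BN => h1.
have h2 : e / N * nm (s *: (T u - u)) <= s * e.
  have -> : s * e = e / N * (s * N) by field; rewrite gt_eqF.
  exact: ler_wpM2l (ltW (divr_gt0 e0 N0)) _ _ hs.
have h3 : Phi (u + s *: (T u - u)) <= (1 - s) * Phi u + s * Phi (T u).
  have -> : u + s *: (T u - u) = (1 - s) *: u + s *: T u.
    by rewrite scalerBr scalerBl scale1r addrCA addrC.
  by apply: Phi_convex; rewrite s0.
have := le_trans h1 h2; rewrite ler_norml /J /dlt /E.
by move: h3; lra.
Qed.

(** The direction T u - u is decisive: if J does not decrease along it, [descent_step] puts [dlt u]
    below every e. *)
Lemma locally_minimal_critical u s0 : 0 < s0 ->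
  (forall s, 0 <= s <= s0 -> J u <= J (u + s *: (T u - u))) -> critical u.
Proof.
move=> s00 hu; apply: dlt_critical; apply: eps0 => e e0.
have [s1 /andP[s10 _] h] := descent_step (nm u) e0.
pose s := Num.min s0 s1; have sp : 0 < s by rewrite lt_min s00.
have := h u s (lexx _); rewrite ltW//= ge_min lexx orbT => /(_ isT) h1.
have := hu s; rewrite ltW//= ge_min lexx => /(_ isT) h2.
by rewrite -(ler_pM2l sp); lra.
Qed.

(** Otherwise a bounded sequence of points at level at least j has [dlt] tending to 0; the critical
    point given by [palais_smale] is approximated by it and so has level at least j. *)
Lemma uniform_descent M j : (forall v, critical v -> J v < j) ->
  exists k s0, [/\ 0 < k, 0 < s0 & forall u s, nm u <= M -> j <= J u ->
    0 <= s <= s0 -> J (u + s *: (T u - u)) <= J u - s * k].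
Proof.
move=> nocrit.
have [k k0 hk] : exists2 k, 0 < k & forall u, nm u <= M -> j <= J u -> k <= dlt u.
  apply: contrapT => hN.
  have : forall n : nat, exists u, [/\ nm u <= M, j <= J u & dlt u <= n.+1%:R^-1].
    move=> n; apply: contrapT => hn; apply: hN.
    exists n.+1%:R^-1; first by rewrite invr_gt0.
    move=> u uM uj; rewrite leNgt; apply/negP => /ltW du; apply: hn.
    by exists u.
  move=> /choice[w hw].
  have [||v cv hv] := @palais_smale w M; try by move=> n; case: (hw n).
  have := nocrit _ cv; apply/negP; rewrite -leNgt; apply/ler_addgt0Pr => e e0.
  have [d d0 hd] := J_continuous M e0; have [n hn] := hv _ d0.
  have [wM jw _] := hw n.
  by have := hd _ _ wM hn; rewrite ler_norml; lra.
have k20 : 0 < k / 2 by rewrite divr_gt0.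
have [s0 /andP[s00 _] hs] := descent_step M k20.
exists (k / 2), s0; split => // u s uM uj sI.
have := hs u s uM sI; have := hk u uM uj.
by case/andP: sI => sge0 _; nra.
Qed.

Hypothesis Psi_bounded : forall M, exists C, forall u, nm u <= M -> `|Psi u| <= C.
Variables (r eta : R) (ub : V).
Hypothesis r0 : 0 < r.
Hypothesis eta0 : 0 < eta.
Hypothesis Psi0 : Psi 0 = 0.
Hypothesis barrier : forall u, Phi u <= r -> Psi u <= r - eta.
Hypothesis ub_r : r <= Phi ub.
Hypothesis ub_J : J ub < 0.

Let J0 : J 0 = 0.
Proof. by rewrite /J Psi0 subr0 -nmP nm0 powR0 ?gt_eqF. Qed.

Lemma J_sphere u : Phi u = r -> eta <= J u.
Proof. by move=> ur; have := @barrier u; rewrite ur lexx => /(_ isT); rewrite /J ur; lra. Qed.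

Lemma ncvg_Phi w v M : (forall n, nm (w n) <= M) -> ncvg w v ->
  forall e, 0 < e -> exists n0, forall n, (n0 <= n)%N -> `|Phi (w n) - Phi v| <= e.
Proof.
move=> wM wv e e0; have [d d0 hd] := Phi_continuous M e0.
by have [n0 h] := wv _ d0; exists n0 => n /h; exact: hd.
Qed.

(** The set Phi <= r is convex, so midpoints of a minimizing sequence compete and their defects
    vanish along the extracted subsequence. The minimum is at most J 0 = 0, hence is not attained on
    the sphere, where J >= eta; a short segment towards T u stays inside, which makes the minimizer
    critical. *)
Lemma minimizer_inside : exists u, [/\ critical u, Phi u < r & J u <= 0].
Proof.
have Jb u : Phi u <= r -> - r <= J u.
  by move=> ur; have := barrier ur; have := Phi_ge0 u; have := eta0; rewrite /J; lra.
have PJ0 : Phi 0 <= r by rewrite -nmP nm0 powR0 ?gt_eqF// ltW.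
have [I [w [hw1 wI] hw]] := @inf_seq [set u | Phi u <= r] J 0 (- r) PJ0 Jb.
have wM n : nm (w n) <= r + 1 by apply: nm_le_Phi; exact: (hw1 n).1.
have [s sn hs] := compactness wM.
have wsM n : nm ((w \o s) n) <= r + 1 by exact: wM.
have [||u wu uI] := minimizing_cvg J_continuous wsM (K := I).
- move=> e /hw[n0 h]; exists n0 => n n0n.
  have := h _ (leq_trans n0n (sn n)); have := wI _ (hw1 (s n)).1.
  by rewrite /= ler_norml; lra.
- move=> e e0; have e20 : 0 < e / 2 by rewrite divr_gt0.
  have [n0 h] := hw _ e20; have [n1 h1] := hs _ e20.
  have e40 : 0 < e / 4 by rewrite divr_gt0.
  have [n2 h2] := hw _ e40; have [n3 h3] := hs _ e40.
  exists (maxn n2 n3) => m n.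
  rewrite !geq_max => /andP[m0 m1] /andP[n0' n1'].
  have k1 := h2 _ (leq_trans m0 (sn m)); have k2 := h2 _ (leq_trans n0' (sn n)).
  have [_ k3] := h3 _ _ m1 n1'; have [_ k4] := h3 _ _ n1' m1.
  have mr : Phi (2^-1 *: (w (s m) + w (s n))) <= r.
    have -> : 2^-1 *: (w (s m) + w (s n)) = (1 - 2^-1) *: w (s m) + 2^-1 *: w (s n).
      by rewrite scalerDr; congr (_ *: _ + _); lra.
    rewrite (le_trans (Phi_convex _ _ _))//; first by lra.
    by have := (hw1 (s m)).1; have := (hw1 (s n)).1 => /=; lra.
  have := wI _ mr; move: k1 k2 k3 k4; rewrite (addrC (w (s n))).
  by rewrite /J /gap /= !ler_norml; lra.
have ur : Phi u <= r.
  apply/ler_addgt0Pr => e e0; have [n0 /(_ _ (leqnn _))] := ncvg_Phi wsM wu e0.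
  by have := (hw1 (s n0)).1 => /=; rewrite ler_norml; lra.
have Ju : J u <= 0 by rewrite uI -J0; exact: wI.
have ur' : Phi u < r.
  rewrite lt_neqAle ur andbT; apply/eqP => /J_sphere; have := eta0; lra.
exists u; split => //.
have rP : 0 < r - Phi u by rewrite subr_gt0.
have [d d0 hd] := Phi_continuous (nm u) rP.
pose s0 := d / (nm (T u - u) + 1).
have N0 : 0 < nm (T u - u) + 1 by rewrite ltr_wpDl ?nm_ge0.
apply: (@locally_minimal_critical u s0); first by rewrite divr_gt0.
move=> t /andP[t0 ts]; rewrite uI; apply: wI => /=.
have /hd : nm (u - (u + t *: (T u - u))) <= d.
  rewrite opprD addrA subrr add0r nmN nmZ ger0_norm//.
  rewrite ler_pdivlMr// in ts; have := nm_ge0 (T u - u); lra.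
by move=> /(_ (lexx _)); rewrite ler_norml; lra.
Qed.

(** The set r <= Phi is not convex, and a midpoint might fall inside. The barrier excludes it:
    inside, Psi <= r - eta, whereas Psi = Phi - J is at least r - eta / 4 far along the sequence and
    changes by at most eta / 4 at the midpoint. *)
Lemma minimizer_outside : exists u, [/\ critical u, r < Phi u & J u <= 0].
Proof.
have [M hM] := coercive 1.
have [C hC] := Psi_bounded M.
(* Points with J <= 1 are bounded by coercivity, so Psi is bounded there; points with J > 1 lie
   above the negative bound anyway. *)
have [K hK] : exists K, forall u, r <= Phi u -> K <= J u.
  exists (- (`|C| + 1)) => u _; have := @hM u; have := ler_norm C.
  have := normr_ge0 C; have [J1|/ltW J1] := leP (J u) 1; last by lra.
  move=> ? ? /(_ isT)/hC; have := Phi_ge0 u; rewrite /J ler_norml; lra.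
have [I [w [hw1 wI] hw]] := @inf_seq [set u | r <= Phi u] J ub K ub_r hK.
have I0 : I < 0 by rewrite (le_lt_trans _ ub_J)//; exact: wI.
have wM n : nm (w n) <= M by apply: hM; have := (hw1 n).2; lra.
have [s sn hs] := compactness wM.
have wsM n : nm ((w \o s) n) <= M by exact: wM.
have [||u wu uI] := minimizing_cvg J_continuous wsM (K := I).
- move=> e /hw[n0 h]; exists n0 => n n0n.
  have := h _ (leq_trans n0n (sn n)); have := wI _ (hw1 (s n)).1.
  by rewrite /= ler_norml; lra.
- move=> e e0; pose e' := Num.min (e / 4) (Num.min (eta / 4) (- I / 4)).
  have e'0 : 0 < e' by have h0 := eta0; rewrite !lt_min; apply/and3P; split; lra.
  have e'1 : e' <= e / 4 by rewrite ge_min lexx.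
  have e'2 : e' <= eta / 4 by rewrite !ge_min lexx orbT.
  have [n2 h2] := hw _ e'0; have [n3 h3] := hs _ e'0.
  exists (maxn n2 n3) => m n.
  rewrite !geq_max => /andP[m0 m1] /andP[n0' n1'].
  have k1 := h2 _ (leq_trans m0 (sn m)); have k2 := h2 _ (leq_trans n0' (sn n)).
  have [_ k3] := h3 _ _ m1 n1'; have [_ k4] := h3 _ _ n1' m1.
  have mr : r <= Phi (2^-1 *: (w (s m) + w (s n))).
    rewrite leNgt; apply/negP => /ltW/barrier h.
    have := (hw1 (s m)).1 => /=; move: k1 k3; rewrite /J ler_norml.
    by lra.
  have := wI _ mr; move: k1 k2 k3 k4; rewrite (addrC (w (s n))).
  by rewrite /J /gap /= !ler_norml; lra.
have ur : r <= Phi u.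
  apply/ler_addgt0Pr => e e0; have [n0 /(_ _ (leqnn _))] := ncvg_Phi wsM wu e0.
  by have := (hw1 (s n0)).1 => /=; rewrite ler_norml; lra.
have ur' : r < Phi u.
  rewrite lt_neqAle ur andbT; apply/eqP => /esym/J_sphere; have := eta0; lra.
exists u; split => //; last by lra.
have rP : 0 < Phi u - r by rewrite subr_gt0.
have [d d0 hd] := Phi_continuous (nm u) rP.
pose s0 := d / (nm (T u - u) + 1).
have N0 : 0 < nm (T u - u) + 1 by rewrite ltr_wpDl ?nm_ge0.
apply: (@locally_minimal_critical u s0); first by rewrite divr_gt0.
move=> t /andP[t0 ts]; rewrite uI; apply: wI => /=.
have /hd : nm (u - (u + t *: (T u - u))) <= d.
  rewrite opprD addrA subrr add0r nmN nmZ ger0_norm//.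
  rewrite ler_pdivlMr// in ts; have := nm_ge0 (T u - u); lra.
by move=> /(_ (lexx _)); rewrite ler_norml; lra.
Qed.

Lemma T_continuous w e : 0 < e -> exists2 dl, 0 < dl & forall w',
  nm (w' - w) <= dl -> nm (T w' - T w) <= e.
Proof.
move=> e0; have [d d0 hd] := T_close (nm w + 1) e0.
have [d' d'0 hd'] := B_continuous (nm w + 1) d0.
exists (Num.min 1 d') => [|w']; first by rewrite lt_min ltr01.
rewrite le_min => /andP[h1 h2].
have w'M : nm w' <= nm w + 1 by have := nmD (w' - w) w; rewrite subrK; lra.
have wM : nm w <= nm w + 1 by rewrite lerDl.
by apply: hd => // h; exact: hd'.
Qed.

Section mountain_pass.
Variables (u1 u2 : V) (s0 : R).
Hypothesis s00 : 0 <= s0.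

(* The cut-off keeps the end points of the path, where J <= 0, fixed. *)
Let chi x := s0 * Num.min 1 (Num.max 0 ((J x - eta / 2) / (eta / 2))).
(** An explicit Euler step along the field T x - x. Iterating it stands in for a flow, so no
    differential equation has to be solved. *)
Let D x := x + chi x *: (T x - x).
Let path k t := iter k D (u1 + t *: (u2 - u1)).

Lemma chi_ge0 x : 0 <= chi x <= s0.
Proof.
rewrite /chi mulr_ge0//=; last by rewrite le_min ler01 le_max lexx.
by rewrite ler_piMr// ge_min lexx.
Qed.

Lemma chi0 x : J x <= eta / 2 -> chi x = 0.
Proof.
move=> h; rewrite /chi (max_idPl _) ?(min_idPr _) ?mulr0//.
by rewrite pmulr_lle0 ?invr_gt0 ?divr_gt0// subr_le0.
Qed.

Lemma chi1 x : eta <= J x -> chi x = s0.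
Proof.
move=> h; have e20 : 0 < eta / 2 by rewrite divr_gt0.
have h1 : 1 <= (J x - eta / 2) / (eta / 2) by rewrite ler_pdivlMr//; lra.
by rewrite /chi (max_idPr _) ?(le_trans ler01)// (min_idPl _)// mulr1.
Qed.

Lemma chi_continuous w e : 0 < e -> exists2 dl, 0 < dl & forall w',
  nm (w' - w) <= dl -> `|chi w' - chi w| <= e.
Proof.
move=> e0; have e20 : 0 < eta / 2 by rewrite divr_gt0.
have k0 : 0 < e * (eta / 2) / (s0 + 1) by rewrite divr_gt0 ?mulr_gt0// ltr_wpDl.
have [d d0 hd] := J_continuous (nm w) k0; exists d => // w'.
rewrite nmBC => /(hd _ _ (lexx _)); rewrite ler_pdivlMr ?ltr_wpDl// => h.
rewrite /chi -mulrBr normrM ger0_norm//.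
set a := (J w - _) / _; set b := (J w' - _) / _.
have hab : `|b - a| * (s0 + 1) <= e.
  rewrite -mulrBl normrM (gtr0_norm (x := _^-1)) ?invr_gt0//.
  rewrite -mulrA mulrCA mulrC ler_pdivrMr//.
  by rewrite (_ : J w' - _ - _ = - (J w - J w')) ?normrN//; ring.
have : `|Num.min 1 (Num.max 0 b) - Num.min 1 (Num.max 0 a)| <= `|b - a|.
  wlog ab : a b {hab} / a <= b => [hw|].
    have [/hw//|/ltW/hw] := leP a b; by rewrite distrC (distrC a).
  have hE (c : R) : Num.min 1 (Num.max 0 c) = if c <= 0 then 0 else if 1 <= c then 1 else c :> R.
    have [c0|c0] := leP c 0; first by rewrite min_r.
    by have [c1|c1] := leP 1 c.
  rewrite !hE [leRHS]ger0_norm ?subr_ge0// ler_norml.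
  by case: (leP a 0); case: (leP b 0); case: (leP 1 a); case: (leP 1 b); lra.
set m := `|Num.min _ _ - _| => hm.
have h0 : 0 <= `|b - a| by [].
have := ler_wpM2l s00 hm; have := s00; lra.
Qed.

Lemma D_continuous w e : 0 < e -> exists2 dl, 0 < dl & forall w',
  nm (w' - w) <= dl -> nm (D w' - D w) <= e.
Proof.
move=> e0; pose e1 := e / (4 * (s0 + 1)); pose K := nm (T w - w) + 1.
have s10 : 0 < s0 + 1 by rewrite ltr_wpDl.
have K0 : 0 < K by rewrite ltr_wpDl ?nm_ge0.
have e10 : 0 < e1 by rewrite divr_gt0// mulr_gt0.
have e1E : e1 * (s0 + 1) = e / 4 by rewrite /e1; field; rewrite gt_eqF.
have [d1 d10 h1] := T_continuous w e10.
have [d2 d20 h2] := chi_continuous w (divr_gt0 e0 (mulr_gt0 (ltr0n R 4) K0)).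
exists (Num.min e1 (Num.min d1 d2)) => [|w']; first by rewrite !lt_min e10 d10.
rewrite !le_min => /and3P[k1 /h1 k2 /h2 k3].
have -> : D w' - D w = (w' - w) + (chi w' *: ((T w' - T w) - (w' - w)) +
    (chi w' - chi w) *: (T w - w)).
  have -> : T w' - T w - (w' - w) = (T w' - w') - (T w - w).
    by rewrite !opprB addrACA [in RHS]addrACA; congr (_ + _); rewrite addrC.
  have cE (c c' : R) (A A' : V) : c' *: (A' - A) + (c' - c) *: A = c' *: A' - c *: A.
    by rewrite scalerBr scalerBl addrA subrK.
  by rewrite cE /D opprD addrACA.
have n1 := nmD (w' - w) (chi w' *: ((T w' - T w) - (w' - w)) + (chi w' - chi w) *: (T w - w)).
have n2 := nmD (chi w' *: ((T w' - T w) - (w' - w))) ((chi w' - chi w) *: (T w - w)).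
have n3 := nmD (T w' - T w) (- (w' - w)).
rewrite nmN in n3; rewrite !nmZ in n2.
have /andP[c0 c1] := chi_ge0 w'; rewrite (ger0_norm c0) in n2.
have n4 : chi w' * nm ((T w' - T w) - (w' - w)) <= s0 * (e1 + e1).
  by apply: ler_pM => //; [exact: nm_ge0|lra].
have n5 : `|chi w' - chi w| * nm (T w - w) <= e / 4.
  have -> : e / 4 = e / (4 * K) * K by field; rewrite gt_eqF.
  by apply: ler_pM => //; [exact: nm_ge0|rewrite lerDl].
by have := s00; lra.
Qed.

Lemma path_continuous k t e : 0 < e -> exists2 dl, 0 < dl & forall t',
  `|t' - t| <= dl -> nm (path k t' - path k t) <= e.
Proof.
elim: k e => [|k IH] e e0.
  have N0 : 0 < nm (u2 - u1) + 1 by rewrite ltr_wpDl ?nm_ge0.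
  exists (e / (nm (u2 - u1) + 1)) => [|t']; first by rewrite divr_gt0.
  rewrite /path /= opprD addrACA subrr add0r -scalerBl nmZ ler_pdivlMr//.
  by have := normr_ge0 (t' - t); lra.
have [d d0 hd] := D_continuous (path k t) e0.
by have [d' d'0 hd'] := IH _ d0; exists d' => // t' /hd' /hd.
Qed.

(** The end points lie where the cut-off vanishes and never move; Phi is continuous along the
    deformed path and takes every value between those at its ends. *)
Lemma path_crosses k v : J u1 <= 0 -> J u2 <= 0 -> Phi u1 <= v <= Phi u2 ->
  exists2 t, 0 <= t <= 1 & Phi (path k t) = v.
Proof.
move=> J1 J2 uv.
have Dfix u : J u <= 0 -> iter k D u = u.
  move=> Ju; elim: k => //= k ->; rewrite /D chi0 ?scale0r ?addr0//.
  by rewrite (le_trans Ju)// divr_ge0// ltW.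
have p0E : path k 0 = u1 by rewrite /path scale0r addr0 Dfix.
have p1E : path k 1 = u2 by rewrite /path scale1r addrC subrK Dfix.
have cf : continuous (fun t => Phi (path k t)).
  move=> t; apply/cvgrPdist_le => e e0.
  have [d d0 hd] := Phi_continuous (nm (path k t)) e0.
  have [d' d'0 hd'] := path_continuous k t d0.
  apply/nbhs_ballP; exists d' => //= t' tt'; apply: hd => //.
  by rewrite nmBC; apply: hd'; rewrite distrC ltW.
have [||t] := @IVT _ (fun t => Phi (path k t)) 0 1 v ler01.
- exact: continuous_subspaceT.
- case/andP: uv => uv1 uv2; rewrite p0E p1E.
  by rewrite ge_min uv1 le_max uv2 orbT.
by rewrite in_itv /= => t01 <-; exists t.
Qed.

(** A step never raises J, and lowers it by s0 k while J >= eta, where the cut-off is full. Starting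
    at level at most c, more than |c| / (s0 k) steps suffice. *)
Lemma path_descends M k c : 0 < k -> 0 < s0 ->
  (forall u, J u <= c -> nm u <= M) ->
  (forall t, 0 <= t <= 1 -> J (u1 + t *: (u2 - u1)) <= c) ->
  (forall u s, nm u <= M -> eta / 2 <= J u -> 0 <= s <= s0 ->
    J (u + s *: (T u - u)) <= J u - s * k) ->
  exists n, forall t, 0 <= t <= 1 -> J (path n t) < eta.
Proof.
move=> k0 s0p cM hc hJ.
have JD u : J u <= c -> J (D u) <= J u /\ (eta <= J u -> J (D u) <= J u - s0 * k).
  move=> uc; have [ue|/ltW ue] := leP (J u) (eta / 2).
    rewrite /D chi0// scale0r addr0; split => // h.
    by have := eta0; lra.
  have := hJ u (chi u) (cM _ uc) ue (chi_ge0 u).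
  have /andP[c0 _] := chi_ge0 u; have := mulr_ge0 c0 (ltW k0).
  by rewrite /D; split=> [|/chi1 <-]; lra.
have sk0 : 0 < s0 * k by exact: mulr_gt0.
exists (Num.truncn (`|c| / (s0 * k))).+1 => t t01.
set n := _.+1.
have hn : c - n%:R * (s0 * k) < eta.
  have : `|c| / (s0 * k) < n%:R by exact: truncnS_gt.
  by rewrite ltr_pdivrMr// => h; have := ler_norm c; have := eta0; lra.
have : forall m, J (path m t) <= c /\ (J (path m t) < eta \/ J (path m t) <= c - m%:R * (s0 * k)).
  elim=> [|m [IH1 IH2]]; first by split; [exact: hc|right; rewrite mul0r subr0; exact: hc].
  have [h1 h2] := JD _ IH1; split; first exact: le_trans h1 IH1.
  have [h3|h3] := ltP (J (path m t)) eta; first by left; exact: le_lt_trans h1 h3.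
  have h4 := h2 h3; case: IH2 => IH2; first by move: h3; rewrite leNgt IH2.
  by right; rewrite -natr1; rewrite /path /= -/(path m t) in h4 *; lra.
by move=> /(_ n)[_ [//|h]]; exact: le_lt_trans h hn.
Qed.

End mountain_pass.

Theorem three_critical_points : exists u1 u2 u3,
  [/\ critical u1, critical u2 & critical u3] /\
  [/\ Phi u1 < Phi u2, J u1 <= 0, J u2 <= 0 & 0 < J u3].
Proof.
have [u1 [c1 P1 J1]] := minimizer_inside.
have [u2 [c2 P2 J2]] := minimizer_outside.
suff [u3 c3 J3] : exists2 u3, critical u3 & eta / 2 <= J u3.
  exists u1, u2, u3; split => //; split => //; first exact: lt_trans P1 P2.
  by rewrite (lt_le_trans _ J3)// divr_gt0.
apply: contrapT => nocrit.
have {}nocrit v : critical v -> J v < eta / 2.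
  by move=> cv; rewrite ltNge; apply/negP => h; apply: nocrit; exists v.
pose N := nm u1 + nm (u2 - u1).
have [C hC] := Psi_bounded N.
pose c := N `^ p + C.
have hc t : 0 <= t <= 1 -> J (u1 + t *: (u2 - u1)) <= c.
  move=> /andP[t0 t1]; have hN : nm (u1 + t *: (u2 - u1)) <= N.
    rewrite (le_trans (nmD _ _))// nmZ ger0_norm// lerD2l.
    by rewrite ler_piMl// nm_ge0.
  have := hC _ hN; move: (hN); rewrite -nm_le ?addr_ge0 ?nm_ge0//.
  by rewrite /J /c ler_norml; lra.
have [M hM] := coercive c.
have [k [s0 [k0 s00 hs]]] := uniform_descent M nocrit.
have [n hn] := path_descends (ltW s00) k0 s00 hM hc hs.
(* Without a critical point at level eta / 2 or higher the deformed path lies below eta; yet it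
   still joins the inside to the outside and meets the sphere Phi = r, where J >= eta. *)
have [|t t01 ht] := @path_crosses u1 u2 s0 (ltW s00) n r J1 J2.
  by rewrite !ltW.
by have := hn t t01; rewrite ltNge J_sphere.
Qed.

(** Equal forms mean one convex functional with two minimizers; the midpoint competes, so the defect
    is nonpositive and [nm (u - v)] is 0. It is used contrapositively: different values of Phi or J
    tell solutions apart as functions. *)
Lemma critical_unique u v : critical u -> critical v ->
  (forall h, B u h = B v h) -> Phi u = Phi v /\ J u = J v.
Proof.
move=> cu cv uv; pose M := Num.max (nm u) (nm v).
have uM : nm u <= M by rewrite le_max lexx.
have vM : nm v <= M by rewrite le_max lexx orbT.
have h : nm (u - v) <= 0.
  apply: eps0 => e e0; have [d d0 hd] := gap_small M e0; apply: hd => //.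
  apply: le_trans (ltW d0); have := cu (2^-1 *: (u + v)); have := cv (2^-1 *: (u + v)).
  by rewrite -!uv !BZ !BD /gap; lra.
split; apply/eqP; rewrite -subr_eq0 -normr_le0; apply: eps0 => e e0.
  by have [d d0 hd] := Phi_continuous M e0; apply: hd => //; rewrite (le_trans h)// ltW.
by have [d d0 hd] := J_continuous M e0; apply: hd => //; rewrite (le_trans h)// ltW.
Qed.

End three_critical_points.

(** * Integration *)

Section integral_setT.
Context d (T : measurableType d) (R : realType) (mu : {measure set T -> \bar R}).

Lemma ge0_integralTZl (k : R) (f : T -> \bar R) : measurable_fun setT f ->
  (forall x, 0 <= f x)%E -> 0 <= k ->
  (\int[mu]_x (k%:E * f x) = k%:E * \int[mu]_x f x)%E.
Proof. by move=> mf f0 k0; rewrite ge0_integralZl. Qed.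

Lemma ge0_integralTZr (k : R) (f : T -> \bar R) : measurable_fun setT f ->
  (forall x, 0 <= f x)%E -> 0 <= k ->
  (\int[mu]_x (f x * k%:E) = \int[mu]_x f x * k%:E)%E.
Proof. by move=> mf f0 k0; rewrite ge0_integralZr. Qed.

Lemma ge0_integralTD (f g : T -> \bar R) : measurable_fun setT f ->
  measurable_fun setT g -> (forall x, 0 <= f x)%E -> (forall x, 0 <= g x)%E ->
  (\int[mu]_x (f x + g x) = \int[mu]_x f x + \int[mu]_x g x)%E.
Proof. by move=> mf mg f0 g0; rewrite ge0_integralD. Qed.

Lemma ge0_le_integralT (f g : T -> \bar R) : measurable_fun setT f ->
  measurable_fun setT g -> (forall x, 0 <= f x)%E ->
  (forall x, f x <= g x)%E -> (\int[mu]_x f x <= \int[mu]_x g x)%E.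
Proof.
move=> mf mg f0 fg; by apply: ge0_le_integral.
Qed.

Lemma integral_indicT (A : set T) : measurable A ->
  (\int[mu]_x (\1_A x)%:E = mu A)%E.
Proof. by move=> mA; rewrite integral_indic// setIT. Qed.

Lemma measurable_indic_EFin (A : set T) : measurable A ->
  measurable_fun setT (fun x => (\1_A x : R)%:E).
Proof. by move=> mA; apply/measurable_EFinP/measurable_indic. Qed.

Lemma indic_EFin_ge0 (A : set T) x : (0 <= (\1_A x : R)%:E)%E.
Proof. by rewrite lee_fin. Qed.

Lemma measurable_ltr (f g : T -> R) : measurable_fun setT f ->
  measurable_fun setT g -> measurable [set x | f x < g x].
Proof.
move=> mf mg; rewrite -[X in measurable X]setTI.
have := measurable_funB mf mg measurableT (measurable_itv `]-oo, 0[%R).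
rewrite preimage_itvNyo; congr (measurable (_ `&` _)).
by apply/seteqP; split=> x /=; rewrite subr_lt0.
Qed.

Lemma measurable_ler (f g : T -> R) : measurable_fun setT f ->
  measurable_fun setT g -> measurable [set x | f x <= g x].
Proof.
move=> mf mg; rewrite -[X in measurable X]setTI.
have := measurable_funB mf mg measurableT (measurable_itv `]-oo, 0]%R).
rewrite preimage_itvNyc; congr (measurable (_ `&` _)).
by apply/seteqP; split=> x /=; rewrite subr_le0.
Qed.

Lemma measure_bigcup_countable0 (I : countType) (F : I -> set T) :
  (forall i, measurable (F i)) -> (forall i, mu (F i) = 0%E) ->
  measurable (\bigcup_i F i) /\ mu (\bigcup_i F i) = 0%E.
Proof.
move=> mF F0; pose N (k : nat) := if unpickle k is Some i then F i else set0.
have mN k : measurable (N k) by rewrite /N; case: unpickle.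
have FN : \bigcup_i F i = \bigcup_k N k.
  apply/seteqP; split=> x [i _ h].
    by exists (pickle i) => //; rewrite /N pickleK.
  by move: h; rewrite /N; case: unpickle => // j h; exists j.
rewrite FN; split; first exact: bigcupT_measurable.
apply/eqP; rewrite eq_le measure_ge0 andbT.
have h : (mu (\bigcup_k N k) <= \sum_(k <oo) mu (N k))%E.
  by apply: measure_sigma_subadditive => //; exact: bigcupT_measurable.
apply: (le_trans h).
by rewrite eseries0// => k _ _; rewrite /N; case: unpickle.
Qed.

Lemma ae_countable (I : countType) (P : I -> T -> Prop) :
  (forall i, {ae mu, forall x, P i x}) -> {ae mu, forall x, forall i, P i x}.
Proof.
move=> /choice[A hA].
have [||mA A0] := @measure_bigcup_countable0 I A; try by move=> i; case: (hA i).
exists (\bigcup_i A i); split => // x /existsNP[i Pi]; exists i => //.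
by case: (hA i) => _ _; apply.
Qed.

End integral_setT.

Section fubini_wrappers.
Context d1 d2 (T1 : measurableType d1) (T2 : measurableType d2) (R : realType).
Variables (m1 : {sigma_finite_measure set T1 -> \bar R})
          (m2 : {sigma_finite_measure set T2 -> \bar R}).

Lemma tonelli (f : T1 -> T2 -> \bar R) :
  measurable_fun setT (fun x : T1 * T2 => f x.1 x.2) ->
  (forall x y, 0 <= f x y)%E ->
  (\int[m1]_x \int[m2]_y f x y = \int[m2]_y \int[m1]_x f x y)%E.
Proof.
move=> mf f0.
exact: (@fubini_tonelli _ _ T1 T2 R m1 m2 (fun x => f x.1 x.2) mf (fun x => f0 x.1 x.2)).
Qed.

Lemma measurable_integral2 (f : T1 -> T2 -> \bar R) :
  measurable_fun setT (fun x : T1 * T2 => f x.1 x.2) ->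
  (forall x y, 0 <= f x y)%E ->
  measurable_fun setT (fun x => \int[m2]_y f x y)%E.
Proof.
move=> mf f0.
exact: (@measurable_fun_fubini_tonelli_F _ _ T1 T2 R m2 (fun x => f x.1 x.2) mf (fun x => f0 x.1 x.2)).
Qed.

Lemma measurable_integral1 (f : T1 -> T2 -> \bar R) :
  measurable_fun setT (fun x : T1 * T2 => f x.1 x.2) ->
  (forall x y, 0 <= f x y)%E ->
  measurable_fun setT (fun y => \int[m1]_x f x y)%E.
Proof.
move=> mf f0.
exact: (@measurable_fun_fubini_tonelli_G _ _ T1 T2 R m1 (fun x => f x.1 x.2) mf (fun x => f0 x.1 x.2)).
Qed.

End fubini_wrappers.

(** * Lebesgue measure on Euclidean space *)

Section lebesgue_borel_theory.
Context (R : realType).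
Local Open Scope ereal_scope.
Local Notation lam := (lebesgue_borel R).
Local Notation leb := (@lebesgue_measure R).

Lemma integral_rV0 (g : 'rV[R]_0 -> \bar R) : measurable_fun setT g ->
  \int[lam 0]_y g y = g 0%R.
Proof.
by move=> mg; rewrite /= /dirac_rV0 integral_dirac// diracT mul1e.
Qed.

Lemma integral_rVS n (g : 'rV[R]_n.+1 -> \bar R) : measurable_fun setT g ->
  (forall x, 0 <= g x) ->
  \int[lam n.+1]_x g x = \int[leb]_t \int[lam n]_y g (rV_cons (t, y)).
Proof.
move=> mg g0; rewrite [LHS](_ : _ =
    \int[pushforward (leb \x lam n) (@rV_cons R n)]_x g x)//.
rewrite ge0_integral_pushforward//; last exact: measurable_rV_cons.
rewrite preimage_setT fubini_tonelli1//; last by move=> x; exact: g0.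
by apply: measurableT_comp => //; exact: measurable_rV_cons.
Qed.

(** Uniqueness of Lebesgue measure: s times the image of the measure under x -> s x + z has the
    right value on half-open intervals. *)
Lemma integral_affine1 (g : R -> \bar R) (s z : R) : (0 < s)%R ->
  measurable_fun setT g -> (forall x, 0 <= g x) ->
  \int[leb]_x g (s * x + z)%R = (s^-1)%:E * \int[leb]_x g x.
Proof.
move=> s0 mg g0.
pose h (x : measurableTypeR R) : measurableTypeR R := (s * x + z)%R.
have mh : measurable_fun setT h.
  by apply: measurable_funD => //; exact: measurable_funM.
pose m' : {measure set (measurableTypeR R) -> \bar R} := pushforward leb h.
pose m := m' mh.
have E A : measurable A -> leb A = mscale (NngNum (ltW s0)) m A.
  apply: (@lebesgue_measure_unique _ (mscale (NngNum (ltW s0)) m)).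
  move=> _ [[a b] _ <-].
  have E1 : m' mh `]a, b]%classic = leb `]((a - z) / s)%R, ((b - z) / s)%R]%classic.
    rewrite /m' /pushforward; congr (leb _).
    apply/seteqP; split=> x; rewrite /h /= !in_itv /= ltr_pdivrMr// ler_pdivlMr//;
    by rewrite ltrBlDr lerBrDr (mulrC x).
  apply: (etrans _ (congr1 (fun y => s%:E * y) (esym E1))).
  rewrite !lebesgue_measure_itv/= !lte_fin ltr_pM2r ?invr_gt0// ltrD2r.
  case: ifP => _; last by rewrite mule0.
  by rewrite -!EFinB -EFinM; congr EFin; field; rewrite gt_eqF.
have -> : \int[leb]_x g x = s%:E * \int[leb]_x g (h x).
  rewrite (eq_measure_integral (mscale (NngNum (ltW s0)) m)); last first.
    by move=> A mA _; exact: E.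
  rewrite ge0_integral_mscale//.
  by congr (_ * _); rewrite /m ge0_integral_pushforward.
by rewrite muleA -EFinM mulVf ?gt_eqF// mul1e.
Qed.

Lemma measurable_affine n (s : R) (z : 'rV[R]_n) :
  measurable_fun setT (fun x : 'rV[R]_n => (s *: x + z)%R).
Proof.
apply: measurable_fun_rVP => i.
under eq_fun do rewrite !mxE.
by apply: measurable_funD => //; apply: measurable_funM => //; exact: measurable_coor.
Qed.

(** Induction on the dimension: the first coordinate is rescaled by the one-dimensional formula, the
    remaining slice by the induction hypothesis. *)
Lemma integral_affine n (g : 'rV[R]_n -> \bar R) (s : R) (z : 'rV[R]_n) :
  (0 < s)%R -> measurable_fun setT g -> (forall x, 0 <= g x) ->
  \int[lam n]_x g (s *: x + z)%R = ((s ^+ n)^-1)%:E * \int[lam n]_x g x.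
Proof.
move=> s0; elim: n g z => [|n IH] g z mg g0.
  rewrite !integral_rV0//; last first.
    by apply: measurableT_comp => //; exact: measurable_affine.
  by rewrite expr0 invr1 mul1e; congr g; apply/rowP => -[].
have maf := measurable_affine s z.
rewrite !integral_rVS//; last exact: measurableT_comp mg maf.
pose z1 := z ord0 ord0; pose z2 := @rsubmx R 1 1 n z.
have zE : z = rV_cons (z1, z2).
  rewrite /rV_cons /=; apply: etrans (esym (@hsubmxK R 1 1 n z)) _.
  congr (@row_mx R 1 1 n _ _).
  apply/rowP => j; rewrite !mxE [j]ord1 eqxx mulr1n /z1; congr (z _ _); exact: val_inj.
have cE t y : (s *: rV_cons (t, y) + z)%R = rV_cons ((s * t + z1)%R, (s *: y + z2)%R).
  rewrite [in LHS]zE /rV_cons /=.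
  transitivity ((s *: (row_mx (t%:M : 'rV[R]_1) y : 'M[R]_(1, 1 + n)) +
    row_mx (z1%:M : 'rV[R]_1) z2)%R : 'M[R]_(1, 1 + n)) => //.
  rewrite scale_row_mx add_row_mx; congr (@row_mx R 1 1 n _ _).
  by rewrite scale_scalar_mx -raddfD.
under eq_integral => t _.
  under eq_integral do rewrite cE.
  over.
have mc t : measurable_fun setT (fun y : 'rV[R]_n => g (rV_cons (t, y))).
  apply: measurableT_comp => //.
  apply: (measurableT_comp (@measurable_rV_cons R n)).
  exact: pair1_measurable.
under eq_integral => t _.
  rewrite (IH (fun y => g (rV_cons ((s * t + z1)%R, y))))//.
  over.
have mF : measurable_fun setT (fun x : measurableTypeR R * 'rV[R]_n =>
    g (rV_cons ((s * x.1 + z1)%R, x.2))).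
  apply: (measurableT_comp mg); apply: (measurableT_comp (@measurable_rV_cons R n)).
  apply: measurable_fun_pair; last exact: measurable_snd.
  apply: measurable_funD => //; apply: measurable_funM => //; exact: measurable_fst.
have mG : measurable_fun setT (fun x : measurableTypeR R * 'rV[R]_n =>
    g (rV_cons (x.1, x.2))).
  apply: (measurableT_comp mg); apply: (measurableT_comp (@measurable_rV_cons R n)).
  by apply: measurable_fun_pair; [exact: measurable_fst|exact: measurable_snd].
rewrite ge0_integralTZl; last 3 first.
- by apply: (measurable_integral2 (lam n) mF) => t y; exact: g0.
- by move=> t; exact: integral_ge0.
- by rewrite invr_ge0 exprn_ge0// ltW.
rewrite (@integral_affine1 (fun t => \int[lam n]_y g (rV_cons (t, y))) _ _ s0); last 2 first.
- by apply: (measurable_integral2 (lam n) mG) => t y; exact: g0.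
- by move=> t; exact: integral_ge0.
by rewrite muleA -EFinM -invfM -exprSr.
Qed.

Lemma dotv_cons n (x y : R * 'rV[R]_n) :
  dotv (rV_cons x) (rV_cons y) = (x.1 * y.1 + dotv x.2 y.2)%R.
Proof.
rewrite /dotv big_ord_recl; congr (_ + _)%R.
  rewrite (_ : ord0 = lshift n ord0 :> 'I_(1 + n)); last exact/val_inj.
  by rewrite /rV_cons !(@row_mxEl _ 1 1 n) !mxE !eqxx !mulr1n.
apply: eq_bigr => i _.
rewrite (_ : lift ord0 i = rshift 1 i :> 'I_(1 + n)); last exact/val_inj.
by rewrite /rV_cons !(@row_mxEr _ 1 1 n).
Qed.

Lemma measurable_dotv d (T : measurableType d) n (f g : T -> 'rV[R]_n) :
  (forall i, measurable_fun setT (fun x => f x ord0 i)) ->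
  (forall i, measurable_fun setT (fun x => g x ord0 i)) ->
  measurable_fun setT (fun x => dotv (f x) (g x)).
Proof.
by move=> mf mg; apply: measurable_sum => i; apply: measurable_funM.
Qed.

Lemma measurable_enorm d (T : measurableType d) n (f : T -> 'rV[R]_n) :
  (forall i, measurable_fun setT (fun x => f x ord0 i)) ->
  measurable_fun setT (fun x => enorm (f x)).
Proof.
move=> mf; rewrite /enorm.
exact: measurableT_comp (continuous_measurable_fun (@sqrt_continuous R)) (measurable_dotv mf mf).
Qed.

(** The Gaussian factors over the coordinates. The value serves twice: it shows that the unit ball
    has finite volume, and it determines that volume. *)
Lemma integral_gauss_rV n :
  \int[lam n]_x (expR (- dotv x x))%:E = ((Num.sqrt pi) ^+ n)%:E.
Proof.
have mg m : measurable_fun setT (fun x : 'rV[R]_m => (expR (- dotv x x))%:E).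
  apply/measurable_EFinP/measurableT_comp => //.
  apply: measurableT_comp => //; apply: measurable_dotv => i; exact: measurable_coor.
elim: n => [|n IH].
  by rewrite integral_rV0// /dotv big_ord0 oppr0 expR0.
rewrite integral_rVS; [|exact: mg|by move=> x; rewrite lee_fin expR_ge0].
transitivity (\int[leb]_t ((expR (- (t * t)))%:E * ((Num.sqrt pi) ^+ n)%:E)).
  apply: eq_integral => t _.
  transitivity (\int[lam n]_y ((expR (- (t * t)))%:E * (expR (- dotv y y))%:E)).
    by apply: eq_integral => y _; rewrite dotv_cons/= opprD expRD EFinM.
  by rewrite ge0_integralTZl ?IH ?expR_ge0//; exact: mg.
rewrite ge0_integralTZr; last 3 first.
- apply/measurable_EFinP/measurableT_comp => //; apply: measurableT_comp => //.
  exact: measurable_funM.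
- by move=> x; rewrite lee_fin expR_ge0.
- by rewrite exprn_ge0// sqrtr_ge0.
rewrite exprS EFinM; congr (_ * _); rewrite -integralT_gauss.
by apply: eq_integral => t _; rewrite /gauss_fun expr2.
Qed.

End lebesgue_borel_theory.

Section real_lemmas.
Context (R : realType).

Lemma mem_itvoy (c y : R) : (y \in (`]c, +oo[%classic : set R)) = (c < y).
Proof. by apply/idP/idP; rewrite inE /= in_itv /= andbT. Qed.

Lemma powR_cvgy (a : R) : a < 0 -> x `^ a @[x --> +oo] --> (0 : R).
Proof.
move=> a0; have na : 0 < - a by rewrite oppr_gt0.
apply/cvgrPdist_le => e e0; near=> x.
rewrite sub0r normrN ger0_norm ?powR_ge0// -(opprK a) powRN.
rewrite -[leRHS]invrK lef_pV2 ?posrE ?invr_gt0 ?powR_gt0//.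
have -> : e^-1 = (e^-1 `^ (- a)^-1) `^ (- a).
  by rewrite -powRrM mulVf ?gt_eqF// powRr1// invr_ge0 ltW.
by rewrite ge0_ler_powR ?nnegrE ?powR_ge0 ?ltW.
Unshelve. all: by end_near. Qed.

Lemma powR_continuous (a x : R) : 0 < x -> {for x, continuous (fun y : R => y `^ a)}.
Proof.
by move=> x0; apply/differentiable_continuous/derivable1_diffP/derivable_powR; rewrite in_itv /= x0.
Qed.

Lemma integral_powR_tail (c q : R) : 0 < c -> 1 < q ->
  (\int[@lebesgue_measure R]_(x in `]c, +oo[) (x `^ (- q))%:E =
   (c `^ (1 - q) / (q - 1))%:E)%E.
Proof.
move=> c0 q1; have q10 : 1 - q != 0 by rewrite subr_eq0 lt_eqF.
rewrite integral_itv_obnd_cbnd; last first.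
  by apply/measurable_EFinP; apply: measurable_funTS; exact: measurable_powR.
have d (x : R) : 0 < x -> is_derive x 1 (fun x : R => x `^ (1 - q) / (1 - q)) (x `^ (- q)).
  move=> x0; have d1 := is_derive1_powR (1 - q) x0.
  have -> : x `^ (- q) = (1 - q)^-1 *: ((1 - q) * x `^ (1 - q - 1)).
    by rewrite /GRing.scale /= mulrA mulVf// mul1r; congr (_ `^ _); ring.
  have -> : (fun x : R => x `^ (1 - q) / (1 - q)) = (1 - q)^-1 \*: (fun x : R => x `^ (1 - q)).
    by apply/funext => y; rewrite /GRing.scale /= mulrC.
  exact: is_deriveZ.
rewrite (@ge0_continuous_FTC2y _ (fun x => x `^ (- q)) (fun x => x `^ (1 - q) / (1 - q)) _ 0).
- by rewrite sub0e -EFinN -mulrN -invrN opprB.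
- by move=> x _; exact: powR_ge0.
- apply: continuous_in_subspaceT => x; rewrite inE /= in_itv /= andbT => cx.
  by apply: powR_continuous; exact: lt_le_trans cx.
- rewrite -(mul0r (1 - q)^-1); apply: cvgMl; apply: powR_cvgy.
  by rewrite subr_lt0.
- by move=> x cx; exact: (@ex_derive _ _ _ _ _ _ _ (d _ (lt_trans c0 cx))).
- apply: cvg_at_right_filter; apply: cvgMl; exact: powR_continuous.
- move=> x; rewrite in_itv /= andbT => cx.
  by rewrite derive1E; exact: (@derive_val _ _ _ _ _ _ _ (d _ (lt_trans c0 cx))).
Qed.

End real_lemmas.

(** * Volume of balls and integrals of negative powers of the norm *)

Section ball_volume.
Context (R : realType) (n : nat).
Local Notation lam := (lebesgue_borel R n).
Local Notation leb := (@lebesgue_measure R).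

Lemma measurable_enormB (x : 'rV[R]_n) :
  measurable_fun setT (fun y : 'rV[R]_n => enorm (y - x)).
Proof.
apply: (measurable_enorm (f := fun y : 'rV[R]_n => y - x)) => i.
under eq_fun do rewrite !mxE.
by apply: measurable_funB => //; exact: measurable_coor.
Qed.

Lemma measurable_enorm_id : measurable_fun setT (fun y : 'rV[R]_n => enorm y).
Proof. by apply: (measurable_enorm (f := idfun)) => i; exact: measurable_coor. Qed.

Lemma measurable_eball (x : 'rV[R]_n) r : measurable (eball x r).
Proof.
rewrite -[X in measurable X]setTI.
have := measurable_enormB x measurableT (measurable_itv `]-oo, r[%R).
by rewrite preimage_itvNyo.
Qed.

Lemma enormZ s (x : 'rV[R]_n) : enorm (s *: x) = `|s| * enorm x.
Proof.
rewrite /enorm /dotv; under eq_bigr do rewrite !mxE mulrACA.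
by rewrite -mulr_sumr sqrtrM ?sqr_ge0// -expr2 sqrtr_sqr.
Qed.

Lemma enorm_ge0 (x : 'rV[R]_n) : 0 <= enorm x.
Proof. exact: sqrtr_ge0. Qed.

Lemma eball_affine (z : 'rV[R]_n) (r : R) : 0 < r ->
  lam (eball z r) = ((r ^+ n)%:E * lam (eball 0 1))%E.
Proof.
move=> r0; rewrite -!integral_indicT; try exact: measurable_eball.
rewrite [in RHS](_ : (fun x => _) = (fun x => (\1_(eball z r) (r *: x + z))%:E)).
  have mB : measurable_fun setT (fun x => (\1_(eball z r) x : R)%:E).
    by apply: measurable_indic_EFin; exact: measurable_eball.
  have -> := @integral_affine R n _ r z r0 mB (@indic_EFin_ge0 _ _ _ _).
  by rewrite muleA -EFinM divff ?mul1e// gt_eqF// exprn_gt0.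
apply/funext => x; rewrite !indicE; congr (_%:R%:E); congr nat_of_bool.
by apply/idP/idP; rewrite !inE /eball /= subr0 addrK enormZ gtr0_norm// gtr_pMr.
Qed.

Definition ball_volume : R := fine (lam (eball 0 1)).

(** On the unit ball the Gaussian is at least e^(-1), so the finite Gaussian integral bounds the
    volume. *)
Lemma ball_volumeE : lam (eball 0 1) = ball_volume%:E.
Proof.
rewrite /ball_volume fineK// ge0_fin_numE//.
have h : ((expR (-1))%:E * lam (eball 0 1) <= ((Num.sqrt pi) ^+ n)%:E :> \bar R)%E.
  have mB := measurable_indic_EFin (R := R) (measurable_eball 0 1).
  rewrite -integral_gauss_rV -integral_indicT; last exact: measurable_eball.
  rewrite -ge0_integralTZl ?expR_ge0//.
  apply: ge0_le_integralT.
  - exact: measurable_funeM.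
  - apply/measurable_EFinP/measurableT_comp => //; apply: measurableT_comp => //.
    by apply: measurable_dotv => i; exact: measurable_coor.
  - by move=> x; rewrite mule_ge0// ?lee_fin ?expR_ge0.
  move=> x; rewrite -EFinM lee_fin indicE.
  have [|_] := boolP (x \in eball 0 1); last by rewrite mulr0 expR_ge0.
  rewrite inE /eball /= subr0 mulr1 ler_expR lerN2 => x1.
  have d0 : 0 <= dotv x x by apply: sumr_ge0 => i _; rewrite -expr2 sqr_ge0.
  by rewrite -(sqr_sqrtr d0) -/(enorm x) expr_le1 ?enorm_ge0// ltW.
have e0 : 0 < expR (-1) :> R by exact: expR_gt0.
rewrite ltey; apply/eqP => H; move: h; rewrite H.
by rewrite gt0_muley ?lte_fin.
Qed.

Lemma ball_volume_ge0 : 0 <= ball_volume.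
Proof. by rewrite -lee_fin -ball_volumeE. Qed.

Lemma lam_eball z r : 0 <= r -> (0 < n)%N -> lam (eball z r) = (ball_volume * r ^+ n)%:E.
Proof.
rewrite le_eqVlt => /predU1P[<- n0|r0 _].
  rewrite expr0n gtn_eqF// mulr0 (_ : eball _ _ = set0) ?measure0//.
  by apply/seteqP; split=> // x; rewrite /eball /= ltNge enorm_ge0.
by rewrite eball_affine// ball_volumeE -EFinM mulrC.
Qed.

Lemma integral_expR_tail (c : R) : 0 <= c ->
  (\int[leb]_(s in `]c, +oo[) (expR (- s))%:E = (expR (- c))%:E)%E.
Proof.
move=> c0; have ce : continuous (fun x : R => expR (- x)).
  by move=> x; apply: continuous_comp; [exact: continuousN|exact: continuous_expR].
have de (x : R) : is_derive x 1 (fun x : R => - expR (- x)) (expR (- x)).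
  have := @is_deriveN _ _ _ (expR \o -%R) x 1 _
    (@is_derive1_comp _ expR -%R x _ _ (is_derive_expR _) (is_deriveN _)).
  by move=> /(_ _ (is_derive_id _ _)); rewrite mulrN1 opprK.
rewrite integral_itv_obnd_cbnd//; last first.
  apply/measurable_EFinP; apply: measurable_funTS; exact: continuous_measurable_fun.
rewrite (@ge0_continuous_FTC2y _ (fun x => expR (- x)) (fun x => - expR (- x)) _ 0).
- by rewrite sub0e EFinN oppeK.
- by move=> x _; exact: expR_ge0.
- exact: continuous_subspaceT.
- rewrite -[X in _ --> X]oppr0; apply: cvgN; exact: cvgr_expR.
- by move=> x _; exact: (@ex_derive _ _ _ _ _ _ _ (de x)).
- by apply: cvg_at_right_filter; apply: cvgN; exact: ce.
- by move=> x _; rewrite derive1E; exact: (@derive_val _ _ _ _ _ _ _ (de x)).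
Qed.

(* Layer-cake computation of the Gaussian integral. *)
Lemma ball_volume_Gamma : (0 < n)%N ->
  (ball_volume%:E * \int[leb]_(t in `]0%R, +oo[) (t `^ (n%:R / 2) * expR (- t))%:E =
   ((Num.sqrt pi) ^+ n)%:E)%E.
Proof.
move=> n0.
(* e^(-|x|^2) is the integral of e^(-y) over y > |x|^2, that is, over the slice of A at x. In the
   other order the slices are balls of radius sqrt y, whose volumes are multiples of y^(n/2) and
   produce the Gamma integral. *)
pose A := [set x : 'rV[R]_n * measurableTypeR R | enorm x.1 ^+ 2 < x.2].
have mA : measurable A.
  apply: (@measurable_ltr _ _ _ (fun x : 'rV[R]_n * measurableTypeR R => enorm x.1 ^+ 2) snd).
    apply: measurable_funX; exact: measurableT_comp measurable_enorm_id measurable_fst.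
  exact: measurable_snd.
pose f (x : 'rV[R]_n) (y : measurableTypeR R) : \bar R := ((expR (- y))%:E * (\1_A (x, y))%:E)%E.
have mf : measurable_fun setT (fun x : 'rV[R]_n * measurableTypeR R => f x.1 x.2).
  apply: emeasurable_funM.
    by apply/measurable_EFinP; apply: measurableT_comp => //; apply: measurableT_comp => //; exact: measurable_snd.
  rewrite (_ : (fun _ => _) = (fun x => (\1_A x)%:E)); last by apply/funext => -[].
  exact: measurable_indic_EFin.
have f0 x y : (0 <= f x y)%E by rewrite mule_ge0 ?lee_fin ?expR_ge0.
have := tonelli lam leb mf f0.
have -> : (\int[lam]_x \int[leb]_y f x y = ((Num.sqrt pi) ^+ n)%:E)%E.
  rewrite -integral_gauss_rV; apply: eq_integral => x _.
  have d0 : 0 <= dotv x x by apply: sumr_ge0 => i _; rewrite -expr2 sqr_ge0.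
  rewrite -integral_expR_tail// [RHS]integral_mkcond; apply: eq_integral => y _.
  rewrite /f patchE indicE mem_itvoy.
  have -> : ((x, y) \in A) = (dotv x x < y).
    by apply/idP/idP; rewrite inE /A /= /enorm sqr_sqrtr.
  by case: ifPn => _; rewrite ?mule1 ?mule0.
move=> ->; rewrite integral_mkcond -ge0_integralTZl; last 3 first.
- apply/(measurable_restrictT _ _).1 => //.
  apply/measurable_EFinP; apply: measurable_funTS; apply: measurable_funM.
    exact: measurable_powR.
  by apply: measurableT_comp => //; exact: measurableT_comp.
- by move=> x; rewrite patchE; case: ifPn => // _; rewrite lee_fin mulr_ge0 ?powR_ge0 ?expR_ge0.
- exact: ball_volume_ge0.
apply: eq_integral => y _.
transitivity ((expR (- y))%:E * lam [set x | (enorm x ^+ 2 < y)%R])%E; last first.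
  have mAy : measurable [set x : 'rV[R]_n | enorm x ^+ 2 < y].
    apply: (@measurable_ltr _ _ _ (fun x : 'rV[R]_n => enorm x ^+ 2) (cst y)) => //.
    by apply: measurable_funX; exact: measurable_enorm_id.
  rewrite -(integral_indicT _ mAy) -ge0_integralTZl ?expR_ge0//.
  exact: measurable_indic_EFin.
rewrite patchE mem_itvoy.
case: ifPn => [y0|]; last first.
  rewrite -leNgt => y0; rewrite (_ : [set x | _] = set0) ?measure0 ?mule0//.
  apply/seteqP; split=> // x /=; rewrite ltNge (le_trans y0)// sqr_ge0//.
have -> : [set x : 'rV[R]_n | enorm x ^+ 2 < y] = eball 0 (Num.sqrt y).
  have h (x : 'rV[R]_n) : (enorm x ^+ 2 < y) = (enorm x < Num.sqrt y).
    by rewrite -[in LHS](sqr_sqrtr (ltW y0)) ltr_pXn2r// nnegrE ?sqrtr_ge0 ?enorm_ge0.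
  by apply/seteqP; split=> x; rewrite /eball /= subr0 h.
rewrite lam_eball ?sqrtr_ge0// -!EFinM; congr EFin.
rewrite -powR12_sqrt ?ltW// -powR_mulrn ?powR_ge0// -powRrM mulrC.
by rewrite (mulrC 2^-1); ring.
Qed.

(* Layer cake again: the sets where |y|^(-b) > s are contained in balls. *)
Lemma le_integral_enorm_powR (b r : R) : 0 <= b < n%:R -> 0 < r ->
  (\int[lam]_y (\1_(eball 0 r) y * enorm y `^ (- b))%:E <=
   (ball_volume * (n%:R / (n%:R - b)) * r `^ (n%:R - b))%:E)%E.
Proof.
move=> /andP[b0 bn] r0; have n0 : (0 < n)%N by rewrite -(ltr0n R) (le_lt_trans b0).
have rn : r `^ n%:R = r ^+ n by rewrite powR_mulrn// ltW.
have [->|bn0] := eqVneq b 0.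
  rewrite subr0 divff ?gt_eqF ?ltr0n// mulr1 rn -(lam_eball 0 (ltW r0) n0).
  rewrite -integral_indicT; last exact: measurable_eball.
  have -> // : (\int[lam]_y (\1_(eball 0 r) y * enorm y `^ (- 0))%:E =
      \int[lam]_y (\1_(eball 0 r) y)%:E)%E.
  by apply: eq_integral => y _; rewrite oppr0 powRr0 mulr1.
have bp : 0 < b by rewrite lt_neqAle eq_sym bn0.
pose g (x : 'rV[R]_n) : R := \1_(eball 0 r) x * enorm x `^ (- b).
have mg : measurable_fun setT g.
  rewrite /g; apply: measurable_funM; first by apply: measurable_indic; exact: measurable_eball.
  exact: measurableT_comp (measurable_powR _) measurable_enorm_id.
have g0 x : 0 <= g x by rewrite mulr_ge0 ?powR_ge0// indicE.
pose A := [set x : 'rV[R]_n * measurableTypeR R | 0 <= x.2] `&`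
  [set x : 'rV[R]_n * measurableTypeR R | x.2 < g x.1].
have mA : measurable A.
  apply: measurableI.
    by apply: (@measurable_ler _ _ _ (cst 0) snd) => //; exact: measurable_snd.
  apply: (@measurable_ltr _ _ _ snd (g \o fst)); first exact: measurable_snd.
  exact: measurableT_comp mg measurable_fst.
pose f (x : 'rV[R]_n) (y : measurableTypeR R) : \bar R := (\1_A (x, y))%:E.
have mf : measurable_fun setT (fun x : 'rV[R]_n * measurableTypeR R => f x.1 x.2).
  rewrite (_ : (fun _ => _) = (fun x => (\1_A x)%:E)); last by apply/funext => -[].
  exact: measurable_indic_EFin.
have f0 x y : (0 <= f x y)%E by rewrite lee_fin.
have := tonelli lam leb mf f0.
have -> : (\int[lam]_x \int[leb]_y f x y = \int[lam]_x (g x)%:E)%E.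
  apply: eq_integral => x _.
  transitivity (leb `[0, g x[%classic); last first.
    by rewrite lebesgue_measure_itv/= lte_fin; case: ltP => h; rewrite ?sube0//; congr EFin; apply/eqP; rewrite eq_le h g0.
  rewrite -integral_indicT//; apply: eq_integral => y _; rewrite /f !indicE.
  congr (_%:R%:E); congr nat_of_bool; apply/idP/idP; rewrite !inE /A /= in_itv /=.
    by case=> -> ->.
  by move=> /andP[].
rewrite /g => ->.
(* c is the value of |x|^(-b) on the sphere of radius r. For levels up to c the level set is bounded
   by the whole ball ([h1]); above c it lies in a ball of radius y^(-1/b), whose volume has an
   integrable tail ([h2]) since q = n / b > 1. *)
pose c := r `^ (- b); have c0 : 0 < c by exact: powR_gt0.
pose q := n%:R / b; have q1 : 1 < q by rewrite /q ltr_pdivlMr// mul1r.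
pose om := ball_volume; have om0 : 0 <= om := ball_volume_ge0.
pose h1 y : \bar R := ((om * r ^+ n)%:E * (\1_(`[0, c]%classic) y)%:E)%E.
pose k2 y : \bar R := ((fun y : R => (y `^ (- q))%:E) \_ (`]c, +oo[%classic)) y.
pose h2 y : \bar R := (om%:E * k2 y)%E.
have mh1 : measurable_fun (setT : set (measurableTypeR R)) h1.
  by apply: measurable_funeM; exact: measurable_indic_EFin.
have k20 y : (0 <= k2 y)%E.
  by rewrite /k2 patchE; case: ifPn => // _; rewrite lee_fin powR_ge0.
have mk2 : measurable_fun (setT : set (measurableTypeR R)) k2.
  apply/(measurable_restrictT _ _).1 => //.
  by apply/measurable_EFinP; apply: measurable_funTS; exact: measurable_powR.
have h10 y : (0 <= h1 y)%E.
  by rewrite mule_ge0// lee_fin ?indicE// mulr_ge0// exprn_ge0// ltW.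
have h20 y : (0 <= h2 y)%E by rewrite mule_ge0// lee_fin.
apply: (@le_trans _ _ (\int[leb]_y (h1 y + h2 y))%E).
  apply: ge0_le_integralT.
  - by apply: (measurable_integral1 lam mf) => x y; exact: f0.
  - by apply: emeasurable_funD => //; exact: measurable_funeM.
  - by move=> y; apply: integral_ge0.
  move=> y.
  have mAy : measurable [set x : 'rV[R]_n | A (x, y)].
    by rewrite -[X in measurable X]setTI; exact: (pair2_measurable y measurableT mA).
  have -> : (\int[lam]_x f x y = lam [set x | A (x, y)])%E.
    rewrite -(integral_indicT _ mAy); apply: eq_integral => x _; rewrite /f !indicE.
    by congr (_%:R%:E); congr nat_of_bool; apply/idP/idP; rewrite !inE.
  have [y0|y0] := ltP y 0.
    rewrite (_ : [set x | _] = set0) ?measure0 ?adde_ge0//.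
    by apply/seteqP; split=> // x [] /=; rewrite leNgt y0.
  have [yc|cy] := leP y c.
    rewrite -[leLHS]adde0; apply: leeD => //.
    rewrite /h1 indicE mem_set ?mule1; last by rewrite /= in_itv /= y0.
    rewrite -(lam_eball 0 (ltW r0) n0); apply: le_measure; rewrite ?inE//.
      exact: measurable_eball.
    move=> x [_] /=; rewrite /g indicE.
    case: (boolP (x \in eball 0 r)) => [|_]; first by rewrite inE.
    by rewrite mul0r ltNge y0.
  have yp : 0 < y := lt_trans c0 cy.
  rewrite -[leLHS]add0e; apply: leeD => //.
  rewrite /h2 /k2 patchE mem_set; last by rewrite /= in_itv /= cy.
  have -> : (om%:E * (y `^ (- q))%:E = lam (eball 0 (y `^ (- b^-1))))%E.
    rewrite lam_eball ?powR_ge0// -EFinM -powR_mulrn ?powR_ge0// -powRrM.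
    by rewrite mulNr (mulrC b^-1).
  apply: le_measure; rewrite ?inE//; first exact: measurable_eball.
  move=> x [_] /=; rewrite /g indicE /eball /= subr0.
  case: (boolP (x \in eball 0 r)) => _; last by rewrite mul0r ltNge y0.
  rewrite mul1r => yx.
  have x0 : 0 < enorm x.
    rewrite lt_neqAle enorm_ge0 andbT eq_sym; apply/eqP => x0; move: yx.
    by rewrite x0 powR0 ?oppr_eq0// ltNge y0.
  have h : y `^ b^-1 < (enorm x)^-1.
    have -> : (enorm x)^-1 = (enorm x `^ (- b)) `^ b^-1.
      by rewrite -powRrM mulNr mulfV ?gt_eqF// powR_inv1// ltW.
    by rewrite gt0_ltr_powR ?invr_gt0// nnegrE ?powR_ge0// ltW.
  by rewrite powRN -[ltLHS]invrK ltf_pV2 ?posrE ?invr_gt0 ?powR_gt0.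
rewrite ge0_integralTD//; last exact: measurable_funeM.
rewrite /h1 ge0_integralTZl; last 3 first.
- exact: measurable_indic_EFin.
- by move=> y; exact: indic_EFin_ge0.
- by rewrite mulr_ge0// exprn_ge0// ltW.
have -> : (\int[leb]_x (\1_(`[0%R, c]%classic) x)%:E = c%:E)%E.
  transitivity (leb `[0%R, c]%classic); first exact: integral_indicT.
  by rewrite lebesgue_measure_itv/= lte_fin c0 sube0.
rewrite /h2 ge0_integralTZl//.
have -> : (\int[leb]_x k2 x = (c `^ (1 - q) / (q - 1))%:E)%E.
  by rewrite /k2 -integral_mkcond integral_powR_tail.
have cE : c `^ (1 - q) = r `^ (n%:R - b).
  by rewrite /c -powRrM /q; congr (_ `^ _); field; rewrite gt_eqF.
have rE : r ^+ n * c = r `^ (n%:R - b).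
  by rewrite /c powRB ?gt_eqF ?implybT// rn powRN.
rewrite -!EFinM -EFinD lee_fin -/om -(mulrA om (r ^+ n) c) rE cE.
have -> : om * (n%:R / (n%:R - b)) * r `^ (n%:R - b) =
  om * r `^ (n%:R - b) + om * (r `^ (n%:R - b) / (q - 1)).
  have nb : n%:R - b != 0 by rewrite subr_eq0 gt_eqF.
  have -> : q - 1 = (n%:R - b) / b by rewrite /q mulrBl divff.
  by field; rewrite ?bn0 ?nb.
by [].
Qed.

End ball_volume.

(** * From the completed Lebesgue measure to the Borel one and back *)

Section borel_representatives.
Context (R : realType) (n : nat).
Local Notation mu := (lebesgue_rV R n).
Local Notation lam := (lebesgue_borel R n).
Local Notation LT := (lebesgue_type R n).

Lemma measurable_borel_lebesgue (A : set 'rV[R]_n) :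
  measurable A -> measurable (A : set LT).
Proof. exact: caratheodory_measurable_mu_ext. Qed.

Lemma lebesgue_rVE (A : set 'rV[R]_n) : measurable A -> mu A = lam A.
Proof. by move=> mA; rewrite /lebesgue_rV /completed_measure_extension measurable_mu_extE. Qed.

Lemma measurable_fun_borel_lebesgue d (T : measurableType d) (f : 'rV[R]_n -> T) :
  measurable_fun setT f -> measurable_fun (setT : set LT) f.
Proof.
move=> mf _ Y mY; rewrite setTI; apply: measurable_borel_lebesgue.
by rewrite -[X in measurable X]setTI; exact: mf.
Qed.

Lemma ge0_integral_lebesgue_borel (f : 'rV[R]_n -> \bar R) :
  measurable_fun setT f -> (forall x, 0 <= f x)%E ->
  (\int[mu]_x f x = \int[lam]_x f x)%E.
Proof.
move=> mf f0.
have mid : measurable_fun (setT : set LT) (id : LT -> 'rV[R]_n).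
  exact: measurable_fun_borel_lebesgue.
pose m' : {measure set 'rV[R]_n -> \bar R} := pushforward mu (id : LT -> 'rV[R]_n).
rewrite (eq_measure_integral (m' mid)); last first.
  by move=> A mA _; exact: esym (lebesgue_rVE mA).
by rewrite [RHS](ge0_integral_pushforward mid).
Qed.

Lemma integral_lebesgue_borel (f : 'rV[R]_n -> \bar R) : measurable_fun setT f ->
  (\int[mu]_x f x = \int[lam]_x f x)%E.
Proof.
move=> mf; rewrite integralE [RHS]integralE.
by rewrite !ge0_integral_lebesgue_borel//; [exact: measurable_funeneg|exact: measurable_funepos].
Qed.

(** Covers of total mass at most 1/(k+1), given by the outer measure, are Borel supersets; their
    intersection is Borel and null. *)
Lemma lebesgue_null_borel (A : set 'rV[R]_n) : mu A = 0%E ->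
  exists B : set 'rV[R]_n, [/\ measurable B, lam B = 0%E & A `<=` B].
Proof.
move=> A0.
have : forall k : nat, exists B : set 'rV[R]_n,
    [/\ measurable B, (lam B <= (k.+1%:R^-1)%:E)%E & A `<=` B].
  move=> k.
  have k0 : (0 < (k.+1%:R^-1)%:E :> \bar R)%E by rewrite lte_fin invr_gt0.
  have : (mu_ext lam A < (k.+1%:R^-1)%:E)%E.
    by move: A0; rewrite /lebesgue_rV /completed_measure_extension => ->.
  move=> /ereal_inf_lt[_ [F [mF AF] <-]] /ltW hF.
  exists (\bigcup_k F k); split => //; first exact: bigcupT_measurable.
  apply: le_trans hF; apply: measure_sigma_subadditive => //.
  exact: bigcupT_measurable.
move=> /choice[B hB]; exists (\bigcap_k B k); split.
- by apply: bigcapT_measurable => k; case: (hB k).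
- apply/eqP; rewrite eq_le measure_ge0 andbT; apply/lee_addgt0Pr => e e0.
  rewrite add0e; have [k] : exists k : nat, k.+1%:R^-1 <= e.
    exists (Num.truncn e^-1); rewrite -[leRHS]invrK lef_pV2 ?posrE ?invr_gt0//.
    by rewrite ltW// truncnS_gt.
  rewrite -lee_fin; apply: le_trans; have [mB hk _] := hB k.
  apply: le_trans hk; apply: le_measure; rewrite ?inE//; last exact: bigcap_inf.
  by apply: bigcapT_measurable => j; case: (hB j).
- by move=> x Ax k _; case: (hB k) => _ _; apply.
Qed.

Lemma ae_borel_lebesgue (P : 'rV[R]_n -> Prop) :
  {ae lam, forall x, P x} -> {ae mu, forall x, P x}.
Proof.
move=> [A [mA A0 PA]]; exists A; split => //; first exact: measurable_borel_lebesgue.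
by rewrite lebesgue_rVE.
Qed.

Lemma ae_lebesgue_borel (P : 'rV[R]_n -> Prop) :
  {ae mu, forall x, P x} -> {ae lam, forall x, P x}.
Proof.
move=> [A [mA /lebesgue_null_borel[B [mB B0 AB]] PA]].
by exists B; split => //; exact: subset_trans AB.
Qed.

(** On a piece of finite measure the intersection of nearly optimal Borel covers exceeds the set by
    a null set, itself contained in a Borel null set. Sigma-finiteness glues the pieces. *)
Lemma lebesgue_measurable_borel (E : set 'rV[R]_n) : measurable (E : set LT) ->
  exists B Z : set 'rV[R]_n, [/\ measurable B, measurable Z, lam Z = 0%E &
    E `\` Z = B `\` Z].
Proof.
move=> mE; have [F FT Foo] := sigma_finiteT lam.
suff : forall k : nat, exists BZ : set 'rV[R]_n * set 'rV[R]_n,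
  [/\ measurable BZ.1, measurable BZ.2, lam BZ.2 = 0%E &
    (E `&` F k) `\` BZ.2 = BZ.1 `\` BZ.2].
  move=> /choice[BZ hBZ].
  have mZ : measurable (\bigcup_k (BZ k).2).
    by apply: bigcupT_measurable => k; case: (hBZ k).
  exists (\bigcup_k (BZ k).1), (\bigcup_k (BZ k).2); split => //.
  - by apply: bigcupT_measurable => k; case: (hBZ k).
  - apply/eqP; rewrite eq_le measure_ge0 andbT.
    have mB2 k : measurable ((fun k => (BZ k).2) k) by case: (hBZ k).
    apply: (le_trans (measure_sigma_subadditive lam mB2 mZ (@subset_refl _ _))).
    by rewrite eseries0// => k _ _; case: (hBZ k).
  - apply/seteqP; split=> x [].
      move=> Ex Zx; split => //; have : [set: 'rV[R]_n] x by [].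
      rewrite FT => -[k _ Fkx]; exists k => //.
      have [_ _ _ /seteqP[h _]] := hBZ k.
      have /h[//] : ((E `&` F k) `\` (BZ k).2) x.
      by split => // Zk; apply: Zx; exists k.
    move=> [k _ Bk] Zx; split => //.
    have [_ _ _ /seteqP[_ h]] := hBZ k.
    have /h[[//]] : ((BZ k).1 `\` (BZ k).2) x.
    by split => // Zk; apply: Zx; exists k.
move=> k; have [mF Fk] := Foo k.
have mFk : measurable (F k : set LT) by exact: measurable_borel_lebesgue.
have mEk : measurable (E `&` F k : set LT) by exact: measurableI.
have Ekoo : (mu (E `&` F k) < +oo)%E.
  have Fk' : (mu (F k) < +oo)%E by rewrite lebesgue_rVE.
  apply: le_lt_trans Fk'.
  by apply: le_measure; rewrite ?inE//; exact: subIsetr.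
have Ekfin : mu (E `&` F k) \is a fin_num by rewrite ge0_fin_numE// measure_ge0.
have : forall m : nat, exists B : set 'rV[R]_n, [/\ measurable B,
    (lam B <= mu (E `&` F k) + (m.+1%:R^-1)%:E)%E & E `&` F k `<=` B].
  move=> m.
  have : (mu_ext lam (E `&` F k) < mu (E `&` F k) + (m.+1%:R^-1)%:E)%E.
    by rewrite -[ltLHS]/(mu (E `&` F k)) lteDl// lte_fin invr_gt0.
  move=> /ereal_inf_lt[_ [G [mG AG] <-]] /ltW hG.
  exists (\bigcup_k G k); split => //; first exact: bigcupT_measurable.
  apply: le_trans hG; apply: measure_sigma_subadditive => //.
  exact: bigcupT_measurable.
move=> /choice[B hB]; pose B' := \bigcap_m B m.
have mB' : measurable B' by apply: bigcapT_measurable => m; case: (hB m).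
have EB' : E `&` F k `<=` B' by move=> x Ex m _; case: (hB m) => _ _; apply.
have B'le : (mu B' <= mu (E `&` F k))%E.
  apply/lee_addgt0Pr => e e0; have [m] : exists m : nat, m.+1%:R^-1 <= e.
    exists (Num.truncn e^-1); rewrite -[leRHS]invrK lef_pV2 ?posrE ?invr_gt0//.
    by rewrite ltW// truncnS_gt.
  rewrite -lee_fin => hm; have [mB hBm _] := hB m.
  rewrite lebesgue_rVE//; apply: (@le_trans _ _ (lam (B m))).
    by apply: le_measure; rewrite ?inE//; exact: bigcap_inf.
  by apply: (le_trans hBm); rewrite leeD2l.
have mB'L : measurable (B' : set LT) by exact: measurable_borel_lebesgue.
have D0 : mu (B' `\` (E `&` F k)) = 0%E.
  rewrite measureD//; last exact: le_lt_trans B'le Ekoo.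
  rewrite (setIidr EB'); apply/eqP; rewrite eq_le; apply/andP; split.
    by rewrite leeBlDr// add0e.
  rewrite leeBrDr// add0e; apply: le_measure; rewrite ?inE//.
have [Z [mZ Z0 hZ]] := lebesgue_null_borel D0.
exists (B', Z); split => //=; apply/seteqP; split=> x [h Zx]; split => //.
  exact: EB'.
by apply: contrapT => hN; apply: Zx; apply: hZ.
Qed.

(** Superlevel sets at rational levels determine the function; discarding the countable union of
    their exceptional sets makes all of them Borel at once. *)
Lemma borel_representative (g : 'rV[R]_n -> R) : measurable_fun (setT : set LT) g ->
  exists Z : set 'rV[R]_n, [/\ measurable Z, lam Z = 0%E &
    measurable_fun (setT : set 'rV[R]_n) (fun x => if x \in Z then 0 else g x)].
Proof.
move=> mg.
have : forall q : rat, exists BZ : set 'rV[R]_n * set 'rV[R]_n,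
    [/\ measurable BZ.1, measurable BZ.2, lam BZ.2 = 0%E &
    [set x | ratr q < g x] `\` BZ.2 = BZ.1 `\` BZ.2].
  move=> q; have mq : measurable ([set x | ratr q < g x] : set LT).
    exact: (@measurable_ltr _ LT R (cst (ratr q)) g).
  by have [B [Z [? ? ? ?]]] := lebesgue_measurable_borel mq; exists (B, Z).
move=> /choice[BZ hBZ]; pose Z := \bigcup_q (BZ q).2.
have [||mZ Z0] := @measure_bigcup_countable0 _ _ R lam _ (fun q => (BZ q).2).
- by move=> q; case: (hBZ q).
- by move=> q; case: (hBZ q).
exists Z; split => //.
set g' := (X in measurable_fun _ X).
have mq q : measurable [set x | ratr q < g' x].
  (* The new function is 0 on Z, so Z belongs to the superlevel set exactly when the level is
     negative. *)
  have -> : [set x | ratr q < g' x] =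
      ((BZ q).1 `\` Z) `|` (if ratr q < 0 :> R then Z else set0).
    have [mB mZq _ /seteqP[h1 h2]] := hBZ q.
    apply/seteqP; split=> x; rewrite /g' /=.
      have [xZ|xZ] := boolP (x \in Z) => hq.
        by right; rewrite hq; rewrite inE in xZ.
      rewrite notin_setE in xZ.
      have /h1[Bx _] : ([set x | ratr q < g x] `\` (BZ q).2) x.
        by split => // Zq; apply: xZ; exists q.
      by left.
    move=> [[Bx xZ]|]; last by case: ifP => // q0 Zx; rewrite mem_set.
    rewrite memNset//; have /h2[//] : ((BZ q).1 `\` (BZ q).2) x.
    by split => // Zq; apply: xZ; exists q.
  have [mB _ _ _] := hBZ q; apply: measurableU; first exact: measurableD.
  by case: ifP.
apply: (measurability _ (RGenOInfty.measurableE R)).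
move=> _ [_ [y ->] <-]; rewrite setTI.
have -> : g' @^-1` `]y, +oo[%classic =
    \bigcup_(q in [set q : rat | y < ratr q]) [set x | ratr q < g' x].
  apply/seteqP; split=> x /=; rewrite in_itv /= andbT.
    by move=> /rat_in_itvoo[q]; rewrite in_itv /= => /andP[yq qg]; exists q.
  by move=> [q /= yq]; exact: lt_trans.
by apply: bigcup_measurable_rat || (rewrite bigcup_mkcond; apply: bigcupT_measurable_rat => q; case: ifP).
Qed.

End borel_representatives.

(** * Test functions *)

Section derivatives.
Context (R : realType).

Lemma is_derive_line (V : normedModType R) (f : V -> R) (x v : V) (s d : R) :
  is_derive s 1 (fun t => f (t *: v + x)) d <-> is_derive (s *: v + x) v f d.
Proof.
have E : (fun h => h^-1 *: (((fun t : R => f (t *: v + x)) \o shift s) (h *: 1) -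
      f (s *: v + x))) =
    (fun h => h^-1 *: ((f \o shift (s *: v + x)) (h *: v) - f (s *: v + x))).
  apply/funext => h /=; congr (_ *: (f _ - _)).
  by rewrite [h *: 1]mulr1 scalerDl addrA.
by split=> -[d1 d2]; split; move: d1 d2; rewrite /derivable /derive /= -?E // ?E.
Qed.

Lemma is_derive_prod (I : eqType) (r : seq I) (w dw : I -> R -> R) (s : R) :
  uniq r -> (forall i, is_derive s 1 (w i) (dw i s)) ->
  is_derive s 1 (fun t => \prod_(i <- r) w i t)
    (\sum_(i <- r) dw i s * \prod_(j <- r | j != i) w j s).
Proof.
move=> + dw'; elim: r => [_|a r IH /= /andP[ar ur]].
  rewrite (_ : (fun _ => _) = cst 1); last by apply/funext => t; rewrite big_nil.
  by rewrite big_nil; exact: is_derive_cst.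
have -> : (fun t => \prod_(i <- a :: r) w i t) = w a * (fun t => \prod_(i <- r) w i t).
  by apply/funext => t; rewrite big_cons.
have := is_deriveM (dw' a) (IH ur).
rewrite big_cons big_cons eqxx /=; congr is_derive.
rewrite addrC; congr (_ + _).
  rewrite /GRing.scale /= mulrC; congr (_ * _); rewrite big_seq [RHS]big_seq_cond.
  by apply: eq_bigl => j; case jr : (j \in r) => //=; symmetry; apply: contraNneq ar => <-.
rewrite /GRing.scale /= mulr_sumr; apply: eq_big_seq => i ir.
by rewrite big_cons ifT 1?mulrCA//; apply: contraNneq ar => ->.
Qed.

(* The functions q(1/t) exp(-1/t), extended by 0 for t <= 0: they are smooth
   and stable under differentiation. *)
Definition flat (q : {poly R}) (t : R) : R :=
  if 0 < t then q.[t^-1] * expR (- t^-1) else 0.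

(** Chain rule with s = 1/t: d/dt = - s^2 d/ds turns q(s) e^(-s) into s^2 (q(s) - q'(s)) e^(-s). *)
Definition flat_deriv (q : {poly R}) : {poly R} := 'X^2 * (q - q^`()).

Lemma powX_expR_bounded k (s : R) : 0 <= s -> s ^+ k * expR (- s) <= k`!%:R.
Proof.
move=> s0; rewrite expRN ler_pdivrMr ?expR_gt0//.
case: k => [|k]; first by rewrite expr0 fact0 mul1r -expR0 ler_expR.
have := expR_ge1Dxn k s0; have f0 : 0 < (k.+1)`!%:R :> R by rewrite ltr0n fact_gt0.
move=> h; have : s ^+ k.+1 / (k.+1)`!%:R <= expR s by lra.
by rewrite ler_pdivrMr// mulrC.
Qed.

Lemma poly_expR_bounded (q : {poly R}) :
  exists2 C, 0 <= C & forall s, 0 <= s -> `|q.[s]| * expR (- s) <= C.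
Proof.
exists (\sum_(i < size q) `|q`_i| * i`!%:R) => [|s s0].
  by apply: sumr_ge0 => i _; rewrite mulr_ge0.
rewrite horner_coef (le_trans (ler_wpM2r (expR_ge0 _) (ler_norm_sum _ _ _)))//.
rewrite mulr_suml; apply: ler_sum => i _.
rewrite normrM (ger0_norm (exprn_ge0 _ s0)) -mulrA ler_wpM2l//.
exact: powX_expR_bounded.
Qed.

(** The polynomial ['X^2 * q] is again bounded against e^(-s), which yields the factor t^2. This
    quadratic decay gives the derivative 0 at the origin. *)
Lemma flat_small (q : {poly R}) :
  exists2 C, 0 <= C & forall t, `|flat q t| <= C * t ^+ 2.
Proof.
have [C C0 hC] := poly_expR_bounded ('X^2 * q); exists C => // t.
rewrite /flat; case: ifPn => t0; last by rewrite normr0 mulr_ge0// sqr_ge0.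
have iv : 0 < t^-1 by rewrite invr_gt0.
have := hC _ (ltW iv); rewrite hornerM hornerXn.
rewrite !normrM (ger0_norm (expR_ge0 _)) (gtr0_norm iv).
set Q := `|q.[_]|; set e := expR _ => h.
have -> : Q * e = t ^+ 2 * (t^-1 * t^-1 * Q * e) by field; rewrite gt_eqF.
by rewrite mulrC ler_wpM2r ?sqr_ge0.
Qed.

Lemma is_derive_flat (q : {poly R}) (t : R) : is_derive t 1 (flat q) (flat (flat_deriv q) t).
Proof.
have [t0|t0|->] := ltgtP t 0.
- rewrite {2}/flat ltNge ltW//=.
  have := is_derive_cst (0 : R) t (1 : R); apply: near_eq_is_derive.
  by near=> s; rewrite /flat /= ltNge ltW//=; near: s; exact: lt_nbhsl.
- have tn0 : t != 0 by rewrite gt_eqF.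
  apply: (near_eq_is_derive (f := (fun s => q.[s] * expR (- s)) \o (fun s : R => s^-1))).
    near=> s; rewrite /flat /= ifT//; near: s; exact: lt_nbhsr.
  have dV : is_derive t 1 (fun s : R => s^-1) (- t ^- 2).
    by have := @is_deriveV _ id t 1 1 tn0 (is_derive_id _ _); rewrite [_ *: _]mulr1.
  have dE (s : R) : is_derive s 1 (fun s : R => expR (- s)) (- expR (- s)).
    have := @is_derive1_comp _ expR -%R s _ _ (is_derive_expR _) (is_deriveN (is_derive_id _ _)).
    by rewrite mulrN1.
  have dM := is_deriveM (is_derive_poly q t^-1) (dE t^-1).
  have := is_derive1_comp dM dV.
  rewrite /flat t0 /flat_deriv hornerM hornerXn hornerD hornerN /GRing.scale /=.
  by congr is_derive; rewrite exprVn; ring.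
- rewrite {2}/flat ltxx.
  have [C C0 hC] := flat_small q.
  suff h : h^-1 *: ((flat q \o shift 0) (h *: 1) - flat q 0) @[h --> 0^'] --> 0.
    by split; [apply/cvg_ex; exists 0|exact: cvg_lim].
  apply/cvgrPdist_le => e e0; near=> h.
  have h0 : h != 0 by near: h; exact: nbhs_dnbhs_neq.
  rewrite sub0r normrN /shift /= addr0 [h *: 1]mulr1 {2}/flat ltxx subr0.
  rewrite normrZ normfV mulrC ler_pdivrMr ?normr_gt0//.
  apply: (le_trans (hC h)); rewrite -normrX ger0_norm ?sqr_ge0// || idtac.
  rewrite -(real_normK (num_real h)) expr2 mulrA ler_wpM2r//.
  have : `|h| <= e / (C + 1).
    near: h; apply: dnbhs0_le; rewrite divr_gt0// ltr_wpDl//.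
  rewrite ler_pdivlMr ?ltr_wpDl//; have := normr_ge0 h; lra.
Unshelve. all: by end_near. Qed.

Lemma continuous_flat q : continuous (flat q).
Proof.
move=> t; apply/differentiable_continuous/derivable1_diffP.
exact: (@ex_derive _ _ _ _ _ _ _ (is_derive_flat q t)).
Qed.

Lemma flat1_ge0 t : 0 <= flat 1 t.
Proof. by rewrite /flat; case: ifP => // _; rewrite hornerE mul1r expR_ge0. Qed.

Lemma flat1_le1 t : flat 1 t <= 1.
Proof.
rewrite /flat; case: ifP => // t0.
by rewrite hornerE mul1r -expR0 ler_expR oppr_le0 invr_ge0 ltW.
Qed.

Lemma flat1_cvg (t : R) : flat 1 (n.+1%:R * t) @[n --> \oo] --> ((0 < t)%R%:R : R).
Proof.
case: ltP => t0; last first.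
  rewrite (_ : (fun _ => _) = cst 0); first exact: cvg_cst.
  apply/funext => n; rewrite /flat ifF//; apply/negbTE; rewrite -leNgt.
  by rewrite mulr_ge0_le0.
rewrite (_ : (fun _ => _) = (fun n => expR (- ((n.+1%:R)^-1 * t^-1)))); last first.
  by apply/funext => n; rewrite /flat ifT ?mulr_gt0// hornerE mul1r invfM.
rewrite -[X in _ --> X]expR0 -oppr0 -(mul0r t^-1).
apply: continuous_cvg; first exact: continuous_expR.
apply: cvgN; apply: cvgMl; exact: cvg_harmonic.
Qed.

End derivatives.

(** * Smooth bumps approximating boxes *)

Section smooth_functions.
Context (R : realType) (n : nat).
Implicit Types phi : 'rV[R]_n -> R.

Lemma class_CS k phi : class_C k.+1 phi -> class_C k phi.
Proof.
elim: k phi => [|k IH] phi [c h]; first by split.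
by split => // i; have [d /IH] := h i.
Qed.

Lemma class_CD k phi psi : class_C k phi -> class_C k psi ->
  class_C k (fun x => phi x + psi x).
Proof.
elim: k phi psi => [|k IH] phi psi [cf hf] [cg hg].
  by split => // x; apply: continuousD; [exact: cf|exact: cg].
split => [x|i]; first by apply: continuousD; [exact: cf|exact: cg].
have [df /IH hf'] := hf i; have [dg /hf' h] := hg i; split.
  by move=> x; apply: derivableD.
congr (class_C k _): h; apply/funext => x.
by rewrite -deriveD.
Qed.

Lemma class_CM k phi psi : class_C k phi -> class_C k psi ->
  class_C k (fun x => phi x * psi x).
Proof.
elim: k phi psi => [|k IH] phi psi hf hg.
  case: hf hg => cf _ [cg _].
  by split => // x; apply: continuousM; [exact: cf|exact: cg].
have hf' := class_CS hf; have hg' := class_CS hg; case: hf hg => cf hf [cg hg].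
split => [x|i]; first by apply: continuousM; [exact: cf|exact: cg].
have [df hdf] := hf i; have [dg hdg] := hg i; split.
  by move=> x; apply: derivableM.
have := class_CD (IH _ _ hf' hdg) (IH _ _ hg' hdf).
congr (class_C k _); apply/funext => x.
by rewrite -[RHS]/('D_(basis_rV R i) (phi * psi) x) deriveM.
Qed.

Lemma class_C_cst k c : class_C k (cst c : 'rV[R]_n -> R).
Proof.
elim: k c => [|k IH] c; first by split => // x; exact: cst_continuous.
split => [x|i]; first exact: cst_continuous.
split=> [x|]; first exact: derivable_cst.
rewrite (_ : (fun _ => _) = cst 0); first exact: IH.
by apply/funext => x; rewrite derive_cst.
Qed.

Lemma class_C_prod k (I : Type) (r : seq I) (w : I -> 'rV[R]_n -> R) :
  (forall i, class_C k (w i)) -> class_C k (fun x => \prod_(i <- r) w i x).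
Proof.
move=> hw; elim: r => [|a r IH].
  rewrite (_ : (fun _ => _) = cst 1); first exact: class_C_cst.
  by apply/funext => x; rewrite big_nil.
rewrite (_ : (fun _ => _) = (fun x => w a x * \prod_(i <- r) w i x)); first exact: class_CM.
by apply/funext => x; rewrite big_cons.
Qed.

Lemma is_derive_affine (g : R -> R) (s c d t : R) :
  is_derive (s * t + c) 1 g d -> is_derive t 1 (fun t : R => g (s * t + c)) (d * s).
Proof.
move=> dg; have da : is_derive t 1 (fun t : R => s * t + c) s.
  have := @is_deriveD _ _ _ _ _ (t : R) (1 : R) _ _
    (is_deriveZ s (is_derive_id t (1 : R))) (is_derive_cst c t (1 : R)).
  by rewrite addr0 [_ *: 1]mulr1.
exact: (@is_derive1_comp _ g (fun t : R => s * t + c) t d s).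
Qed.

Lemma is_derive_affine_coor (g : R -> R) (s c d : R) (j : 'I_n) (x v : 'rV[R]_n) :
  is_derive (s * x ord0 j + c) 1 g d ->
  is_derive x v (fun x => g (s * x ord0 j + c)) (d * (s * v ord0 j)).
Proof.
move=> dg; rewrite -(add0r x) -(scale0r v); apply/is_derive_line.
have -> : (fun t : R => g (s * (t *: v + x) ord0 j + c)) =
    (fun t : R => g ((s * v ord0 j) * t + (s * x ord0 j + c))).
  by apply/funext => t; rewrite !mxE; congr g; ring.
by apply: is_derive_affine; rewrite mulr0 add0r.
Qed.

(** The derivative of a [flat] function is again [flat] up to a constant factor, so the induction on
    k runs over all polynomials q. *)
Lemma class_C_flat k q (s c : R) (j : 'I_n) :
  class_C k (fun x : 'rV[R]_n => flat q (s * x ord0 j + c)).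
Proof.
have cont q' : continuous (fun x : 'rV[R]_n => flat q' (s * x ord0 j + c)).
  move=> x; apply: (@continuous_comp _ _ _ (fun x : 'rV[R]_n => s * x ord0 j + c) (flat q')); last exact: continuous_flat.
  apply: continuousD; last exact: cst_continuous.
  apply: continuousM; [exact: cst_continuous|exact: coord_continuous].
elim: k q => [|k IH] q; first by split.
split => // i.
have d x := @is_derive_affine_coor _ s c _ j x (basis_rV R i) (is_derive_flat q _).
split=> [x|]; first exact: (@ex_derive _ _ _ _ _ _ _ (d x)).
have -> : 'D_(basis_rV R i) (fun x : 'rV[R]_n => flat q (s * x ord0 j + c)) =
    (fun x => flat (flat_deriv q) (s * x ord0 j + c) *
    cst (s * (basis_rV R i) ord0 j) x).
  by apply/funext => x; exact: (@derive_val _ _ _ _ _ _ _ (d x)).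
by apply: class_CM => //; exact: class_C_cst.
Qed.

Definition bump1 (m : nat) (a b : R) (t : R) : R :=
  flat 1 (m.+1%:R * (t - a)) * flat 1 (m.+1%:R * (b - t)).
(** A tensor product, so that calculus reduces to one variable. It vanishes off [box a b] and tends
    to its indicator as m grows, and translates of bumps are bumps. *)
Definition bump (m : nat) (a b x : 'rV[R]_n) : R :=
  \prod_(i < n) bump1 m (a ord0 i) (b ord0 i) (x ord0 i).
Definition box (a b : 'rV[R]_n) : set 'rV[R]_n :=
  [set x | forall i, a ord0 i < x ord0 i < b ord0 i].

Lemma class_C_bump k m a b : class_C k (bump m a b).
Proof.
apply: class_C_prod => i; apply: class_CM.
  have -> : (fun x : 'rV[R]_n => flat 1 (m.+1%:R * (x ord0 i - a ord0 i))) =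
     (fun x => flat 1 (m.+1%:R * x ord0 i + - (m.+1%:R * a ord0 i))).
    by apply/funext => x; rewrite mulrBr.
  exact: class_C_flat.
have -> : (fun x : 'rV[R]_n => flat 1 (m.+1%:R * (b ord0 i - x ord0 i))) =
   (fun x => flat 1 (- m.+1%:R * x ord0 i + (m.+1%:R * b ord0 i))).
  by apply/funext => x; rewrite mulrBr mulNr addrC.
exact: class_C_flat.
Qed.

Lemma bump1_ge0 m a b t : 0 <= bump1 m a b t.
Proof. by rewrite mulr_ge0 ?flat1_ge0. Qed.

Lemma bump1_le1 m a b t : bump1 m a b t <= 1.
Proof. by rewrite mulr_ile1 ?flat1_ge0 ?flat1_le1. Qed.

Lemma bump_ge0 m a b x : 0 <= bump m a b x.
Proof. by apply: prodr_ge0 => i _; exact: bump1_ge0. Qed.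

Lemma bump_le1 m a b x : bump m a b x <= 1.
Proof.
rewrite -(expr1n _ #|'I_n|) -prodr_const; apply: ler_prod => i _.
by rewrite bump1_ge0 bump1_le1.
Qed.

Lemma bump1_eq0 m a b t : ~~ (a < t < b) -> bump1 m a b t = 0.
Proof.
have F s : s <= 0 -> flat 1 (m.+1%:R * s) = 0.
  by move=> s0; rewrite /flat ifF// pmulr_rgt0// ltNge s0.
rewrite negb_and -!leNgt => /orP[h|h]; rewrite /bump1.
  by rewrite F ?mul0r// subr_le0.
by rewrite [X in _ * X]F ?mulr0// subr_le0.
Qed.

Lemma bump_eq0 m a b x : ~ box a b x -> bump m a b x = 0.
Proof.
move=> /existsNP[i /negP h]; rewrite /bump (bigD1 i)//= bump1_eq0// mul0r//.
Qed.

Lemma bump_cvg a b x : bump m a b x @[m --> \oo] --> (\1_(box a b) x : R).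
Proof.
have -> : (\1_(box a b) x : R) =
    \prod_(i < n) ((0 < x ord0 i - a ord0 i)%R%:R * (0 < b ord0 i - x ord0 i)%R%:R).
  rewrite indicE; have [|h] := boolP (x \in box a b).
    rewrite inE => h; rewrite big1// => i _; have /andP[h1 h2] := h i.
    by rewrite !subr_gt0 h1 h2 mulr1.
  rewrite notin_setE in h; move: h => /existsNP[i /negP].
  rewrite negb_and => h; rewrite (bigD1 i)//= !subr_gt0.
  by case/orP: h => /negbTE ->; rewrite ?mul0r ?mulr0 ?mul0r.
rewrite /bump; elim/big_ind2 : _ => //= || idtac.
have : forall r : seq 'I_n, \prod_(i <- r) bump1 m (a ord0 i) (b ord0 i) (x ord0 i) @[m --> \oo] -->
   (\prod_(i <- r) ((0 < x ord0 i - a ord0 i)%R%:R * (0 < b ord0 i - x ord0 i)%R%:R) : R).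
  elim=> [|i r IH].
    by rewrite big_nil; under eq_fun do rewrite big_nil; exact: cvg_cst.
  rewrite big_cons; under eq_fun do rewrite big_cons.
  by apply: cvgM => //; apply: cvgM; exact: flat1_cvg.
exact.
Qed.

Lemma compact_closed_box (a b : 'rV[R]_n) :
  compact [set x : 'rV[R]_n | forall i, a ord0 i <= x ord0 i <= b ord0 i].
Proof.
have := @rV_compact R n (fun i => `[a ord0 i, b ord0 i]%classic).
move=> /(_ (fun i => @segment_compact _ _ _)); exact.
Qed.

Lemma test_bump m a b : test_function (bump m a b).
Proof.
split=> [k|]; first exact: class_C_bump.
have cb := @compact_closed_box a b.
apply: (subclosed_compact _ cb); first exact: closed_closure.
have /closure_id E : closed [set x : 'rV[R]_n | forall i, a ord0 i <= x ord0 i <= b ord0 i].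
  by apply: compact_closed => //; exact: norm_hausdorff.
rewrite [X in _ `<=` X]E; apply: closureS => x /eqP hx i.
apply: contrapT => h; apply: hx; apply: bump_eq0 => /(_ i) /andP[h1 h2].
by apply: h; rewrite !ltW.
Qed.

Lemma bump_shift m a b z x : bump m a b (x - z) = bump m (a + z) (b + z) x.
Proof.
rewrite /bump; apply: eq_bigr => i _; rewrite /bump1 !mxE.
by congr (flat _ (_ * _) * flat _ (_ * _)); ring.
Qed.

(** The product rule along a line gives the derivative in any direction as an expression linear in
    that direction; evaluating it on the basis vectors identifies the coefficients as the partial
    derivatives. *)
Lemma bump_derive m a b (x v : 'rV[R]_n) :
  is_derive x v (bump m a b) (\sum_(i < n) v ord0 i * 'D_(basis_rV R i) (bump m a b) x).
Proof.
pose dw i t : R := flat (flat_deriv 1) (m.+1%:R * (t - a ord0 i)) * m.+1%:R * flat 1 (m.+1%:R * (b ord0 i - t))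
  - flat 1 (m.+1%:R * (t - a ord0 i)) * (flat (flat_deriv 1) (m.+1%:R * (b ord0 i - t)) * m.+1%:R).
have H (u : 'rV[R]_n) : is_derive x u (bump m a b)
   (\sum_(i < n) (u ord0 i * dw i (x ord0 i)) * \prod_(j < n | j != i) bump1 m (a ord0 j) (b ord0 j) (x ord0 j)).
  rewrite -[in is_derive x](add0r x) -(scale0r u); apply/is_derive_line.
  pose w i t := bump1 m (a ord0 i) (b ord0 i) ((t *: u + x) ord0 i).
  have dw' i : is_derive (0 : R) 1 (w i) (u ord0 i * dw i (x ord0 i)).
    have d1 := @is_derive_affine _ (m.+1%:R * u ord0 i) (m.+1%:R * (x ord0 i - a ord0 i)) _ 0
      (is_derive_flat 1 _).
    have d2 := @is_derive_affine _ (- (m.+1%:R * u ord0 i)) (m.+1%:R * (b ord0 i - x ord0 i)) _ 0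
      (is_derive_flat 1 _).
    have := is_deriveM d1 d2; rewrite !mulr0 !add0r /GRing.scale /=.
    have -> : w i = (fun t => flat 1 (m.+1%:R * u ord0 i * t + m.+1%:R * (x ord0 i - a ord0 i))) *
        (fun t => flat 1 (- (m.+1%:R * u ord0 i) * t + m.+1%:R * (b ord0 i - x ord0 i))).
      apply/funext => t; rewrite /w /bump1 !mxE.
      have -> : m.+1%:R * (t * u ord0 i + x ord0 i - a ord0 i) =
        m.+1%:R * u ord0 i * t + m.+1%:R * (x ord0 i - a ord0 i) by ring.
      have -> // : m.+1%:R * (b ord0 i - (t * u ord0 i + x ord0 i)) =
        - (m.+1%:R * u ord0 i) * t + m.+1%:R * (b ord0 i - x ord0 i) by ring.
    by congr is_derive; rewrite /dw; ring.
  have := @is_derive_prod _ _ (index_enum 'I_n) w (fun i _ => u ord0 i * dw i (x ord0 i)) 0 (index_enum_uniq _) dw'.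
  congr is_derive; apply: eq_bigr => i _; congr (_ * _); apply: eq_bigr => j _.
  by rewrite /w !mxE mul0r add0r.
have := H v; congr is_derive; apply: eq_bigr => i _.
rewrite (@derive_val _ _ _ _ _ _ _ (H (basis_rV R i))).
have -> : \sum_(k < n) basis_rV R i ord0 k * dw k (x ord0 k) *
     \prod_(j < n | j != k) bump1 m (a ord0 j) (b ord0 j) (x ord0 j) =
   dw i (x ord0 i) * \prod_(j < n | j != i) bump1 m (a ord0 j) (b ord0 j) (x ord0 j).
  rewrite (bigD1 i)//= [X in _ + X = _]big1 ?addr0 => [|j ji].
    by rewrite /basis_rV !mxE !eqxx mul1r.
  by rewrite /basis_rV !mxE eqxx /= (negbTE ji) !mul0r.
by rewrite mulrA.
Qed.

End smooth_functions.

(** * Integrals of real-valued functions *)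

Section real_integrals.
Context d (T : measurableType d) (R : realType) (mu : {measure set T -> \bar R}).
Local Notation intb f := (mu.-integrable setT (EFin \o f)).
Implicit Types f g : T -> R.

Lemma intb_measurable f : intb f -> measurable_fun setT f.
Proof. by move=> /measurable_int /measurable_EFinP. Qed.

Lemma intb_le f g : measurable_fun setT f -> intb g ->
  (forall x, `|f x| <= g x) -> intb f.
Proof.
move=> mf ig fg; apply: le_integrable ig => //; first exact/measurable_EFinP.
by move=> x _; rewrite /= lee_fin (le_trans (fg x))// ler_norm.
Qed.

Lemma intb_ge0 f : measurable_fun setT f -> (forall x, 0 <= f x) ->
  (\int[mu]_x (f x)%:E < +oo)%E -> intb f.
Proof.
move=> mf f0 foo; apply/integrableP; split; first exact/measurable_EFinP.
by under eq_integral do rewrite /= ger0_norm//.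
Qed.

Lemma intbD f g : intb f -> intb g -> intb (fun x => f x + g x).
Proof. by move=> hf hg; have := integrableD measurableT hf hg. Qed.

Lemma intbZ k f : intb f -> intb (fun x => k * f x).
Proof. by move=> hf; have := integrableZl measurableT k hf. Qed.

Lemma intbN f : intb f -> intb (fun x => - f x).
Proof. by move=> hf; have := integrableN hf. Qed.

Lemma intbB f g : intb f -> intb g -> intb (fun x => f x - g x).
Proof. by move=> hf hg; apply: intbD => //; exact: intbN. Qed.

Lemma intb_norm f : intb f -> intb (fun x => `|f x|).
Proof. by move=> hf; have := integrable_norm hf. Qed.

Lemma intb0 : intb (fun=> 0).
Proof. exact: integrable0. Qed.

Lemma intb_sum (I : Type) (r : seq I) (P : pred I) (F : I -> T -> R) :
  (forall i, intb (F i)) -> intb (fun x => \sum_(i <- r | P i) F i x).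
Proof.
move=> hF; elim: r => [|i r IH].
  by rewrite (_ : (fun _ => _) = fun=> 0) ?intb0//; apply/funext => x; rewrite big_nil.
case Pi : (P i).
  rewrite (_ : (fun _ => _) = fun x => F i x + \sum_(j <- r | P j) F j x).
    exact: intbD.
  by apply/funext => x; rewrite big_cons Pi.
rewrite (_ : (fun _ => _) = fun x => \sum_(j <- r | P j) F j x)//.
by apply/funext => x; rewrite big_cons Pi.
Qed.

Lemma rintD f g : intb f -> intb g ->
  \int[mu]_x (f x + g x) = \int[mu]_x f x + \int[mu]_x g x.
Proof. by move=> hf hg; rewrite RintegralD. Qed.

Lemma rintB f g : intb f -> intb g ->
  \int[mu]_x (f x - g x) = \int[mu]_x f x - \int[mu]_x g x.
Proof. by move=> hf hg; rewrite RintegralB. Qed.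

Lemma rintZ k f : intb f -> \int[mu]_x (k * f x) = k * \int[mu]_x f x.
Proof. by move=> hf; rewrite RintegralZl. Qed.

(** The positive or the negative part has infinite integral, so the extended integral is infinite
    and [fine] sends it to 0. In consequence constants can be pulled out of any measurable
    integrand, see [rintZ_measurable]. *)
Lemma rint_nonintegrable f : measurable_fun setT f -> ~ intb f -> \int[mu]_x f x = 0.
Proof.
move=> mf nf; have mE : measurable_fun setT (EFin \o f) by exact/measurable_EFinP.
rewrite /Rintegral integralE.
set a := (X in (X - _)%E); set b := (X in (_ - X)%E).
have a0 : (0 <= a)%E by exact: integral_ge0.
have b0 : (0 <= b)%E by exact: integral_ge0.
have : a = +oo%E \/ b = +oo%E.
  have [->|aoo] := eqVneq a +oo%E; first by left.
  have [->|boo] := eqVneq b +oo%E; first by right.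
  exfalso; apply: nf; apply/integrableP; split => //.
  under eq_integral => x _ do rewrite -/((abse \o (EFin \o f)) x) fune_abse.
  rewrite ge0_integralTD//; try by move=> x; rewrite ?funepos_ge0 ?funeneg_ge0.
  - by rewrite lte_add_pinfty// -ge0_fin_numE// fin_numE ?aoo ?boo ?andbT ?gt_eqF//
      (lt_le_trans _ a0, lt_le_trans _ b0)// ltNye.
  - exact: measurable_funepos.
  - exact: measurable_funeneg.
by case=> ->; [case: b b0 => // r _|case: a a0 => // r _].
Qed.

Lemma rintZ_measurable k f : measurable_fun setT f ->
  \int[mu]_x (k * f x) = k * \int[mu]_x f x.
Proof.
move=> mf; have [->|k0] := eqVneq k 0.
  rewrite mul0r /Rintegral (_ : (fun _ => _) = cst 0%E) ?integral0//.
  by apply/funext => x; rewrite mul0r.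
have [hf|hf] := pselect (intb f); first exact: rintZ.
rewrite (rint_nonintegrable mf hf) mulr0 rint_nonintegrable//; first exact: measurable_funM.
move=> /(intbZ k^-1) h; apply: hf; move: h.
rewrite (_ : EFin \o _ = EFin \o f)//.
by apply/funext => x; rewrite /= mulKf.
Qed.

Lemma rint0 : \int[mu]_x (0 : R) = 0.
Proof. by rewrite /Rintegral integral0. Qed.

Lemma rintN f : \int[mu]_x (- f x) = - \int[mu]_x f x.
Proof.
rewrite /Rintegral integralE [X in _ = - fine X]integralE.
rewrite -[X in X^\+%E]/(\- (EFin \o f))%E -[X in X^\-%E]/(\- (EFin \o f))%E funeposN funenegN.
have h0 : forall g : T -> \bar R, (forall x, (0 <= g x)%E) -> (0 <= \int[mu]_x g x)%E.
  by move=> g hg; exact: integral_ge0.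
have := h0 _ (funepos_ge0 (EFin \o f)); have := h0 _ (funeneg_ge0 (EFin \o f)).
set a := integral _ _ _; set b := integral _ _ _.
case: a => [a||]; case: b => [b||] //= _ _; rewrite ?oppr0 ?opprB//; lra.
Qed.

Lemma rint_sum (I : Type) (r : seq I) (P : pred I) (F : I -> T -> R) :
  (forall i, intb (F i)) ->
  \int[mu]_x (\sum_(i <- r | P i) F i x) = \sum_(i <- r | P i) \int[mu]_x F i x.
Proof.
move=> hF; elim: r => [|i r IH].
  by under eq_fun do rewrite big_nil; rewrite big_nil; exact: rint0.
rewrite big_cons; under eq_fun do rewrite big_cons; case: ifP => // _.
by rewrite rintD ?IH//; exact: intb_sum.
Qed.

Lemma rint_ge0 f : (forall x, 0 <= f x) -> 0 <= \int[mu]_x f x.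
Proof. by move=> f0; apply: Rintegral_ge0. Qed.

Lemma le_rint f g : intb f -> intb g -> (forall x, f x <= g x) ->
  \int[mu]_x f x <= \int[mu]_x g x.
Proof. by move=> hf hg fg; apply: le_Rintegral. Qed.

Lemma ae_eq_rint f g : measurable_fun setT f -> measurable_fun setT g ->
  {ae mu, forall x, f x = g x} -> \int[mu]_x f x = \int[mu]_x g x.
Proof.
move=> mf mg fg; congr fine; apply: ae_eq_integral => //; try exact/measurable_EFinP.
by apply: filterS fg => x + _ => ->.
Qed.

Lemma ae_eq_intb f g : intb f -> measurable_fun setT g ->
  {ae mu, forall x, f x = g x} -> intb g.
Proof.
move=> hf mg fg; apply/integrableP; split; first exact/measurable_EFinP.
have mf := intb_measurable hf; have /integrableP[_] := hf.
rewrite (ge0_ae_eq_integral (g := fun x => `|(EFin \o g) x|%E))//.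
- by apply: measurableT_comp => //; exact/measurable_EFinP.
- by apply: measurableT_comp => //; exact/measurable_EFinP.
- by apply: filterS fg => x /= -> .
Qed.

Lemma ae_le_rint f g : intb f -> intb g -> {ae mu, forall x, f x <= g x} ->
  \int[mu]_x f x <= \int[mu]_x g x.
Proof.
move=> hf hg fg; have mf := intb_measurable hf; have mg := intb_measurable hg.
have -> : \int[mu]_x g x = \int[mu]_x Num.max (f x) (g x).
  apply: ae_eq_rint => //; first exact: measurable_maxr.
  by apply: filterS fg => x /max_r ->.
apply: le_rint => //.
  apply: (ae_eq_intb hg); first exact: measurable_maxr.
  by apply: filterS fg => x /max_r ->.
by move=> x; rewrite le_max lexx.
Qed.

Lemma le_norm_rint f : intb f -> `|\int[mu]_x f x| <= \int[mu]_x `|f x|.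
Proof. by move=> hf; apply: le_normr_Rintegral. Qed.

Lemma rint_EFin f : intb f -> (\int[mu]_x f x)%:E = (\int[mu]_x (f x)%:E)%E.
Proof. by move=> hf; rewrite /Rintegral fineK//; exact: integrable_fin_num. Qed.

Lemma rint_dominated (f_ : nat -> T -> R) f g :
  (forall n, measurable_fun setT (f_ n)) -> measurable_fun setT f ->
  {ae mu, forall x, f_ n x @[n --> \oo] --> f x} -> intb g ->
  {ae mu, forall x, forall n, `|f_ n x| <= g x} ->
  [/\ intb f, \int[mu]_x f_ n x @[n --> \oo] --> \int[mu]_x f x &
    \int[mu]_x `|f_ n x - f x| @[n --> \oo] --> (0 : R)].
Proof.
move=> mf_ mf ff ig fg.
have [h1 h2 h3] : [/\ mu.-integrable setT (EFin \o f),
   [sequence \int[mu]_x `|(EFin \o f_ n) x - (EFin \o f) x|]_n @ \oo --> 0 &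
   [sequence \int[mu]_x ((EFin \o f_ n) x)]_n @ \oo --> \int[mu]_x (EFin \o f) x]%E.
  apply: (@dominated_convergence _ _ _ mu setT measurableT _ _ (EFin \o g)) => //.
  - by move=> n; exact/measurable_EFinP.
  - exact/measurable_EFinP.
  - by apply: filterS ff => x + _; exact: cvg_EFin || (move=> ? ; apply/cvg_EFin => //; exact: nearW).
  - by apply: filterS fg => x + n _; rewrite /= lee_fin; apply.
have if_ n : intb (f_ n).
  apply/integrableP; split; first exact/measurable_EFinP.
  have /integrableP[_] := ig; apply: le_lt_trans.
  apply: ae_ge0_le_integral => //.
  - by apply: measurableT_comp => //; exact/measurable_EFinP.
  - by apply: measurableT_comp => //; exact: measurable_int ig.
  - by apply: filterS fg => x + _; move=> /(_ n) h; rewrite /= lee_fin (le_trans h)// ler_norm.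
split => //.
  by apply: fine_cvg; rewrite fineK//; exact: integrable_fin_num.
by apply: (@fine_cvg _ _ _ _ _ 0).
Qed.

Lemma rint_cst_indic (A : set T) (c : R) : measurable A -> (mu A < +oo)%E ->
  intb (fun x => c * \1_A x) /\ \int[mu]_x (c * \1_A x) = c * fine (mu A).
Proof.
move=> mA Aoo; have h : intb (\1_A : T -> R) 
  by apply: intb_ge0 => //; rewrite integral_indicT.
split; first exact: intbZ.
by rewrite rintZ// /Rintegral integral_indicT.
Qed.

End real_integrals.

(** * Fubini's theorem for real-valued integrals *)

Section real_fubini.
Context d1 d2 (T1 : measurableType d1) (T2 : measurableType d2) (R : realType).
Variables (m1 : {sigma_finite_measure set T1 -> \bar R})
          (m2 : {sigma_finite_measure set T2 -> \bar R}).

(** The inner integrals are finite on almost every slice, where [fine] changes nothing, so Fubini's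
    theorem for extended integrals carries over. *)
Lemma rint_fubini (f : T1 -> T2 -> R) :
  measurable_fun setT (fun x : T1 * T2 => f x.1 x.2) ->
  (\int[m1]_x \int[m2]_y `|f x y|%:E < +oo)%E ->
  [/\ m1.-integrable setT (EFin \o (fun x => \int[m2]_y f x y)),
      m2.-integrable setT (EFin \o (fun y => \int[m1]_x f x y)) &
  \int[m1]_x \int[m2]_y f x y = \int[m2]_y \int[m1]_x f x y].
Proof.
move=> mf foo.
pose F (x : T1 * T2) := (f x.1 x.2)%:E.
have mF : measurable_fun setT F by exact/measurable_EFinP.
have iF : (m1 \x m2)%E.-integrable setT F by apply/integrable12ltyP.
have E1 : {ae m1, forall x, (\int[m2]_y f x y)%:E = fubini_F m2 F x}.
  apply: filterS (ae_integrable1 iF) => x hx.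
  by rewrite /Rintegral fineK//; exact: integrable_fin_num.
have E2 : {ae m2, forall y, (\int[m1]_x f x y)%:E = fubini_G m1 F y}.
  apply: filterS (ae_integrable2 iF) => y hy.
  by rewrite /Rintegral fineK//; exact: integrable_fin_num.
have mFx : measurable_fun setT (fun x => \int[m2]_y f x y).
  by apply: measurableT_comp => //; exact: measurable_fubini_F iF.
have mFy : measurable_fun setT (fun y => \int[m1]_x f x y).
  by apply: measurableT_comp => //; exact: measurable_fubini_G iF.
have I1 := integrable_fubini_F iF.
have I2 : m2.-integrable setT (fubini_G m1 F).
  apply/integrableP; split; first exact: measurable_fubini_G iF.
  have := foo; have mN : measurable_fun setT (fun x : T1 * T2 => `|F x|%E) by exact: measurableT_comp.
  rewrite -[X in (X < _)%E -> _]/(\int[m1]_x \int[m2]_y `|F (x, y)|)%E.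
  rewrite [X in (X < _)%E -> _](@fubini_tonelli _ _ _ _ _ _ _ (fun x => `|F x|%E) mN)//.
  apply: le_lt_trans; apply: ge0_le_integral => //.
  - by apply: measurableT_comp => //; exact: measurable_fubini_G iF.
  - exact: (@measurable_fun_fubini_tonelli_G _ _ _ _ _ m1 (fun x => `|F x|%E) mN).
  - move=> y _; apply: le_abse_integral => //.
    by apply: measurableT_comp => //; exact: measurable_fun_pair1.
have h1 : m1.-integrable setT (EFin \o (fun x => \int[m2]_y f x y)).
  apply/integrableP; split; first exact/measurable_EFinP.
  have /integrableP[_] := I1; rewrite (ge0_ae_eq_integral (g := fun x => `|(\int[m2]_y f x y)%:E|%E))//.
  - by apply: measurableT_comp => //; exact: measurable_int I1.
  - by apply: measurableT_comp => //; exact/measurable_EFinP.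
  - by apply: filterS E1 => x <-.
have h2 : m2.-integrable setT (EFin \o (fun y => \int[m1]_x f x y)).
  apply/integrableP; split; first exact/measurable_EFinP.
  have /integrableP[_] := I2; rewrite (ge0_ae_eq_integral (g := fun y => `|(\int[m1]_x f x y)%:E|%E))//.
  - by apply: measurableT_comp => //; exact: measurable_int I2.
  - by apply: measurableT_comp => //; exact/measurable_EFinP.
  - by apply: filterS E2 => x <-.
split => //; rewrite {1}/Rintegral [RHS]/Rintegral; congr fine.
transitivity (\int[m1]_x fubini_F m2 F x)%E.
  apply: ae_eq_integral => //; first exact/measurable_EFinP.
    exact: measurable_int I1.
  by apply: filterS E1 => x + _.
transitivity (\int[m2]_y fubini_G m1 F y)%E; first exact: Fubini.
apply: ae_eq_integral => //; last by apply: filterS E2 => y + _ => /esym.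
  exact: measurable_int I2.
exact/measurable_EFinP.
Qed.

Lemma measurable_rint2 (f : T1 -> T2 -> R) :
  measurable_fun setT (fun x : T1 * T2 => f x.1 x.2) ->
  measurable_fun setT (fun x => \int[m2]_y f x y).
Proof.
move=> mf; have mE : measurable_fun setT (fun x : T1 * T2 => (f x.1 x.2)%:E) by exact/measurable_EFinP.
apply: measurableT_comp => //; under eq_fun do rewrite integralE.
pose F (x : T1 * T2) := (f x.1 x.2)%:E.
apply: emeasurable_funB.
  rewrite (_ : (fun _ => _) = fun x => (\int[m2]_y F^\+ (x, y))%E); last first.
    by apply/funext => x; apply: eq_integral => y _; rewrite !funeposE.
  apply: (measurable_integral2 m2 (f := fun x y => F^\+%E (x, y))); last by move=> x y; exact: funepos_ge0.
  rewrite (_ : (fun _ => _) = F^\+%E); first exact: measurable_funepos.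
  by apply/funext => -[].
rewrite (_ : (fun _ => _) = fun x => (\int[m2]_y F^\- (x, y))%E); last first.
  by apply/funext => x; apply: eq_integral => y _; rewrite !funenegE.
apply: (measurable_integral2 m2 (f := fun x y => F^\-%E (x, y))); last by move=> x y; exact: funeneg_ge0.
rewrite (_ : (fun _ => _) = F^\-%E); first exact: measurable_funeneg.
by apply/funext => -[].
Qed.

End real_fubini.

(** * Joint measurability of functions measurable in x and continuous in y *)

Section caratheodory_functions.
Context d (T : measurableType d) (R : realType).

(** [ungrid k (grid k y)] rounds every coordinate of y down to a multiple of 1/(k+1), an
    approximation of y with countably many values. *)
Definition grid (k : nat) n (y : 'rV[R]_n) : 'rV[int]_n :=
  \row_i Num.floor (k.+1%:R * y ord0 i).
Definition ungrid (k : nat) n (j : 'rV[int]_n) : 'rV[R]_n :=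
  \row_i ((j ord0 i)%:~R / k.+1%:R).

Lemma mx_norm_le n (v : 'rV[R]_n) e : 0 <= e -> (forall i, `|v ord0 i| <= e) -> `|v| <= e.
Proof.
move=> e0 h; rewrite /Num.norm /= mx_normE.
rewrite -[e]/((NngNum e0)%:num) num_le; apply/bigmax_leP; split => // -[i j] _.
by rewrite -num_le /= [i]ord1.
Qed.

Lemma grid_cvg n (y : 'rV[R]_n) : ungrid k (grid k y) @[k --> \oo] --> y.
Proof.
apply/cvgrPdist_le => e e0.
near=> k.
have hk : k.+1%:R^-1 <= e :> R.
  have : `|k.+1%:R^-1| <= e :> R by near: k; apply: (@cvgr0_norm_le _ _ _ _ _ (@harmonic R)) => //; exact: cvg_harmonic.
  by rewrite ger0_norm.
apply: (le_trans _ hk); apply: mx_norm_le => [|i]; first by rewrite invr_ge0.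
rewrite !mxE; have k0 : 0 < k.+1%:R :> R by rewrite ltr0n.
have := floor_le (k.+1%:R * y ord0 i); have := floorD1_gt (k.+1%:R * y ord0 i).
rewrite intrD; set z := (Num.floor _)%:~R => h1 h2.
have -> : y ord0 i - z / k.+1%:R = (k.+1%:R * y ord0 i - z) * k.+1%:R^-1.
  by field; rewrite gt_eqF.
rewrite ger0_norm ?mulr_ge0 ?invr_ge0 ?subr_ge0// ler_piMl ?invr_ge0//.
by move: h1; rewrite mulr1z; lra.
Unshelve. all: by end_near. Qed.

(** Rounding the second variable leaves preimages that are countable unions of measurable
    rectangles; by continuity these approximations converge to f. *)
Lemma measurable_caratheodory n (f : T -> 'rV[R]_n -> R) :
  (forall y, measurable_fun setT (f ^~ y)) -> (forall x, continuous (f x)) ->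
  measurable_fun setT (fun x : T * 'rV[R]_n => f x.1 x.2).
Proof.
move=> mf cf.
apply: (@measurable_fun_cvg _ _ _ setT (fun k (x : T * 'rV[R]_n) => f x.1 (ungrid k (grid k x.2)))).
- move=> k _ Y mY; rewrite setTI.
  have -> : (fun x : T * 'rV[R]_n => f x.1 (ungrid k (grid k x.2))) @^-1` Y =
      \bigcup_(j : 'rV[int]_n) (((f ^~ (ungrid k j)) @^-1` Y) `*` (@grid k n @^-1` [set j])).
    apply/seteqP; split=> [[x y] /= h|[x y] [j _ [/= h1 h2]]].
      by exists (grid k y).
    by rewrite h2.
  have mj (j : 'rV[int]_n) : measurable (((f ^~ (ungrid k j)) @^-1` Y) `*` (@grid k n @^-1` [set j])).
    apply: measurableX; first by rewrite -[X in measurable X]setTI; exact: mf.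
    have -> : @grid k n @^-1` [set j] = \bigcap_(i in [set: 'I_n])
        [set y | (j ord0 i)%:~R <= k.+1%:R * y ord0 i] `&` 
        \bigcap_(i in [set: 'I_n]) [set y | k.+1%:R * y ord0 i < (j ord0 i + 1)%:~R].
      apply/seteqP; split=> [y <-|y [h1 h2]].
        by split=> i _ /=; rewrite mxE; [exact: floor_le|exact: floorD1_gt].
      apply/rowP => i; rewrite mxE; apply/eqP; rewrite eq_le; apply/andP; split.
        by rewrite -ltzD1 floor_lt_int; exact: h2.
      by rewrite floor_ge_int; exact: h1.
    have mi (i : 'I_n) : measurable_fun setT (fun y : 'rV[R]_n => k.+1%:R * y ord0 i).
      by apply: measurable_funM => //; exact: measurable_coor.
    by apply: measurableI; apply: fin_bigcap_measurable => // i _;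
      [exact: measurable_ler|exact: measurable_ltr].
  by apply: (@countable_bigcupT_measurable _ _ _ _) => //; exact: countableP.
- move=> x _; apply: (cvg_comp _ (f x.1)); first exact: grid_cvg.
  exact: cf.
Qed.

End caratheodory_functions.

(** The sigma-algebra on ['rV] is generated by the coordinates rather than by open sets, so this is
    an instance of the preceding lemma, with a function constant in its first variable. *)
Lemma continuous_measurable_rV (R : realType) n (phi : 'rV[R]_n -> R) :
  continuous phi -> measurable_fun setT phi.
Proof.
move=> cphi; have := @measurable_caratheodory _ 'rV[R]_n R n (fun _ y => phi y).
move=> /(_ (fun y => measurable_cst _) (fun _ => cphi)) h.
rewrite (_ : phi = (fun x => phi x.2) \o (fun x : 'rV[R]_n => (x, x)))//.
apply: (measurableT_comp h); exact: measurable_fun_pair.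
Qed.

(** * The fundamental lemma of the calculus of variations, on boxes *)

Section fundamental_lemma.
Context (R : realType) (n : nat).
Local Notation lam := (@lebesgue_borel R n).
Local Notation intb f := (lam.-integrable setT (EFin \o f)).
Implicit Types (g : 'rV[R]_n -> R) (a b : 'rV[R]_n).

Definition boxes : set (set 'rV[R]_n) := [set A | exists a b, A = box a b].

Lemma box_setI a b a' b' : box a b `&` box a' b' =
  box (\row_i Num.max (a ord0 i) (a' ord0 i)) (\row_i Num.min (b ord0 i) (b' ord0 i)).
Proof.
apply/seteqP; split=> x.
  move=> [h h'] i; rewrite !mxE gt_max lt_min.
  by move/andP: (h i) => [-> ->]; move/andP: (h' i) => [-> ->].
move=> h; split=> i; have := h i; rewrite !mxE gt_max lt_min;
  by move=> /andP[/andP[h1 h2] /andP[h3 h4]]; rewrite ?h1 ?h2 ?h3 ?h4.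
Qed.

Lemma boxesI : setI_closed boxes.
Proof.
move=> _ _ [a [b ->]] [a' [b' ->]]; rewrite box_setI.
by exists (\row_i Num.max (a ord0 i) (a' ord0 i)), (\row_i Num.min (b ord0 i) (b' ord0 i)).
Qed.

Lemma measurable_box a b : measurable (box a b).
Proof.
have -> : box a b = \bigcap_(i in [set: 'I_n]) ([set x | a ord0 i < x ord0 i] `&`
    [set x | x ord0 i < b ord0 i]).
  by apply/seteqP; split=> x h i; [move=> _; exact/andP|apply/andP/h].
apply: fin_bigcap_measurable => // i _; apply: measurableI; apply: measurable_ltr => //;
  exact: measurable_coor.
Qed.

Definition cube (k : R) : set 'rV[R]_n := box (const_mx (- k)) (const_mx k).

Lemma cubeP k x : cube k x <-> forall i, `|x ord0 i| < k.
Proof.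
by split=> h i; have := h i; rewrite !mxE ltr_norml.
Qed.

Lemma subset_cube k k' : k <= k' -> cube k `<=` cube k'.
Proof.
by move=> kk' x /cubeP h; apply/cubeP => i; exact: lt_le_trans kk'.
Qed.

Lemma bigcup_cube (x : 'rV[R]_n) : exists k : nat, cube k%:R x.
Proof.
exists (Num.bound (\sum_i `|x ord0 i|)); apply/cubeP => i.
apply: le_lt_trans (archi_boundP _); last by apply: sumr_ge0.
by rewrite (bigD1 i)//= lerDl; apply: sumr_ge0.
Qed.

(** An open half-space is a countable union of boxes growing in the other directions, so the
    coordinates are measurable for the sigma-algebra generated by boxes. *)
Lemma measurable_boxes : measurable `<=` <<s boxes >>.
Proof.
move=> A mA; have : measurable_fun [set: g_sigma_algebraType boxes] (id : _ -> 'rV[R]_n).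
  apply: measurable_fun_rVP => i; apply: (measurability _ (RGenInftyO.measurableE R)) => //.
  move=> _ [_ [x ->] <-]; rewrite setTI.
  pose b (k : nat) : 'rV[R]_n := \row_j (if j == i then x else k%:R).
  have -> : (fun t : 'rV[R]_n => t ord0 i) @^-1` `]-oo, x[%classic =
      \bigcup_(k : nat) box (const_mx (- k%:R)) (b k).
    apply/seteqP; split=> y /=.
      rewrite in_itv /= => yx; have [k /cubeP hk] := bigcup_cube y.
      exists k => // j; have := hk j; rewrite ltr_norml !mxE => /andP[-> h] /=.
      by case: eqP => // ->.
    by move=> [k _ /(_ i)]; rewrite !mxE eqxx in_itv /= => /andP[].
  apply: bigcupT_measurable => k; apply: sub_sigma_algebra.
  by exists (const_mx (- k%:R)), (b k).
by move=> /(_ measurableT _ mA); rewrite setTI.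
Qed.

(** Monotone class argument: the sets over which g integrates to 0 form a lambda-system containing
    the boxes, which are stable under intersection and generate the Borel sets. *)
Lemma integral_box_eq0_ae g : intb g ->
  (forall a b, \int[lam]_x (\1_(box a b) x * g x) = 0) ->
  {ae lam, forall x, g x = 0}.
Proof.
move=> ig g0; have mg := intb_measurable ig.
have mI A : measurable A -> measurable_fun setT (fun x : 'rV[R]_n => \1_A x * g x).
  by move=> mA; apply: measurable_funM => //; exact: measurable_indic.
have bI A x : `|\1_A x * g x| <= `|g x|.
  by rewrite indicE; case: (_ \in _); rewrite /= ?mul1r// mul0r normr0.
have iI A : measurable A -> intb (fun x => \1_A x * g x).
  by move=> mA; apply: intb_le (intb_norm ig) _ => //; exact: mI.
pose H : set (set 'rV[R]_n) :=
  [set A | measurable A /\ \int[lam]_x (\1_A x * g x) = 0].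
have ndH : ndseq_closed H.
  move=> F ndF HF; split; first by apply: bigcupT_measurable => i; case: (HF i).
  have mF i : measurable (F i) by case: (HF i).
  have [|||||_ + _] := @rint_dominated _ _ _ lam (fun i x => \1_(F i) x * g x)
    (fun x => \1_(\bigcup_i F i) x * g x) (fun x => `|g x|).
  - by move=> i; exact: mI.
  - by apply: mI; exact: bigcupT_measurable.
  - apply: aeW => x; have [h|h] := pselect ((\bigcup_i F i) x); last first.
      have -> : (fun i => \1_(F i) x * g x) = fun=> \1_(\bigcup_i F i) x * g x.
        apply/funext => i; congr (_ * _); rewrite !indicE !memNset//.
        by move=> Fi; apply: h; exists i.
      exact: cvg_cst.
    case: (h) => k _ Fk; apply: cvg_near_cst; exists k => // i /= ki.
    rewrite !indicE !mem_set//.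
    by have /subsetPset := ndF _ _ ki; exact.
  - exact: intb_norm.
  - by apply: aeW => x i; exact: bI.
  under eq_fun do rewrite (HF _).2.
  by move=> /cvg_lim <-//; rewrite lim_cst.
have H0 : boxes `<=` H.
  by move=> _ [a [b ->]]; split; [exact: measurable_box|exact: g0].
have HT : H setT.
  have -> : [set: 'rV[R]_n] = \bigcup_(k : nat) cube k%:R.
    apply/seteqP; split=> // x _; have [k hk] := bigcup_cube x; by exists k.
  apply: ndH => [i j ij|i]; first by apply/subsetPset/subset_cube; rewrite ler_nat.
  by apply: H0; exists (const_mx (- i%:R)), (const_mx i%:R).
have LH : lambda_system setT H.
  split => // A B BA [mA A0] [mB B0]; split; first exact: measurableD.
  have -> : (fun x => \1_(A `\` B) x * g x) = (fun x => \1_A x * g x - \1_B x * g x).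
    apply/funext => x; rewrite -mulrBl; congr (_ * _); rewrite !indicE in_setD.
    have [xB|xB] := boolP (x \in B); rewrite ?andbF ?andbT ?subr0//.
    by rewrite (_ : x \in A) ?subrr//; move: xB; rewrite !inE; exact: BA.
  by rewrite rintB ?A0 ?B0 ?subr0//; exact: iI.
have HM A : measurable A -> \int[lam]_x (\1_A x * g x) = 0.
  move=> mA; have := lambda_system_subset boxesI LH H0 (fun _ _ => @subsetT _ _).
  by move=> /(_ A) []//; exact: measurable_boxes.
have := @integral_ae_eq _ _ _ lam setT measurableT (cst 0%E) (EFin \o g) ig.
move=> /(_ (@measurable_cst _ _ _ _ _ _)) h; have {}h : ae_eq lam setT (EFin \o g) (cst 0%E).
  apply: h => E _ mE; rewrite integral0 integral_mkcond epatch_indic.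
  have := HM E mE; rewrite -[X in _ -> _ = X]/(0%:E) => <-; rewrite rint_EFin; last exact: iI.
  by apply: eq_integral => x _; rewrite /= EFinM muleC.
by apply: filterS h => x /(_ I) [].
Qed.

Definition locally_integrable g := forall a b, intb (fun x => \1_(box a b) x * g x).

Lemma locally_integrable_box_eq0_ae g : locally_integrable g ->
  (forall a b, \int[lam]_x (\1_(box a b) x * g x) = 0) ->
  {ae lam, forall x, g x = 0}.
Proof.
move=> lg g0.
have h (k : nat) : {ae lam, forall x, \1_(cube k%:R) x * g x = 0}.
  apply: integral_box_eq0_ae => [|a b]; first exact: lg.
  transitivity (\int[lam]_x (\1_(box a b `&` cube k%:R) x * g x)).
    by congr Rintegral; apply/funext => x; rewrite indicI mulrA.
  by rewrite box_setI g0.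
apply: filterS (ae_countable h) => x hx; have [k hk] := bigcup_cube x.
by have := hx k; rewrite indicE mem_set// mul1r.
Qed.

End fundamental_lemma.

(** * Inner product and Euclidean norm *)

Section euclidean_space.
Context (R : realType) (n : nat).
Implicit Types x y z : 'rV[R]_n.

Lemma dotvC x y : dotv x y = dotv y x.
Proof. by apply: eq_bigr => i _; rewrite mulrC. Qed.

Lemma dotvDl x y z : dotv (x + y) z = dotv x z + dotv y z.
Proof. by rewrite -big_split; apply: eq_bigr => i _ /=; rewrite mxE mulrDl. Qed.

Lemma dotvZl k x y : dotv (k *: x) y = k * dotv x y.
Proof. by rewrite /dotv mulr_sumr; apply: eq_bigr => i _; rewrite mxE mulrA. Qed.

Lemma dotvDr x y z : dotv z (x + y) = dotv z x + dotv z y.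
Proof. by rewrite dotvC dotvDl !(dotvC z). Qed.

Lemma dotvZr k x y : dotv x (k *: y) = k * dotv x y.
Proof. by rewrite dotvC dotvZl dotvC. Qed.

Lemma dotvv_ge0 x : 0 <= dotv x x.
Proof. by apply: sumr_ge0 => i _; rewrite -expr2 sqr_ge0. Qed.

Lemma enorm_sqr x : enorm x ^+ 2 = dotv x x.
Proof. by rewrite sqr_sqrtr// dotvv_ge0. Qed.

Lemma coor_le_enorm x i : `|x ord0 i| <= enorm x.
Proof.
rewrite -sqrtr_sqr ler_sqrt ?dotvv_ge0// /dotv (bigD1 i)//= -expr2 lerDl.
by apply: sumr_ge0 => j _; rewrite -expr2 sqr_ge0.
Qed.

Lemma enorm0 : enorm (0 : 'rV[R]_n) = 0.
Proof. by rewrite -(scale0r 0) enormZ normr0 mul0r. Qed.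

Lemma enorm_eq0 x : (enorm x == 0) = (x == 0).
Proof.
apply/idP/idP => [/eqP x0|/eqP->]; last by rewrite enorm0.
apply/eqP/rowP => i; rewrite mxE; apply/eqP; rewrite -normr_le0 -x0.
exact: coor_le_enorm.
Qed.

Lemma dotv_le x y : dotv x y <= enorm x * enorm y.
Proof.
have [/eqP|x0] := eqVneq (enorm x) 0.
  by rewrite enorm_eq0 => /eqP ->; rewrite enorm0 mul0r -(scale0r 0) dotvZl mul0r.
have [/eqP|y0] := eqVneq (enorm y) 0.
  by rewrite enorm_eq0 => /eqP ->; rewrite enorm0 mulr0 -(scale0r 0) dotvZr mul0r.
have xy : 0 < enorm x * enorm y by rewrite mulr_gt0// lt_def ?x0 ?y0 enorm_ge0.
(* The squared norm of |y| x - |x| y is 2 |x| |y| (|x| |y| - <x, y>). *)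
have := dotvv_ge0 (enorm y *: x + - enorm x *: y).
rewrite !(dotvDl, dotvDr, dotvZl, dotvZr) -!enorm_sqr (dotvC y x) => h.
rewrite -subr_ge0 -(pmulr_rge0 _ xy).
by nra.
Qed.

Lemma dotv_CS x y : `|dotv x y| <= enorm x * enorm y.
Proof.
rewrite ler_norml dotv_le andbT lerNl -mulN1r -dotvZl.
by rewrite (le_trans (dotv_le _ _))// enormZ normrN1 mul1r.
Qed.

Lemma enormD x y : enorm (x + y) <= enorm x + enorm y.
Proof.
rewrite -(ler_pXn2r (_ : 0 < 2)%N) ?nnegrE ?addr_ge0 ?enorm_ge0//.
rewrite enorm_sqr !(dotvDl, dotvDr) -!enorm_sqr (dotvC y x).
by have := dotv_le x y; nra.
Qed.

Lemma enormN x : enorm (- x) = enorm x.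
Proof. by rewrite -scaleN1r enormZ normrN1 mul1r. Qed.

Lemma enorm_lipschitz x y : `|enorm x - enorm y| <= enorm (x - y).
Proof.
rewrite ler_norml; apply/andP; split.
  by have := enormD (y - x) x; rewrite subrK -(opprB x) enormN; lra.
by have := enormD (x - y) y; rewrite subrK; lra.
Qed.

Lemma enorm_parallelogram x y :
  enorm (x + y) ^+ 2 + enorm (x - y) ^+ 2 = 2 * enorm x ^+ 2 + 2 * enorm y ^+ 2.
Proof.
rewrite !enorm_sqr -[- y]scaleN1r !(dotvDl, dotvDr, dotvZl, dotvZr); ring.
Qed.

Lemma enorm_le_sum x : enorm x <= \sum_i `|x ord0 i|.
Proof.
have s0 : 0 <= \sum_i `|x ord0 i| by exact: sumr_ge0.
rewrite -(ler_pXn2r (_ : 0 < 2)%N) ?nnegrE ?enorm_ge0//.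
rewrite enorm_sqr [leRHS]expr2 mulr_suml /dotv; apply: ler_sum => i _.
rewrite -expr2 -real_normK ?num_real// expr2 ler_wpM2l//.
by rewrite (bigD1 i)//= lerDl sumr_ge0.
Qed.

End euclidean_space.

(** * Weak gradients along lines *)

Lemma continuous_sum (R : realType) (T : topologicalType) (I : Type) (r : seq I)
  (F : I -> T -> R) : (forall i, continuous (F i)) ->
  continuous (fun x => \sum_(i <- r) F i x).
Proof.
move=> cF; elim: r => [|i r IH] x.
  by under eq_fun do rewrite big_nil; exact: cvg_cst.
rewrite /continuous_at big_cons; under eq_fun do rewrite big_cons.
by apply: cvgD; [exact: cF|exact: IH].
Qed.

Section translations.
Context (R : realType) (n : nat).
Local Notation lam := (@lebesgue_borel R n).
Local Notation intb f := (lam.-integrable setT (EFin \o f)).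
Implicit Types (f g u : 'rV[R]_n -> R) (z : 'rV[R]_n).

Lemma measurable_shift z : measurable_fun setT (fun x : 'rV[R]_n => x + z).
Proof.
by have := measurable_affine 1 z; under eq_fun do rewrite scale1r.
Qed.

Lemma measurable_funshift d (T : measurableType d) (h : 'rV[R]_n -> T) z :
  measurable_fun setT h -> measurable_fun setT (fun x : 'rV[R]_n => h (x + z)).
Proof. by move=> mh; exact: measurableT_comp mh (measurable_shift z). Qed.

Lemma integral_shift (g : 'rV[R]_n -> \bar R) z : measurable_fun setT g ->
  (forall x, 0 <= g x)%E -> (\int[lam]_x g (x + z)%R = \int[lam]_x g x)%E.
Proof.
move=> mg g0; have := @integral_affine R n g 1 z ltr01 mg g0.
under eq_integral do rewrite scale1r.
by move=> ->; rewrite expr1n invr1 mul1e.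
Qed.

Lemma rint_shift g z : measurable_fun setT g ->
  \int[lam]_x g (x + z) = \int[lam]_x g x.
Proof.
move=> mg; have mE : measurable_fun setT (EFin \o g) by exact/measurable_EFinP.
rewrite /Rintegral; congr fine; rewrite integralE [RHS]integralE; congr (_ - _)%E.
  transitivity (\int[lam]_x (EFin \o g)^\+ (x + z)%R)%E.
    by apply: eq_integral => x _; rewrite !funeposE.
  by apply: (@integral_shift (EFin \o g)^\+%E z (measurable_funepos mE)) => x; exact: funepos_ge0.
transitivity (\int[lam]_x (EFin \o g)^\- (x + z)%R)%E.
    by apply: eq_integral => x _; rewrite !funenegE.
  by apply: (@integral_shift (EFin \o g)^\-%E z (measurable_funeneg mE)) => x; exact: funeneg_ge0.
Qed.

Lemma intb_shift g z : intb g -> intb (fun x : 'rV[R]_n => g (x + z)).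
Proof.
move=> ig; have mg := intb_measurable ig; apply/integrableP; split.
  by apply/measurable_EFinP; exact: measurable_funshift.
rewrite (@integral_shift (fun x => `|g x|%:E)%E)//.
  by have /integrableP[] := ig.
by apply/measurable_EFinP; exact: measurableT_comp.
Qed.

End translations.

Section compact_support.
Context (R : realType) (n : nat).
Local Notation lam := (@lebesgue_borel R n).
Local Notation leb := (@lebesgue_measure R).
Local Notation intb f := (lam.-integrable setT (EFin \o f)).
Local Notation RM := (measurableTypeR R).
Local Notation I01 := (`[0%R, 1%R]%classic : set RM).
Implicit Types (f g u psi phi : 'rV[R]_n -> R) (z : 'rV[R]_n).

Definition bounded_support psi := exists2 C, 0 <= C & exists M,
  forall x, `|psi x| <= C * \1_(cube M) x.

Lemma locally_integrable_mul u psi : measurable_fun setT u -> locally_integrable u ->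
  measurable_fun setT psi -> bounded_support psi -> intb (fun x => u x * psi x).
Proof.
move=> mu lu mpsi [C C0 [M hM]].
apply: (@intb_le _ _ _ _ _ (fun x => C * `|\1_(cube M) x * u x|)).
- exact: measurable_funM.
- by apply: intbZ; apply: intb_norm; exact: lu.
- move=> x; rewrite normrM mulrC (le_trans (ler_wpM2r _ (hM x)))//.
  by rewrite normrM -mulrA (ger0_norm (_ : 0 <= \1_(cube M) x)).
Qed.

Lemma mx_entry_le_norm z i : `|z ord0 i| <= `|z|.
Proof. by rewrite [leRHS]mx_normrE (le_trans _ (le_bigmax _ _ (ord0, i))). Qed.

Lemma cube_line (M s : R) x z : 0 <= s <= 1 -> cube M (x - s *: z) -> cube (M + `|z|) x.
Proof.
move=> /andP[s0 s1] /cubeP h; apply/cubeP => i; have := h i; rewrite !mxE => hi.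
have -> : x ord0 i = x ord0 i - s * z ord0 i + s * z ord0 i by ring.
rewrite (le_lt_trans (ler_normD _ _))// ltr_leD// normrM ger0_norm//.
by rewrite (le_trans _ (mx_entry_le_norm z i))// ler_piMl.
Qed.

Lemma measurable_line z : measurable_fun setT (fun w : 'rV[R]_n * RM => w.1 + w.2 *: z).
Proof.
apply: measurable_fun_rVP => i; under eq_fun do rewrite !mxE.
apply: measurable_funD; first exact: measurableT_comp (measurable_coor i) measurable_fst.
by apply: measurable_funM => //; exact: measurable_snd.
Qed.

Lemma measurable_lineB z : measurable_fun setT (fun w : 'rV[R]_n * RM => w.1 - w.2 *: z).
Proof.
have := measurable_line (- z); congr (measurable_fun _ _).
by apply/funext => w; rewrite scalerN.
Qed.

Lemma lebesgue_I01 : lebesgue_measure I01 = 1%E.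
Proof. by rewrite lebesgue_measure_itv /= lte01 oppr0 adde0. Qed.

Lemma indic_box_shift (a b : 'rV[R]_n) z x : \1_(box (a + z) (b + z)) (x + z) = \1_(box a b) x :> R.
Proof.
rewrite !indicE; congr (nat_of_bool _)%:R; apply/idP/idP; rewrite !inE => h i; have := h i;
  by rewrite !mxE ltrD2r ltrD2r.
Qed.

Lemma locally_integrable_shift u z : locally_integrable u ->
  locally_integrable (fun x => u (x + z)).
Proof.
move=> lu a b; have := intb_shift z (lu (a + z) (b + z)).
by under eq_fun do rewrite indic_box_shift.
Qed.

Lemma locally_integrableB f g : locally_integrable f -> locally_integrable g ->
  locally_integrable (fun x => f x - g x).
Proof.
by move=> lf lg a b; under eq_fun do rewrite mulrBr; exact: intbB.
Qed.

Lemma locally_integrableZ k f : locally_integrable f -> locally_integrable (fun x => k * f x).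
Proof.
by move=> lf a b; under eq_fun do rewrite mulrCA; exact: intbZ.
Qed.

Lemma locally_integrable_sum (I : Type) (r : seq I) (F : I -> 'rV[R]_n -> R) :
  (forall i, locally_integrable (F i)) ->
  locally_integrable (fun x => \sum_(i <- r) F i x).
Proof.
by move=> lF a b; under eq_fun do rewrite mulr_sumr; apply: intb_sum => i; exact: lF.
Qed.

Lemma box_subset_cube (a b : 'rV[R]_n) : exists M : R, box a b `<=` cube M.
Proof.
exists (\sum_i (`|a ord0 i| + `|b ord0 i| + 1)) => x h; apply/cubeP => i.
rewrite (bigD1 i)//= ltr_wpDr//; first by apply: sumr_ge0 => j _; rewrite !addr_ge0.
have /andP[h1 h2] := h i; rewrite ltr_norml; apply/andP; split.
  by have := ler_norm (- a ord0 i); have := normr_ge0 (b ord0 i); rewrite normrN; lra.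
by have := ler_norm (b ord0 i); have := normr_ge0 (a ord0 i); lra.
Qed.

Lemma bounded_support_box psi a b C : 0 <= C -> (forall x, `|psi x| <= C) ->
  (forall x, ~ box a b x -> psi x = 0) -> bounded_support psi.
Proof.
move=> C0 hC h0; exists C => //; have [M hM] := box_subset_cube a b; exists M => x.
have [hx|hx] := pselect (box a b x).
  by rewrite indicE mem_set ?mulr1//; exact: hM.
by rewrite h0// normr0 mulr_ge0.
Qed.

Lemma bounded_support_indic_box a b : bounded_support (\1_(box a b)).
Proof.
apply: (@bounded_support_box _ a b 1) => // x; rewrite indicE.
  by case: (_ \in _); rewrite /= ?normr0 ?normr1.
by move=> hx; rewrite memNset.
Qed.

Lemma bounded_support_bump m a b : bounded_support (bump m a b).
Proof.
apply: (@bounded_support_box _ a b 1) => // x; last exact: bump_eq0.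
by rewrite ger0_norm ?bump_ge0 ?bump_le1.
Qed.

Lemma compact_cube (K : set 'rV[R]_n) : compact K -> exists M, K `<=` cube M.
Proof.
move=> /compact_bounded[M [Mr hM]]; exists (M + 2) => x Kx; apply/cubeP => i.
apply: (@le_lt_trans _ _ (M + 1)); last by rewrite ltrD2l ltr1n.
by apply: (le_trans (mx_entry_le_norm x i)); apply: hM => //; rewrite ltrDl.
Qed.

Lemma continuous_bounded_support psi (K : set 'rV[R]_n) : compact K -> continuous psi ->
  (forall x, ~ K x -> psi x = 0) -> bounded_support psi.
Proof.
move=> cK cpsi h0; have [M hM] := compact_cube cK.
have /compact_bounded[C [Cr hC]] := continuous_compact (continuous_subspaceT cpsi) cK.
exists (`|C| + 1); first by rewrite addr_ge0.
exists M => x; have [Kx|Kx] := pselect (K x); last by rewrite h0// normr0 mulr_ge0// addr_ge0.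
rewrite indicE mem_set ?mulr1; last exact: hM.
by apply: hC; [rewrite (le_lt_trans (ler_norm _))// ltrDl|exists x].
Qed.

Lemma test_function_bounded_support phi : test_function phi -> bounded_support phi.
Proof.
move=> [/(_ 0%N)[cphi _] cK]; apply: (continuous_bounded_support cK) => // x h.
by apply: contrapT => px; apply: h; apply: subset_closure; exact/eqP.
Qed.

Lemma test_derive_bounded_support phi i : test_function phi ->
  bounded_support (fun x => 'D_(basis_rV R i) phi x).
Proof.
move=> [/(_ 1%N)[cphi /(_ i)[dphi [cd _]]] cK]; apply: (continuous_bounded_support cK) => // x h.
have : \forall y \near x, phi y = 0.
  have : open (~` closure [set x | phi x != 0]) by apply: closed_openC; exact: closed_closure.
  move=> /(_ x h); apply: filterS => y hy; apply: contrapT => py.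
  by apply: hy; apply: subset_closure; exact/eqP.
move=> h0; rewrite (_ : 'D_(basis_rV R i) phi x = 'D_(basis_rV R i) (cst 0) x).
  exact: derive_cst.
exact: near_eq_derive.
Qed.

Lemma test_measurable phi : test_function phi -> measurable_fun setT phi.
Proof. by move=> [/(_ 0%N)[cphi _] _]; exact: continuous_measurable_rV. Qed.

Lemma test_derive_measurable phi i : test_function phi ->
  measurable_fun setT (fun x => 'D_(basis_rV R i) phi x).
Proof.
by move=> [/(_ 1%N)[_ /(_ i)[_ [cd _]]] _]; exact: continuous_measurable_rV.
Qed.

Lemma line_FTC phi (dphi : 'rV[R]_n -> R) (v x : 'rV[R]_n) :
  (forall x, is_derive x v phi (dphi x)) -> continuous dphi ->
  phi (x + v) - phi x = \int[leb]_s (\1_I01 s * dphi (x + s *: v)).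
Proof.
move=> dp cd; pose F (s : R) := phi (s *: v + x); pose f (s : R) := dphi (s *: v + x).
have dF (s : R) : is_derive s 1 F (f s) by apply/is_derive_line.
have cf : continuous f.
  move=> s; apply: (@continuous_comp _ _ _ (fun s : R => s *: v + x) dphi); last exact: cd.
  by apply: continuousD; [exact: scalel_continuous|exact: cst_continuous].
have cF : continuous F.
  move=> s; apply/differentiable_continuous/derivable1_diffP.
  exact: (@ex_derive _ _ _ _ _ _ _ (dF s)).
have := @continuous_FTC2 R f F 0 1 ltr01 (continuous_subspaceT cf).
have dL : derivable_oo_LRcontinuous F 0 1.
  split; first by move=> s _; exact: (@ex_derive _ _ _ _ _ _ _ (dF s)).
    by apply: cvg_at_right_filter; exact: cF.
  by apply: cvg_at_left_filter; exact: cF.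
have FE : {in `]0%R, 1%R[, F^`()%classic =1 f}.
  by move=> s _; rewrite derive1E; exact: (@derive_val _ _ _ _ _ _ _ (dF s)).
move=> /(_ dL FE); rewrite /F scale1r scale0r add0r (addrC v) => E.
rewrite -[LHS]/(fine ((phi (x + v))%:E - (phi x)%:E)%E) -E /Rintegral; congr fine.
rewrite [LHS]integral_mkcond epatch_indic; apply: eq_integral => s _.
by rewrite /= -EFinM mulrC /f addrC.
Qed.

Lemma integrable_line psi x z : measurable_fun setT psi -> bounded_support psi ->
  leb.-integrable setT (EFin \o (fun s : RM => \1_I01 s * psi (x - s *: z))).
Proof.
move=> mpsi [C C0 [M hM]].
apply: (@intb_le _ _ _ _ _ (fun s => C * \1_I01 s)) => //.
- apply: measurable_funM; first exact: measurable_indic.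
  apply: measurableT_comp mpsi _.
  by have := measurableT_comp (measurable_lineB z) (@measurable_pair1 _ _ 'rV[R]_n RM x).
- have oo : (leb I01 < +oo)%E by have -> := lebesgue_I01; rewrite ltry.
  by have [] := @rint_cst_indic _ _ _ leb I01 C (@measurable_itv R `[0,1]%R) oo.
move=> s; rewrite normrM (ger0_norm (_ : 0 <= \1_I01 s))// mulrC ler_wpM2r//.
apply: (le_trans (hM _)); rewrite -[leRHS]mulr1 ler_wpM2l// indicE.
Qed.

(** * Averages along a segment and their adjoint *)

Section line_fubini.
Variables (u psi : 'rV[R]_n -> R) (z : 'rV[R]_n).
Hypotheses (mu : measurable_fun setT u) (lu : locally_integrable u)
  (mpsi : measurable_fun setT psi) (bpsi : bounded_support psi).

Let mI : measurable_fun setT (fun w : 'rV[R]_n * RM => (\1_I01 w.2 : R)).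
Proof.
apply: (@measurableT_comp _ _ _ _ _ _ (\1_I01 : RM -> R)); last exact: measurable_snd.
by apply: measurable_indic; exact: measurable_itv.
Qed.

Let mf1 : measurable_fun setT (fun w : 'rV[R]_n * RM => \1_I01 w.2 * (u w.1 * psi (w.1 - w.2 *: z))).
Proof.
apply: measurable_funM => //; apply: measurable_funM.
  exact: measurableT_comp mu measurable_fst.
exact: measurableT_comp mpsi (measurable_lineB z).
Qed.

Let mf2 : measurable_fun setT (fun w : 'rV[R]_n * RM => \1_I01 w.2 * (u (w.1 + w.2 *: z) * psi w.1)).
Proof.
apply: measurable_funM => //; apply: measurable_funM.
  exact: measurableT_comp mu (measurable_line z).
exact: measurableT_comp mpsi measurable_fst.
Qed.

(** psi(x - s z) vanishes unless x lies in the support cube of psi enlarged by |z|, so local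
    integrability of u gives a finite double integral. *)
Let fin1 : (\int[lam]_x \int[leb]_s `|\1_I01 s * (u x * psi (x - s *: z))|%:E < +oo)%E.
Proof.
have [C C0 [M hM]] := bpsi.
have mN : measurable_fun setT (fun w : 'rV[R]_n * RM => `|\1_I01 w.2 * (u w.1 * psi (w.1 - w.2 *: z))|%:E).
  by apply/measurable_EFinP; exact: measurableT_comp mf1.
have mIx : measurable_fun setT (fun x : RM => (\1_I01 x : R)%:E).
  by apply/measurable_EFinP; exact: measurable_indic.
apply: (@le_lt_trans _ _ (\int[lam]_x `|C * (\1_(cube (M + `|z|)) x * u x)|%:E)%E).
  apply: ge0_le_integralT => //.
  - apply: (measurable_integral2 (leb) (f := fun (x : 'rV[R]_n) (s : RM) => `|\1_I01 s * (u x * psi (x - s *: z))|%:E) mN) => //.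
  - apply/measurable_EFinP; apply: measurableT_comp => //; apply: measurable_funM => //.
    by apply: measurable_funM => //; apply: measurable_indic; exact: measurable_box.
  - by move=> x; exact: integral_ge0.
  move=> x; apply: (@le_trans _ _ (\int[leb]_s (`|C * (\1_(cube (M + `|z|)) x * u x)|%:E * (\1_I01 s)%:E))%E).
    apply: ge0_le_integralT => //.
    - apply/measurable_EFinP; apply: measurableT_comp => //.
      apply: measurable_funM; first exact: measurable_indic.
      apply: measurable_funM => //; apply: measurableT_comp mpsi _.
      by have := measurableT_comp (measurable_lineB z) (@measurable_pair1 _ _ 'rV[R]_n RM x).
    - exact: measurable_funeM.
    move=> s; rewrite -EFinM lee_fin indicE; have [sI|sI] := boolP (s \in I01); last first.
      by rewrite !(mul0r, mulr0, normr0).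
    rewrite mul1r mulr1 !normrM (ger0_norm C0) mulrA [leRHS]mulrC ler_wpM2l//.
    apply: (le_trans (hM _)); apply: ler_wpM2l => //; rewrite [leRHS]ger0_norm// !indicE.
    have [h|h] := boolP (_ - _ \in cube M); last by [].
    rewrite mem_set//; move: h; rewrite inE; apply: cube_line.
    by move: sI; rewrite inE /= in_itv.
  rewrite ge0_integralTZl// integral_indicT//.
  by rewrite [X in (_ * X)%E](lebesgue_I01 : _ = _) mule1.
by have /integrableP[] := intbZ C (lu (const_mx (- (M + `|z|))) (const_mx (M + `|z|))).
Qed.

Let fin2 : (\int[lam]_x \int[leb]_s `|\1_I01 s * (u (x + s *: z) * psi x)|%:E < +oo)%E.
Proof.
have m1 : measurable_fun setT (fun w : 'rV[R]_n * RM => `|\1_I01 w.2 * (u w.1 * psi (w.1 - w.2 *: z))|%:E).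
  by apply/measurable_EFinP; exact: measurableT_comp mf1.
have m2 : measurable_fun setT (fun w : 'rV[R]_n * RM => `|\1_I01 w.2 * (u (w.1 + w.2 *: z) * psi w.1)|%:E).
  by apply/measurable_EFinP; exact: measurableT_comp mf2.
have E1 := tonelli lam leb (f := fun x s => `|\1_I01 s * (u x * psi (x - s *: z))|%:E) m1 (fun x s => normr_ge0 _).
have E2 := tonelli lam leb (f := fun x s => `|\1_I01 s * (u (x + s *: z) * psi x)|%:E) m2 (fun x s => normr_ge0 _).
suff E : (\int[leb]_s \int[lam]_x `|\1_I01 s * (u (x + s *: z) * psi x)|%:E = 
     \int[leb]_s \int[lam]_x `|\1_I01 s * (u x * psi (x - s *: z))|%:E)%E.
  by apply: (le_lt_trans _ fin1); rewrite le_eqVlt; apply/orP; left; apply/eqP; apply: (etrans E2); apply: (etrans E); exact: esym E1.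
apply: eq_integral => s _.
rewrite -[RHS](@integral_shift _ _ _ (s *: z))//.
  by apply: eq_integral => x _; rewrite addrK.
exact: (measurableT_comp m1 (@measurable_pair2 _ _ 'rV[R]_n RM s)).
Qed.

Lemma rint_line_fubini :
  intb (fun x => u x * \int[leb]_s (\1_I01 s * psi (x - s *: z))) /\
  \int[lam]_x (u x * \int[leb]_s (\1_I01 s * psi (x - s *: z))) =
  \int[leb]_s (\1_I01 s * \int[lam]_x (u x * psi (x - s *: z))).
Proof.
have [h0 _ h] := @rint_fubini _ _ _ _ _ lam leb (fun x s => \1_I01 s * (u x * psi (x - s *: z))) mf1 fin1.
have -> : (fun x => u x * \int[leb]_s (\1_I01 s * psi (x - s *: z))) =
    (fun x => \int[leb]_s (\1_I01 s * (u x * psi (x - s *: z)))).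
  apply/funext => x; rewrite -rintZ; first by congr Rintegral; apply/funext => s; ring.
  exact: integrable_line.
split => //.
rewrite h; congr Rintegral; apply/funext => s.
rewrite rintZ//; apply: locally_integrable_mul => //.
  exact: measurable_funshift.
have [C C0 [M hM]] := bpsi; exists C => //; exists (M + `|s *: z|) => x.
apply: (le_trans (hM _)); rewrite ler_wpM2l// !indicE.
have [hx|] := boolP (_ - _ \in cube M); last by [].
rewrite mem_set//; apply: (@cube_line M 1); first by rewrite ler01 lexx.
by rewrite scale1r; rewrite inE in hx.
Qed.

(** Translation invariance moves the shift s z from u to psi inside the exchanged integrals. With
    [rint_line_fubini] it says that averaging along - z is the adjoint of averaging along z. *)
Lemma rint_line_shift :
  intb (fun x => (\int[leb]_s (\1_I01 s * u (x + s *: z))) * psi x) /\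
  \int[lam]_x ((\int[leb]_s (\1_I01 s * u (x + s *: z))) * psi x) =
  \int[leb]_s (\1_I01 s * \int[lam]_x (u x * psi (x - s *: z))).
Proof.
have [i1 _ h] := @rint_fubini _ _ _ _ _ lam leb (fun x s => \1_I01 s * (u (x + s *: z) * psi x)) mf2 fin2.
have E x : (\int[leb]_s (\1_I01 s * u (x + s *: z))) * psi x =
    \int[leb]_s (\1_I01 s * (u (x + s *: z) * psi x)).
  have [->|px] := eqVneq (psi x) 0.
    rewrite mulr0 -[LHS](@rint0 _ _ _ leb); congr Rintegral; apply/funext => s.
    by rewrite !mulr0.
  rewrite mulrC -rintZ_measurable; first by congr Rintegral; apply/funext => s; ring.
  apply: measurable_funM; first exact: measurable_indic.
  exact: measurableT_comp mu (measurableT_comp (measurable_line z) (@measurable_pair1 _ _ 'rV[R]_n RM x)).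
have -> : (fun x => (\int[leb]_s (\1_I01 s * u (x + s *: z))) * psi x) =
    (fun x => \int[leb]_s (\1_I01 s * (u (x + s *: z) * psi x))).
  exact/funext.
split => //; rewrite h; congr Rintegral; apply/funext => s.
rewrite rintZ; last first.
  apply: (@locally_integrable_mul (fun x => u (x + s *: z))) => //.
    exact: measurable_funshift.
  exact: locally_integrable_shift.
congr (_ * _); rewrite -(@rint_shift _ _ (fun x => u x * psi (x - s *: z)) (s *: z)).
  by congr Rintegral; apply/funext => x; rewrite addrK.
by apply: measurable_funM => //; rewrite -scaleN1r; exact: measurable_funshift.
Qed.

End line_fubini.

Lemma locally_integrable_line u z : measurable_fun setT u -> locally_integrable u ->
  locally_integrable (fun x => \int[leb]_s (\1_I01 s * u (x + s *: z))).
Proof.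
move=> mu lu a b; under eq_fun do rewrite mulrC.
have mb : measurable_fun setT (\1_(box a b) : 'rV[R]_n -> R) by apply: measurable_indic; exact: measurable_box.
by have [] := rint_line_shift z mu lu mb (bounded_support_indic_box a b).
Qed.

(** The weak gradient relation is tested on bumps: the argument translates test functions and
    approximates indicators of boxes, and bumps are stable under the one and converge to the
    other. *)
Definition bump_gradient u (G : 'rV[R]_n -> 'rV[R]_n) := forall m a b i,
  \int[lam]_x (u x * 'D_(basis_rV R i) (bump m a b) x) =
  - \int[lam]_x (G x ord0 i * bump m a b x).

(** * The fundamental theorem of calculus for weak gradients *)

Section ftc.
Variables (u : 'rV[R]_n -> R) (G : 'rV[R]_n -> 'rV[R]_n).
Hypotheses (mu : measurable_fun setT u) (lu : locally_integrable u)
  (mG : forall i, measurable_fun setT (fun x => G x ord0 i))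
  (lG : forall i, locally_integrable (fun x => G x ord0 i))
  (uG : bump_gradient u G).

Let P z i x := \int[leb]_s (\1_I01 s * G (x + s *: z) ord0 i).

Let lP z i : locally_integrable (P z i).
Proof. exact: (locally_integrable_line z (mG i) (lG i)). Qed.

Let bump_derive_shift m a b i x z :
  'D_(basis_rV R i) (bump m a b) (x - z) = 'D_(basis_rV R i) (bump m (a + z) (b + z)) x.
Proof.
have E : (fun h : R => h^-1 *: ((bump m a b \o shift (x - z)) (h *: basis_rV R i) - bump m a b (x - z))) =
  (fun h => h^-1 *: ((bump m (a + z) (b + z) \o shift x) (h *: basis_rV R i) - bump m (a + z) (b + z) x)).
  by apply/funext => h /=; rewrite -!bump_shift addrA.
by rewrite /derive E.
Qed.

Let dbump m a b (x v : 'rV[R]_n) := \sum_(i < n) v ord0 i * 'D_(basis_rV R i) (bump m a b) x.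

Let bump_line m a b x z : bump m a b (x - z) - bump m a b x =
  - \sum_i (z ord0 i * \int[leb]_s (\1_I01 s * 'D_(basis_rV R i) (bump m a b) (x - s *: z))).
Proof.
have cd i : continuous (fun x => 'D_(basis_rV R i) (bump m a b) x).
  by have [/(_ 1%N)[_ /(_ i)[_ [cd _]]] _] := test_bump m a b.
have D y : is_derive y (- z) (bump m a b) (dbump m a b y (- z)) by exact: bump_derive.
rewrite (line_FTC x D); last first.
  apply: (continuous_sum (F := fun i y => (- z) ord0 i * 'D_(basis_rV R i) (bump m a b) y)) => i y.
  apply: (@continuousM _ _ (fun=> (- z) ord0 i) (fun y => 'D_(basis_rV R i) (bump m a b) y)).
    exact: cst_continuous.
  exact: cd.
have ii i : leb.-integrable setT (EFin \o
    (fun s : RM => \1_I01 s * 'D_(basis_rV R i) (bump m a b) (x - s *: z))).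
  apply: (@integrable_line (fun x => 'D_(basis_rV R i) (bump m a b) x)).
    exact: (test_derive_measurable i (test_bump m a b)).
  exact: (test_derive_bounded_support i (test_bump m a b)).
transitivity (\int[leb]_s (\sum_i (- z ord0 i * (\1_I01 s * 'D_(basis_rV R i) (bump m a b) (x - s *: z))))).
  congr Rintegral; apply/funext => s; rewrite /dbump mulr_sumr; apply: eq_bigr => i _.
  by rewrite scalerN !mxE; ring.
rewrite rint_sum; last by move=> i; exact: intbZ.
by rewrite -sumrN; apply: eq_bigr => i _; rewrite rintZ// mulNr.
Qed.

(** The error in the fundamental theorem of calculus for the shift z, with P the mean of G along the
    segment. The aim is to show that it vanishes almost everywhere. *)
Let h z x := u (x + z) - u x - \sum_i (z ord0 i * P z i x).

Let lh z : locally_integrable (h z).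
Proof.
apply: locally_integrableB.
  by apply: locally_integrableB => //; exact: locally_integrable_shift.
by apply: locally_integrable_sum => i; exact: locally_integrableZ.
Qed.

Let mh z : measurable_fun setT (h z).
Proof.
apply: measurable_funB.
  by apply: measurable_funB => //; exact: measurable_funshift.
apply: measurable_sum => i; apply: measurable_funM => //.
apply: (measurable_rint2 (leb) (f := fun (x : 'rV[R]_n) (s : RM) => \1_I01 s * G (x + s *: z) ord0 i)).
apply: measurable_funM; last exact: measurableT_comp (mG i) (measurable_line z).
apply: (@measurableT_comp _ _ _ _ _ _ (\1_I01 : RM -> R)); last exact: measurable_snd.
by apply: measurable_indic; exact: measurable_itv.
Qed.

Let measurable_bump m (a b : 'rV[R]_n) : measurable_fun setT (bump m a b).
Proof. exact: test_measurable (test_bump m a b). Qed.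

(** A translation moves the increment of u onto the bump; the bump, being smooth, obeys the
    fundamental theorem along the segment, and the weak gradient relation for the translated bumps
    turns its partial derivatives back into G. *)
Let h_bump z m a b : \int[lam]_x (h z x * bump m a b x) = 0.
Proof.
pose phi := bump m a b.
have mphi : measurable_fun setT phi by exact: measurable_bump.
have bphi : bounded_support phi by exact: bounded_support_bump.
have mD i := test_derive_measurable i (test_bump m a b).
have bD i := test_derive_bounded_support i (test_bump m a b).
have lus := locally_integrable_shift z lu.
have i1 : intb (fun x => u (x + z) * phi x).
  by apply: (locally_integrable_mul _ lus) => //; exact: measurable_funshift.
have i2 : intb (fun x => u x * phi x) by exact: locally_integrable_mul.
have i3 i : intb (fun x => P z i x * phi x).
  by have [] := rint_line_shift z (mG i) (lG i) mphi bphi.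
transitivity (\int[lam]_x (u (x + z) * phi x - u x * phi x) -
    \int[lam]_x (\sum_i (z ord0 i * (P z i x * phi x)))).
  rewrite -rintB; [|exact: intbB|by apply: intb_sum => i; exact: intbZ].
  congr Rintegral; apply/funext => x; rewrite /h !mulrBl mulr_suml.
  by congr (_ - _); apply: eq_bigr => i _; rewrite mulrA.
rewrite [X in _ - X]rint_sum; last by move=> i; exact: intbZ.
transitivity ((- \int[lam]_x (\sum_i (z ord0 i * (u x * \int[leb]_s (\1_I01 s *
    'D_(basis_rV R i) phi (x - s *: z)))))) -
  \sum_(i < n) \int[lam]_x (z ord0 i * (P z i x * phi x))).
  congr (_ - _); rewrite rintB// -[X in X - _](@rint_shift _ _ _ (- z)); last first.
    by apply: measurable_funM => //; exact: measurable_funshift.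
  rewrite -rintB//; last first.
    by have := intb_shift (- z) i1.
  rewrite -rintN.
  congr Rintegral; apply/funext => x; rewrite subrK -mulrBr bump_line mulrN mulr_sumr.
  by congr (- _); apply: eq_bigr => i _; rewrite mulrCA.
have F i := rint_line_fubini z mu lu (mD i) (bD i).
rewrite rint_sum; last by move=> i; apply: intbZ; case: (F i).
rewrite -sumrN -sumrB big1// => i _.
have [_ E] := rint_line_shift z (mG i) (lG i) mphi bphi.
have [iF EF] := F i; rewrite rintZ// [X in _ - X]rintZ// [X in _ - _ * X]E EF.
rewrite -mulrN -mulrBr -rintN.
set X := Rintegral _ _ _; set Y := Rintegral _ _ _; suff -> : X = Y by rewrite subrr mulr0.
rewrite /X /Y.
congr Rintegral; apply/funext => s; rewrite -mulrN; congr (_ * _).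
under eq_fun do rewrite bump_derive_shift.
rewrite uG opprK; congr Rintegral; apply/funext => x.
by rewrite /phi bump_shift.
Qed.

(** The error integrates to 0 against bumps, hence against indicators of boxes by dominated
    convergence, and the fundamental lemma applies. *)
Lemma ae_FTC z : {ae lam, forall x,
  u (x + z) - u x = \sum_i (z ord0 i * \int[leb]_s (\1_I01 s * G (x + s *: z) ord0 i))}.
Proof.
have := locally_integrable_box_eq0_ae (@lh z).
move=> H; suff : {ae lam, forall x, h z x = 0}.
  by apply: filterS => x /eqP; rewrite subr_eq0 => /eqP.
apply: H => a b.
have mB : measurable_fun setT (\1_(box a b) : 'rV[R]_n -> R).
  by apply: measurable_indic; exact: measurable_box.
have [|||||_ + _] := @rint_dominated _ _ _ lam (fun m x => bump m a b x * h z x)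
    (fun x => \1_(box a b) x * h z x) (fun x => `|\1_(box a b) x * h z x|).
- by move=> m; exact: measurable_funM.
- exact: measurable_funM.
- by apply: aeW => x; apply: cvgMl; exact: bump_cvg.
- by apply: intb_norm; exact: lh.
- apply: aeW => x m; rewrite !normrM ler_wpM2r// ger0_norm ?bump_ge0// indicE.
  have [xB|xB] := boolP (x \in box a b); first by rewrite normr1 bump_le1.
  by rewrite bump_eq0// => hx; rewrite mem_set in xB.
rewrite (_ : (fun m => _) = fun=> 0); last first.
  apply/funext => m; rewrite -(h_bump z m a b).
  by congr Rintegral; apply/funext => x; rewrite mulrC.
by move=> /cvg_lim <-//; rewrite lim_cst.
Qed.

(** The right-hand side is an extended integral: where it is infinite the bound is trivial, and
    elsewhere Cauchy-Schwarz applies under the integral sign. *)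
Lemma ae_FTC_le z : {ae lam, forall x,
  (`|u (x + z) - u x|%:E <=
   \int[leb]_s (\1_I01 s * (enorm z * enorm (G (x + s *: z))))%:E)%E}.
Proof.
apply: filterS (ae_FTC z) => x ->.
have mGx i : measurable_fun setT (fun s : RM => G (x + s *: z) ord0 i).
  exact: measurableT_comp (mG i) (measurableT_comp (measurable_line z) (@measurable_pair1 _ _ 'rV[R]_n RM x)).
have mI : measurable_fun setT (\1_I01 : RM -> R) by exact: measurable_indic.
pose g (s : RM) := \1_I01 s * (enorm z * enorm (G (x + s *: z))).
have g0 s : 0 <= g s by rewrite mulr_ge0// mulr_ge0 ?enorm_ge0.
have mg : measurable_fun setT g.
  apply: measurable_funM => //; apply: measurable_funM => //.
  exact: (measurable_enorm (f := fun s : RM => G (x + s *: z)) mGx).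
have bg s : `|\sum_i (z ord0 i * (\1_I01 s * G (x + s *: z) ord0 i))| <= g s.
  under eq_bigr do rewrite mulrCA; rewrite -mulr_sumr normrM ger0_norm// ler_wpM2l//.
  exact: dotv_CS.
have [ig|nig] := pselect (leb.-integrable setT (EFin \o g)); last first.
  rewrite [leRHS](_ : _ = +oo%E) ?leey//; apply/eqP; rewrite eq_le leey /=.
  by rewrite leNgt; apply/negP => hg; apply: nig; exact: intb_ge0.
rewrite -/g -rint_EFin// lee_fin.
have [z0|z0] := eqVneq (enorm z) 0.
  have -> : z = 0 by apply/eqP; rewrite -enorm_eq0 z0.
  rewrite big1 ?normr0; first by apply: rint_ge0 => s; rewrite mulr_ge0// mulr_ge0 ?enorm_ge0.
  by move=> i _; rewrite mxE mul0r.
have zp : 0 < enorm z by rewrite lt_def z0 enorm_ge0.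
have ii i : leb.-integrable setT (EFin \o (fun s : RM => \1_I01 s * G (x + s *: z) ord0 i)).
  apply: (@intb_le _ _ _ _ _ (fun s => (enorm z)^-1 * g s)); [exact: measurable_funM|exact: intbZ|].
  move=> s; rewrite /g mulrCA mulKf// normrM ger0_norm// ler_wpM2l//.
  exact: coor_le_enorm.
under eq_bigr do rewrite -rintZ//.
rewrite -rint_sum; last by move=> i; exact: intbZ.
apply: (le_trans (le_norm_rint _)); first by apply: intb_sum => i; exact: intbZ.
by apply: le_rint => //; first by apply: intb_norm; apply: intb_sum => i; exact: intbZ.
Qed.

End ftc.

End compact_support.

(** * Morrey's inequality *)

Section hoelder_inequality.
Context d (T : measurableType d) (R : realType) (mu : {measure set T -> \bar R}).

Lemma integral_hoelder (f g : T -> R) (p q a b : R) :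
  measurable_fun setT f -> measurable_fun setT g ->
  (forall x, 0 <= f x) -> (forall x, 0 <= g x) ->
  0 < p -> 0 < q -> p^-1 + q^-1 = 1 -> 0 <= a -> 0 <= b ->
  (\int[mu]_x (f x `^ p)%:E <= a%:E)%E -> (\int[mu]_x (g x `^ q)%:E <= b%:E)%E ->
  (\int[mu]_x (f x * g x)%:E <= (a `^ p^-1 * b `^ q^-1)%:E)%E.
Proof.
move=> mf mg f0 g0 p0 q0 pq a0 b0 fa gb.
have := @hoelder _ _ _ mu f g p q mf mg p0 q0 pq.
rewrite Lnorm1 unlock /= => h.
apply: (@le_trans _ _ (\int[mu]_x `|(f \* g)%R x|%:E)%E).
  by under [leRHS]eq_integral do rewrite /= ger0_norm ?mulr_ge0//.
have le1 (k : T -> R) (r c : R) : 0 < r -> 0 <= c -> (forall x, 0 <= k x) ->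
    (\int[mu]_x (k x `^ r)%:E <= c%:E)%E ->
    ((\int[mu]_x (`|k x| `^ r)%:E) `^ r^-1 <= (c `^ r^-1)%:E)%E.
  move=> r0 c0 k0 kc; rewrite -poweR_EFin; apply: gt0_ler_poweR.
  - by rewrite invr_ge0 ltW.
  - rewrite in_itv /= leey andbT; apply: integral_ge0 => x _.
    by rewrite lee_fin powR_ge0.
  - by rewrite in_itv /= leey andbT lee_fin.
  - by under eq_integral do rewrite ger0_norm//.
apply: (le_trans h); rewrite EFinM; apply: lee_pmul; rewrite ?poweR_ge0//; exact: le1.
Qed.

Lemma ge0_integral_eq0_ae (f : T -> \bar R) : measurable_fun setT f ->
  (forall x, 0 <= f x)%E -> (\int[mu]_x f x = 0)%E -> {ae mu, forall x, f x = 0%E}.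
Proof.
move=> mf f0 If0; have := (@ae_eq_integral_abs _ _ _ mu setT measurableT f mf).1.
have -> : (\int[mu]_x `|f x| = 0)%E by under eq_integral do rewrite gee0_abs//.
by move=> /(_ erefl); apply: filterS => x /(_ I).
Qed.

End hoelder_inequality.

Section ae_product.
Context d1 d2 (T1 : measurableType d1) (T2 : measurableType d2) (R : realType).
Variables (m1 : {sigma_finite_measure set T1 -> \bar R})
          (m2 : {sigma_finite_measure set T2 -> \bar R}).

(** By Tonelli's theorem the exceptional set is null in the product, so the quantifiers can be
    exchanged. The line formula holds for each shift at almost every point; Morrey's estimate wants
    almost every shift at a fixed point. *)
Lemma ae_section (P : set (T1 * T2)) : measurable P ->
  (forall y, {ae m1, forall x, P (x, y)}) -> {ae m1, forall x, {ae m2, forall y, P (x, y)}}.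
Proof.
move=> mP h.
have mC : measurable (~` P) by exact: measurableC.
have mI : measurable_fun setT (fun w : T1 * T2 => (\1_(~` P) (w.1, w.2) : R)%:E).
  rewrite (_ : (fun w => _) = EFin \o \1_(~` P)); last by apply/funext => -[].
  by apply/measurable_EFinP; exact: measurable_indic.
have I0 x y : (0 <= (\1_(~` P) (x, y) : R)%:E)%E by rewrite lee_fin.
have E := tonelli m1 m2 (f := fun x y => (\1_(~` P) (x, y) : R)%:E) mI I0.
have Z : (\int[m2]_y \int[m1]_x (\1_(~` P) (x, y) : R)%:E = 0)%E.
  rewrite integral0_eq// => y _.
  have := h y; rewrite /almost_everywhere /negligible => -[A [mA A0 PA]].
  apply/eqP; rewrite eq_le integral_ge0// andbT -A0 -integral_indicT//.
  apply: ge0_le_integralT => //.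
  - exact: measurableT_comp mI (@measurable_pair2 _ _ T1 T2 y).
  - exact: measurable_indic_EFin.
  move=> x; rewrite lee_fin !indicE; case: (boolP ((x, y) \in ~` P)) => //.
  by rewrite inE => Pxy; rewrite mem_set//; exact: PA.
rewrite {}Z in E.
have := ge0_integral_eq0_ae (measurable_integral2 m2 (f := fun x y => (\1_(~` P) (x, y) : R)%:E) mI I0) _ E.
move=> /(_ (fun x => integral_ge0 _ (fun y _ => I0 x y))).
apply: filterS => x Ex.
have := ge0_integral_eq0_ae _ (I0 x) Ex.
move=> /(_ (measurableT_comp mI (@measurable_pair1 _ _ T1 T2 x))).
apply: filterS => y [] /eqP; rewrite indicE pnatr_eq0 eqb0 notin_setE /setC /=.
by move=> /contrapT.
Qed.

End ae_product.

(** * The kernel of Morrey's estimate *)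

Section morrey_kernel.
Context (R : realType) (n : nat).
Local Notation lam := (@lebesgue_borel R n).
Local Notation leb := (@lebesgue_measure R).
Local Notation RM := (measurableTypeR R).
Local Notation I01 := (`[0%R, 1%R]%classic : set RM).
Local Notation J01 := (`]0%R, 1%R]%classic : set RM).
Hypothesis n0 : (0 < n)%N.

(** The substitution y = s z degenerates at s = 0, so that end point is removed beforehand. *)
Lemma integral_I01_J01 (h : RM -> \bar R) : measurable_fun setT h ->
  (forall s, 0 <= h s)%E ->
  (\int[leb]_s ((\1_I01 s)%:E * h s) = \int[leb]_s ((\1_J01 s)%:E * h s))%E.
Proof.
move=> mh h0.
have m1 : measurable_fun setT (fun s : RM => (\1_I01 s)%:E * h s)%E.
  by apply: emeasurable_funM => //; apply/measurable_EFinP; exact: measurable_indic.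
have m2 : measurable_fun setT (fun s : RM => (\1_J01 s)%:E * h s)%E.
  by apply: emeasurable_funM => //; apply/measurable_EFinP; exact: measurable_indic.
apply: ge0_ae_eq_integral => //.
- by move=> s _; rewrite mule_ge0.
- by move=> s _; rewrite mule_ge0.
exists [set 0]; split => //=; first exact: lebesgue_measure_set1.
move=> s /= hs; apply: contrapT => s0; apply: hs => _; congr (_%:E * _)%E.
rewrite !indicE; congr (nat_of_bool _)%:R.
apply/idP/idP; rewrite !inE /= !in_itv /= => /andP[h1 h2]; rewrite h2 andbT; last exact: ltW.
by rewrite lt_neqAle h1 andbT eq_sym; apply/eqP.
Qed.

Lemma indic_eball (r : R) (y : 'rV[R]_n) : \1_(eball 0 r) y = (enorm y < r)%R%:R :> R.
Proof.
by rewrite indicE; congr (nat_of_bool _)%:R; apply/idP/idP; rewrite inE /eball /= subr0.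
Qed.

(** Only s > e / r contributes; letting s run up to infinity instead of 1 enlarges the integral to
    an explicit tail of s^(-n-1). *)
Lemma integral_inner_kernel (r e : R) : 0 < r -> 0 < e ->
  (\int[leb]_s (\1_J01 s * (s `^ (- (n%:R + 1)) * (e < s * r)%R%:R))%:E <=
   ((e < r)%R%:R * ((e / r) `^ (- n%:R) / n%:R))%:E)%E.
Proof.
move=> r0 e0; have er0 : 0 < e / r by rewrite divr_gt0.
case: ltP => er; last first.
  rewrite mul0r integral0_eq// => s _; rewrite indicE.
  have [|] := boolP (s \in J01); last by rewrite mul0r.
  rewrite inE /= in_itv /= => /andP[s0 s1]; rewrite ltNge (le_trans _ er) ?mulr0//.
  by rewrite ler_piMl// ltW.
rewrite mul1r.
have := @integral_powR_tail R (e / r) (n%:R + 1) er0.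
rewrite ltrDr ltr0n n0 => /(_ isT).
rewrite (_ : 1 - (n%:R + 1) = - n%:R); last by ring.
rewrite addrK => <-; rewrite [leRHS]integral_mkcond epatch_indic.
have mp : measurable_fun setT (fun s : RM => s `^ (- (n%:R + 1))) by exact: measurable_powR.
apply: ge0_le_integralT.
- apply/measurable_EFinP; apply: measurable_funM; first exact: measurable_indic.
  apply: measurable_funM => //.
  rewrite (_ : (fun s => _) = \1_[set s : RM | e < s * r]).
    by apply: measurable_indic; apply: measurable_ltr => //; exact: measurable_funM.
  by apply/funext => s; rewrite indicE mem_setE.
- apply: emeasurable_funM; first exact/measurable_EFinP.
  by apply/measurable_EFinP; exact: measurable_indic.
- by move=> s; rewrite lee_fin !mulr_ge0// powR_ge0.
- move=> s; rewrite /= -EFinM lee_fin mulrCA ler_wpM2l ?powR_ge0// !indicE mem_itvoy.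
  rewrite ltr_pdivrMr//; case: ltP => _; rewrite ?mulr0 ?mulr1//.
  by case: (s \in J01).
Qed.

(** For fixed s the substitution y = s z turns |z| g(x + s z) dz on |z| < r into s^(-n-1) |y| g(x +
    y) dy on |y| < s r; integrating in s first leaves the kernel (r^n / n) |y|^(1-n). *)
Lemma integral_kernel_le (g : 'rV[R]_n -> R) (x : 'rV[R]_n) (r : R) :
  measurable_fun setT g -> (forall y, 0 <= g y) -> 0 < r ->
  (\int[lam]_z ((\1_(eball 0 r) z)%:E *
     \int[leb]_s (\1_I01 s * (enorm z * g (x + s *: z)))%:E) <=
   (r ^+ n / n%:R)%:E *
   \int[lam]_y (\1_(eball 0 r) y * enorm y `^ (1 - n%:R) * g (x + y))%:E)%E.
Proof.
move=> mg g0 r0.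
have me : measurable_fun setT (fun z : 'rV[R]_n => enorm z) by exact: measurable_enorm_id.
have mxz : measurable_fun setT (fun w : 'rV[R]_n * RM => g (x + w.2 *: w.1)).
  apply: measurableT_comp mg _; apply: measurable_fun_rVP => i.
  under eq_fun do rewrite !mxE.
  apply: measurable_funD => //; apply: measurable_funM; first exact: measurable_snd.
  exact: measurableT_comp (measurable_coor i) measurable_fst.
have mB : measurable_fun setT (\1_(eball (0 : 'rV[R]_n) r) : _ -> R).
  by apply: measurable_indic; exact: measurable_eball.
have mJ : measurable_fun setT (fun w : 'rV[R]_n * RM => \1_J01 w.2 : R).
  apply: (@measurableT_comp _ _ _ _ _ _ (\1_J01 : RM -> R)); last exact: measurable_snd.
  by apply: measurable_indic; exact: measurable_itv.
pose f1 z (s : RM) : R := \1_J01 s * (\1_(eball 0 r) z * (enorm z * g (x + s *: z))).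
have mf1 : measurable_fun setT (fun w : 'rV[R]_n * RM => (f1 w.1 w.2)%:E).
  apply/measurable_EFinP; apply: measurable_funM => //; apply: measurable_funM.
    exact: measurableT_comp mB measurable_fst.
  by apply: measurable_funM => //; exact: measurableT_comp me measurable_fst.
have f10 z s : (0 <= (f1 z s)%:E)%E by rewrite lee_fin !mulr_ge0 ?enorm_ge0.
pose f2 y (s : RM) : R := (\1_J01 s * (s `^ (- (n%:R + 1)) * (enorm y < s * r)%R%:R)) * (enorm y * g (x + y)).
have mf2 : measurable_fun setT (fun w : 'rV[R]_n * RM => (f2 w.1 w.2)%:E).
  apply/measurable_EFinP; apply: measurable_funM.
    apply: measurable_funM => //; apply: measurable_funM.
      exact: measurableT_comp (measurable_powR _) measurable_snd.
    rewrite (_ : (fun w => _) = \1_[set w : 'rV[R]_n * RM | enorm w.1 < w.2 * r]).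
      apply: measurable_indic; apply: measurable_ltr; first exact: measurableT_comp me measurable_fst.
      by apply: measurable_funM => //; exact: measurable_snd.
    by apply/funext => s; rewrite indicE mem_setE.
  apply: measurable_funM; first exact: measurableT_comp me measurable_fst.
  apply: measurableT_comp mg _; apply: measurable_fun_rVP => i.
  under eq_fun do rewrite !mxE; apply: measurable_funD => //.
  exact: measurableT_comp (measurable_coor i) measurable_fst.
have f20 y s : (0 <= (f2 y s)%:E)%E by rewrite lee_fin !mulr_ge0 ?enorm_ge0 ?powR_ge0.
have E1 : (\int[lam]_z ((\1_(eball 0 r) z)%:E *
     \int[leb]_s (\1_I01 s * (enorm z * g (x + s *: z)))%:E) =
   \int[lam]_z \int[leb]_s (f1 z s)%:E)%E.
  apply: eq_integral => z _.
  have mh : measurable_fun setT (fun s : RM => (enorm z * g (x + s *: z))%:E).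
    apply/measurable_EFinP; apply: measurable_funM => //.
    exact: (measurableT_comp mxz (@measurable_pair1 _ _ 'rV[R]_n RM z)).
  have h0 s : (0 <= (enorm z * g (x + s *: z))%:E)%E by rewrite lee_fin mulr_ge0 ?enorm_ge0.
  under eq_integral do rewrite EFinM.
  rewrite integral_I01_J01// -ge0_integralTZl//.
  - by apply: eq_integral => s _; rewrite -!EFinM /f1 mulrCA.
  - apply: emeasurable_funM => //; apply/measurable_EFinP; exact: measurable_indic.
  - by move=> s; rewrite mule_ge0.
have E2 : (\int[leb]_s \int[lam]_z (f1 z s)%:E = \int[leb]_s \int[lam]_y (f2 y s)%:E)%E.
  apply: eq_integral => s _.
  have [|sJ] := boolP (s \in J01); last first.
    rewrite !integral0_eq// => z _.
      by rewrite /f2 indicE (negbTE sJ) !mul0r.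
    by rewrite /f1 indicE (negbTE sJ) !mul0r.
  move=> sJ; move: (sJ); rewrite inE /= in_itv /= => /andP[s0 s1].
  have mf2s : measurable_fun setT (fun y => (s ^+ n * f2 y s)%:E).
    apply/measurable_EFinP; apply: measurable_funM => //; apply/measurable_EFinP.
    exact: (measurableT_comp mf2 (@measurable_pair2 _ _ 'rV[R]_n RM s)).
  have := @integral_affine R n (fun y => (s ^+ n * f2 y s)%:E) s 0 s0 mf2s.
  have f2s0 y : (0 <= (s ^+ n * f2 y s)%:E)%E.
    by rewrite lee_fin mulr_ge0 ?exprn_ge0 ?(ltW s0)// -lee_fin f20.
  move=> /(_ f2s0); under [X in _ = (_ * X)%E]eq_integral do rewrite EFinM.
  have sn0 : s ^+ n != 0 by rewrite expf_eq0 gt_eqF// andbF.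
  rewrite [X in _ = (_ * X)%E]ge0_integralTZl ?exprn_ge0 ?(ltW s0)//; last first.
    exact: (measurableT_comp mf2 (@measurable_pair2 _ _ 'rV[R]_n RM s)).
  rewrite muleA -EFinM mulVf// mul1e => <-.
  apply: eq_integral => z _; congr (_%:E).
  rewrite /f1 /f2 indicE sJ !mul1r addr0 enormZ gtr0_norm//.
  rewrite (ltr_pM2l s0) indic_eball.
  rewrite opprD powRD; last by rewrite (gt_eqF s0) implybT.
  rewrite powR_inv1 ?(ltW s0)// powRN powR_mulrn ?(ltW s0)//.
  by field; rewrite sn0 gt_eqF.
rewrite E1 (tonelli lam leb mf1 f10) E2 -(tonelli lam leb mf2 f20) -ge0_integralTZl//; last 3 first.
- apply/measurable_EFinP; apply: measurable_funM.
    by apply: measurable_funM => //; apply: measurableT_comp (measurable_powR _) me.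
  by apply: measurableT_comp mg _; have := measurable_shift x; under eq_fun do rewrite addrC.
- by move=> y; rewrite lee_fin !mulr_ge0 ?powR_ge0.
- by rewrite divr_ge0// exprn_ge0 ?(ltW r0).
apply: ge0_le_integralT.
- exact: (measurable_integral2 leb mf2 f20).
- apply: measurable_funeM; apply/measurable_EFinP; apply: measurable_funM.
    by apply: measurable_funM => //; apply: measurableT_comp (measurable_powR _) me.
  by apply: measurableT_comp mg _; have := measurable_shift x; under eq_fun do rewrite addrC.
- by move=> y; apply: integral_ge0 => s _.
move=> y; have [y0|y0] := eqVneq (enorm y) 0.
  rewrite integral0_eq; first by rewrite -EFinM lee_fin !mulr_ge0 ?powR_ge0 ?invr_ge0 ?exprn_ge0 ?(ltW r0).
  by move=> s _; rewrite /f2 y0 !(mul0r, mulr0).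
have yp : 0 < enorm y by rewrite lt_def y0 enorm_ge0.
under eq_integral do rewrite /f2 EFinM.
rewrite ge0_integralTZr; last 3 first.
- apply/measurable_EFinP; apply: measurable_funM; first exact: measurable_indic.
  apply: measurable_funM; first exact: measurable_powR.
  rewrite (_ : (fun s => _) = \1_[set s : RM | enorm y < s * r]).
    by apply: measurable_indic; apply: measurable_ltr => //; exact: measurable_funM.
  by apply/funext => s; rewrite indicE mem_setE.
- by move=> s; rewrite lee_fin !mulr_ge0// powR_ge0.
- by rewrite mulr_ge0 ?enorm_ge0.
apply: (le_trans (lee_wpmul2r _ (integral_inner_kernel r0 yp))).
  by rewrite lee_fin mulr_ge0 ?enorm_ge0.
rewrite -!EFinM lee_fin indic_eball le_eqVlt; apply/orP; left; apply/eqP.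
rewrite powRM ?invr_ge0 ?(ltW r0) ?enorm_ge0//.
rewrite [1 - n%:R]addrC powRD; last by rewrite y0 implybT.
have -> : r^-1 `^ (- n%:R) = r ^+ n.
  by rewrite powRN powR_mulrn ?invr_ge0 ?(ltW r0)// exprVn invrK.
by rewrite powRr1 ?enorm_ge0//; ring.
Qed.

End morrey_kernel.

Section morrey.
Context (R : realType) (n : nat).
Local Notation lam := (@lebesgue_borel R n).
Local Notation leb := (@lebesgue_measure R).
Local Notation RM := (measurableTypeR R).
Local Notation I01 := (`[0%R, 1%R]%classic : set RM).
Variable p : R.
Hypotheses (n0 : (0 < n)%N) (np : n%:R < p).

Let p1 : 1 < p.
Proof. by rewrite (le_lt_trans _ np)// ler1n. Qed.

Lemma ball_volume_gt0 : 0 < ball_volume R n.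
Proof.
rewrite lt_def ball_volume_ge0 andbT; apply/eqP => b0.
have := @ball_volume_Gamma R n n0; rewrite b0 mul0e => /eqP.
by rewrite eq_sym eqe expf_eq0 sqrtr_eq0 leNgt pi_gt0 andbF.
Qed.

(** The power of 1/|y| in the p'-th power of the kernel |y|^(1-n), with p' = p / (p - 1). It is
    below n exactly because p > n. *)
Definition morrey_exponent : R := (n%:R - 1) * (p / (p - 1)).

Definition morrey_constant (r : R) : R :=
  r ^+ n / n%:R * (ball_volume R n * (n%:R / (n%:R - morrey_exponent)) *
    r `^ (n%:R - morrey_exponent)) `^ ((p - 1) / p).

Lemma morrey_exponentB : n%:R - morrey_exponent = (p - n%:R) / (p - 1).
Proof. by rewrite /morrey_exponent; field; have := p1; lra. Qed.

Lemma morrey_exponent_bounds : 0 <= morrey_exponent < n%:R.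
Proof.
rewrite -(subr_gt0 _ n%:R) morrey_exponentB divr_gt0 ?subr_gt0// andbT.
by rewrite mulr_ge0 ?subr_ge0 ?ler1n// divr_ge0// ?subr_ge0 ltW// (lt_trans _ p1).
Qed.

Lemma morrey_constant_ge0 r : 0 <= r -> 0 <= morrey_constant r.
Proof. by move=> r0; rewrite mulr_ge0 ?powR_ge0// mulr_ge0 ?exprn_ge0 ?invr_ge0. Qed.

Lemma integral_morrey_kernel (g : 'rV[R]_n -> R) (a : R) (x : 'rV[R]_n) (r : R) :
  measurable_fun setT g -> (forall y, 0 <= g y) -> 0 <= a ->
  (\int[lam]_y (g y `^ p)%:E <= a%:E)%E -> 0 < r ->
  (\int[lam]_z ((\1_(eball 0 r) z)%:E *
     \int[leb]_s (\1_I01 s * (enorm z * g (x + s *: z)))%:E) <=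
   (morrey_constant r * a `^ p^-1)%:E)%E.
Proof.
move=> mg g0 a0 ga r0; have p0 : 0 < p by have := p1; lra.
apply: (le_trans (integral_kernel_le n0 x mg g0 r0)).
rewrite /morrey_constant -(mulrA (r ^+ n / n%:R)) [leRHS]EFinM.
apply: lee_wpmul2l; first by rewrite lee_fin divr_ge0 ?exprn_ge0 ?(ltW r0).
have me : measurable_fun setT (fun z : 'rV[R]_n => enorm z) by exact: measurable_enorm_id.
have mB : measurable_fun setT (\1_(eball (0 : 'rV[R]_n) r) : _ -> R).
  by apply: measurable_indic; exact: measurable_eball.
have -> : (p - 1) / p = (p / (p - 1))^-1 by rewrite invf_div.
have mgx : measurable_fun setT (fun y => g (x + y)).
  by apply: measurableT_comp mg _; have := measurable_shift x; under eq_fun do rewrite addrC.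
apply: (@integral_hoelder _ _ _ lam (fun y => \1_(eball 0 r) y * enorm y `^ (1 - n%:R)) (fun y => g (x + y))).
- by apply: measurable_funM => //; exact: measurableT_comp (measurable_powR _) me.
- exact: mgx.
- by move=> y; rewrite mulr_ge0 ?powR_ge0.
- by [].
- by rewrite divr_gt0 ?subr_gt0.
- exact: p0.
- by field; rewrite !gt_eqF ?subr_gt0.
- by rewrite !mulr_ge0 ?powR_ge0 ?ball_volume_ge0 ?invr_ge0// subr_ge0 ltW//; case/andP: morrey_exponent_bounds.
- exact: a0.
- apply: le_trans (le_integral_enorm_powR morrey_exponent_bounds r0).
  rewrite le_eqVlt; apply/orP; left; apply/eqP; apply: eq_integral => y _; congr (_%:E).
  rewrite powRM ?powR_ge0// -powRrM indicE; congr (_ * _ `^ _).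
    case: (_ \in _); first by rewrite powR1.
    by rewrite powR0// mulf_neq0 ?invr_neq0 ?gt_eqF ?subr_gt0.
  by rewrite /morrey_exponent -mulNr opprB.
- have mgp : measurable_fun setT (fun y => (g y `^ p)%:E).
    by apply/measurable_EFinP; exact: measurableT_comp (measurable_powR _) mg.
  have := integral_shift x mgp (fun y => powR_ge0 _ _).
  by under eq_integral do rewrite addrC; move=> ->.
Qed.

Section morrey_inequality.
Variables (u : 'rV[R]_n -> R) (G : 'rV[R]_n -> 'rV[R]_n) (a : R).
Hypotheses (mu : measurable_fun setT u) (lu : locally_integrable u)
  (mG : forall i, measurable_fun setT (fun x => G x ord0 i))
  (lG : forall i, locally_integrable (fun x => G x ord0 i))
  (uG : bump_gradient u G)
  (a0 : 0 <= a) (Ga : (\int[lam]_y (enorm (G y) `^ p)%:E <= a%:E)%E).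

(** One null set serves all radii: [ae_section] gives, at almost every x, the segment bound for
    almost every shift, and the kernel estimate is then applied at x for each r. *)
Lemma morrey : {ae lam, forall x, forall r, 0 < r ->
  (\int[lam]_z (\1_(eball 0 r) z * `|u (x + z) - u x|)%:E <=
   (morrey_constant r * a `^ p^-1)%:E)%E}.
Proof.
have mg : measurable_fun setT (fun x => enorm (G x)) by exact: measurable_enorm.
pose f x z := (\int[leb]_s (\1_I01 s * (enorm z * enorm (G (x + s *: z))))%:E)%E.
have mD : measurable_fun setT (fun w : 'rV[R]_n * 'rV[R]_n => `|u (w.1 + w.2) - u w.1|).
  apply: measurableT_comp => //; apply: measurable_funB; last exact: measurableT_comp mu measurable_fst.
  apply: measurableT_comp mu _; apply: measurable_fun_rVP => i; under eq_fun do rewrite !mxE.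
  by apply: measurable_funD; exact: measurableT_comp (measurable_coor i) _.
have mf : measurable_fun setT (fun w : 'rV[R]_n * 'rV[R]_n => f w.1 w.2).
  apply: (measurable_integral2 leb (f := fun (w : 'rV[R]_n * 'rV[R]_n) (s : RM) =>
    (\1_I01 s * (enorm w.2 * enorm (G (w.1 + s *: w.2))))%:E)).
    apply/measurable_EFinP; apply: measurable_funM.
      apply: (@measurableT_comp _ _ _ _ _ _ (\1_I01 : RM -> R)); last exact: measurable_snd.
      by apply: measurable_indic; exact: measurable_itv.
    apply: measurable_funM.
      apply: (measurable_enorm (f := fun w : ('rV[R]_n * 'rV[R]_n) * RM => w.1.2)) => i.
      exact: measurableT_comp (measurable_coor i) (measurableT_comp measurable_snd measurable_fst).
    apply: measurableT_comp mg _; apply: measurable_fun_rVP => i; under eq_fun do rewrite !mxE.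
    apply: measurable_funD.
      exact: measurableT_comp (measurable_coor i) (measurableT_comp measurable_fst measurable_fst).
    apply: measurable_funM; first exact: measurable_snd.
    exact: measurableT_comp (measurable_coor i) (measurableT_comp measurable_snd measurable_fst).
  by move=> w s; rewrite lee_fin !mulr_ge0 ?enorm_ge0.
have mP : measurable [set w : 'rV[R]_n * 'rV[R]_n | (`|u (w.1 + w.2) - u w.1|%:E <= f w.1 w.2)%E].
  have := measurable_lee measurableT (measurable_funS measurableT (@subsetT _ _) (measurableT_comp (@EFin_measurable _ _) mD)) mf.
  by rewrite setTI.
have := @ae_section _ _ _ _ _ lam lam _ mP.
move=> /(_ (fun z => @ae_FTC_le R n u G mu lu mG lG uG z)).
apply: filterS => x hx r r0.
apply: le_trans (integral_morrey_kernel x mg (fun y => enorm_ge0 _) a0 Ga r0).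
have mDx : measurable_fun setT (fun z => `|u (x + z) - u x|).
  exact: (measurableT_comp mD (@measurable_pair1 _ _ 'rV[R]_n 'rV[R]_n x)).
have mI : measurable_fun setT (fun z : 'rV[R]_n => (\1_(eball 0 r) z : R)%:E).
  by apply: measurable_indic_EFin; exact: measurable_eball.
apply: ae_ge0_le_integral => //.
- by under eq_fun do rewrite EFinM; apply: emeasurable_funM => //; exact/measurable_EFinP.
- by move=> z _; rewrite mule_ge0 ?lee_fin//; apply: integral_ge0 => s _; rewrite lee_fin !mulr_ge0 ?enorm_ge0.
- apply: emeasurable_funM => //.
  exact: (measurableT_comp mf (@measurable_pair1 _ _ 'rV[R]_n 'rV[R]_n x)).
- by apply: filterS hx => z hz _; rewrite EFinM; apply: lee_wpmul2l => //; rewrite lee_fin.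
Qed.

Variable a' : R.
Hypotheses (a'0 : 0 <= a') (ua : (\int[lam]_y (`|u y| `^ p)%:E <= a'%:E)%E).

Let p0 : 0 < p.
Proof. by have := p1; lra. Qed.

(** |u(x)| <= |u(x + z)| + |u(x + z) - u(x)| is integrated over the shifts z in a ball: Hoelder's
    inequality for the first term, [morrey] for the second. *)
Lemma ae_ball_bound : {ae lam, forall x, forall r, 0 < r ->
  ball_volume R n * r ^+ n * `|u x| <=
    (ball_volume R n * r ^+ n) `^ ((p - 1) / p) * a' `^ p^-1 +
    morrey_constant r * a `^ p^-1}.
Proof.
apply: filterS morrey => x hx r r0; have bv := ball_volume_gt0.
have rn0 : 0 < r ^+ n by rewrite exprn_gt0.
have mI : measurable_fun setT (fun z : 'rV[R]_n => \1_(eball 0 r) z : R).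
  by apply: measurable_indic; exact: measurable_eball.
have mus : measurable_fun setT (fun z => u (x + z)).
  by have := measurable_funshift x mu; under eq_fun do rewrite addrC.
rewrite -lee_fin EFinM -(lam_eball 0 (ltW r0) n0) -integral_indicT; last exact: measurable_eball.
rewrite -ge0_integralTZr//; last exact/measurable_EFinP.
apply: (@le_trans _ _ (\int[lam]_z ((\1_(eball 0 r) z * `|u (x + z)|)%:E +
   (\1_(eball 0 r) z * `|u (x + z) - u x|)%:E))%E).
  apply: ge0_le_integralT.
  - by apply: emeasurable_funM => //; exact/measurable_EFinP.
  - apply: emeasurable_funD; apply/measurable_EFinP; apply: measurable_funM => //;
      apply: measurableT_comp => //; exact: measurable_funB.
  - by move=> z; rewrite -EFinM lee_fin mulr_ge0.
  - move=> z; rewrite -EFinM -EFinD lee_fin -mulrDr ler_wpM2l//.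
    have -> : u x = u (x + z) - (u (x + z) - u x) by ring.
    by rewrite (le_trans (ler_normB _ _))// opprB addrCA subrr addr0.
rewrite ge0_integralTD; last 4 first.
- by apply/measurable_EFinP; apply: measurable_funM => //; exact: measurableT_comp.
- apply/measurable_EFinP; apply: measurable_funM => //.
  by apply: measurableT_comp => //; exact: measurable_funB.
- by move=> z; rewrite lee_fin mulr_ge0.
- by move=> z; rewrite lee_fin mulr_ge0.
rewrite EFinD; apply: leeD; last exact: hx.
have -> : (p - 1) / p = (p / (p - 1))^-1 by rewrite invf_div.
apply: (@integral_hoelder _ _ _ lam (fun z => \1_(eball 0 r) z) (fun z => `|u (x + z)|)).
- exact: mI.
- exact: measurableT_comp.
- by [].
- by [].
- by rewrite divr_gt0 ?subr_gt0.
- exact: p0.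
- by field; rewrite !gt_eqF ?subr_gt0.
- by rewrite mulr_ge0 ?ltW.
- exact: a'0.
- rewrite -(lam_eball 0 (ltW r0) n0) -integral_indicT; last exact: measurable_eball.
  rewrite le_eqVlt; apply/orP; left; apply/eqP; apply: eq_integral => z _; congr (_%:E).
  rewrite indicE; case: (_ \in _); first by rewrite powR1.
  by rewrite powR0// mulf_neq0 ?invr_neq0 ?gt_eqF ?subr_gt0.
- have mup : measurable_fun setT (fun y => (`|u y| `^ p)%:E).
    by apply/measurable_EFinP; apply: measurableT_comp (measurable_powR _) _; exact: measurableT_comp.
  have := integral_shift x mup (fun y => powR_ge0 _ _).
  by under eq_integral do rewrite addrC; move=> ->.
Qed.

End morrey_inequality.

End morrey.

(** Convexity at the midpoint. The factor 2^(p-1), after a p-th root, is the power of 2 in k_a. *)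
Lemma powR_addp (R : realType) (p x y : R) : 1 <= p -> 0 <= x -> 0 <= y ->
  (x + y) `^ p <= 2 `^ (p - 1) * (x `^ p + y `^ p).
Proof.
move=> p1 x0 y0; pose m := (x + y) / 2; have m0 : 0 <= m by rewrite divr_ge0 ?addr_ge0.
have h1 := powR_tangent p1 m0 x0; have h2 := powR_tangent p1 m0 y0.
have h : 2 * m `^ p <= x `^ p + y `^ p.
  apply: le_trans (lerD h1 h2); rewrite addrACA -mulrDr.
  by rewrite (_ : x - m + (y - m) = 0) ?mulr0 ?addr0; [rewrite /m; lra|rewrite /m; field].
have -> : x + y = 2 * m by rewrite /m; field.
have e : 2 `^ p = 2 `^ (p - 1) * 2 :> R.
  by rewrite -[X in _ * X]powRr1// -powRD ?pnatr_eq0 ?implybT//; congr (_ `^ _); ring.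
rewrite powRM// e.
by rewrite -mulrA ler_wpM2l ?powR_ge0.
Qed.

Lemma powRV (R : realType) (x t : R) : 0 <= x -> x^-1 `^ t = (x `^ t)^-1.
Proof. by move=> x0; rewrite -powR_inv1// -powRrM mulN1r powRN. Qed.

Lemma powRM5 (R : realType) (t x y z w v : R) : 0 <= x -> 0 <= y -> 0 <= z -> 0 <= w -> 0 <= v ->
  (x * y * z * w * v) `^ t = x `^ t * y `^ t * z `^ t * w `^ t * v `^ t.
Proof. by move=> x0 y0 z0 w0 v0; rewrite !powRM ?mulr_ge0. Qed.

(** By [ball_volume_Gamma] the volume times Gamma(1 + n/2) is pi^(n/2) as an extended real; the
    Gamma integral cannot be infinite, since the volume is positive and the product finite. *)
Lemma gamma_ratioE (R : realType) n : (0 < n)%N ->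
  gamma_ratio R n = (ball_volume R n)^-1.
Proof.
move=> n0; have bv := @ball_volume_gt0 R n n0.
have := @ball_volume_Gamma R n n0.
rewrite /gamma_ratio /Gamma.
have -> : (fun t : R => t `^ (1 + n%:R / 2 - 1) * expR (- t)) = (fun t => t `^ (n%:R / 2) * expR (- t)).
  by apply/funext => t; congr (_ `^ _ * _); ring.
have -> : (Num.sqrt (pi : R)) ^+ n = pi `^ (n%:R / 2).
  rewrite -powR12_sqrt ?pi_ge0// -powR_mulrn ?powR_ge0// -powRrM.
  by congr (_ `^ _); field.
rewrite /Rintegral; set J := integral _ _ _ => h.
have J0 : (0 <= J)%E by apply: integral_ge0 => t _; rewrite lee_fin mulr_ge0 ?powR_ge0 ?expR_ge0.
have pn0 : pi `^ (n%:R / 2) != 0 :> R by rewrite gt_eqF// powR_gt0// pi_gt0.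
case: J h J0 => [j||]//= h _.
- have {}h : ball_volume R n * j = pi `^ (n%:R / 2) by case: h.
  have j0 : j != 0 by move: pn0; rewrite -h; apply: contra_neq => ->; rewrite mulr0.
  by rewrite -h; field; rewrite j0 gt_eqF.
- by move: h; rewrite mulry gtr0_sg// mul1e.
Qed.

(** * The pointwise bound with the constant k_a *)

Section sup_bound.
Context (R : realType) (n : nat).
Variable p am : R.
Hypotheses (n0 : (0 < n)%N) (np : n%:R < p) (am0 : 0 < am).
Local Notation om := (ball_volume R n).
Local Notation A := ((p - 1) / (p - n%:R)).

Let p1 : 1 < p.
Proof. by rewrite (le_lt_trans _ np)// ler1n. Qed.

Let nR : 0 < n%:R :> R.
Proof. by rewrite ltr0n. Qed.

Let A0 : 0 < A.
Proof. by rewrite divr_gt0 ?subr_gt0. Qed.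

(* The radius at which Morrey's estimate on balls is optimal; it produces the
   constant k_a exactly. *)
Definition best_radius : R := (n%:R / (am * A `^ (p - 1))) `^ p^-1.

Lemma best_radius_gt0 : 0 < best_radius.
Proof. by rewrite powR_gt0// divr_gt0// mulr_gt0// powR_gt0. Qed.

(** With V the volume of the ball, the gradient term of the ball estimate enters with the factor
    V^(-1) n^(-1) A^(p-1) r^p and the function term with V^(-1). The radius with n^(-1) A^(p-1) r^p
    = 1 / am gives them the ratio 1 : am that they have in the energy. *)
Lemma morrey_constant_powR r : 0 < r ->
  (morrey_constant n p r / (om * r ^+ n)) `^ p =
  (om * r ^+ n)^-1 * (n%:R^-1 * A `^ (p - 1) * r `^ p).
Proof.
move=> r0; have om0 := ball_volume_gt0 R n0; have p0 : 0 < p by have := p1; lra.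
have rn0 : 0 < r ^+ n by rewrite exprn_gt0.
rewrite /morrey_constant morrey_exponentB//.
have -> : n%:R / ((p - n%:R) / (p - 1)) = n%:R * A by rewrite invf_div.
rewrite (_ : r ^+ n / n%:R * _ / _ = (n%:R * om)^-1 * (om * (n%:R * A) * r `^ ((p - n%:R) / (p - 1))) `^ ((p - 1) / p)); last first.
  by field; rewrite !gt_eqF// subr_gt0.
have oA0 : 0 < om * (n%:R * A) by apply: mulr_gt0 => //; apply: mulr_gt0.
have no0 : 0 < n%:R * om by exact: mulr_gt0.
rewrite (@powRM _ (n%:R * om)^-1 _ p) ?powR_ge0 ?invr_ge0 ?(ltW no0)//.
rewrite -[X in _ * X]powRrM divfK ?(gt_eqF p0)//.
rewrite (@powRM _ (om * (n%:R * A)) _ (p - 1)) ?powR_ge0 ?(ltW oA0)//.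
rewrite -[X in _ * (_ * X)]powRrM divfK; last by rewrite subr_eq0 gt_eqF.
rewrite (mulrA om) (@powRM _ (om * n%:R) A) ?(ltW A0) ?mulr_ge0 ?(ltW om0) ?(ltW nR)//.
have -> : (n%:R * om)^-1 `^ p = (n%:R * om)^-1 * ((n%:R * om) `^ (p - 1))^-1.
  rewrite -powR_inv1 ?mulr_ge0 ?(ltW om0) ?(ltW nR)// -powRrM mulN1r -powRN -powRD.
    by congr (_ `^ _); ring.
  by rewrite (gt_eqF (mulr_gt0 nR om0)) implybT.
have -> : r `^ (p - n%:R) = r `^ p / r ^+ n.
  by rewrite powRB ?(gt_eqF r0) ?implybT// powR_mulrn// ltW.
rewrite (mulrC om); field; rewrite !gt_eqF ?powR_gt0 ?mulr_gt0//.
Qed.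

Lemma const_k_powR : const_k n p am `^ p =
  2 `^ (p - 1) * (om * best_radius ^+ n)^-1 / am.
Proof.
have om0 := ball_volume_gt0 R n0; have p0 : 0 < p by have := p1; lra.
have e1 : (1 / am) `^ ((p - n%:R) / p ^+ 2) `^ p = am^-1 * am `^ (n%:R / p).
  rewrite div1r -powRrM.
  have -> : (p - n%:R) / p ^+ 2 * p = 1 - n%:R / p by field; rewrite gt_eqF.
  rewrite powRB ?invr_eq0 ?(gt_eqF am0) ?implybT//.
  rewrite powRr1 ?invr_ge0 ?(ltW am0)// powRV ?(ltW am0)//.
  by rewrite invrK.
have e2 : 2 `^ ((p - 1) / p) `^ p = 2 `^ (p - 1) :> R by rewrite -powRrM divfK// gt_eqF.
have e3 : om^-1 `^ (1 / p) `^ p = om^-1.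
  by rewrite -powRrM divfK ?gt_eqF// powRr1// invr_ge0 ltW.
have e4 : (1 / n%:R `^ (n%:R / p ^+ 2)) `^ p = (n%:R `^ (n%:R / p))^-1 :> R.
  rewrite div1r -powRN -powRrM -powRN; congr (_ `^ _); field; by rewrite gt_eqF.
have e5 : A `^ (n%:R * (p - 1) / p ^+ 2) `^ p = (A `^ (p - 1)) `^ (n%:R / p).
  by rewrite -!powRrM; congr (_ `^ _); field; rewrite gt_eqF.
have e6 : best_radius ^+ n = n%:R `^ (n%:R / p) / (am `^ (n%:R / p) * (A `^ (p - 1)) `^ (n%:R / p)).
  rewrite -(@powR_mulrn _ best_radius n (powR_ge0 _ _)) /best_radius -powRrM (mulrC p^-1).
  have aA : 0 < am * A `^ (p - 1) by rewrite mulr_gt0 ?powR_gt0.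
  rewrite -(@powRM _ am _ (n%:R / p) (ltW am0) (powR_ge0 _ _)).
  rewrite -(@powRV _ (am * A `^ (p - 1)) (n%:R / p) (ltW aA)).
  by rewrite -(@powRM _ n%:R _ (n%:R / p) (ltW nR))// invr_ge0 ltW.
have i0 : 0 <= 1 / n%:R `^ (n%:R / p ^+ 2) :> R by rewrite divr_ge0 ?powR_ge0.
rewrite /const_k (gamma_ratioE _ n0) (powRM5 p (powR_ge0 _ _) (powR_ge0 _ _) (powR_ge0 _ _) i0 (powR_ge0 _ _)).
rewrite e1 e2 e3 e4 e5 e6; field.
by rewrite !gt_eqF ?powR_gt0.
Qed.

Lemma const_k_gt0 : 0 < const_k n p am.
Proof.
have om0 := ball_volume_gt0 R n0.
rewrite /const_k gamma_ratioE// !mulr_gt0 ?powR_gt0 ?divr_gt0 ?invr_gt0 ?powR_gt0 ?subr_gt0//.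
Qed.

Variables (u : 'rV[R]_n -> R) (G : 'rV[R]_n -> 'rV[R]_n) (a a' : R).
Local Notation lam := (@lebesgue_borel R n).
Hypotheses (mu : measurable_fun setT u) (lu : locally_integrable u)
  (mG : forall i, measurable_fun setT (fun x => G x ord0 i))
  (lG : forall i, locally_integrable (fun x => G x ord0 i))
  (uG : bump_gradient u G)
  (a0 : 0 <= a) (Ga : (\int[lam]_y (enorm (G y) `^ p)%:E <= a%:E)%E)
  (a'0 : 0 <= a') (ua : (\int[lam]_y (`|u y| `^ p)%:E <= a'%:E)%E).

Lemma ae_sup_bound : {ae lam, forall x, `|u x| `^ p <= const_k n p am `^ p * (a + am * a')}.
Proof.
have om0 := ball_volume_gt0 R n0; have p0 : 0 < p by have := p1; lra.
have r0 := best_radius_gt0.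
apply: filterS (ae_ball_bound n0 np mu lu mG lG uG a0 Ga a'0 ua) => x /(_ _ r0).
set r := best_radius in r0 *; have rn0 : 0 < r ^+ n by rewrite exprn_gt0.
set V := om * r ^+ n; have V0 : 0 < V by rewrite mulr_gt0.
have Hr : r `^ p = n%:R / (am * A `^ (p - 1)).
  rewrite /r /best_radius -powRrM mulVf ?(gt_eqF p0)// powRr1//.
  by rewrite divr_ge0 ?ler0n ?mulr_ge0 ?powR_ge0 ?(ltW am0).
set K := morrey_constant n p r; have K0 : 0 <= K by exact/morrey_constant_ge0/ltW.
move=> h; have {}h : `|u x| <= V `^ (- p^-1) * a' `^ p^-1 + K / V * a `^ p^-1.
  rewrite -(ler_pM2l V0) (le_trans h)// le_eqVlt; apply/orP; left; apply/eqP.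
  have -> : V `^ ((p - 1) / p) = V * V `^ (- p^-1).
    rewrite -{2}(powRr1 (ltW V0)) -powRD ?(gt_eqF V0) ?implybT//.
    by congr (_ `^ _); field; rewrite gt_eqF.
  by field; rewrite gt_eqF.
apply: (le_trans (ge0_ler_powR (ltW p0) _ _ h)); rewrite ?nnegrE//.
  by rewrite addr_ge0// mulr_ge0 ?powR_ge0// divr_ge0// ltW.
apply: (le_trans (powR_addp (ltW p1) _ _)).
- by rewrite mulr_ge0 ?powR_ge0.
- by rewrite mulr_ge0 ?powR_ge0// divr_ge0// ltW.
have := morrey_constant_powR r0; have := const_k_powR; rewrite -/K -/r -/V.
clearbody K V => -> HK; rewrite -!mulrA ler_wpM2l ?powR_ge0//.
rewrite (@powRM _ (V `^ _)) ?powR_ge0// !mulrA (@powRM _ (K / V)) ?powR_ge0//; last first.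
  by rewrite divr_ge0// ltW.
have HV : (V `^ (- p^-1)) `^ p = V^-1.
  by rewrite -powRrM mulNr mulVf ?(gt_eqF p0)// powRN powRr1 ?(ltW V0).
have Hp (t : R) : 0 <= t -> (t `^ p^-1) `^ p = t.
  by move=> t0; rewrite -powRrM mulVf ?(gt_eqF p0)// powRr1.
rewrite HK HV (Hp a' a'0) (Hp a a0) Hr.
rewrite le_eqVlt; apply/orP; left; apply/eqP; field.
by rewrite !gt_eqF ?powR_gt0.
Qed.

End sup_bound.

(** * Compactness and Hoelder continuity *)

(** All limits are taken along one ultrafilter finer than the eventual filter, which makes them
    simultaneous in i; for each m an index at least m, close to the first m limits, is then
    picked. *)
Lemma diagonal_subsequence (R : realType) (al : nat -> nat -> R) (C : nat -> R) :
  (forall k i, `|al k i| <= C i) ->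
  exists s : nat -> nat, (forall m, (m <= s m)%N) /\
    exists l : nat -> R, forall i m, (i < m)%N -> `|al (s m) i - l i| <= m.+1%:R^-1.
Proof.
move=> alC; have [U [UU U_ge]] := ultraFilterLemma (eventually_filter).
have Ul i : exists l, forall e, 0 < e -> U [set k | `|al k i - l| <= e].
  have cK : compact (`[- C i, C i]%classic : set R) by exact: segment_compact.
  have UP : ProperFilter (al ^~ i @ U) by apply: fmap_proper_filter.
  have [|l [_ cl]] := cK _ UP.
    apply: (@filterE _ U) => k; rewrite /= in_itv /= -ler_norml; exact: alC.
  exists l => e e0.
  have [//|h] := in_ultra_setVsetC [set k | `|al k i - l| <= e] UU.
  have := cl (~` [set y | `|y - l| <= e]) [set y | `|y - l| <= e] h.
  have : nbhs l [set y : R | `|y - l| <= e].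
    apply/nbhs_ballP; exists e => //= y; rewrite /ball /= distrC => /ltW; exact.
  by move=> nl /(_ nl)[y []].
have [l Hl] := choice Ul.
have Us m : exists k, (m <= k)%N /\ forall i, (i < m)%N -> `|al k i - l i| <= m.+1%:R^-1.
  have h : U [set k | forall i, (i < m)%N -> `|al k i - l i| <= m.+1%:R^-1].
    elim: {-2}m => [|j IH]; first by apply: filterE => k i.
    apply: filterS (filterI IH (Hl j m.+1%:R^-1 _)) => [k [h1 h2] i|]; last by rewrite invr_gt0.
    by rewrite ltnS leq_eqVlt => /predU1P[->//|]; exact: h1.
  have hm : U [set k | (m <= k)%N] by apply: U_ge; exists m.
  by have [k [mk hk]] := filter_ex (filterI hm h); exists k.
have [s Hs] := choice Us.
exists s; split => [m|]; first by case: (Hs m).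
by exists l => i m im; case: (Hs m) => _; exact.
Qed.

Lemma cauchy_seq_cvg (R : realType) (w : nat -> R) :
  (forall e, 0 < e -> exists m0, forall m m', (m0 <= m)%N -> (m0 <= m')%N -> `|w m - w m'| <= e) ->
  cvgn w.
Proof.
move=> h; apply/cauchy_cvgP/cauchy_ballP => e e0.
have [m0 hm] := h _ (divr_gt0 e0 (ltr0n R 2)).
exists (w @` [set m | (m0 <= m)%N], w @` [set m | (m0 <= m)%N]).
  by split; exists m0 => // m /= mm; exists m.
move=> [y z] [[m /= mm <-] [m' /= mm' <-]]; rewrite /ball /=.
by rewrite (le_lt_trans (hm _ _ mm mm'))// ltr_pdivrMr// ltr_pMr// ltr1n.
Qed.

(** * Points at which Morrey's estimate holds *)

Section good_points.
Context (R : realType) (n : nat).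
Local Notation lam := (@lebesgue_borel R n).
Local Notation om := (ball_volume R n).
Local Notation intb f := (lam.-integrable setT (EFin \o f)).
Implicit Types (u : 'rV[R]_n -> R) (x c : 'rV[R]_n) (K : R -> R).
Hypothesis n0 : (0 < n)%N.

Lemma ae_shift (P : 'rV[R]_n -> Prop) h : {ae lam, forall x, P x} ->
  {ae lam, forall x, P (x + h)}.
Proof.
move=> [N [mN N0 PN]]; exists [set x | N (x + h)]; split.
- by have := measurable_shift h measurableT mN; rewrite setTI.
- rewrite -integral_indicT; last by have := measurable_shift h measurableT mN; rewrite setTI.
  rewrite -N0 -(integral_indicT _ mN) -(integral_shift h (measurable_indic_EFin mN))//.
- by move=> x /= hx; exact: PN.
Qed.

(** The estimate is required at all radii at once; at such a point the value of u can be compared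
    with averages over nearby balls. *)
Definition good K u x := forall r, 0 < r ->
  (\int[lam]_z (\1_(eball 0 r) z * `|u (x + z) - u x|)%:E <= (K r)%:E)%E.

Lemma good_ball K u x c rho : measurable_fun setT u -> good K u x -> 0 < rho ->
  enorm (c - x) <= rho ->
  (\int[lam]_y (\1_(eball c rho) y * `|u y - u x|)%:E <= (K (2 * rho))%:E)%E.
Proof.
move=> mu gx r0 cx; apply: le_trans (gx _ (mulr_gt0 (ltr0n _ 2) r0)).
have md : measurable_fun setT (fun y => `|u y - u x|).
  by apply: measurableT_comp => //; exact: measurable_funB.
have mI : measurable_fun setT (fun y => (\1_(eball c rho) y * `|u y - u x|)%:E).
  apply/measurable_EFinP; apply: measurable_funM => //; apply: measurable_indic.
  exact: measurable_eball.
rewrite -(integral_shift x mI) => [|y]; last by rewrite lee_fin mulr_ge0.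
apply: ge0_le_integralT.
- exact: measurable_funshift mI.
- apply/measurable_EFinP; apply: measurable_funM.
    by apply: measurable_indic; exact: measurable_eball.
  by under eq_fun do rewrite (addrC x); exact: measurable_funshift md.
- by move=> y; rewrite lee_fin mulr_ge0.
- move=> y; rewrite lee_fin addrC ler_wpM2r// !indicE.
  case: (boolP (x + y \in eball c rho)) => // h; rewrite mem_set//.
  move: h; rewrite inE /eball /= subr0 => h.
  have -> : y = (x + y - c) + (c - x) by rewrite addrA subrK addrAC subrr add0r.
  by rewrite (le_lt_trans (enormD _ _))// mulr2n mulrDl !mul1r ltr_leD.
Qed.

(** The ball around c lies in the ball of radius 2 rho around x. So the value at a good point is
    close to an average over a ball with a nearby center, and countably many averages, over rational
    balls, control all these values. *)
Lemma good_average K u x c rho : measurable_fun setT u -> good K u x -> 0 < rho ->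
  enorm (c - x) <= rho -> intb (fun y => \1_(eball c rho) y * u y) ->
  `|om * rho ^+ n * u x - \int[lam]_y (\1_(eball c rho) y * u y)| <= K (2 * rho).
Proof.
move=> mu gx r0 cx iu; have := good_ball mu gx r0 cx.
have moo : (lam (eball c rho) < +oo)%E by rewrite (lam_eball c (ltW r0) n0) ltry.
have mB := @measurable_eball R n c rho.
have [iI EI] := rint_cst_indic (u x) mB moo.
have {}EI : \int[lam]_y (u x * \1_(eball c rho) y) = om * rho ^+ n * u x.
  apply: (etrans (etrans EI (congr1 (fun z => u x * fine z) (lam_eball c (ltW r0) n0)))).
  exact: mulrC.
rewrite -lee_fin -EI -rintB// => h; apply: (le_trans _ h).
have E : (fun y => \1_(eball c rho) y * `|u y - u x|) =
    (fun y => `|u x * \1_(eball c rho) y - \1_(eball c rho) y * u y|).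
  apply/funext => y; rewrite (mulrC (u x)) -mulrBr normrM (distrC (u x)).
  by rewrite (ger0_norm (_ : 0 <= \1_(eball c rho) y)).
under [leRHS]eq_integral do rewrite (congr1 (fun f => f _) E).
rewrite -rint_EFin; last by apply: intb_norm; exact: intbB.
by rewrite lee_fin le_norm_rint//; exact: intbB.
Qed.

(** Both values are compared with one average, over the ball centered at x' whose radius is the
    distance of the two points. *)
Lemma good_hoelder K u x x' : measurable_fun setT u -> good K u x -> good K u x' ->
  0 < enorm (x' - x) -> (forall c rho, intb (fun y => \1_(eball c rho) y * u y)) ->
  om * enorm (x' - x) ^+ n * `|u x' - u x| <= 2 * K (2 * enorm (x' - x)).
Proof.
move=> mu gx gx' h iu; have := good_average mu gx h (lexx _) (iu _ _).
have x'0 : enorm (x' - x') <= enorm (x' - x) by rewrite subrr enorm0 ltW.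
have := good_average mu gx' h x'0 (iu _ _).
set V := om * _; set J := Rintegral _ _ _ => h1 h2.
have V0 : 0 <= V by rewrite mulr_ge0 ?ball_volume_ge0 ?exprn_ge0 ?enorm_ge0.
rewrite -{1}(ger0_norm V0) -normrM.
have -> : V * (u x' - u x) = (V * u x' - J) - (V * u x - J) by ring.
by rewrite (le_trans (ler_normB _ _))// mulr2n mulrDl !mul1r lerD.
Qed.

Lemma rational_dense x rho : 0 < rho -> exists q : 'rV[rat]_n, enorm (map_mx ratr q - x) < rho.
Proof.
move=> r0; pose e := rho / n%:R; have e0 : 0 < e by rewrite divr_gt0// ltr0n.
have h i : exists q : rat, `|ratr q - x ord0 i| < e.
  have [|q] := @rat_in_itvoo R (x ord0 i - e) (x ord0 i + e); first lra.
  rewrite in_itv /= => /andP[h1 h2]; exists q; rewrite ltr_norml; apply/andP; split; lra.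
have [q Hq] := choice h; exists (\row_i q i).
rewrite (le_lt_trans (enorm_le_sum _))//.
have -> : rho = \sum_(i < n) e by rewrite sumr_const card_ord -mulr_natr divfK// pnatr_eq0 gtn_eqF.
apply: ltr_sum; last by move=> i _; rewrite !mxE.
by apply/hasP; exists (Ordinal n0); rewrite ?mem_index_enum.
Qed.

End good_points.

Section sobolev_points.
Context (R : realType) (n : nat).
Local Notation lam := (@lebesgue_borel R n).
Local Notation om := (ball_volume R n).
Local Notation intb f := (lam.-integrable setT (EFin \o f)).
Variable p : R.
Hypotheses (n0 : (0 < n)%N) (np : n%:R < p).

Let p1 : 1 < p.
Proof. by rewrite (le_lt_trans _ np)// ler1n. Qed.

Lemma le_1DpowR (x : R) : 0 <= x -> x <= 1 + x `^ p.
Proof.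
move=> x0; have [x1|x1] := leP x 1; first by rewrite (le_trans x1)// lerDl powR_ge0.
rewrite (@le_trans _ _ (x `^ p))// ?lerDr// -{1}(powRr1 x0).
by apply: ler_powR; [exact: ltW|exact: ltW].
Qed.

Lemma integrable_indic_powR (A : set 'rV[R]_n) (u : 'rV[R]_n -> R) :
  measurable A -> (lam A < +oo)%E -> measurable_fun setT u ->
  intb (fun x => `|u x| `^ p) -> intb (fun x => \1_A x * u x).
Proof.
move=> mA Aoo mu iu.
have [iA _] := rint_cst_indic 1 mA Aoo.
apply: (intb_le _ (intbD iA iu)); first by apply: measurable_funM => //; exact: measurable_indic.
move=> x; rewrite mul1r indicE; case: (_ \in _) => /=; rewrite ?mul1r ?mul0r.
  exact: le_1DpowR.
by rewrite normr0 addr_ge0// powR_ge0.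
Qed.

Lemma lebesgue_box_lty (a b : 'rV[R]_n) : (lam (box a b) < +oo)%E.
Proof.
have [M hM] := box_subset_cube a b.
have sub : (cube M : set 'rV[R]_n) `<=` eball 0 (n%:R * `|M| + 1).
  move=> x /cubeP h; rewrite /eball /= subr0 (le_lt_trans (enorm_le_sum _))//.
  rewrite (@le_lt_trans _ _ (\sum_(i < n) `|M|))//.
    by apply: ler_sum => i _; rewrite (le_trans (ltW (h i)))// ler_norm.
  by rewrite sumr_const card_ord -[X in X < _]mulr_natl ltrDl.
apply: (@le_lt_trans _ _ (lam (eball 0 (n%:R * `|M| + 1)))).
  apply: le_measure; rewrite ?inE; [exact: measurable_box|exact: measurable_eball|].
  exact: subset_trans hM sub.
by rewrite lam_eball ?ltry// addr_ge0// mulr_ge0.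
Qed.

Lemma locally_integrable_powR (u : 'rV[R]_n -> R) : measurable_fun setT u ->
  intb (fun x => `|u x| `^ p) -> locally_integrable u.
Proof.
by move=> mu iu a b; apply: integrable_indic_powR => //; [exact: measurable_box|exact: lebesgue_box_lty].
Qed.

Definition hoelder_exponent : R := (p - n%:R) / p.

Lemma hoelder_exponent_gt0 : 0 < hoelder_exponent.
Proof. by rewrite divr_gt0 ?subr_gt0// (lt_trans _ p1). Qed.

Lemma morrey_constantE : exists2 C, 0 <= C & forall r, 0 <= r ->
  morrey_constant n p r = C * r ^+ n * r `^ hoelder_exponent.
Proof.
exists (n%:R^-1 * (om * (n%:R / (n%:R - morrey_exponent n p))) `^ ((p - 1) / p)).
  by rewrite mulr_ge0 ?powR_ge0 ?invr_ge0.
move=> r r0; rewrite /morrey_constant powRM ?powR_ge0//; last first.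
  rewrite mulr_ge0 ?ball_volume_ge0 ?divr_ge0// subr_ge0 ltW//.
  by case/andP: (morrey_exponent_bounds n0 np).
rewrite -powRrM morrey_exponentB//.
have -> : (p - n%:R) / (p - 1) * ((p - 1) / p) = hoelder_exponent.
  by rewrite /hoelder_exponent; field; have := p1 => p1'; rewrite !gt_eqF ?subr_gt0// (lt_trans _ p1').
ring.
Qed.

Section compactness.
Variables (u : nat -> 'rV[R]_n -> R) (G : nat -> 'rV[R]_n -> 'rV[R]_n) (a a' : R).
Hypotheses (mu : forall k, measurable_fun setT (u k))
  (mG : forall k i, measurable_fun setT (fun x => G k x ord0 i))
  (iu : forall k, intb (fun x => `|u k x| `^ p))
  (lG : forall k i, locally_integrable (fun x => G k x ord0 i))
  (uG : forall k, bump_gradient (u k) (G k))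
  (a0 : 0 <= a) (Ga : forall k, (\int[lam]_y (enorm (G k y) `^ p)%:E <= a%:E)%E)
  (ua : forall k, \int[lam]_y (`|u k y| `^ p) <= a').

Let lu k : locally_integrable (u k).
Proof. exact: locally_integrable_powR. Qed.

Let iB k c r : intb (fun y => \1_(eball c r) y * u k y).
Proof.
apply: integrable_indic_powR => //; first exact: measurable_eball.
have [r0|r0] := leP 0 r; first by rewrite lam_eball ?ltry.
rewrite (_ : eball c r = set0) ?measure0 ?ltry//.
apply/seteqP; split=> // x; rewrite /eball /= => h.
by have := enorm_ge0 (x - c); rewrite leNgt (lt_trans h r0).
Qed.

Let av k (c : 'rV[R]_n) r := \int[lam]_y (\1_(eball c r) y * u k y).

Let av_bound k c r : 0 <= r <= 1 -> `|av k c r| <= om + a'.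
Proof.
move=> /andP[r0 r1]; have moo : (lam (eball c r) < +oo)%E by rewrite lam_eball ?ltry.
have mB := @measurable_eball R n c r.
have [iI EI] := rint_cst_indic 1 mB moo.
have {}EI : \int[lam]_y (1 * \1_(eball c r) y) = om * r ^+ n.
  apply: (etrans (etrans EI (congr1 (fun z => 1 * fine z) (lam_eball c r0 n0)))).
  exact: mul1r.
apply: (le_trans (le_norm_rint (iB _ _ _))).
apply: (@le_trans _ _ (\int[lam]_y (1 * \1_(eball c r) y + `|u k y| `^ p))).
  apply: le_rint; [by apply: intb_norm; exact: iB|exact: intbD|].
  move=> y; rewrite mul1r indicE; case: (_ \in _) => /=; rewrite ?mul1r ?mul0r.
    exact: le_1DpowR.
  by rewrite normr0 add0r powR_ge0.
rewrite rintD// EI lerD// ler_piMr ?ball_volume_ge0// exprn_ile1//.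
Qed.

(** Averages over balls with rational centers and radii 1/(j+1) form countably many bounded
    sequences, so a diagonal extraction makes all of them converge. At a good point the values
    differ from nearby averages by an error that is uniform in k and vanishes with the radius. *)
Lemma ae_convergent_subsequence : exists s : nat -> nat, (forall m, (m <= s m)%N) /\
  {ae lam, forall x, cvgn (fun m => u (s m) x)}.
Proof.
pose al k i := if @unpickle ('rV[rat]_n * nat)%type i is Some (q, j)
  then av k (map_mx ratr q) j.+1%:R^-1 else 0.
have al_le k i : `|al k i| <= om + a'.
  rewrite /al; case: unpickle => [[q j]|].
    by apply: av_bound; rewrite invr_ge0 ler0n invf_le1 ?ler1n.
  rewrite normr0 addr_ge0 ?ball_volume_ge0//.
  by apply: le_trans (ua 0); apply: rint_ge0 => y; exact: powR_ge0.
have [s [ms [l Hl]]] := diagonal_subsequence al_le.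
exists s; split => //.
pose K r := morrey_constant n p r * a `^ p^-1.
have gx : {ae lam, forall x, forall k, good K (u k) x}.
  by apply: ae_countable => k; exact: morrey.
apply: filterS gx => x gx; apply: cauchy_seq_cvg => e e0.
have [C C0 HC] := morrey_constantE; have om0 := ball_volume_gt0 R n0.
have al0 := hoelder_exponent_gt0.
pose D := C * 2 ^+ n * a `^ p^-1 / om.
have D0 : 0 <= D by rewrite divr_ge0 ?(ltW om0)// !mulr_ge0 ?powR_ge0 ?exprn_ge0.
(* Each of the two comparisons of a value with an average costs e / 3, and the two averages together
   another e / 3. *)
pose e' := e / 3; have e'0 : 0 < e' by rewrite divr_gt0.
have [j Hj] : exists j : nat, D * (2 * j.+1%:R^-1) `^ hoelder_exponent <= e'.
  pose t := (e' / (D + 1)) `^ hoelder_exponent^-1.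
  have t0 : 0 < t by rewrite powR_gt0// divr_gt0// ltr_wpDl.
  exists (Num.bound (2 / t)); set J := Num.bound _.
  have hJ : 2 * J.+1%:R^-1 <= t.
    rewrite ler_pdivrMr ?ltr0n// mulrC -ler_pdivrMr//.
    have := archi_boundP (divr_ge0 (ler0n R 2) (ltW t0)) => /ltW /le_trans; apply.
    by rewrite ler_nat.
  have h : (2 * J.+1%:R^-1) `^ hoelder_exponent <= e' / (D + 1).
    apply: (@le_trans _ _ (t `^ hoelder_exponent)).
      by apply: (ge0_ler_powR (ltW al0)) => //; rewrite nnegrE; [rewrite mulr_ge0 ?invr_ge0|exact: ltW].
    by rewrite /t -powRrM mulVf ?gt_eqF// powRr1// divr_ge0 ?(ltW e'0) ?addr_ge0.
  apply: (le_trans (ler_wpM2l D0 h)); rewrite mulrCA ler_piMr ?(ltW e'0)//.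
  by rewrite ler_pdivrMr ?ltr_wpDl// mul1r lerDl.
set rho : R := j.+1%:R^-1 in Hj; have r0 : 0 < rho by rewrite invr_gt0.
have [q Hq] := rational_dense n0 x r0.
pose i := pickle (q, j); pose V := om * rho ^+ n.
have V0 : 0 < V by rewrite mulr_gt0// exprn_gt0.
have alE k : al k i = av k (map_mx ratr q) rho by rewrite /al /i pickleK.
have avx k : `|V * u k x - al k i| <= V * e'.
  rewrite alE; apply: (le_trans (good_average n0 (mu k) (gx k) r0 (ltW Hq) (iB _ _ _))).
  rewrite /K HC ?mulr_ge0 ?(ltW r0)//; apply: le_trans (ler_wpM2l (ltW V0) Hj).
  rewrite le_eqVlt; apply/orP; left; apply/eqP; rewrite /V /D exprMn; field.
  by rewrite gt_eqF.
pose m0 := maxn i.+1 (Num.bound (2 / (V * e'))).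
exists m0 => m m' mm mm'.
have H k : (m0 <= k)%N -> `|al (s k) i - l i| <= V * e' / 2.
  rewrite geq_max => /andP[ik bk]; apply: (le_trans (Hl _ _ ik)).
  have Ve : 0 < V * e' by rewrite mulr_gt0.
  rewrite -[leRHS]invrK lef_pV2 ?posrE ?invr_gt0 ?divr_gt0// invf_div.
  have := archi_boundP (divr_ge0 (ler0n R 2) (ltW Ve)) => /ltW /le_trans; apply.
  by rewrite ler_nat (leq_trans bk).
rewrite -(ler_pM2l V0) -{1}(gtr0_norm V0) -normrM.
have -> : V * (u (s m) x - u (s m') x) = (V * u (s m) x - al (s m) i) -
   (V * u (s m') x - al (s m') i) + (al (s m) i - l i) - (al (s m') i - l i) by ring.
rewrite (le_trans (ler_normB _ _))//.
have h1 := avx (s m); have h2 := avx (s m'); have h3 := H _ mm; have h4 := H _ mm'.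
have h5 := ler_normD ((V * u (s m) x - al (s m) i) - (V * u (s m') x - al (s m') i)) (al (s m) i - l i).
have h6 := ler_normB (V * u (s m) x - al (s m) i) (V * u (s m') x - al (s m') i).
have -> : V * e = V * e' * 3 by rewrite /e'; field.
lra.
Qed.

End compactness.

Section hoelder_continuity.
Variables (u : 'rV[R]_n -> R) (G : 'rV[R]_n -> 'rV[R]_n).
Hypotheses (mu : measurable_fun setT u)
  (mG : forall i, measurable_fun setT (fun x => G x ord0 i))
  (iu : intb (fun x => `|u x| `^ p)) (iG : intb (fun x => enorm (G x) `^ p))
  (lG : forall i, locally_integrable (fun x => G x ord0 i))
  (uG : bump_gradient u G).

(** For almost every x both x and x + h are good, and [good_hoelder] compares them. The exceptional
    set depends on h, the constant does not. *)
Lemma ae_hoelder : exists2 C, 0 <= C & forall h, h != 0 ->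
  {ae lam, forall x, `|u (x + h) - u x| <= C * enorm h `^ hoelder_exponent}.
Proof.
have om0 := ball_volume_gt0 R n0.
pose a := \int[lam]_x (enorm (G x) `^ p).
have a0 : 0 <= a by apply: rint_ge0 => x; exact: powR_ge0.
have Ga : (\int[lam]_x (enorm (G x) `^ p)%:E <= a%:E)%E by rewrite rint_EFin.
have lu := locally_integrable_powR mu iu.
have gx := morrey n0 np mu lu mG lG uG a0 Ga.
have [C C0 HC] := morrey_constantE.
exists (2 * (C * 2 ^+ n * 2 `^ hoelder_exponent * a `^ p^-1) / om).
  by rewrite divr_ge0 ?(ltW om0)// !mulr_ge0 ?powR_ge0 ?exprn_ge0.
move=> h hn0; have e0 : 0 < enorm h by rewrite lt_def enorm_eq0 hn0 enorm_ge0.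
apply: filterS (filterI gx (ae_shift h gx)) => x [g1 g2].
have xh : enorm (x + h - x) = enorm h by rewrite addrC addKr.
have := @good_hoelder _ _ n0 (fun r => morrey_constant n p r * a `^ p^-1) u x (x + h) mu g1 g2.
rewrite xh => /(_ e0) H.
have {}H := H (fun c r => integrable_indic_powR (measurable_eball c r) _ mu iu).
have en0 : 0 < om * enorm h ^+ n by rewrite mulr_gt0// exprn_gt0.
rewrite -(ler_pM2l en0); apply: (le_trans (H _)).
  move=> c r; have [r0|r0] := leP 0 r; first by rewrite lam_eball ?ltry.
  rewrite (_ : eball c r = set0) ?measure0 ?ltry//.
  apply/seteqP; split=> // y; rewrite /eball /= => hy.
  by have := enorm_ge0 (y - c); rewrite leNgt (lt_trans hy r0).
rewrite HC ?mulr_ge0 ?enorm_ge0// powRM ?enorm_ge0// exprMn.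
by rewrite le_eqVlt; apply/orP; left; apply/eqP; field; rewrite gt_eqF.
Qed.

End hoelder_continuity.

End sobolev_points.

(** * Sobolev functions with Borel representatives *)

Lemma ae_mono d (T : measurableType d) (R : realType) (mu : {measure set T -> \bar R})
    (P Q : T -> Prop) : (forall x, P x -> Q x) -> {ae mu, forall x, P x} -> {ae mu, forall x, Q x}.
Proof. by move=> PQ; exact: filterS. Qed.

Lemma ae_and d (T : measurableType d) (R : realType) (mu : {measure set T -> \bar R})
    (P Q : T -> Prop) : {ae mu, forall x, P x} -> {ae mu, forall x, Q x} ->
  {ae mu, forall x, P x /\ Q x}.
Proof. by move=> aP aQ; exact: (filterI aP aQ). Qed.

Lemma ae_eq_integral_powR d (T : measurableType d) (R : realType)
    (mu : {measure set T -> \bar R}) (p : R) (f g : T -> R) :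
  measurable_fun setT f -> measurable_fun setT g -> {ae mu, forall x, f x = g x} ->
  (\int[mu]_x (`|f x| `^ p)%:E = \int[mu]_x (`|g x| `^ p)%:E)%E.
Proof.
move=> mf mg fg; have mp (h : T -> R) : measurable_fun setT h ->
    measurable_fun setT (fun x => (`|h x| `^ p)%:E).
  move=> mh; apply/measurable_EFinP; apply: measurableT_comp (measurable_powR _) _.
  exact: measurableT_comp.
apply: ge0_ae_eq_integral => //; [exact: mp|exact: mp|..].
by apply: filterS fg => x -> _.
Qed.

Section borel_sobolev.
Context (R : realType) (n : nat).
Local Notation lam := (@lebesgue_borel R n).
Local Notation mu := (lebesgue_rV R n).
Local Notation LT := (lebesgue_type R n).
Local Notation intb f := (lam.-integrable setT (EFin \o f)).
Implicit Types (u v : 'rV[R]_n -> R) (G H : 'rV[R]_n -> 'rV[R]_n) (p : R).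

Definition borel_weak_gradient u G := forall phi, test_function phi -> forall i,
  \int[lam]_x (u x * 'D_(basis_rV R i) phi x) = - \int[lam]_x (G x ord0 i * phi x).

(** The counterpart of [sobolev] for Borel functions and the Borel measure, where iterated integrals
    are available; [borel_sobolevP] and [sobolev_representative] pass between the two. *)
Definition borel_sobolev p u G : Prop :=
  [/\ measurable_fun setT u, forall i, measurable_fun setT (fun x => G x ord0 i),
      intb (fun x => `|u x| `^ p), intb (fun x => enorm (G x) `^ p)
    & borel_weak_gradient u G].

Lemma borel_weak_gradient_bump u G : borel_weak_gradient u G -> bump_gradient u G.
Proof. by move=> h m a b i; exact: h (test_bump m a b) i. Qed.

Lemma powRD_le p (x y : R) : 0 <= p -> 0 <= x -> 0 <= y ->
  (x + y) `^ p <= 2 `^ p * (x `^ p + y `^ p).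
Proof.
move=> p0; wlog xy : x y / x <= y => [hw x0 y0|x0 y0].
  by have [/hw|/ltW/hw] := leP x y; [exact|rewrite addrC [X in _ * X]addrC; exact].
apply: (@le_trans _ _ ((2 * y) `^ p)).
  by apply: (ge0_ler_powR p0); rewrite ?nnegrE ?addr_ge0 ?mulr_ge0// mulr2n mulrDl !mul1r lerD2r.
by rewrite powRM// ler_wpM2l ?powR_ge0// lerDr powR_ge0.
Qed.

Lemma integrable_powR_norm p (f : 'rV[R]_n -> R) (g : 'rV[R]_n -> R) : 0 <= p ->
  measurable_fun setT f -> (forall x, `|f x| <= g x) -> intb (fun x => g x `^ p) ->
  intb (fun x => `|f x| `^ p).
Proof.
move=> p0 mf fg ig; apply: (intb_le _ ig).
  by apply: measurableT_comp (measurable_powR _) _; exact: measurableT_comp.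
move=> x; rewrite ger0_norm ?powR_ge0//; apply: (ge0_ler_powR p0); rewrite ?nnegrE//.
exact: le_trans (fg x).
Qed.

Lemma integrable_powRD p (f g : 'rV[R]_n -> R) : 0 <= p ->
  measurable_fun setT f -> measurable_fun setT g ->
  (forall x, 0 <= f x) -> (forall x, 0 <= g x) ->
  intb (fun x => f x `^ p) -> intb (fun x => g x `^ p) ->
  intb (fun x => (f x + g x) `^ p).
Proof.
move=> p0 mf mg f0 g0 i1 i2; apply: (intb_le _ (intbZ (2 `^ p) (intbD i1 i2))).
  by apply: measurableT_comp (measurable_powR _) _; exact: measurable_funD.
by move=> x; rewrite ger0_norm ?powR_ge0// powRD_le.
Qed.

Lemma integrable_powR_enorm p G : 0 < p ->
  (forall i, measurable_fun setT (fun x => G x ord0 i)) ->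
  (forall i, intb (fun x => `|G x ord0 i| `^ p)) -> intb (fun x => enorm (G x) `^ p).
Proof.
move=> p0 mG iG.
have H (r : seq 'I_n) : measurable_fun setT (fun x => \sum_(i <- r) `|G x ord0 i|) /\
    intb (fun x => (\sum_(i <- r) `|G x ord0 i|) `^ p).
  elim: r => [|i r [m IH]].
    split.
      by rewrite (_ : (fun x => _) = fun=> 0)//; apply/funext => x; rewrite big_nil.
    rewrite (_ : (fun x => _) = fun=> 0); first exact: intb0.
    by apply/funext => x; rewrite big_nil powR0// gt_eqF.
  have E : (fun x => \sum_(j <- i :: r) `|G x ord0 j|) =
      (fun x => `|G x ord0 i| + \sum_(j <- r) `|G x ord0 j|).
    by apply/funext => x; rewrite big_cons.
  have mi : measurable_fun setT (fun x => `|G x ord0 i|) by exact: measurableT_comp.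
  split; first by rewrite E; exact: measurable_funD.
  have -> : (fun x => (\sum_(j <- i :: r) `|G x ord0 j|) `^ p) =
      (fun x => (`|G x ord0 i| + \sum_(j <- r) `|G x ord0 j|) `^ p).
    by apply/funext => x; rewrite big_cons.
  apply: integrable_powRD => //; first exact: ltW.
  by move=> x; exact: sumr_ge0.
have [m h] := H (index_enum 'I_n).
apply: (intb_le _ h).
  by apply: measurableT_comp (measurable_powR _) _; exact: measurable_enorm.
move=> x; rewrite ger0_norm ?powR_ge0//; apply: (ge0_ler_powR (ltW p0)).
- by rewrite nnegrE enorm_ge0.
- by rewrite nnegrE sumr_ge0.
- exact: enorm_le_sum.
Qed.

Lemma Lfun_powR p u : 0 < p -> u \in Lfun mu p%:E ->
  measurable_fun (setT : set LT) u /\ (\int[mu]_x (`|u x| `^ p)%:E < +oo)%E.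
Proof.
move=> p0; rewrite inE => /andP[]; rewrite !inE /= => mu_ fn; split => //.
move: fn; rewrite /finite_norm unlock /= => /lty_poweRy; apply.
by rewrite invr_eq0 gt_eqF.
Qed.

Lemma powR_Lfun p u : 0 < p -> measurable_fun (setT : set LT) u ->
  (\int[mu]_x (`|u x| `^ p)%:E < +oo)%E -> u \in Lfun mu p%:E.
Proof.
move=> p0 mu_ iu; rewrite inE; apply/andP; split; rewrite !inE//=.
rewrite /finite_norm unlock /=; exact: poweR_lty.
Qed.

Lemma borel_sobolevP p u G : 0 < p -> borel_sobolev p u G -> sobolev p u G.
Proof.
move=> p0 [mu_ mG iu iG wG].
have mG' i := measurable_fun_borel_lebesgue (mG i).
have iGi i : intb (fun x => `|G x ord0 i| `^ p).
  by apply: (integrable_powR_norm (ltW p0) (mG i) _ iG) => x; exact: coor_le_enorm.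
have mp (f : 'rV[R]_n -> R) : measurable_fun setT f -> measurable_fun setT (fun x => (`|f x| `^ p)%:E).
  move=> mf; apply/measurable_EFinP; apply: measurableT_comp (measurable_powR _) _.
  exact: measurableT_comp.
have L (f : 'rV[R]_n -> R) : measurable_fun setT f -> intb (fun x => `|f x| `^ p) -> f \in Lfun mu p%:E.
  move=> mf ifp; apply: powR_Lfun => //; first exact: measurable_fun_borel_lebesgue.
  rewrite ge0_integral_lebesgue_borel//; last exact: mp.
  have /integrableP[_] := ifp.
  by under eq_integral do rewrite /= ger0_norm ?powR_ge0//.
split; [exact: L|by move=> i; exact: L|].
move=> phi tphi i; have := wG phi tphi i.
rewrite /Rintegral -!integral_lebesgue_borel//; apply/measurable_EFinP; apply: measurable_funM => //.
  exact: test_measurable.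
exact: test_derive_measurable.
Qed.

Lemma sobolev_representative p u G : 0 < p -> sobolev p u G ->
  exists u' G', [/\ borel_sobolev p u' G', {ae mu, forall x, u x = u' x}
    & {ae mu, forall x, G x = G' x}].
Proof.
move=> p0 [Lu LG wG].
have rep (f : 'rV[R]_n -> R) : f \in Lfun mu p%:E -> exists f', [/\ measurable_fun setT f',
    {ae mu, forall x, f x = f' x} & intb (fun x => `|f' x| `^ p)].
  move=> /(Lfun_powR p0)[mf fp]; have [Z [mZ Z0 mf']] := borel_representative mf.
  set f' := (fun x => _) in mf'.
  have ff' : {ae mu, forall x, f x = f' x}.
    apply: ae_borel_lebesgue; exists Z; split => // x /= h; apply: contrapT => Zx.
    by apply: h; rewrite /f' memNset.
  have ff'' : {ae mu, forall x, f' x = f x} by apply: ae_mono ff' => x ->.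
  exists f'; split => //.
  have mp : measurable_fun setT (fun x => `|f' x| `^ p).
    by apply: measurableT_comp (measurable_powR _) _; exact: measurableT_comp.
  apply: intb_ge0 => //.
  have mpE : measurable_fun setT (fun x => (`|f' x| `^ p)%:E) by exact/measurable_EFinP.
  have E := ge0_integral_lebesgue_borel mpE (fun x => powR_ge0 _ _).
  apply: le_lt_trans fp; rewrite -E le_eqVlt; apply/orP; left; apply/eqP.
  apply: (ae_eq_integral_powR p (measurable_fun_borel_lebesgue mf') mf); exact: ff''.
have [u' [mu' uu' iu']] := rep _ Lu.
have [g Hg] := choice (fun i => rep _ (LG i)).
pose G' x : 'rV[R]_n := \row_i g i x.
have mG' i : measurable_fun setT (fun x => G' x ord0 i).
  by under eq_fun do rewrite mxE; case: (Hg i).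
have GG' : {ae mu, forall x, G x = G' x}.
  apply: ae_mono (ae_countable (fun i => (let: And3 _ h _ := Hg i in h))) => x hx.
  by apply/rowP => i; rewrite mxE.
exists u', G'; split => //; split => //.
  apply: integrable_powR_enorm => // i; under eq_fun do rewrite mxE; by case: (Hg i).
have Lm (f : 'rV[R]_n -> R) : f \in Lfun mu p%:E -> measurable_fun (setT : set LT) f.
  by move=> /(Lfun_powR p0)[].
move=> phi tphi i.
have mphi := test_measurable tphi; have mD := test_derive_measurable i tphi.
have E (f f' psi : 'rV[R]_n -> R) : measurable_fun (setT : set LT) f -> measurable_fun setT f' ->
    {ae mu, forall x, f x = f' x} -> measurable_fun setT psi ->
    \int[lam]_x (f' x * psi x) = \int[mu]_x (f x * psi x).
  move=> mf mf' ff' mpsi; rewrite /Rintegral -integral_lebesgue_borel; last first.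
    by apply/measurable_EFinP; exact: measurable_funM.
  rewrite -/(Rintegral _ _ _) -/(Rintegral _ _ _); apply: ae_eq_rint.
  - by apply: measurable_fun_borel_lebesgue; exact: measurable_funM.
  - by apply: measurable_funM => //; exact: measurable_fun_borel_lebesgue.
  - by apply: ae_mono ff' => x ->.
rewrite (E u u' _ (Lm _ Lu) mu' uu' mD) (wG phi tphi i); congr (- _).
have GG'i : {ae mu, forall x, G x ord0 i = G' x ord0 i} by apply: ae_mono GG' => x ->.
by rewrite (E _ _ phi (Lm _ (LG i)) (mG' i) GG'i mphi).
Qed.

Lemma borel_sobolev0 p : 0 < p -> borel_sobolev p (fun=> 0) (fun=> 0).
Proof.
move=> p0; split => //.
- by under eq_fun do rewrite normr0 powR0 ?gt_eqF//; exact: intb0.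
- by under eq_fun do rewrite enorm0 powR0 ?gt_eqF//; exact: intb0.
- move=> phi _ i; under eq_fun do rewrite mul0r; rewrite rint0.
  by under [in RHS]eq_fun do rewrite mxE mul0r; rewrite rint0 oppr0.
Qed.

Lemma borel_sobolevD p u v G H : (0 < n)%N -> n%:R < p -> borel_sobolev p u G -> borel_sobolev p v H ->
  borel_sobolev p (fun x => u x + v x) (fun x => G x + H x).
Proof.
move=> n0 np [mu_ mG iu iG wG] [mv mH iv iH wH].
have p0 : 0 < p by rewrite (le_lt_trans _ np).
have mGe := measurable_enorm mG; have mHe := measurable_enorm mH.
have mGH i : measurable_fun setT (fun x => (G x + H x) ord0 i).
  by under eq_fun do rewrite mxE; exact: measurable_funD.
have lu := locally_integrable_powR n0 np mu_ iu.
have lv := locally_integrable_powR n0 np mv iv.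
have iGi i : intb (fun x => `|G x ord0 i| `^ p).
  by apply: (integrable_powR_norm (ltW p0) (mG i) _ iG) => x; exact: coor_le_enorm.
have iHi i : intb (fun x => `|H x ord0 i| `^ p).
  by apply: (integrable_powR_norm (ltW p0) (mH i) _ iH) => x; exact: coor_le_enorm.
have lG i : locally_integrable (fun x => G x ord0 i) by exact: (locally_integrable_powR n0 np (mG i) (iGi i)).
have lH i : locally_integrable (fun x => H x ord0 i) by exact: (locally_integrable_powR n0 np (mH i) (iHi i)).
split => //; first exact: measurable_funD.
- apply: (integrable_powR_norm (ltW p0) _ (fun x => ler_normD (u x) (v x))); first exact: measurable_funD.
  by apply: integrable_powRD => //; [exact: ltW|exact: measurableT_comp|exact: measurableT_comp].
- apply: (intb_le _ (integrable_powRD (ltW p0) mGe mHe (fun x => enorm_ge0 _) (fun x => enorm_ge0 _) iG iH)).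
    by apply: measurableT_comp (measurable_powR _) _; exact: measurable_enorm.
  move=> x; rewrite ger0_norm ?powR_ge0//; apply: (ge0_ler_powR (ltW p0)).
  + by rewrite nnegrE enorm_ge0.
  + by rewrite nnegrE addr_ge0 ?enorm_ge0.
  + exact: enormD.
- move=> phi tphi i.
  have mphi := test_measurable tphi; have mD := test_derive_measurable i tphi.
  have bphi := test_function_bounded_support tphi; have bD := test_derive_bounded_support i tphi.
  under eq_fun do rewrite mulrDl; under [in RHS]eq_fun do rewrite mxE mulrDl.
  rewrite !rintD; first by rewrite (wG phi tphi i) (wH phi tphi i) opprD.
  + exact: (locally_integrable_mul (mG i) (lG i) mphi bphi).
  + exact: (locally_integrable_mul (mH i) (lH i) mphi bphi).
  + exact: locally_integrable_mul.
  + exact: locally_integrable_mul.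
Qed.

Lemma borel_sobolevZ p k u G : 0 < p -> borel_sobolev p u G ->
  borel_sobolev p (fun x => k * u x) (fun x => k *: G x).
Proof.
move=> p0 [mu_ mG iu iG wG]; split.
- exact: measurable_funM.
- by move=> i; under eq_fun do rewrite mxE; exact: measurable_funM.
- by under eq_fun do rewrite normrM powRM//; exact: intbZ.
- by under eq_fun do rewrite enormZ powRM ?enorm_ge0//; exact: intbZ.
- move=> phi tphi i; under eq_fun do rewrite -mulrA; under [in RHS]eq_fun do rewrite mxE -mulrA.
  rewrite !rintZ_measurable ?(wG phi tphi i) ?mulrN//.
    by apply: measurable_funM => //; exact: test_measurable.
  by apply: measurable_funM => //; exact: test_derive_measurable.
Qed.

End borel_sobolev.

(** * The energy *)

Section energy.
Context (R : realType) (n : nat) (p : R).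
Hypothesis p1 : 1 < p.
Implicit Types (G H : 'rV[R]_n) (b u v t : R).

Let p0 : 0 < p.
Proof. by rewrite (lt_trans _ p1). Qed.

Definition energy b G u : R := enorm G `^ p + b * `|u| `^ p.

Lemma energy_ge0 b G u : 0 <= b -> 0 <= energy b G u.
Proof. by move=> b0; rewrite addr_ge0 ?mulr_ge0 ?powR_ge0. Qed.

Lemma energyZ b G u t : energy b (t *: G) (t * u) = `|t| `^ p * energy b G u.
Proof.
by rewrite /energy enormZ normrM !powRM ?enorm_ge0// mulrDr mulrCA.
Qed.

Lemma powR_convex t x y : 0 <= t <= 1 -> 0 <= x -> 0 <= y ->
  ((1 - t) * x + t * y) `^ p <= (1 - t) * x `^ p + t * y `^ p.
Proof.
move=> /andP[t0 t1] x0 y0; have t1' : 0 <= 1 - t by rewrite subr_ge0.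
set m := _ + _; have m0 : 0 <= m by rewrite addr_ge0 ?mulr_ge0.
have h1 := ler_wpM2l t1' (powR_tangent (ltW p1) m0 x0).
have h2 := ler_wpM2l t0 (powR_tangent (ltW p1) m0 y0).
apply: le_trans (lerD h1 h2).
have mE : m = (1 - t) * x + t * y by [].
clearbody m; set q := m `^ (p - 1); set c := m `^ p.
have -> : (1 - t) * (c + p * q * (x - m)) + t * (c + p * q * (y - m)) =
  c + p * q * ((1 - t) * x + t * y - m) by ring.
by rewrite -mE subrr mulr0 addr0.
Qed.

Lemma energy_convex b G H u v t : 0 <= b -> 0 <= t <= 1 ->
  energy b ((1 - t) *: G + t *: H) ((1 - t) * u + t * v) <=
  (1 - t) * energy b G u + t * energy b H v.
Proof.
move=> b0 t01; have /andP[t0 t1] := t01; have t1' : 0 <= 1 - t by rewrite subr_ge0.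
rewrite /energy !mulrDr addrACA lerD//.
  apply: le_trans (powR_convex t01 (enorm_ge0 G) (enorm_ge0 H)).
  apply: (ge0_ler_powR (ltW p0)); rewrite ?nnegrE ?addr_ge0 ?mulr_ge0 ?enorm_ge0//.
  by rewrite (le_trans (enormD _ _))// !enormZ !ger0_norm.
rewrite mulrCA [X in _ <= _ + X]mulrCA -mulrDr ler_wpM2l//.
apply: le_trans (powR_convex t01 (normr_ge0 u) (normr_ge0 v)).
apply: (ge0_ler_powR (ltW p0)); rewrite ?nnegrE ?addr_ge0 ?mulr_ge0//.
by rewrite (le_trans (ler_normD _ _))// !normrM !(ger0_norm t0) !(ger0_norm t1').
Qed.

Let uniform_convexity_step e (x y al be K : R) : 0 <= K -> 0 <= al -> 0 <= be ->
  y `^ p <= e / 2 `^ p * 2 * x `^ p + K * ((al `^ p + be `^ p) / 2 - x `^ p) ->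
  0 <= e -> 0 <= (al `^ p + be `^ p) / 2 - x `^ p -> 0 <= x -> 0 <= y ->
  (2 * y) `^ p <= e * (al `^ p + be `^ p) + 2 `^ p * K * ((al `^ p + be `^ p) / 2 - x `^ p).
Proof.
move=> K0 al0 be0 h e0 g0 x0 y0; rewrite powRM//.
have P0 : 0 < 2 `^ p :> R by rewrite powR_gt0.
apply: (le_trans (ler_wpM2l (ltW P0) h)); rewrite mulrDr mulrA lerD//; last by rewrite mulrA.
have -> : 2 `^ p * (e / 2 `^ p * 2) * x `^ p = e * (2 * x `^ p) by field; rewrite gt_eqF.
by rewrite ler_wpM2l//; lra.
Qed.

Lemma energy_uniformly_convex e : 0 < e -> exists2 C, 0 <= C & forall b G H u v, 0 <= b ->
  energy b (G - H) (u - v) <= e * (energy b G u + energy b H v) +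
    C * ((energy b G u + energy b H v) / 2 - energy b (2^-1 *: (G + H)) (2^-1 * (u + v))).
Proof.
move=> e0; have P0 : 0 < 2 `^ p :> R by rewrite powR_gt0.
(* With y half the distance and x the norm of the midpoint, multiplying by 2^p turns the tau term
   into e times 2 x^p, which is at most e times al^p + be^p. *)
have tau0 : 0 < e / 2 `^ p * 2 by rewrite mulr_gt0// divr_gt0.
have [K K0 HK] := powR_parallelogram p1 tau0.
exists (2 `^ p * K); first by rewrite mulr_ge0// ltW.
move=> b G H u v b0.
have h2 : (0 : R) <= 2^-1 by rewrite invr_ge0.
have hG : enorm (G - H) `^ p <= e * (enorm G `^ p + enorm H `^ p) + 2 `^ p * K *
    ((enorm G `^ p + enorm H `^ p) / 2 - enorm (2^-1 *: (G + H)) `^ p).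
  have E1 : enorm (2^-1 *: (G + H)) = enorm (G + H) / 2 by rewrite enormZ ger0_norm// mulrC.
  have E2 : enorm (G - H) = 2 * (enorm (G - H) / 2) by field.
  rewrite E1 [X in X `^ p <= _]E2.
  have tri : 2 * (enorm (G + H) / 2) <= enorm G + enorm H.
    by rewrite mulrC divfK ?pnatr_eq0// enormD.
  have x0 : 0 <= enorm (G + H) / 2 by rewrite divr_ge0 ?enorm_ge0.
  have y0 : 0 <= enorm (G - H) / 2 by rewrite divr_ge0 ?enorm_ge0.
  apply: uniform_convexity_step => //; rewrite ?enorm_ge0 ?(ltW e0)//.
    apply: HK => //; rewrite ?enorm_ge0//.
    by have := enorm_parallelogram G H; rewrite !expr_div_n; lra.
  by apply: powR_gap_ge0 => //; rewrite ?enorm_ge0.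
have hu : `|u - v| `^ p <= e * (`|u| `^ p + `|v| `^ p) + 2 `^ p * K *
    ((`|u| `^ p + `|v| `^ p) / 2 - `|2^-1 * (u + v)| `^ p).
  have E1 : `|2^-1 * (u + v)| = `|u + v| / 2 by rewrite normrM ger0_norm// mulrC.
  have E2 : `|u - v| = 2 * (`|u - v| / 2) by field.
  rewrite E1 [X in X `^ p <= _]E2.
  have tri : 2 * (`|u + v| / 2) <= `|u| + `|v|.
    by rewrite mulrC divfK ?pnatr_eq0// ler_normD.
  have x0 : 0 <= `|u + v| / 2 by rewrite divr_ge0.
  have y0 : 0 <= `|u - v| / 2 by rewrite divr_ge0.
  apply: uniform_convexity_step => //; rewrite ?(ltW e0)//.
    apply: HK => //.
    by rewrite !expr_div_n !real_normK ?num_real//; field.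
  exact: powR_gap_ge0.
rewrite /energy; apply: (le_trans (lerD hG (ler_wpM2l b0 hu))).
rewrite le_eqVlt; apply/orP; left; apply/eqP.
set g1 := enorm G `^ p; set g2 := enorm H `^ p; set g3 := enorm _ `^ p.
by set u1 := `|u| `^ p; set u2 := `|v| `^ p; set u3 := `|_| `^ p; ring.
Qed.

End energy.

Section ae_limits.
Context d (T : measurableType d) (R : realType) (mu : {measure set T -> \bar R}).

(** The upper limit is measurable and defined everywhere, so it serves as the limit wherever there
    is one. *)
Lemma measurable_limit (f : nat -> T -> R) : (forall k, measurable_fun setT (f k)) ->
  exists2 g : T -> R, measurable_fun setT g &
    forall x, cvgn (fun k => f k x) -> f k x @[k --> \oo] --> g x.
Proof.
move=> mf; exists (fun x => fine (limn_esup (fun k => (f k x)%:E))).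
  apply: measurableT_comp => //; apply: measurable_fun_limn_esup => k.
  exact/measurable_EFinP.
move=> x /cvg_ex[l fl]; have : (f k x)%:E @[k --> \oo] --> l%:E.
  by apply/cvg_EFin => //; exact: nearW.
move=> /cvg_limn_einf_sup[_ ->]; exact: fl.
Qed.

Lemma half_sum_le k : \sum_(0 <= j < k) (2^-1 : R) ^+ j <= 2.
Proof.
suff -> : \sum_(0 <= j < k) (2^-1 : R) ^+ j = 2 - 2 * 2^-1 ^+ k.
  by rewrite gerBl mulr_ge0// exprn_ge0// invr_ge0.
elim: k => [|k IH]; first by rewrite big_nil expr0 mulr1 subrr.
by rewrite big_nat_recr//= IH exprS; field.
Qed.

(** The sum of the series is integrable, hence finite almost everywhere, and bounds every term. *)
Lemma ae_bounded_of_summable (e : nat -> T -> R) : (forall k, measurable_fun setT (e k)) ->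
  (forall k x, 0 <= e k x) -> (forall k, \int[mu]_x (e k x)%:E <= (2^-1 ^+ k)%:E)%E ->
  {ae mu, forall x, exists M, forall k, e k x <= M}.
Proof.
move=> me e0 ie; pose S x := (\sum_(k <oo) (e k x)%:E)%E.
have mE k : measurable_fun setT (fun x => (e k x)%:E) by exact/measurable_EFinP.
have E : (\int[mu]_x S x = \sum_(k <oo) \int[mu]_x (e k x)%:E)%E.
  by apply: integral_nneseries => // k x _; rewrite lee_fin.
have S0 x : (0 <= S x)%E by apply: nneseries_ge0 => k _ _; rewrite lee_fin.
have mS : measurable_fun setT S.
  by apply: ge0_emeasurable_sum => // k x _ _; rewrite lee_fin.
have iS : mu.-integrable setT S.
  apply/integrableP; split => //; under eq_integral do rewrite gee0_abs//.
  rewrite E; apply: (@le_lt_trans _ _ (2%:E)); last exact: ltry.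
  apply: lime_le; first by apply: is_cvg_nneseries => k _ _; apply: integral_ge0 => x _; rewrite lee_fin.
  apply: nearW => k; apply: (@le_trans _ _ (\sum_(0 <= j < k) (2^-1 ^+ j)%:E)%E).
    by apply: lee_sum => j _; exact: ie.
  by rewrite sumEFin lee_fin half_sum_le.
apply: filterS (integrable_ae measurableT iS) => x /(_ I) Sx.
exists (fine (S x)) => k; rewrite -lee_fin fineK//.
have := @nneseries_lim_ge R (fun k => (e k x)%:E) xpredT 0%N k.+1.
move=> /(_ (fun n _ _ => e0 n x)); apply: le_trans; rewrite big_nat_recr//=.
by rewrite leeDr//; apply: sume_ge0 => j _; rewrite lee_fin.
Qed.

Lemma fast_cvg (w : nat -> R) (M : R) : 0 <= M ->
  (forall k, `|w k.+1 - w k| <= M / 2 ^+ k) -> cvgn w.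
Proof.
move=> M0 wM; have step k j : `|w (k + j)%N - w k| <= M / 2 ^+ k * (2 - 2 / 2 ^+ j).
  elim: j => [|j IH]; first by rewrite addn0 subrr normr0 expr0 divr1 subrr mulr0.
  have -> : w (k + j.+1)%N - w k = (w (k + j).+1 - w (k + j)%N) + (w (k + j)%N - w k).
    by rewrite addnS; ring.
  rewrite (le_trans (ler_normD _ _))//; apply: (le_trans (lerD (wM _) IH)).
  rewrite exprD exprS le_eqVlt; apply/orP; left; apply/eqP; field.
  by rewrite !expf_neq0 ?pnatr_eq0.
apply: cauchy_seq_cvg => e e0.
have [k0 Hk] : exists k0, M * 4 <= e * 2 ^+ k0.
  exists (Num.bound (M * 4 / e)); rewrite [leRHS]mulrC -ler_pdivrMr//.
  have := archi_boundP (divr_ge0 (mulr_ge0 M0 (ler0n R 4)) (ltW e0)) => /ltW /le_trans; apply.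
  by rewrite -natrX ler_nat ltnW// ltn_expl.
have P0 : 0 < 2 ^+ k0 :> R by rewrite exprn_gt0.
have H m : (k0 <= m)%N -> `|w m - w k0| <= e / 2.
  move=> km; rewrite -(subnKC km); apply: (le_trans (step _ _)).
  apply: (@le_trans _ _ (M / 2 ^+ k0 * 2)).
    by rewrite ler_wpM2l ?divr_ge0 ?(ltW P0)// gerBl divr_ge0// exprn_ge0.
  by rewrite mulrAC ler_pdivrMr//; lra.
exists k0 => m m' mm mm'.
have -> : w m - w m' = (w m - w k0) - (w m' - w k0) by ring.
by rewrite (le_trans (ler_normB _ _))// (le_trans (lerD (H _ mm) (H _ mm')))//; lra.
Qed.

End ae_limits.

Lemma cvg_powR (R : realType) (p : R) (f : nat -> R) (l : R) : 1 <= p -> (forall k, 0 <= f k) -> 0 <= l ->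
  f k @[k --> \oo] --> l -> f k `^ p @[k --> \oo] --> l `^ p.
Proof.
move=> p1 f0 l0 fl; pose L := p * (l + 1) `^ (p - 1).
have L0 : 0 <= L by rewrite mulr_ge0 ?powR_ge0// (le_trans _ p1).
apply/cvgrPdist_le => e e0; near=> k.
have h1 : `|l - f k| <= 1 by near: k; move/cvgrPdist_le : fl; exact.
have h2 : `|l - f k| <= e / (L + 1).
  by near: k; move/cvgrPdist_le : fl; apply; rewrite divr_gt0// ltr_wpDl.
have fk : f k <= l + 1 by move: h1; rewrite ler_norml; lra.
have := @powR_lipschitz R p (l + 1) l (f k) p1.
rewrite l0 f0 fk lerDl ler01 => /(_ isT isT) /le_trans; apply.
apply: (le_trans (ler_wpM2l L0 h2)); rewrite mulrCA ler_piMr ?(ltW e0)//.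
by rewrite ler_pdivrMr ?ltr_wpDl// mul1r lerDl.
Unshelve. all: by end_near. Qed.

Lemma cvg_sum_seq (R : realType) (I : Type) (r : seq I) (f : nat -> I -> R) (l : I -> R) :
  (forall i, f k i @[k --> \oo] --> l i) ->
  \sum_(i <- r) f k i @[k --> \oo] --> \sum_(i <- r) l i.
Proof.
move=> fl; elim: r => [|i r IH].
  by rewrite big_nil; under eq_fun do rewrite big_nil; exact: cvg_cst.
by rewrite big_cons; under eq_fun do rewrite big_cons; exact: cvgD.
Qed.

Lemma cvg_enorm (R : realType) n (f : nat -> 'rV[R]_n) (l : 'rV[R]_n) :
  (forall i, f k ord0 i @[k --> \oo] --> l ord0 i) -> enorm (f k) @[k --> \oo] --> enorm l.
Proof.
move=> fl; apply: (cvg_comp (fun k => dotv (f k) (f k)) (@Num.sqrt R)); last exact: sqrt_continuous.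
by apply: cvg_sum_seq => i; apply: cvgM; exact: fl.
Qed.

Lemma ge_min_l (R : realType) (x y : R) : Num.min x y <= x.
Proof. by rewrite ge_min lexx. Qed.

(** * Completeness of the Sobolev space for the energy *)

Section completeness.
Context (R : realType) (n : nat) (p : R).
Local Notation lam := (@lebesgue_borel R n).
Local Notation intb f := (lam.-integrable setT (EFin \o f)).
Hypotheses (n0 : (0 < n)%N) (np : n%:R < p).

Let p1 : 1 < p.
Proof. by rewrite (le_lt_trans _ np)// ler1n. Qed.

Let p0 : 0 < p.
Proof. by rewrite (lt_trans _ p1). Qed.

Implicit Types (u v f : 'rV[R]_n -> R) (G H : 'rV[R]_n -> 'rV[R]_n).

Lemma le_deltaDpowR (t dl : R) : 0 < dl -> 0 <= t -> t <= dl + dl `^ (1 - p) * t `^ p.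
Proof.
move=> dl0 t0; have [h|h] := leP t dl.
  by rewrite (le_trans h)// lerDl mulr_ge0 ?powR_ge0.
have tp : 0 < t by exact: lt_trans h.
apply: (@le_trans _ _ (dl `^ (1 - p) * t `^ p)); last by rewrite lerDr ltW.
have -> : t `^ p = t * t `^ (p - 1).
  by rewrite -{2}(powRr1 t0) -powRD ?(gt_eqF tp) ?implybT//; congr (_ `^ _); ring.
rewrite mulrCA ler_peMr//.
rewrite -(opprB p) powRN mulrC ler_pdivlMr ?powR_gt0// mul1r.
by apply: ge0_ler_powR; rewrite ?nnegrE ?subr_ge0 ?ltW.
Qed.

(** Below a small threshold |f| contributes little on the bounded support, and above it |f| is at
    most a multiple of |f|^p. This lets the weak gradient relation pass to limits. *)
Lemma test_integral_small (psi : 'rV[R]_n -> R) : measurable_fun setT psi -> bounded_support psi ->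
  forall e : R, 0 < e -> exists2 dl : R, 0 < dl & forall f, measurable_fun setT f ->
    intb (fun x => `|f x| `^ p) -> \int[lam]_x (`|f x| `^ p) <= dl ->
    `|\int[lam]_x (f x * psi x)| <= e.
Proof.
move=> mpsi bpsi e e0; have [C C0 [M hM]] := bpsi.
have mQ : measurable (cube M : set 'rV[R]_n) by exact: measurable_box.
have Qoo := lebesgue_box_lty n0 (const_mx (- M)) (const_mx M).
pose V := fine (lam (cube M)).
have V0 : 0 <= V by rewrite fine_ge0.
pose a := e / 2 / (C * V + 1).
have CV0 : 0 < C * V + 1 by rewrite ltr_wpDl// mulr_ge0.
have a0 : 0 < a by rewrite !divr_gt0.
pose K := C * a `^ (1 - p); have K0 : 0 <= K by rewrite mulr_ge0 ?powR_ge0.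
exists (e / 2 / (K + 1)); first by rewrite !divr_gt0// ltr_wpDl.
move=> f mf ifp hf.
have lf := locally_integrable_powR n0 np mf ifp.
have ifpsi := locally_integrable_mul mf lf mpsi bpsi.
have [iI EI] := @rint_cst_indic _ _ _ lam (cube M) (C * a) mQ Qoo.
apply: (le_trans (le_norm_rint ifpsi)).
apply: (@le_trans _ _ (\int[lam]_x (C * a * \1_(cube M) x + K * `|f x| `^ p))).
  apply: le_rint; [exact: intb_norm|by apply: intbD => //; exact: intbZ|].
  move=> x; rewrite normrM; apply: (le_trans (ler_wpM2l (normr_ge0 _) (hM x))).
  rewrite indicE; case: (_ \in _); rewrite /= ?mulr1 ?mulr0 ?add0r; last first.
    by rewrite mulr_ge0// powR_ge0.
  by rewrite mulrC /K -mulrA -mulrDr ler_wpM2l// le_deltaDpowR.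
rewrite rintD//; last exact: intbZ.
rewrite EI (rintZ _ ifp) -/V.
have h1 : C * a * V <= e / 2.
  have -> : C * a * V = (e / 2) * ((C * V) / (C * V + 1)) by rewrite /a; field; rewrite gt_eqF.
  by rewrite ler_piMr ?divr_ge0 ?(ltW e0)// ler_pdivrMr// mul1r lerDl.
have h2 : K * \int[lam]_x (`|f x| `^ p) <= e / 2.
  apply: (le_trans (ler_wpM2l K0 hf)); rewrite mulrCA ler_piMr ?divr_ge0 ?(ltW e0)//.
  by rewrite ler_pdivrMr ?ltr_wpDl// mul1r lerDl.
lra.
Qed.

Variables (b : 'rV[R]_n -> R) (am an : R).
Hypotheses (mb : measurable_fun setT b) (am0 : 0 < am) (b_bnd : forall x, am <= b x <= an).

Let b0 x : 0 <= b x.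
Proof. by have /andP[h _] := b_bnd x; rewrite (le_trans _ h)// ltW. Qed.

Definition energy_of (u : 'rV[R]_n -> R) (G : 'rV[R]_n -> 'rV[R]_n) (x : 'rV[R]_n) : R :=
  energy p (b x) (G x) (u x).

Lemma measurable_powR_norm (f : 'rV[R]_n -> R) : measurable_fun setT f ->
  measurable_fun setT (fun x => `|f x| `^ p).
Proof.
by move=> mf; apply: measurableT_comp (measurable_powR _) _; exact: measurableT_comp.
Qed.

Lemma measurable_energy u G : measurable_fun setT u ->
  (forall i, measurable_fun setT (fun x => G x ord0 i)) ->
  measurable_fun setT (energy_of u G).
Proof.
move=> mu mG; apply: measurable_funD.
  by apply: measurableT_comp (measurable_powR _) _; exact: measurable_enorm.
by apply: measurable_funM => //; exact: measurable_powR_norm.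
Qed.

Lemma integrable_energy u G : borel_sobolev p u G -> intb (energy_of u G).
Proof.
move=> [mu mG iu iG _]; apply: (intb_le _ (intbD iG (intbZ an iu))).
  exact: measurable_energy.
move=> x; rewrite ger0_norm ?energy_ge0// lerD2l ler_wpM2r ?powR_ge0//.
by case/andP: (b_bnd x).
Qed.

Lemma le_energy_grad u G x : enorm (G x) `^ p <= energy_of u G x.
Proof. by rewrite lerDl mulr_ge0// powR_ge0. Qed.

Lemma le_energy_fun u G x : `|u x| `^ p <= am^-1 * energy_of u G x.
Proof.
rewrite ler_pdivlMl// (@le_trans _ _ (b x * `|u x| `^ p))//.
  by rewrite ler_wpM2r ?powR_ge0//; case/andP: (b_bnd x).
by rewrite lerDr powR_ge0.
Qed.

Lemma integrable_of_energy u G : measurable_fun setT u ->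
  (forall i, measurable_fun setT (fun x => G x ord0 i)) -> intb (energy_of u G) ->
  intb (fun x => `|u x| `^ p) /\ intb (fun x => enorm (G x) `^ p).
Proof.
move=> mu mG ie; split.
  apply: (intb_le _ (intbZ am^-1 ie)); first exact: measurable_powR_norm.
  by move=> x; rewrite ger0_norm ?powR_ge0// le_energy_fun.
apply: (intb_le _ ie).
  by apply: measurableT_comp (measurable_powR _) _; exact: measurable_enorm.
by move=> x; rewrite ger0_norm ?powR_ge0// le_energy_grad.
Qed.

Lemma borel_sobolevB u v G H : borel_sobolev p u G -> borel_sobolev p v H ->
  borel_sobolev p (fun x => u x - v x) (fun x => G x - H x).
Proof.
move=> hu /(borel_sobolevZ (-1) p0) hv; have := borel_sobolevD n0 np hu hv.
by under eq_fun do rewrite mulN1r; under [X in borel_sobolev _ _ X]eq_fun do rewrite scaleN1r.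
Qed.

(** Riesz-Fischer: a fast subsequence converges almost everywhere, Fatou's lemma turns this into
    convergence in energy of the whole sequence, and [test_integral_small] carries the weak gradient
    relation to the limit. *)
Lemma sobolev_complete (u : nat -> 'rV[R]_n -> R) (G : nat -> 'rV[R]_n -> 'rV[R]_n) :
  (forall k, borel_sobolev p (u k) (G k)) ->
  (forall e, 0 < e -> exists n0, forall m k, (n0 <= m)%N -> (n0 <= k)%N ->
     \int[lam]_x energy_of (fun x => u m x - u k x) (fun x => G m x - G k x) x <= e) ->
  exists v H, borel_sobolev p v H /\ forall e, 0 < e -> exists n0, forall m, (n0 <= m)%N ->
    \int[lam]_x energy_of (fun x => u m x - v x) (fun x => G m x - H x) x <= e.
Proof.
move=> hw cw.
have mu k : measurable_fun setT (u k) by case: (hw k).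
have mG k i : measurable_fun setT (fun x => G k x ord0 i) by case: (hw k).
pose en m k := energy_of (fun x => u m x - u k x) (fun x => G m x - G k x).
have en0 m k x : 0 <= en m k x by exact: energy_ge0.
have ien m k : intb (en m k) by apply: integrable_energy; exact: borel_sobolevB.
(* Energies of increments at most 2^(-k) / 2^(k p) stay summable after multiplication by q k;
   boundedness at almost every point then makes the increments themselves of order 2^(-k). *)
pose q k : R := (2 ^+ k) `^ p.
have q0 k : 0 < q k by rewrite powR_gt0 ?exprn_gt0.
have c0 k : 0 < 2^-1 ^+ k / q k by rewrite divr_gt0// exprn_gt0// invr_gt0.
have [N HN] := choice (fun k => cw _ (c0 k)).
(* Summing the N j up to k makes s nondecreasing, with s k at least N k; the summand k makes it at
   least k. *)
pose s k := (\sum_(j < k.+1) N j + k)%N.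
have sS k : (s k <= s k.+1)%N by rewrite /s leq_add// [X in (_ <= X)%N]big_ord_recr/= leq_addr.
have sk k : (k <= s k)%N by rewrite /s leq_addl.
have Ns k : (N k <= s k)%N by rewrite /s big_ord_recr/= -addnA addnCA leq_addr.
have s_ge k j : (k <= j)%N -> (N k <= s j)%N.
  elim: j => [|j IH]; first by rewrite leqn0 => /eqP->.
  rewrite leq_eqVlt => /predU1P[->|]; first exact: Ns.
  by rewrite ltnS => /IH h; exact: leq_trans h (sS j).
have ae_fast : {ae lam, forall x, exists M, forall k, q k * en (s k.+1) (s k) x <= M}.
  apply: ae_bounded_of_summable.
  - by move=> k; apply: measurable_funM => //; exact: intb_measurable (ien _ _).
  - by move=> k x; rewrite mulr_ge0// ltW.
  move=> k; rewrite -rint_EFin; last exact: intbZ.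
  rewrite rintZ// lee_fin -ler_pdivlMl// mulrC; apply: HN; last exact: Ns.
  exact: s_ge.
have ae_cvg : {ae lam, forall x, cvgn (fun k => u (s k) x) /\ forall i, cvgn (fun k => G (s k) x ord0 i)}.
  apply: filterS ae_fast => x [M hM].
  have M0 : 0 <= M by apply: le_trans (hM 0%N); rewrite mulr_ge0// ltW.
  have root t y k : 0 <= t -> 0 <= y -> t `^ p <= y * (M / q k) -> t <= (y * M) `^ p^-1 / 2 ^+ k.
    move=> t0 y0 h; have := @ge0_ler_powR _ p^-1 _ _ _ _ _ h.
    rewrite invr_ge0 ltW// nnegrE powR_ge0 nnegrE !mulr_ge0 ?invr_ge0 ?(ltW (q0 k))// -powRrM mulfV ?gt_eqF// powRr1//.
    move=> /(_ isT isT isT) /le_trans; apply; rewrite mulrA powRM ?mulr_ge0 ?invr_ge0 ?(ltW (q0 k))//.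
    rewrite ler_wpM2l ?powR_ge0// powRV ?(ltW (q0 k))// /q -powRrM mulfV ?gt_eqF// powRr1 ?exprn_ge0//.
  have eM k : en (s k.+1) (s k) x <= M / q k by rewrite ler_pdivlMr// mulrC.
  split=> [|i].
    apply: (@fast_cvg R _ ((am^-1 * M) `^ p^-1)); first exact: powR_ge0.
    move=> k; apply: root; rewrite ?invr_ge0 ?(ltW am0)//.
    apply: (le_trans (le_energy_fun (fun x => u (s k.+1) x - u (s k) x) (fun x => G (s k.+1) x - G (s k) x) x)).
    by rewrite ler_wpM2l ?invr_ge0 ?(ltW am0)//; exact: eM.
  apply: (@fast_cvg R _ ((1 * M) `^ p^-1)); first exact: powR_ge0.
  move=> k; apply: root => //; rewrite mul1r.
  apply: le_trans (eM k); apply: le_trans (le_energy_grad (fun x => u (s k.+1) x - u (s k) x) (fun x => G (s k.+1) x - G (s k) x) x).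
  apply: (ge0_ler_powR (ltW p0)); rewrite ?nnegrE ?enorm_ge0//.
  by have := coor_le_enorm (G (s k.+1) x - G (s k) x) i; rewrite !mxE.
have [v mv Hv] := measurable_limit (fun k => mu (s k)).
have hex i : exists h : 'rV[R]_n -> R, measurable_fun setT h /\ forall x,
    cvgn (fun k => G (s k) x ord0 i) -> G (s k) x ord0 i @[k --> \oo] --> h x.
  by have [h h1 h2] := measurable_limit (fun k => mG (s k) i); exists h.
have [h Hh] := choice hex.
pose H x : 'rV[R]_n := \row_i h i x.
have mH i : measurable_fun setT (fun x => H x ord0 i).
  by under eq_fun do rewrite mxE; case: (Hh i).
pose enl m := energy_of (fun x => u m x - v x) (fun x => G m x - H x).
have mul m : measurable_fun setT (fun x => u m x - v x) by exact: measurable_funB.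
have mGl m i : measurable_fun setT (fun x => (G m x - H x) ord0 i).
  by under eq_fun do rewrite !mxE; apply: measurable_funB => //; case: (Hh i).
have menl m : measurable_fun setT (enl m) by exact: measurable_energy.
have enl0 m x : 0 <= enl m x by exact: energy_ge0.
have cvg_en m : {ae lam, forall x, en m (s k) x @[k --> \oo] --> enl m x}.
  apply: filterS ae_cvg => x [cu cG].
  have cu' := Hv x cu; have cG' i := (Hh i).2 x (cG i).
  apply: cvgD.
    apply: (cvg_powR (ltW p1)); [by move=> k; exact: enorm_ge0|exact: enorm_ge0|].
    apply: cvg_enorm => i; rewrite !mxE; under eq_fun do rewrite !mxE.
    by apply: cvgB; [exact: cvg_cst|exact: cG'].
  apply: cvgM; first exact: cvg_cst.
  apply: (cvg_powR (ltW p1)) => //; apply: cvg_norm; apply: cvgB; first exact: cvg_cst.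
  exact: cu'.
(* For fixed m the densities en m (s k) converge to enl m almost everywhere as k grows, so a bound
   on their integrals passes to the limit by Fatou's lemma. *)
have fat m e k0 : (forall k, (k0 <= k)%N -> \int[lam]_x en m (s k) x <= e) ->
    (\int[lam]_x (enl m x)%:E <= e%:E)%E.
  move=> hm; have mek k : measurable_fun setT (fun x => (en m (s k) x)%:E).
    by apply/measurable_EFinP; exact: intb_measurable (ien _ _).
  apply: (@le_trans _ _ (\int[lam]_x limn_einf (fun k => (en m (s k) x)%:E))%E).
    rewrite le_eqVlt; apply/orP; left; apply/eqP; apply: ae_eq_integral => //.
    - exact/measurable_EFinP.
    - apply: measurableT_comp => //; apply: measurable_fun_limn_esup => k.
      exact: measurableT_comp.
    - apply: filterS (cvg_en m) => x hx _.
      have : (en m (s k) x)%:E @[k --> \oo] --> (enl m x)%:E.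
        by apply/cvg_EFin => //; exact: nearW.
      by move=> /cvg_limn_einf_sup[->].
  apply: (le_trans (@fatou _ _ _ lam setT measurableT (fun k x => (en m (s k) x)%:E) _ _)) => //.
    by move=> k x _; rewrite lee_fin.
  rewrite limn_einf_lim; apply: lime_le; first exact: is_cvg_einfs.
  exists k0 => // k /= kk; apply: (@le_trans _ _ (\int[lam]_x (en m (s k) x)%:E)%E).
    by apply: ereal_inf_lbound; exists k => /=.
  by rewrite -rint_EFin// lee_fin; exact: hm.
have small e : 0 < e -> exists N0, forall m, (N0 <= m)%N -> intb (enl m) /\ \int[lam]_x enl m x <= e.
  move=> e0; have [N0 H0] := cw _ e0; exists N0 => m hm.
  have hE : (\int[lam]_x (enl m x)%:E <= e%:E)%E.
    by apply: (fat m e N0) => k hk; apply: H0 => //; exact: leq_trans hk (sk k).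
  have ii : intb (enl m) by apply: intb_ge0 => //; exact: le_lt_trans hE (ltry _).
  by split => //; rewrite -lee_fin rint_EFin.
exists v, H; split; last first.
  by move=> e e0; have [N0 HN0] := small _ e0; exists N0 => m hm; case: (HN0 m hm).
have small_u e : 0 < e -> exists N0, forall m, (N0 <= m)%N ->
    [/\ intb (fun x => `|u m x - v x| `^ p), \int[lam]_x (`|u m x - v x| `^ p) <= e,
        intb (fun x => enorm (G m x - H x) `^ p) & \int[lam]_x (enorm (G m x - H x) `^ p) <= e].
  move=> e0; have e'0 : 0 < Num.min (am * e) e by rewrite lt_min mulr_gt0.
  have [N0 HN0] := small _ e'0; exists N0 => m hm.
  have [i1 i2] := HN0 m hm; have [j1 j2] := integrable_of_energy (mul m) (mGl m) i1.
  split => //.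
    apply: (@le_trans _ _ (\int[lam]_x (am^-1 * enl m x))).
      by apply: le_rint => //; [exact: intbZ|move=> x; exact: le_energy_fun].
    by rewrite rintZ// ler_pdivrMl// (le_trans i2)// ge_min lexx.
  apply: (@le_trans _ _ (\int[lam]_x (enl m x))).
    by apply: le_rint => // x; exact: (le_energy_grad (fun x => u m x - v x) (fun x => G m x - H x) x).
  by rewrite (le_trans i2)// ge_min lexx orbT.
have [N1 HN1] := small_u _ ltr01; have [j1 _ j2 _] := HN1 _ (leqnn N1).
have [_ _ iu1 iG1 _] := hw N1.
have mn (f : 'rV[R]_n -> R) : measurable_fun setT f -> measurable_fun setT (fun x => `|f x|).
  by move=> mf; exact: measurableT_comp.
have iv : intb (fun x => `|v x| `^ p).
  apply: (@integrable_powR_norm _ _ p v (fun x => `|u N1 x| + `|u N1 x - v x|) (ltW p0) mv).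
    by move=> x; have := ler_normB (u N1 x) (u N1 x - v x); rewrite opprB addrC subrK.
  by apply: integrable_powRD => //; [exact: ltW|exact: mn|exact: mn].
have iH : intb (fun x => enorm (H x) `^ p).
  apply: (intb_le _ (integrable_powRD (ltW p0) (measurable_enorm (mG N1)) (measurable_enorm (mGl N1)) _ _ iG1 j2)).
  - by apply: measurableT_comp (measurable_powR _) _; exact: measurable_enorm.
  - by move=> x; exact: enorm_ge0.
  - by move=> x; exact: enorm_ge0.
  - move=> x; rewrite ger0_norm ?powR_ge0//; apply: (ge0_ler_powR (ltW p0)).
    + by rewrite nnegrE enorm_ge0.
    + by rewrite nnegrE addr_ge0 ?enorm_ge0.
    + by have := enormD (G N1 x) (- (G N1 x - H x)); rewrite enormN opprB addrC subrK.
split => // phi tphi i; apply/eqP; rewrite -subr_eq0 -normr_le0; apply/ler_addgt0Pl => e e0; rewrite addr0.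
have mphi := test_measurable tphi; have mD := test_derive_measurable i tphi.
have bphi := test_function_bounded_support tphi; have bD := test_derive_bounded_support i tphi.
have e20 : 0 < e / 2 by rewrite divr_gt0.
have [d1 d10 Hd1] := test_integral_small mD bD e20.
have [d2 d20 Hd2] := test_integral_small mphi bphi e20.
have dm : 0 < Num.min d1 d2 by rewrite lt_min d10.
have [N2 HN2] := small_u _ dm.
have := HN2 N2 (leqnn _); set m := N2 => -[k1 k2 k3 k4].
have [_ _ ium iGm wGm] := hw m.
have k5 : intb (fun x => `|(G m x - H x) ord0 i| `^ p).
  by apply: (integrable_powR_norm (ltW p0) (mGl m i) _ k3) => x; exact: coor_le_enorm.
have k6 : \int[lam]_x (`|(G m x - H x) ord0 i| `^ p) <= d2.
  apply: (@le_trans _ _ (\int[lam]_x (enorm (G m x - H x) `^ p))).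
    apply: le_rint => // x; apply: (ge0_ler_powR (ltW p0)); rewrite ?nnegrE ?enorm_ge0//.
    exact: coor_le_enorm.
  by rewrite (le_trans k4)// ge_min lexx orbT.
have h1 := Hd1 _ (mul m) k1 (le_trans k2 (ge_min_l _ _)); have h2 := Hd2 _ (mGl m i) k5 k6.
have lf f psi : measurable_fun setT f -> intb (fun x => `|f x| `^ p) ->
    measurable_fun setT psi -> bounded_support psi -> intb (fun x => f x * psi x).
  move=> mf jf mpsi bpsi; apply: locally_integrable_mul => //.
  exact: (locally_integrable_powR n0 np mf jf).
have iGmi : intb (fun x => `|G m x ord0 i| `^ p).
  by apply: (integrable_powR_norm (ltW p0) (mG m i) _ iGm) => x; exact: coor_le_enorm.
have iHi : intb (fun x => `|H x ord0 i| `^ p).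
  by apply: (integrable_powR_norm (ltW p0) (mH i) _ iH) => x; exact: coor_le_enorm.
have E1 : \int[lam]_x ((u m x - v x) * 'D_(basis_rV R i) phi x) =
    \int[lam]_x (u m x * 'D_(basis_rV R i) phi x) - \int[lam]_x (v x * 'D_(basis_rV R i) phi x).
  by rewrite -rintB; [congr Rintegral; apply/funext => x; rewrite mulrBl|exact: lf|exact: lf].
have E2 : \int[lam]_x ((G m x - H x) ord0 i * phi x) =
    \int[lam]_x (G m x ord0 i * phi x) - \int[lam]_x (H x ord0 i * phi x).
  rewrite -rintB; [congr Rintegral; apply/funext => x; rewrite !mxE mulrBl//|exact: (lf (fun x => G m x ord0 i))|exact: (lf (fun x => H x ord0 i))].
rewrite E1 (wGm phi tphi i) in h1; rewrite E2 in h2.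
move: h1 h2; set a1 := \int[lam]_x (G m x ord0 i * phi x); set a2 := Rintegral _ _ _; set a3 := Rintegral _ _ _ => h1 h2.
have -> : a2 - - a3 = - ((- a1 - a2) + (a1 - a3)) by ring.
by rewrite normrN (le_trans (ler_normD _ _))// (splitr e); exact: lerD h1 h2.
Qed.

End completeness.

(** * Superposition operators *)

Section scalar_functions.
Context (R : realType).
Local Notation leb := (@lebesgue_measure R).

Lemma uniform_continuity_segment (phi : R -> R) (M e : R) : continuous phi -> 0 < e ->
  exists2 rho : R, 0 < rho & forall a t, `|a| <= M -> `|t| <= rho -> `|phi (a + t) - phi a| <= e.
Proof.
move=> cphi e0; have cK : compact (`[- M, M]%classic : set R) by exact: segment_compact.
move/compact_near_coveringP : cK => cK.
have := cK R (nbhs (0 : R)) (fun t a => `|phi (a + t) - phi a| <= e) _.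
case=> [a _|rho /= rho0 H].
  have c2 : {for (a, 0), continuous (fun z : R * R => phi (z.1 + z.2) - phi z.1)}.
    apply: cvgB; last by apply: (cvg_comp _ _ (@cvg_fst _ _ _ _ _)); exact: cphi.
    apply: (cvg_comp (fun z : R * R => z.1 + z.2) phi (add_continuous _)); exact: cphi.
  have /cvgrPdist_le := c2 => /(_ _ e0) /=.
  by apply: filterS => -[y t] /=; rewrite addr0 subrr sub0r normrN.
exists (rho / 2); first by rewrite divr_gt0.
move=> a t aM ta; apply: (H t).
  by rewrite /ball_ /= sub0r normrN (le_lt_trans ta)// ltr_pdivrMr// ltr_pMr// ltr1n.
by rewrite /= in_itv /= -ler_norml.
Qed.

Variable phi : R -> R.
Hypothesis cphi : continuous phi.
(** Scalar primitives are written as [primitive] over a dummy space of dimension 0: the point does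
    not enter the integral, so the results apply to [primitive g x] by conversion. *)
Local Notation P := (primitive (fun _ : 'rV[R]_0 => phi) 0).

Let iphi (a b : R) : leb.-integrable `[a, b] (EFin \o phi).
Proof.
by apply: continuous_compact_integrable; [exact: segment_compact|exact: continuous_subspaceT].
Qed.

(** [primitive] is defined by cases on the sign of t; comparing it with the integral from - K
    removes the cases on a bounded interval. *)
Lemma primitive_antiderivative (K : R) : 0 < K -> exists Phi : R -> R,
  (forall x, - K < x < K -> is_derive x 1 Phi (phi x)) /\
  (forall t, - K < t < K -> P t = Phi t - Phi 0).
Proof.
move=> K0; pose Phi x := \int[leb]_(t in `[- K, x]) phi t.
have dPhi x : - K < x < K -> is_derive x 1 Phi (phi x).
  move=> /andP[x1 x2]; have := @continuous_FTC1_closed R phi (- K) x K x2 (iphi _ _) x1 (@cphi x).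
  move=> [d1 d2]; apply: DeriveDef; [exact: d1|by rewrite -derive1E d2].
have cPhi x : - K < x < K -> {for x, continuous Phi}.
  move=> /dPhi d; apply/differentiable_continuous/derivable1_diffP.
  exact: (@ex_derive _ _ _ _ _ _ _ d).
have step a b : - K < a -> b < K -> a < b -> \int[leb]_(t in `[a, b]) phi t = Phi b - Phi a.
  move=> aK bK ab; rewrite /Rintegral (@continuous_FTC2 R phi Phi a b ab)//.
  - exact: continuous_subspaceT.
  - split.
    + move=> x; rewrite in_itv /= => /andP[x1 x2].
      have d : is_derive x 1 Phi (phi x) by apply: dPhi; rewrite (lt_trans aK)// (lt_trans x2).
      exact: (@ex_derive _ _ _ _ _ _ _ d).
    + by apply: cvg_at_right_filter; apply: cPhi; rewrite aK (lt_trans ab).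
    + by apply: cvg_at_left_filter; apply: cPhi; rewrite bK (lt_trans aK).
  - move=> x; rewrite in_itv /= => /andP[x1 x2]; rewrite derive1E.
    have d : is_derive x 1 Phi (phi x) by apply: dPhi; rewrite (lt_trans aK)// (lt_trans x2).
    exact: (@derive_val _ _ _ _ _ _ _ d).
exists Phi; split => // t /andP[t1 t2]; rewrite /primitive.
have [t0|t0|<-] := ltgtP 0 t.
- by rewrite step// oppr_lt0.
- by rewrite step// opprB.
- by rewrite subrr set_itv1 Rintegral_set1.
Qed.

Lemma primitive_MVT (a b : R) : exists2 xi, Num.min a b <= xi <= Num.max a b &
  P b - P a = phi xi * (b - a).
Proof.
wlog ab : a b / a <= b => [hw|].
  case/orP: (le_total a b) => [/hw//|/hw[xi h E]].
  by exists xi; [rewrite minC maxC|rewrite -opprB E -mulrN opprB].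
pose K := `|a| + `|b| + 1; have K0 : 0 < K by rewrite ltr_wpDl// addr_ge0.
have [Phi [dPhi PE]] := primitive_antiderivative K0.
have bound x : a <= x <= b -> - K < x < K.
  move=> /andP[h1 h2]; apply/andP; split.
    by have := ler_norm (- a); have := normr_ge0 b; rewrite normrN /K; lra.
  by have := ler_norm b; have := normr_ge0 a; rewrite /K; lra.
have [] := @MVT_segment R Phi phi a b ab.
- move=> x; rewrite in_itv /= => /andP[h1 h2]; apply: dPhi; apply: bound.
  by rewrite !ltW.
- apply: continuous_in_subspaceT => x; rewrite inE /= in_itv /= => /bound /dPhi d.
  apply/differentiable_continuous/derivable1_diffP.
  exact: (@ex_derive _ _ _ _ _ _ _ d).
move=> xi; rewrite in_itv /= => h E; exists xi; first by rewrite min_l ?max_r.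
by rewrite !PE ?bound ?ab ?lexx// -E; ring.
Qed.

Lemma primitive0 : P 0 = 0.
Proof. by rewrite /primitive lexx set_itv1 Rintegral_set1. Qed.

Lemma primitive_lipschitz (s m t t' : R) : (forall x, `|x| <= s -> `|phi x| <= m) ->
  `|t| <= s -> `|t'| <= s -> `|P t - P t'| <= m * `|t - t'|.
Proof.
move=> hm ts ts'; have [xi h ->] := primitive_MVT t' t.
rewrite normrM ler_wpM2r// hm// ler_norml.
move: h ts ts'; rewrite !ler_norml => /andP[]; have [_|_] := leP t' t; lra.
Qed.

Lemma primitive_expansion (a t e : R) : (forall s, `|s| <= `|t| -> `|phi (a + s) - phi a| <= e) ->
  `|P (a + t) - P a - phi a * t| <= e * `|t|.
Proof.
move=> h; have [xi hx ->] := primitive_MVT a (a + t).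
have -> : phi xi * (a + t - a) - phi a * t = (phi (a + (xi - a)) - phi a) * t.
  by rewrite subrKC; ring.
rewrite normrM ler_wpM2r// h//.
move: hx; have [_|_] := leP a (a + t) => /andP[h1 h2]; rewrite ler_norml;
  have := ler_norm t; have := ler_norm (- t); rewrite normrN; lra.
Qed.

End scalar_functions.

Section caratheodory_scalar.
Context d (T : measurableType d) (R : realType).
Local Notation RM := (measurableTypeR R).

Lemma measurable_caratheodory1 (g : T -> R -> R) :
  (forall t, measurable_fun setT (g ^~ t)) -> (forall x, continuous (g x)) ->
  measurable_fun setT (fun w : T * RM => g w.1 w.2).
Proof.
move=> mg cg; pose h x (v : 'rV[R]_1) := g x (v ord0 ord0).
have mh := @measurable_caratheodory _ T R 1 h (fun y => mg _).
have {}mh := mh (fun x v => cvg_comp _ _ (@coord_continuous R 1 1 ord0 ord0 v) (@cg x _)).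
have mc : measurable_fun setT (fun w : T * RM => (w.1, const_mx w.2 : 'rV[R]_1)).
  apply: measurable_fun_pair; first exact: measurable_fst.
  by apply: measurable_fun_rVP => i; under eq_fun do rewrite mxE; exact: measurable_snd.
by have := measurableT_comp mh mc; rewrite /h /comp /=; under eq_fun do rewrite mxE.
Qed.

Lemma measurable_superposition (g : T -> R -> R) (w : T -> R) :
  (forall t, measurable_fun setT (g ^~ t)) -> (forall x, continuous (g x)) ->
  measurable_fun setT w -> measurable_fun setT (fun x => g x (w x)).
Proof.
move=> mg cg mw; have mc : measurable_fun setT (fun x => (x, w x : RM)).
  by apply: measurable_fun_pair.
exact: (measurableT_comp (measurable_caratheodory1 mg cg) mc).
Qed.

End caratheodory_scalar.

(** * Superposition operators on bounded functions *)

Section superposition.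
Context (R : realType) (n : nat).
Local Notation lam := (@lebesgue_borel R n).
Local Notation leb := (@lebesgue_measure R).
Local Notation RM := (measurableTypeR R).
Local Notation intb f := (lam.-integrable setT (EFin \o f)).
Variables (g : 'rV[R]_n -> R -> R) (m : R -> 'rV[R]_n -> R).
Hypotheses (mg : forall t, measurable_fun setT (g ^~ t)) (cg : forall x, continuous (g x))
  (im : forall s, intb (m s)) (gm : forall (s : R) x (t : R), `|t| <= s -> `|g x t| <= m s x).
Local Notation F := (primitive g).

Lemma measurable_primitive t : measurable_fun setT (F ^~ t).
Proof.
have mj := measurable_caratheodory1 mg cg.
have H (a b : R) : measurable_fun setT (fun x => \int[leb]_(xi in `[a, b]) g x xi).
  rewrite (_ : (fun x => _) = fun x => \int[leb]_xi (\1_(`[a, b]%classic : set RM) xi * g x xi)).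
    apply: (measurable_rint2 leb (f := fun x (xi : RM) => \1_(`[a, b]%classic : set RM) xi * g x xi)).
    apply: measurable_funM => //.
    apply: (@measurableT_comp _ _ _ _ _ _ (\1_(`[a, b]%classic : set RM) : RM -> R)); last exact: measurable_snd.
    by apply: measurable_indic; exact: measurable_itv.
  apply/funext => x; rewrite Rintegral_mkcond; congr Rintegral.
  by rewrite patch_indic; apply/funext => xi; rewrite /= mulrC.
rewrite /primitive; case: (leP 0 t) => _; first exact: H.
by have := measurableT_comp (@oppr_measurable R setT) (H t 0).
Qed.

Lemma primitive_lip s x t t' : `|t| <= s -> `|t'| <= s -> `|F x t - F x t'| <= m s x * `|t - t'|.
Proof.
by move=> ts ts'; apply: (primitive_lipschitz (@cg x)) ts ts' => xi; exact: gm.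
Qed.

Lemma primitive_le s x t : `|t| <= s -> `|F x t| <= m s x * `|t|.
Proof.
move=> ts; have E0 : F x 0 = 0 := primitive0 (g x).
have := @primitive_lip s x t 0 ts; rewrite E0 normr0 !subr0; apply.
exact: le_trans ts.
Qed.

Lemma continuous_primitive x : continuous (F x).
Proof.
move=> t; apply/cvgrPdist_le => e e0; pose s := `|t| + 1; pose K := m s x.
have ts : `|t| <= s by rewrite lerDl.
have K0 : 0 <= K := le_trans (normr_ge0 _) (gm x ts).
pose dl := Num.min 1 (e / (K + 1)).
have dl0 : 0 < dl by rewrite lt_min ltr01 divr_gt0// ltr_wpDl.
have /cvgrPdist_le/(_ _ dl0) : y @[y --> t] --> t by exact: cvg_id.
apply: filterS => y; rewrite le_min => /andP[h1 h2].
have ys : `|y| <= s.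
  have -> : y = t - (t - y) by rewrite subKr.
  by rewrite (le_trans (ler_normB _ _))// lerD2l.
apply: (le_trans (primitive_lip x ts ys)); apply: (@le_trans _ _ ((K + 1) * `|t - y|)).
  by rewrite ler_wpM2r// lerDl.
by rewrite mulrC -ler_pdivlMr// ltr_wpDl.
Qed.

Let dominated (q : nat -> 'rV[R]_n -> R) (k : 'rV[R]_n -> R) :
  (forall j, measurable_fun setT (q j)) -> intb k ->
  {ae lam, forall x, forall j, `|q j x| <= k x} ->
  {ae lam, forall x, q j x @[j --> \oo] --> (0 : R)} ->
  forall e : R, 0 < e -> exists j0, forall j, (j0 <= j)%N -> \int[lam]_x `|q j x| <= e.
Proof.
move=> mq ik qk q0 e e0.
have [|||||_ _] := @rint_dominated _ _ _ lam q (fun=> 0) k => //.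
move=> /cvgrPdist_le /(_ _ e0)[j0 _ H]; exists j0 => j jj.
have := H j jj; rewrite sub0r normrN ger0_norm; last exact: rint_ge0.
by under eq_fun do rewrite subr0.
Qed.

Let ae_intb (q k : 'rV[R]_n -> R) : measurable_fun setT q -> intb k ->
  {ae lam, forall x, `|q x| <= k x} -> intb q.
Proof.
move=> mq ik qk; have [|||||-> _ _] // := @rint_dominated _ _ _ lam (fun=> q) q k.
  by apply: aeW => x; exact: cvg_cst.
by apply: ae_mono qk.
Qed.

Lemma integrable_superposition (u : 'rV[R]_n -> R) (M : R) :
  measurable_fun setT u -> {ae lam, forall x, `|u x| <= M} ->
  [/\ intb (fun x => g x (u x)), \int[lam]_x `|g x (u x)| <= \int[lam]_x m M x,
   intb (fun x => F x (u x)) & \int[lam]_x `|F x (u x)| <= M * \int[lam]_x m M x].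
Proof.
move=> mu uM.
have gu : {ae lam, forall x, `|g x (u x)| <= m M x} by apply: ae_mono uM => x; exact: gm.
have Fu : {ae lam, forall x, `|F x (u x)| <= M * m M x}.
  apply: ae_mono uM => x h; apply: (le_trans (primitive_le x h)); rewrite mulrC.
  by rewrite ler_wpM2r// (le_trans (normr_ge0 _) (gm x h)).
have ig : intb (fun x => g x (u x)).
  by apply: (ae_intb (k := m M)) => //; exact: measurable_superposition.
have iF : intb (fun x => F x (u x)).
  apply: (ae_intb (k := fun x => M * m M x)) => //; last exact: intbZ.
  exact: (measurable_superposition measurable_primitive continuous_primitive).
split=> //; first by apply: ae_le_rint => //; exact: intb_norm.
by rewrite -rintZ//; apply: ae_le_rint => //; [exact: intb_norm|exact: intbZ].
Qed.

(** The modulus of continuity of g varies with x, so the proof is by contradiction: offending pairs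
    at distance 1/(j+1) give differences that tend to 0 pointwise and are dominated by an integrable
    function. *)
Lemma superposition_uniform (M e : R) : 0 < e -> exists2 rho : R, 0 < rho & forall u v : 'rV[R]_n -> R,
  measurable_fun setT u -> measurable_fun setT v ->
  {ae lam, forall x, `|u x| <= M} -> {ae lam, forall x, `|v x| <= M} ->
  {ae lam, forall x, `|u x - v x| <= rho} -> \int[lam]_x `|g x (u x) - g x (v x)| <= e.
Proof.
move=> e0; apply: contrapT => neg.
have {}neg j : exists uv : ('rV[R]_n -> R) * ('rV[R]_n -> R),
    [/\ measurable_fun setT uv.1, measurable_fun setT uv.2,
      {ae lam, forall x, [/\ `|uv.1 x| <= M, `|uv.2 x| <= M & `|uv.1 x - uv.2 x| <= j.+1%:R^-1]}
    & e < \int[lam]_x `|g x (uv.1 x) - g x (uv.2 x)|].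
  apply: contrapT => h; apply: neg; exists j.+1%:R^-1; first by rewrite invr_gt0.
  move=> u v mu mv uM vM uv; rewrite leNgt; apply/negP => el; apply: h; exists (u, v).
  split => //; apply: filterS (filterI uM (filterI vM uv)) => x [h1 [h2 h3]]; by split.
have [w Hw] := choice neg.
pose q j x := g x ((w j).1 x) - g x ((w j).2 x).
have aew : {ae lam, forall x, forall j, [/\ `|(w j).1 x| <= M, `|(w j).2 x| <= M &
    `|(w j).1 x - (w j).2 x| <= j.+1%:R^-1]}.
  by apply: ae_countable => j; case: (Hw j).
have [||||j0 /(_ j0 (leqnn _))] := @dominated q (fun x => 2 * m M x) _ _ _ _ e e0.
- by move=> j; apply: measurable_funB; apply: measurable_superposition => //; case: (Hw j).
- exact: intbZ.
- apply: filterS aew => x hx j; have [h1 h2 _] := hx j.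
  by rewrite (le_trans (ler_normB _ _))// mulr2n mulrDl !mul1r lerD// gm.
- apply: filterS aew => x hx; apply/cvgrPdist_le => d d0.
  have [rho rho0 Hr] := uniform_continuity_segment M (@cg x) d0.
  near=> j; rewrite sub0r normrN /q; have [h1 h2 h3] := hx j.
  have -> : (w j).1 x = (w j).2 x + ((w j).1 x - (w j).2 x) by rewrite addrC subrK.
  apply: Hr => //; apply: (le_trans h3).
  have : `|j.+1%:R^-1| <= rho :> R by near: j; apply: (@cvgr0_norm_le _ _ _ _ _ (@harmonic R)) => //; exact: cvg_harmonic.
  by rewrite ger0_norm.
by rewrite leNgt; case: (Hw j0) => _ _ _ ->.
Unshelve. all: by end_near. Qed.

(** The same contradiction for the remainder divided by eta: the Lipschitz bound of F and the bound
    on g dominate it, and the first-order expansion at each point sends it to 0. *)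
Lemma primitive_uniform (M e : R) : 0 < e -> exists2 rho : R, 0 < rho & forall (u h : 'rV[R]_n -> R) (eta : R),
  0 < eta <= rho -> measurable_fun setT u -> measurable_fun setT h ->
  {ae lam, forall x, `|u x| <= M} -> {ae lam, forall x, `|h x| <= eta} ->
  \int[lam]_x `|F x (u x + h x) - F x (u x) - g x (u x) * h x| <= e * eta.
Proof.
move=> e0; apply: contrapT => neg.
have {}neg j : exists uh : (('rV[R]_n -> R) * ('rV[R]_n -> R)) * R,
    [/\ 0 < uh.2 <= j.+1%:R^-1, measurable_fun setT uh.1.1, measurable_fun setT uh.1.2,
      {ae lam, forall x, `|uh.1.1 x| <= M /\ `|uh.1.2 x| <= uh.2}
    & e * uh.2 < \int[lam]_x `|F x (uh.1.1 x + uh.1.2 x) - F x (uh.1.1 x) - g x (uh.1.1 x) * uh.1.2 x|].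
  apply: contrapT => h; apply: neg; exists j.+1%:R^-1; first by rewrite invr_gt0.
  move=> u v eta he mu mv uM vM; rewrite leNgt; apply/negP => el; apply: h; exists (u, v, eta).
  by split => //; exact: filterI.
have [w Hw] := choice neg.
pose q j x := (w j).2^-1 * (F x ((w j).1.1 x + (w j).1.2 x) - F x ((w j).1.1 x) - g x ((w j).1.1 x) * (w j).1.2 x).
have aew : {ae lam, forall x, forall j, `|(w j).1.1 x| <= M /\ `|(w j).1.2 x| <= (w j).2}.
  by apply: ae_countable => j; case: (Hw j).
have w0 j : 0 < (w j).2 by case: (Hw j) => /andP[].
have w1 j : (w j).2 <= 1.
  by case: (Hw j) => /andP[_ h] _ _ _ _; rewrite (le_trans h)// invf_le1 ?ler1n.
have mq j : measurable_fun setT (q j).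
  have [_ m1 m2 _ _] := Hw j; apply: measurable_funM => //; apply: measurable_funB.
    apply: measurable_funB.
      by apply: (measurable_superposition measurable_primitive continuous_primitive); exact: measurable_funD.
    exact: (measurable_superposition measurable_primitive continuous_primitive).
  by apply: measurable_funM => //; exact: measurable_superposition.
have [|||j0 /(_ j0 (leqnn _))] := @dominated q (fun x => 2 * m (M + 1) x) mq _ _ _ e e0.
- exact: intbZ.
- apply: filterS aew => x hx j; have [h1 h2] := hx j.
  have h3 : `|(w j).1.1 x| <= M + 1 by rewrite (le_trans h1)// lerDl.
  have h4 : `|(w j).1.1 x + (w j).1.2 x| <= M + 1.
    by rewrite (le_trans (ler_normD _ _))// lerD// (le_trans h2).
  rewrite normrM gtr0_norm ?invr_gt0// ler_pdivrMl//.
  apply: (le_trans (ler_normB _ _)).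
  have k1 := primitive_lip x h4 h3; rewrite (_ : _ + _ - _ = (w j).1.2 x) in k1; last by ring.
  have k2 := gm x h3; have mM0 := le_trans (normr_ge0 _) k2.
  have -> : (w j).2 * (2 * m (M + 1) x) = m (M + 1) x * (w j).2 + m (M + 1) x * (w j).2 by ring.
  rewrite normrM lerD//; last by apply: ler_pM.
  by apply: (le_trans k1); rewrite ler_wpM2l.
- apply: filterS aew => x hx; apply/cvgrPdist_le => d d0.
  have [rho rho0 Hr] := uniform_continuity_segment M (@cg x) d0.
  near=> j; rewrite sub0r normrN /q; have [h1 h2] := hx j.
  rewrite normrM gtr0_norm ?invr_gt0// ler_pdivrMl//.
  apply: (@le_trans _ _ (d * `|(w j).1.2 x|)); last by rewrite mulrC ler_wpM2r// ltW.
  apply: (primitive_expansion (@cg x)) => s sh; apply: Hr => //; apply: (le_trans sh); apply: (le_trans h2).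
  have : `|j.+1%:R^-1| <= rho :> R by near: j; apply: (@cvgr0_norm_le _ _ _ _ _ (@harmonic R)) => //; exact: cvg_harmonic.
  by rewrite ger0_norm//; apply: le_trans; case: (Hw j) => /andP[].
rewrite leNgt; have [_ _ _ _ h] := Hw j0.
under eq_fun do rewrite normrM gtr0_norm ?invr_gt0//.
rewrite rintZ_measurable; last first.
  apply: measurableT_comp => //.
  have := measurable_funM (measurable_cst (w j0).2) (mq j0).
  congr (measurable_fun setT _); apply/funext => x; by rewrite /= /q mulrA mulfV ?gt_eqF// mul1r.
by rewrite ltr_pdivlMl// mulrC h.
Unshelve. all: by end_near. Qed.

Let cvg_norm_bound (q : nat -> R) (l M : R) : (forall j, `|q j| <= M) ->
  q j @[j --> \oo] --> l -> `|l| <= M.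
Proof.
move=> qM ql; have h : `|q j| @[j --> \oo] --> `|l| by exact: cvg_norm.
rewrite -(cvg_lim _ h)//.
by apply: limr_le; [exact: cvgP h|exact: nearW].
Qed.

(** Dominated convergence to the almost everywhere limit l. At the midpoint the Lipschitz bound of F
    reduces the claim to the integrals of [m M] times |w j - l| and |w k - l|. *)
Lemma superposition_cauchy (w : nat -> 'rV[R]_n -> R) (M : R) : (forall j, measurable_fun setT (w j)) ->
  (forall j, {ae lam, forall x, `|w j x| <= M}) -> {ae lam, forall x, cvgn (fun j => w j x)} ->
  forall e : R, 0 < e -> exists j0, forall j k, (j0 <= j)%N -> (j0 <= k)%N ->
    \int[lam]_x `|g x (w j x) - g x (w k x)| <= e /\
    \int[lam]_x `|F x (w j x) - F x (2^-1 * (w j x + w k x))| <= e.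
Proof.
move=> mw wM cw e e0.
have [l ml hl] := measurable_limit mw.
have aew : {ae lam, forall x, (forall j, `|w j x| <= M) /\ w j x @[j --> \oo] --> l x}.
  by apply: ae_and; [exact: ae_countable|apply: ae_mono cw => x /hl].
have e40 : 0 < e / 2 by rewrite divr_gt0.
pose K := \int[lam]_x m M x.
have [||||j0 H0] := @dominated (fun j x => g x (w j x) - g x (l x)) (fun x => 2 * m M x) _ _ _ _ _ e40.
- by move=> j; apply: measurable_funB; apply: measurable_superposition.
- exact: intbZ.
- apply: ae_mono aew => x [h1 h2] j.
  have lM : `|l x| <= M by exact: cvg_norm_bound h1 h2.
  by rewrite (le_trans (ler_normB _ _))// mulr2n mulrDl !mul1r lerD// gm.
- apply: ae_mono aew => x [h1 h2]; rewrite -(subrr (g x (l x))).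
  apply: cvgB; last exact: cvg_cst.
  exact: (cvg_comp _ _ h2 (@cg x _)).
have mwl i : {ae lam, forall x, `|m M x * (w i x - l x)| <= 2 * `|M| * m M x}.
  apply: ae_mono aew => x [h1 h2].
  have lM : `|l x| <= M by exact: cvg_norm_bound h1 h2.
  have m0 : 0 <= m M x := le_trans (normr_ge0 _) (gm x lM).
  rewrite normrM ger0_norm// mulrC ler_wpM2r// (le_trans (ler_normB _ _))//.
  by rewrite mulr2n mulrDl !mul1r lerD// (le_trans _ (ler_norm M)).
have [||||j1 H1] := @dominated (fun j x => m M x * (w j x - l x)) (fun x => 2 * `|M| * m M x) _ _ _ _ _ e40.
- move=> j; apply: measurable_funM; first exact: intb_measurable.
  exact: measurable_funB.
- exact: intbZ.
- by apply: ae_countable => j; exact: mwl.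
- apply: ae_mono aew => x [h1 h2]; rewrite -(mulr0 (m M x)) -(subrr (l x)).
  by apply: cvgM; [exact: cvg_cst|apply: cvgB => //; exact: cvg_cst].
exists (maxn j0 j1) => j k; rewrite !geq_max => /andP[a1 a2] /andP[b1 b2].
have lM : {ae lam, forall x, `|l x| <= M}.
  by apply: ae_mono aew => x [h1 h2]; exact: cvg_norm_bound h1 h2.
have [il _ _ _] := integrable_superposition ml lM.
have ig i : intb (fun x => g x (w i x)) by have [] := integrable_superposition (mw i) (wM i).
have iF i : intb (fun x => F x (w i x)) by have [] := integrable_superposition (mw i) (wM i).
have im' i : intb (fun x => m M x * (w i x - l x)).
  apply: (ae_intb (k := fun x => 2 * `|M| * m M x)); last exact: mwl.
    by apply: measurable_funM; [exact: intb_measurable|exact: measurable_funB].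
  exact: intbZ.
split.
  apply: (@le_trans _ _ (\int[lam]_x (`|g x (w j x) - g x (l x)| + `|g x (w k x) - g x (l x)|))).
    apply: le_rint; [by apply: intb_norm; exact: intbB| |].
      by apply: intbD; apply: intb_norm; exact: intbB.
    by move=> x; rewrite (distrC (g x (w k x))); exact: ler_distD.
  rewrite rintD; [|by apply: intb_norm; exact: intbB..].
  by rewrite (splitr e) lerD// ?H0.
have mh : measurable_fun setT (fun x => 2^-1 * (w j x + w k x)).
  by apply: measurable_funM => //; exact: measurable_funD.
have hM : {ae lam, forall x, `|2^-1 * (w j x + w k x)| <= M}.
  apply: ae_mono aew => x [h1 _]; rewrite normrM gtr0_norm ?invr_gt0//.
  by rewrite ler_pdivrMl// mulr2n mulrDl !mul1r (le_trans (ler_normD _ _))// lerD.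
have [_ _ ih _] := integrable_superposition mh hM.
apply: (@le_trans _ _ (\int[lam]_x (`|m M x * (w j x - l x)| + `|m M x * (w k x - l x)|))).
  apply: ae_le_rint; [by apply: intb_norm; exact: intbB| |].
    by apply: intbD; exact: intb_norm.
  apply: ae_mono (ae_and aew hM) => x [[h1 _] h2].
  have m0 : 0 <= m M x := le_trans (normr_ge0 _) (gm x h2).
  apply: (le_trans (primitive_lip x (h1 j) h2)).
  rewrite !normrM (ger0_norm m0) -mulrDr ler_wpM2l//.
  have -> : w j x - 2^-1 * (w j x + w k x) = 2^-1 * ((w j x - l x) - (w k x - l x)) by field.
  rewrite normrM gtr0_norm ?invr_gt0// ler_pdivrMl// (le_trans (ler_normB _ _))//.
  by rewrite ler_peMl ?ler1n ?addr_ge0.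
rewrite rintD; [|exact: intb_norm..].
by rewrite (splitr e) lerD// ?H1.
Qed.

End superposition.

Section sobolev_space.
Context (R : realType) (n : nat) (p : R) (n0 : (0 < n)%N) (np : n%:R < p).

Let p0 : 0 < p.
Proof. by rewrite (le_lt_trans _ np). Qed.

(* The tuple only serves to make the hypotheses n0 and np part of the predicate,
   so that the module structure built from them can be inferred. *)
Definition sobolev_pair (w : ('rV[R]_n -> R) * ('rV[R]_n -> 'rV[R]_n)) : bool :=
  (n0, np, `[< borel_sobolev p w.1 w.2 >]).2.

Lemma sobolev_pair_submod : submod_closed sobolev_pair.
Proof.
split; first by apply/asboolP; exact: (borel_sobolev0 n p0).
move=> k [u G] [v H] /asboolP hu /asboolP hv; apply/asboolP.
exact: (borel_sobolevD n0 np (borel_sobolevZ k p0 hu) hv).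
Qed.

HB.instance Definition _ := GRing.isSubmodClosed.Build _ _ sobolev_pair
  sobolev_pair_submod.

Record sobolev_space := SobolevSpace {
  sobolev_val : ('rV[R]_n -> R) * ('rV[R]_n -> 'rV[R]_n) ;
  _ : sobolev_val \in sobolev_pair }.

HB.instance Definition _ := [isSub for sobolev_val].
HB.instance Definition _ := gen_eqMixin sobolev_space.
HB.instance Definition _ := gen_choiceMixin sobolev_space.
HB.instance Definition _ := [SubChoice_isSubLmodule of sobolev_space by <:].

End sobolev_space.

(** * The variational problem *)

Section energy_functional.
Context (R : realType) (n : nat) (p : R) (n0 : (0 < n)%N) (np : n%:R < p).
Local Notation lam := (@lebesgue_borel R n).
Local Notation intb f := (lam.-integrable setT (EFin \o f)).
Local Notation V := (sobolev_space n0 np).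
Variables (b : 'rV[R]_n -> R) (am an : R).
Hypotheses (mb : measurable_fun setT b) (am0 : 0 < am) (b_bnd : forall x, am <= b x <= an).

Let p1 : 1 < p.
Proof. by rewrite (le_lt_trans _ np)// ler1n. Qed.
Let p0 : 0 < p. Proof. exact: lt_trans p1. Qed.
Let b0 x : 0 <= b x.
Proof. by case/andP: (b_bnd x) => h _; exact: le_trans (ltW am0) h. Qed.

Definition sobolev_fun (w : V) : 'rV[R]_n -> R := (sobolev_val w).1.
Definition sobolev_grad (w : V) : 'rV[R]_n -> 'rV[R]_n := (sobolev_val w).2.

Lemma sobolev_spaceP w : borel_sobolev p (sobolev_fun w) (sobolev_grad w).
Proof. by case: w => w hw; exact/asboolP. Qed.

Lemma sobolev_funD w v x : sobolev_fun (w + v) x = sobolev_fun w x + sobolev_fun v x.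
Proof. by []. Qed.

Lemma sobolev_funZ k w x : sobolev_fun (k *: w) x = k * sobolev_fun w x.
Proof. by []. Qed.

Lemma sobolev_gradD w v x : sobolev_grad (w + v) x = sobolev_grad w x + sobolev_grad v x.
Proof. by []. Qed.

Lemma sobolev_gradZ k w x : sobolev_grad (k *: w) x = k *: sobolev_grad w x.
Proof. by []. Qed.

Lemma sobolev_fun0 x : sobolev_fun 0 x = 0.
Proof. by []. Qed.

Definition sobolev_energy (w : V) : R :=
  p^-1 * \int[lam]_x energy_of p b (sobolev_fun w) (sobolev_grad w) x.

Let intE (w : V) : intb (energy_of p b (sobolev_fun w) (sobolev_grad w)).
Proof. exact: (integrable_energy mb am0 b_bnd (sobolev_spaceP w)). Qed.

Lemma sobolev_energy_ge0 w : 0 <= sobolev_energy w.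
Proof.
rewrite mulr_ge0 ?invr_ge0 ?(ltW p0)//; apply: rint_ge0 => x.
exact: energy_ge0.
Qed.

Lemma sobolev_energyZ t w : sobolev_energy (t *: w) = `|t| `^ p * sobolev_energy w.
Proof.
rewrite /sobolev_energy mulrCA; congr (_ * _); rewrite -(rintZ _ (intE w)).
by congr Rintegral; apply/funext => x; exact: (energyZ p (b x) (sobolev_grad w x) (sobolev_fun w x) t).
Qed.

Lemma sobolev_energy_convex t x y : 0 <= t <= 1 ->
  sobolev_energy ((1 - t) *: x + t *: y) <=
  (1 - t) * sobolev_energy x + t * sobolev_energy y.
Proof.
move=> t01; rewrite /sobolev_energy !(mulrCA _ p^-1) -mulrDr ler_wpM2l ?invr_ge0 ?(ltW p0)//.
rewrite -(rintZ _ (intE x)) -(rintZ _ (intE y)) -rintD; [|exact: intbZ..].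
apply: le_rint; [exact: intE|by apply: intbD; exact: intbZ|].
move=> z; exact: (energy_convex p1 (sobolev_grad x z) (sobolev_grad y z) (sobolev_fun x z) (sobolev_fun y z) (b0 z) t01).
Qed.

Lemma sobolev_energy_uniformly_convex e : 0 < e ->
  exists2 C, 0 <= C & forall x y, sobolev_energy (x - y) <=
    e * (sobolev_energy x + sobolev_energy y) +
    C * ((sobolev_energy x + sobolev_energy y) / 2 - sobolev_energy (2^-1 *: (x + y))).
Proof.
move=> e0; have [C C0 H] := energy_uniformly_convex n p1 e0; exists C => // x y.
rewrite /sobolev_energy.
set ex := \int[lam]_z _; set ez := \int[lam]_z _; set ey := \int[lam]_z _; set em := \int[lam]_z _.
have -> : e * (p^-1 * ez + p^-1 * ey) + C * ((p^-1 * ez + p^-1 * ey) / 2 - p^-1 * em) =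
  p^-1 * (e * (ez + ey) + C * (2^-1 * (ez + ey) - em)) by ring.
rewrite ler_wpM2l ?invr_ge0 ?(ltW p0)// /ex /ez /ey /em.
have i1 := intE x; have i2 := intE y; have i3 := intE (2^-1 *: (x + y)).
rewrite -rintD// -!rintZ//; last exact: intbD.
rewrite -rintB//; last by apply: intbZ; exact: intbD.
rewrite -rintZ//; last by apply: intbB => //; apply: intbZ; exact: intbD.
rewrite -rintD//; [|by apply: intbZ; exact: intbD|by apply: intbZ; apply: intbB => //; apply: intbZ; exact: intbD].
apply: le_rint; [exact: intE| |].
  apply: intbD; first by apply: intbZ; exact: intbD.
  by apply: intbZ; apply: intbB => //; apply: intbZ; exact: intbD.
move=> z; have := H (b z) (sobolev_grad x z) (sobolev_grad y z) (sobolev_fun x z) (sobolev_fun y z) (b0 z).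
  by rewrite (mulrC (energy _ _ _ _ + _)).
exact: intbD.
Qed.

Lemma sobolev_energy_complete (w : nat -> V) :
  (forall e, 0 < e -> exists n0, forall m n, (n0 <= m)%N -> (n0 <= n)%N ->
     sobolev_energy (w m - w n) <= e) ->
  exists v, forall e, 0 < e -> exists n0, forall n, (n0 <= n)%N ->
     sobolev_energy (w n - v) <= e.
Proof.
move=> hw; have [|u [G [uG huG]]] := @sobolev_complete _ _ _ n0 np b am an mb am0 b_bnd
  (fun k => sobolev_fun (w k)) (fun k => sobolev_grad (w k)) (fun k => sobolev_spaceP (w k)).
  move=> e e0; have [k hk] := hw (e / p) (divr_gt0 e0 p0); exists k => i j ki kj.
  by have := hk i j ki kj; rewrite /sobolev_energy mulrC ler_pM2r ?invr_gt0.
have hG : (u, G) \in sobolev_pair n0 np by apply/asboolP.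
exists (SobolevSpace hG) => e e0; have [k hk] := huG _ (mulr_gt0 p0 e0).
by exists k => i ki; rewrite /sobolev_energy mulrC ler_pdivrMr// mulrC; exact: hk.
Qed.

Local Notation nm w := (sobolev_energy w `^ p^-1).

Lemma integral_grad_le w : \int[lam]_x enorm (sobolev_grad w x) `^ p +
  am * \int[lam]_x `|sobolev_fun w x| `^ p <= p * sobolev_energy w.
Proof.
have [_ _ iu iG _] := sobolev_spaceP w.
rewrite /sobolev_energy mulrA mulfV ?gt_eqF// mul1r -rintZ// -rintD//; last exact: intbZ.
apply: le_rint; [by apply: intbD => //; exact: intbZ|exact: intE|] => x.
by rewrite lerD2l ler_wpM2r ?powR_ge0//; case/andP: (b_bnd x).
Qed.

Lemma sobolev_sup_bound w :
  {ae lam, forall x, `|sobolev_fun w x| `^ p <= const_k n p am `^ p * (p * sobolev_energy w)}.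
Proof.
have [mu mG iu iG wG] := sobolev_spaceP w.
apply: ae_mono (@ae_sup_bound _ _ _ _ n0 np am0 _ _ _ _ mu _ mG _
  (borel_weak_gradient_bump wG) _ _ _ _) => [x hx| | | | | |].
- apply: (le_trans hx); rewrite ler_wpM2l ?powR_ge0//; exact: integral_grad_le.
- exact: (locally_integrable_powR n0 np).
- move=> i; apply: (locally_integrable_powR n0 np) => //.
  by apply: (integrable_powR_norm (ltW p0)) iG => // x; exact: coor_le_enorm.
- by apply: rint_ge0 => x; exact: powR_ge0.
- by rewrite rint_EFin.
- by apply: rint_ge0 => x; exact: powR_ge0.
- by rewrite rint_EFin.
Qed.

(** The factor p^(1/p) undoes the 1/p in [sobolev_energy]. *)
Definition sup_constant : R := const_k n p am * p `^ p^-1.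

Lemma sup_constant_gt0 : 0 < sup_constant.
Proof. by rewrite mulr_gt0 ?powR_gt0// (const_k_gt0 n0 np am0). Qed.

Lemma sobolev_norm_bound w : {ae lam, forall x, `|sobolev_fun w x| <= sup_constant * nm w}.
Proof.
apply: ae_mono (sobolev_sup_bound w) => x hx.
have kg := const_k_gt0 n0 np am0.
rewrite -(powRr1 (normr_ge0 _)) -(mulfV (lt0r_neq0 p0)) powRrM.
have -> : sup_constant * nm w = (const_k n p am `^ p * (p * sobolev_energy w)) `^ p^-1.
  have e0 := sobolev_energy_ge0 w; rewrite /sup_constant.
  move: kg e0; move: (const_k n p am) (sobolev_energy w) => k e kg e0.
  have pe0 : 0 <= p * e by rewrite mulr_ge0// ltW.
  rewrite (powRM _ (powR_ge0 _ _) pe0) (powRM _ (ltW p0) e0) -powRrM mulfV ?gt_eqF//.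
  by rewrite powRr1 ?(ltW kg)// mulrA.
by apply: ge0_ler_powR; rewrite ?nnegrE ?invr_ge0 ?(ltW p0)// ?powR_ge0// mulr_ge0 ?powR_ge0// mulr_ge0 ?sobolev_energy_ge0 ?(ltW p0).
Qed.

(** * The nonlinear term as a perturbation of the energy *)

Section nonlinear.
Variables (g : 'rV[R]_n -> R -> R) (m : R -> 'rV[R]_n -> R) (lambda : R).
Hypotheses (mg : forall t, measurable_fun setT (g ^~ t)) (cg : forall x, continuous (g x))
  (im : forall s, intb (m s)) (gm : forall (s : R) x (t : R), `|t| <= s -> `|g x t| <= m s x)
  (lambda0 : 0 < lambda).
Local Notation F := (primitive g).
Local Notation Phi := sobolev_energy.

Definition nonlinear_form (u h : V) : R :=
  lambda * \int[lam]_x (g x (sobolev_fun u x) * sobolev_fun h x).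
Definition nonlinear_energy (u : V) : R := lambda * \int[lam]_x F x (sobolev_fun u x).
Local Notation B := nonlinear_form.
Local Notation Psi := nonlinear_energy.
Local Notation K := sup_constant.

Let mV (w : V) : measurable_fun setT (sobolev_fun w).
Proof. by case: (sobolev_spaceP w). Qed.

Let bV (w : V) M : nm w <= M -> {ae lam, forall x, `|sobolev_fun w x| <= K * M}.
Proof.
move=> wM; apply: ae_mono (sobolev_norm_bound w) => x h.
by apply: (le_trans h); rewrite ler_wpM2l// ltW// sup_constant_gt0.
Qed.

Let intb_bounded (q h : 'rV[R]_n -> R) (c : R) : intb q -> measurable_fun setT h ->
  {ae lam, forall x, `|h x| <= c} ->
  intb (fun x => q x * h x) /\ `|\int[lam]_x (q x * h x)| <= c * \int[lam]_x `|q x|.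
Proof.
move=> iq mh hc.
have hq : {ae lam, forall x, `|q x * h x| <= c * `|q x|}.
  by apply: ae_mono hc => x hx; rewrite normrM mulrC ler_wpM2r.
have iqc : intb (fun x => c * `|q x|) by apply: intbZ; exact: intb_norm.
have iqh : intb (fun x => q x * h x).
  have mqh : measurable_fun setT (fun x => q x * h x).
    by apply: measurable_funM; [exact: intb_measurable iq|exact: mh].
  have [|||||-> _ _] // := @rint_dominated _ _ _ lam (fun=> fun x => q x * h x) (fun x => q x * h x) (fun x => c * `|q x|).
    by apply: aeW => x; exact: cvg_cst.
  by apply: ae_mono hq.
split=> //; apply: (le_trans (le_norm_rint iqh)); rewrite -rintZ; last exact: intb_norm.
by apply: ae_le_rint => //; exact: intb_norm.
Qed.

Let ig (u : V) : intb (fun x => g x (sobolev_fun u x)).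
Proof. by have [] := integrable_superposition mg cg im gm (mV u) (bV (lexx (nm u))). Qed.

Let iF (u : V) : intb (fun x => F x (sobolev_fun u x)).
Proof. by have [] := integrable_superposition mg cg im gm (mV u) (bV (lexx (nm u))). Qed.

Let igh (u h : V) : intb (fun x => g x (sobolev_fun u x) * sobolev_fun h x).
Proof. by have [] := intb_bounded (ig u) (mV h) (bV (lexx (nm h))). Qed.

Lemma nonlinear_formD u x y : B u (x + y) = B u x + B u y.
Proof.
rewrite /B -mulrDr -rintD//; congr (_ * _); congr Rintegral.
by apply/funext => z; rewrite mulrDr.
Qed.

Lemma nonlinear_formZ u t x : B u (t *: x) = t * B u x.
Proof.
rewrite /B mulrCA -[in RHS]rintZ//; congr (_ * _); congr Rintegral.
by apply/funext => z; rewrite sobolev_funZ mulrCA.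
Qed.

Let intm0 s : 0 <= s -> 0 <= \int[lam]_x m s x.
Proof.
by move=> s0; apply: rint_ge0 => x; apply: (le_trans (normr_ge0 (g x 0))); rewrite gm ?normr0.
Qed.

Let Bdiff (u v h : V) (e : R) :
  \int[lam]_x `|g x (sobolev_fun u x) - g x (sobolev_fun v x)| <= e ->
  `|B u h - B v h| <= lambda * (K * nm h * e).
Proof.
move=> he; rewrite /B -mulrBr -rintB// normrM gtr0_norm// ler_wpM2l ?(ltW lambda0)//.
rewrite (_ : (fun x => _) = fun x => (g x (sobolev_fun u x) - g x (sobolev_fun v x)) * sobolev_fun h x).
  have [_ h1] := intb_bounded (intbB (ig u) (ig v)) (mV h) (bV (lexx (nm h))).
  apply: (le_trans h1); rewrite ler_wpM2l// mulr_ge0 ?powR_ge0//.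
  exact: ltW sup_constant_gt0.
by apply/funext => x; rewrite mulrBl.
Qed.

Lemma nonlinear_form_bounded M : exists2 C, 0 <= C &
  forall u h, nm u <= M -> `|B u h| <= C * nm h.
Proof.
have K0 := sup_constant_gt0.
have [M0|M0] := leP 0 M; last first.
  exists 0 => // u h uM; have := le_lt_trans uM M0; rewrite ltNge => /negP[]; exact: powR_ge0.
exists (lambda * (K * \int[lam]_x m (K * M) x)).
  by rewrite mulr_ge0 ?(ltW lambda0)// mulr_ge0 ?(ltW K0)// intm0// mulr_ge0 ?(ltW K0).
move=> u h uM; rewrite normrM gtr0_norm// -(mulrA lambda) ler_wpM2l ?(ltW lambda0)//.
have [_ h1] := intb_bounded (ig u) (mV h) (bV (lexx (nm h))).
apply: (le_trans h1); rewrite mulrAC; apply: ler_wpM2r; first exact: powR_ge0.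
apply: ler_wpM2l; first exact: ltW.
by have [] := integrable_superposition mg cg im gm (mV u) (bV uM).
Qed.

Lemma nonlinear_form_continuous M e : 0 < e -> exists2 dl, 0 < dl &
  forall u v h, nm u <= M -> nm v <= M -> nm (u - v) <= dl -> `|B u h - B v h| <= e * nm h.
Proof.
move=> e0; have K0 := sup_constant_gt0.
have [rho rho0 H] := superposition_uniform mg cg im gm (K * M) (divr_gt0 e0 (mulr_gt0 lambda0 K0)).
exists (rho / K); first exact: divr_gt0.
move=> u v h uM vM uv; have uv' : {ae lam, forall x, `|sobolev_fun u x - sobolev_fun v x| <= rho}.
  have := bV uv; rewrite mulrCA mulfV ?gt_eqF// mulr1; exact.
apply: (le_trans (Bdiff h (H _ _ (mV u) (mV v) (bV uM) (bV vM) uv'))).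
rewrite le_eqVlt; apply/orP; left; apply/eqP; field.
by rewrite !gt_eqF.
Qed.

Lemma nonlinear_energy_derivative M e : 0 < e -> exists2 dl, 0 < dl &
  forall u h, nm u <= M -> nm h <= dl -> `|Psi (u + h) - Psi u - B u h| <= e * nm h.
Proof.
move=> e0; have K0 := sup_constant_gt0.
have [rho rho0 H] := primitive_uniform mg cg im gm (K * M) (divr_gt0 e0 (mulr_gt0 lambda0 K0)).
exists (rho / K); first exact: divr_gt0.
move=> u h uM hr.
have step eta : 0 < eta <= rho -> K * nm h <= eta -> `|Psi (u + h) - Psi u - B u h| <= e / K * eta.
  move=> er hn; have hb : {ae lam, forall x, `|sobolev_fun h x| <= eta}.
    by apply: ae_mono (bV (lexx (nm h))) => x hx; exact: le_trans hx hn.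
  have h1 := H _ _ _ er (mV u) (mV h) (bV uM) hb.
  rewrite /Psi /B -!mulrBr -rintB// -rintB//; last exact: intbB.
  rewrite normrM gtr0_norm//.
  have -> : e / K * eta = lambda * (e / (lambda * K) * eta).
    by field; rewrite !gt_eqF.
  rewrite ler_wpM2l ?(ltW lambda0)//; apply: le_trans h1; apply: le_norm_rint.
  by apply: intbB => //; exact: intbB.
have Kh : K * nm h <= rho by rewrite mulrC -ler_pdivlMr.
have [h0|h0] := eqVneq (nm h) 0; last first.
  have h00 : 0 < nm h by rewrite lt_def h0 powR_ge0.
  apply: (le_trans (step (K * nm h) _ (lexx _))); first by rewrite mulr_gt0.
  by rewrite mulrA -(mulrA e) mulVf ?gt_eqF// mulr1.
(* [primitive_uniform] asks for a positive bound on h. When the norm of h is 0 this bound is made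
   arbitrarily small. *)
rewrite h0 mulr0; apply/ler_addgt0Pr => d d0; rewrite add0r.
pose eta := Num.min rho (d * (K / e)).
have eta0 : 0 < eta by rewrite lt_min rho0 mulr_gt0// divr_gt0.
apply: (le_trans (step eta _ _)); first by rewrite eta0 ge_min_l.
  by rewrite h0 mulr0 ltW.
apply: (@le_trans _ _ (e / K * (d * (K / e)))).
  by rewrite ler_wpM2l ?divr_ge0 ?(ltW e0) ?(ltW K0)// ge_min lexx orbT.
rewrite le_eqVlt; apply/orP; left; apply/eqP; field.
by rewrite !gt_eqF.
Qed.

(** Bounded energy gives a common sup bound and, by [ae_convergent_subsequence], convergence almost
    everywhere of a subsequence; [superposition_cauchy] turns this into the two claims. *)
Lemma nonlinear_compactness (w : nat -> V) M : (forall n, nm (w n) <= M) ->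
  exists2 s : nat -> nat, (forall n, (n <= s n)%N) &
    forall e, 0 < e -> exists n0, forall m n, (n0 <= m)%N -> (n0 <= n)%N ->
      (forall h, `|B (w (s m)) h - B (w (s n)) h| <= e * nm h) /\
      `|Psi (w (s m)) - Psi (2^-1 *: (w (s m) + w (s n)))| <= e.
Proof.
move=> wM; have K0 := sup_constant_gt0.
have M0 : 0 <= M := le_trans (powR_ge0 _ _) (wM 0%N).
have PM k : Phi (w k) <= M `^ p.
  rewrite -[leLHS]powRr1 ?sobolev_energy_ge0// -(mulVf (lt0r_neq0 p0)) powRrM.
  by apply: ge0_ler_powR; rewrite ?nnegrE ?(ltW p0)// powR_ge0.
have GE k : (\int[lam]_y (enorm (sobolev_grad (w k) y) `^ p)%:E <= (p * M `^ p)%:E)%E.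
  have [_ _ iu iG _] := sobolev_spaceP (w k).
  rewrite -rint_EFin// lee_fin; apply: le_trans (_ : p * Phi (w k) <= _); last by rewrite ler_wpM2l ?(ltW p0).
  apply: le_trans (integral_grad_le (w k)); rewrite lerDl mulr_ge0 ?(ltW am0)//.
  by apply: rint_ge0 => x; exact: powR_ge0.
have UE k : \int[lam]_y `|sobolev_fun (w k) y| `^ p <= am^-1 * (p * M `^ p).
  have [_ _ iu iG _] := sobolev_spaceP (w k).
  rewrite ler_pdivlMl//; apply: le_trans (_ : p * Phi (w k) <= _); last by rewrite ler_wpM2l ?(ltW p0).
  apply: le_trans (integral_grad_le (w k)); rewrite lerDr.
  by apply: rint_ge0 => x; exact: powR_ge0.
have [||||||||s [ss cs]] := @ae_convergent_subsequence R n p n0 np (fun k => sobolev_fun (w k))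
   (fun k => sobolev_grad (w k)) (p * M `^ p) (am^-1 * (p * M `^ p)).
- by move=> k; exact: mV.
- by move=> k; case: (sobolev_spaceP (w k)).
- by move=> k; case: (sobolev_spaceP (w k)).
- move=> k i; have [_ mG _ iG _] := sobolev_spaceP (w k); apply: (locally_integrable_powR n0 np) => //.
  by apply: (integrable_powR_norm (ltW p0)) iG => // x; exact: coor_le_enorm.
- by move=> k; apply: borel_weak_gradient_bump; case: (sobolev_spaceP (w k)).
- by rewrite mulr_ge0 ?powR_ge0 ?(ltW p0).
- exact: GE.
- exact: UE.
exists s => // e e0; pose e' := Num.min (e / (lambda * K)) (e / lambda).
have e'0 : 0 < e' by rewrite lt_min !divr_gt0// mulr_gt0.
have [j0 H] := superposition_cauchy mg cg im gm (fun j => mV (w (s j))) (fun j => bV (wM (s j))) cs e'0.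
exists j0 => i j ji jj; have [h1 h2] := H i j ji jj; split.
  move=> h; apply: (le_trans (Bdiff h (le_trans h1 (ge_min_l _ _)))).
  rewrite le_eqVlt; apply/orP; left; apply/eqP; field.
  by rewrite !gt_eqF.
rewrite /Psi -mulrBr -rintB// normrM gtr0_norm// mulrC -ler_pdivlMr//.
apply: (le_trans (le_norm_rint (intbB (iF _) (iF _)))); apply: (le_trans h2).
by rewrite ge_min lexx orbT.
Qed.

Lemma nonlinear_energy_bounded M : exists C, forall u, nm u <= M -> `|Psi u| <= C.
Proof.
exists (lambda * (K * M * \int[lam]_x m (K * M) x)) => u uM.
rewrite normrM gtr0_norm// ler_wpM2l ?(ltW lambda0)//; apply: (le_trans (le_norm_rint (iF u))).
by have [] := integrable_superposition mg cg im gm (mV u) (bV uM).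
Qed.

Hypothesis Fcoer : forall e : R, 0 < e -> exists2 delta : R, 0 < delta &
  {ae lam, forall x, forall t, delta < `|t| -> F x t <= e * `|t| `^ p}.

Lemma nonlinear_coercive j : exists M, forall u, Phi u - Psi u <= j -> nm u <= M.
Proof.
(* With this e, lambda e int |u|^p equals (2 p)^(-1) am int |u|^p, which is at most half of Phi
   u. *)
pose e := am / (2 * lambda * p).
have e0 : 0 < e by rewrite divr_gt0// !mulr_gt0.
have [d d0 hd] := Fcoer e0; pose C := lambda * (d * \int[lam]_x m d x).
exists ((2 * (`|j| + `|C|)) `^ p^-1) => u uj.
apply: ge0_ler_powR; rewrite ?nnegrE ?invr_ge0 ?(ltW p0) ?sobolev_energy_ge0 ?mulr_ge0 ?addr_ge0//.
have [_ _ iu iG _] := sobolev_spaceP u.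
suff : Psi u <= Phi u / 2 + C by have := ler_norm j; have := ler_norm C; lra.
have h1 : \int[lam]_x F x (sobolev_fun u x) <=
    e * \int[lam]_x `|sobolev_fun u x| `^ p + d * \int[lam]_x m d x.
  rewrite -!rintZ// -rintD; [|exact: intbZ..].
  apply: ae_le_rint => //; first by apply: intbD; exact: intbZ.
  apply: ae_mono hd => x hx; have [ud|/hx h] := leP `|sobolev_fun u x| d.
    apply: (le_trans (ler_norm _)); apply: (le_trans (primitive_le cg gm x ud)).
    have m0 : 0 <= m d x := le_trans (normr_ge0 _) (gm x ud).
    rewrite -[leLHS]add0r; apply: lerD; first by rewrite mulr_ge0 ?powR_ge0 ?(ltW e0).
    by rewrite mulrC; apply: ler_wpM2r.
  apply: (le_trans h); rewrite lerDl mulr_ge0 ?(ltW d0)//.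
  by apply: (le_trans (normr_ge0 (g x 0))); rewrite gm ?normr0 ?(ltW d0).
rewrite /Psi; apply: (le_trans (_ : _ <= lambda * (e * \int[lam]_x `|sobolev_fun u x| `^ p + d * \int[lam]_x m d x))).
  by rewrite ler_wpM2l ?(ltW lambda0).
rewrite mulrDr lerD2r.
have h2 : am * \int[lam]_x `|sobolev_fun u x| `^ p <= p * Phi u.
  apply: le_trans (integral_grad_le u); rewrite lerDr.
  by apply: rint_ge0 => x; exact: powR_ge0.
have -> : lambda * (e * \int[lam]_x `|sobolev_fun u x| `^ p) =
  (2 * p)^-1 * (am * \int[lam]_x `|sobolev_fun u x| `^ p).
  by rewrite /e; field; rewrite !gt_eqF.
apply: (le_trans (_ : _ <= (2 * p)^-1 * (p * Phi u))).
  by rewrite ler_wpM2l// invr_ge0 mulr_ge0 ?(ltW p0).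
rewrite le_eqVlt; apply/orP; left; apply/eqP; field.
by rewrite gt_eqF.
Qed.

Variables (c : R) (Mx : 'rV[R]_n -> R) (ub : V).
Hypotheses (c0 : 0 < c) (iMx : intb Mx)
  (FMx : {ae lam, forall x, forall t, `|t| <= c -> F x t <= Mx x})
  (lMx : lambda * \int[lam]_x Mx x < c `^ p / (p * const_k n p am `^ p))
  (ub_c : c `^ p / (p * const_k n p am `^ p) <= Phi ub) (ub_J : Phi ub < Psi ub).

Let k0 : 0 < const_k n p am `^ p.
Proof. by rewrite powR_gt0// (const_k_gt0 n0 np am0). Qed.

Lemma nonlinear_barrier u : Phi u <= c `^ p / (p * const_k n p am `^ p) ->
  Psi u <= lambda * \int[lam]_x Mx x.
Proof.
move=> uc; rewrite ler_wpM2l ?(ltW lambda0)//; apply: ae_le_rint => //.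
apply: ae_mono (ae_and FMx (sobolev_sup_bound u)) => x [h1 h2]; apply: h1.
have h3 : `|sobolev_fun u x| `^ p <= c `^ p.
  apply: (le_trans h2); rewrite mulrA mulrC -ler_pdivlMr ?mulr_gt0//.
  by rewrite (mulrC (const_k n p am `^ p)).
rewrite leNgt; apply/negP => h4; have := gt0_ltr_powR p0 (ltW c0 : c \in Num.nneg) _ h4.
by rewrite nnegrE => /(_ (normr_ge0 _)); rewrite ltNge h3.
Qed.

Local Notation crit u := (forall v, Phi u - B u u <= Phi v - B u v).

Theorem three_distinct_critical_points : exists u1 u2 u3 : V,
  [/\ crit u1, crit u2 & crit u3] /\
  [/\ ~ {ae lam, forall x, sobolev_fun u1 x = sobolev_fun u2 x},
      ~ {ae lam, forall x, sobolev_fun u1 x = sobolev_fun u3 x}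
    & ~ {ae lam, forall x, sobolev_fun u2 x = sobolev_fun u3 x}].
Proof.
have Psi0 : Psi 0 = 0.
  rewrite /Psi (_ : (fun x => _) = fun=> 0) ?rint0 ?mulr0//.
  by apply/funext => x; rewrite sobolev_fun0; exact: primitive0.
have eta0 : 0 < c `^ p / (p * const_k n p am `^ p) - lambda * \int[lam]_x Mx x by rewrite subr_gt0.
have r0 : 0 < c `^ p / (p * const_k n p am `^ p) by rewrite divr_gt0 ?powR_gt0 ?mulr_gt0.
have barr u : Phi u <= c `^ p / (p * const_k n p am `^ p) ->
    Psi u <= c `^ p / (p * const_k n p am `^ p) - (c `^ p / (p * const_k n p am `^ p) - lambda * \int[lam]_x Mx x).
  by move=> /nonlinear_barrier; rewrite subKr.
have ubJ : Phi ub - Psi ub < 0 by rewrite subr_lt0.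
have [u1 [u2 [u3 [[c1 c2 c3] [P12 J1 J2 J3]]]]] := three_critical_points p1 sobolev_energy_ge0 sobolev_energyZ
  sobolev_energy_convex sobolev_energy_uniformly_convex sobolev_energy_complete nonlinear_formD
  nonlinear_formZ nonlinear_form_bounded nonlinear_form_continuous nonlinear_energy_derivative
  nonlinear_compactness nonlinear_coercive nonlinear_energy_bounded r0 eta0 Psi0 barr ub_c ubJ.
(* B u depends only on the almost everywhere class of u, so critical points that agree almost
   everywhere share the values of Phi and J. *)
have uniq u v : critical Phi B u -> critical Phi B v ->
    {ae lam, forall x, sobolev_fun u x = sobolev_fun v x} ->
    Phi u = Phi v /\ Phi u - Psi u = Phi v - Psi v.
  move=> cu cv uv; apply: (critical_unique p1 sobolev_energy_ge0 sobolev_energyZ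
  sobolev_energy_convex sobolev_energy_uniformly_convex nonlinear_formD
  nonlinear_formZ nonlinear_form_bounded nonlinear_energy_derivative cu cv).
  move=> h; congr (_ * _); apply: ae_eq_rint; [exact: intb_measurable (igh u h)|exact: intb_measurable (igh v h)|].
  by apply: ae_mono uv => x ->.
exists u1, u2, u3; split; first by split.
split.
- by move=> /(uniq _ _ c1 c2)[E _]; rewrite E ltxx in P12.
- by move=> /(uniq _ _ c1 c3)[_ E]; move: J3; rewrite -E ltNge J1.
- by move=> /(uniq _ _ c2 c3)[_ E]; move: J3; rewrite -E ltNge J2.
Qed.

End nonlinear.
End energy_functional.

(** * Borel data *)

Section coefficient.
Context (R : realType) (n : nat) (n0 : (0 < n)%N).
Local Notation mu := (lebesgue_rV R n).
Local Notation lam := (@lebesgue_borel R n).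

Lemma lebesgue_rV_gt0 : (0 < mu setT)%E.
Proof.
rewrite lebesgue_rVE; last exact: measurableT.
apply: (@lt_le_trans _ _ (lam (eball 0 1))).
  by rewrite ball_volumeE lte_fin ball_volume_gt0.
by apply: le_measure; rewrite ?inE//; exact: measurable_eball.
Qed.

(** The bounds on a hold almost everywhere only; clamping a Borel representative makes them hold
    everywhere. The interval is nonempty because the whole space is not null. *)
Lemma bounded_coefficient (a : 'rV[R]_n -> R) :
  let am := fine (ess_inf mu (EFin \o a)) in
  let an := fine (Lnorm mu +oo%E (EFin \o a)) in
  a \in Lfun mu +oo%E -> 0 < am ->
  exists b : 'rV[R]_n -> R, [/\ measurable_fun setT b, forall x, am <= b x <= an
    & {ae mu, forall x, a x = b x}].
Proof.
move=> am an; rewrite inE => /andP[]; rewrite !inE /= => ma fa am0.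
(* [fine] sends infinite values to 0, so am > 0 forces the essential infimum to be finite. *)
have amE : ess_inf mu (EFin \o a) = am%:E.
  by rewrite /am fineK//; move: am0; rewrite /am; case: (ess_inf _ _) => //=; rewrite ltxx.
have lE : Lnorm mu +oo%E (EFin \o a) = ess_sup mu (abse \o (EFin \o a)).
  by rewrite unlock lebesgue_rV_gt0.
have h1 : {ae mu, forall x, am <= a x}.
  have := ess_inf_le mu (EFin \o a); rewrite amE.
  by apply: ae_mono => x; rewrite /= lee_fin.
have h2' := ess_sup_ge mu (abse \o (EFin \o a)).
have sfin : ess_sup mu (abse \o (EFin \o a)) \is a fin_num.
  rewrite fin_numE -lE; move: fa; rewrite /finite_norm => /lt_eqF ->; rewrite andbT lE.
  apply/eqP => E; rewrite E in h2'.
  have := lebesgue_rV_gt0; suff -> : mu setT = 0%E by rewrite ltxx.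
  case: h2' => A [mA A0 AT]; apply/eqP; rewrite -measure_le0 -A0.
  by apply: le_measure; rewrite ?inE//; apply: subset_trans AT => x _ /=; rewrite leeNy_eq.
have h2 : {ae mu, forall x, `|a x| <= an}.
  move: h2'; rewrite -(fineK sfin) -lE; apply: ae_mono => x /=.
  by rewrite lee_fin.
have aman : am <= an.
  rewrite leNgt; apply/negP => lt.
  have := lebesgue_rV_gt0; suff -> : mu setT = 0%E by rewrite ltxx.
  case: (ae_and h1 h2) => A [mA A0 AT]; apply/eqP; rewrite -measure_le0 -A0.
  apply: le_measure; rewrite ?inE//; apply: subset_trans AT => x _ /= -[h3 h4].
  by have := le_trans h3 (le_trans (ler_norm _) h4); rewrite leNgt lt.
have [Z [mZ Z0 ma']] := borel_representative ma.
exists (fun x => Num.max am (Num.min (if x \in Z then 0 else a x) an)); split.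
- by apply: measurable_maxr => //; exact: measurable_minr.
- by move=> x; rewrite le_max lexx ge_max aman ge_min lexx orbT.
have nZ : {ae mu, forall x, ~ Z x}.
  by apply: ae_borel_lebesgue; exists Z; split => // x /= /contrapT.
apply: ae_mono (ae_and (ae_and h1 h2) nZ) => x [[h3 h4] h5].
rewrite memNset// min_l ?max_r//; exact: le_trans (ler_norm _) h4.
Qed.

End coefficient.

Section caratheodory_data.
Context (R : realType) (n : nat).
Local Notation mu := (lebesgue_rV R n).
Local Notation lam := (@lebesgue_borel R n).
Local Notation LT := (lebesgue_type R n).
Local Notation intb f := (lam.-integrable setT (EFin \o f)).

Lemma ae_null_set (P : 'rV[R]_n -> Prop) : {ae mu, forall x, P x} ->
  exists Z : set 'rV[R]_n, [/\ measurable Z, lam Z = 0%E & forall x, ~ Z x -> P x].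
Proof.
move=> /ae_lebesgue_borel [Z [mZ Z0 ZP]]; exists Z; split => // x nZ.
by apply: contrapT => nP; apply: nZ; exact: ZP.
Qed.

Lemma null_set_ae (Z : set 'rV[R]_n) : measurable Z -> lam Z = 0%E ->
  {ae mu, forall x, ~ Z x}.
Proof.
by move=> mZ Z0; apply: ae_borel_lebesgue; exists Z; split => // x /= /contrapT.
Qed.

Lemma rational_seq (t : R) : exists q : nat -> rat, ratr (q k) @[k --> \oo] --> t.
Proof.
have h k : exists q : rat, t < ratr q < t + k.+1%:R^-1.
  have lt : t < t + k.+1%:R^-1 by rewrite ltrDl invr_gt0.
  by have [q] := rat_in_itvoo lt; exists q.
have [q hq] := choice h; exists q.
have c0 : t + k.+1%:R^-1 @[k --> \oo] --> t.
  by rewrite -[X in _ --> X]addr0; apply: cvgD; [exact: cvg_cst|exact: cvg_harmonic].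
apply: (@squeeze_cvgr _ _ _ _ (fun=> t) (fun k => t + k.+1%:R^-1)) => //; last exact: cvg_cst.
by apply: nearW => k; case/andP: (hq k) => h1 h2; rewrite !ltW.
Qed.

(** Borel representatives are taken at rational t only, outside one null set on which everything is
    put to 0; continuity in t then gives measurability at every real t. *)
Lemma caratheodory_data (f : 'rV[R]_n -> R -> R) : L1_caratheodory f ->
  exists (h : 'rV[R]_n -> R -> R) (m : R -> 'rV[R]_n -> R),
    [/\ forall t, measurable_fun setT (h ^~ t), forall x, continuous (h x),
        forall s, intb (m s), forall (s : R) x (t : R), `|t| <= s -> `|h x t| <= m s x
      & {ae mu, forall x, f x = h x}].
Proof.
move=> [mf cf intf].
pose S k x := ereal_sup [set `|f x t|%:E | t in [set t : R | `|t| <= k.+1%:R]].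
have iS k : mu.-integrable setT (S k) by apply: intf.
have mS k : measurable_fun (setT : set LT) (fun x => fine (S k x)).
  by apply: measurableT_comp; [exact: fine_measurable|case/integrableP: (iS k)].
have Sfin : {ae mu, forall x, forall k, S k x \is a fin_num}.
  by apply: ae_countable => k; apply: ae_mono (integrable_ae measurableT (iS k)) => x; exact.
have [Zf hZf] := choice (fun q : rat => borel_representative (mf (ratr q))).
have [Zs hZs] := choice (fun k => borel_representative (mS k)).
have nZf : {ae mu, forall x, forall q, ~ Zf q x}.
  by apply: ae_countable => q; have [h1 h2 _] := hZf q; exact: null_set_ae.
have nZs : {ae mu, forall x, forall k, ~ Zs k x}.
  by apply: ae_countable => k; have [h1 h2 _] := hZs k; exact: null_set_ae.
have [Z [mZ Z0 ZP]] := ae_null_set (ae_and (ae_and cf Sfin) (ae_and nZf nZs)).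
pose h x t := if x \in Z then 0 else f x t.
(* [S k] is the supremum over |t| <= k + 1, so truncating |s| still covers |t| <= |s|; with integer
   radii, countably many exceptional sets serve all s. *)
pose m (s : R) x := if x \in Z then 0 else fine (S (Num.truncn `|s|) x).
have indZ x (y : R) : (if x \in Z then 0 else y) = \1_(~` Z) x * y.
  by rewrite indicE in_setC; case: (x \in Z); rewrite /= ?mul0r ?mul1r.
have mhq q : measurable_fun setT (h ^~ (ratr q)).
  rewrite (_ : h ^~ _ = fun x => \1_(~` Z) x * (if x \in Zf q then 0 else f x (ratr q))).
    by apply: measurable_funM; [apply: measurable_indic; exact: measurableC|case: (hZf q)].
  apply/funext => x; rewrite /h indZ; case: (boolP (x \in Z)) => [xZ|/negP xZ].
    by rewrite indicE in_setC xZ /= !mul0r.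
  congr (_ * _); rewrite memNset//; apply ZP; by move=> /mem_set.
have ch x : continuous (h x).
  move=> t; rewrite /h; case: (boolP (x \in Z)) => [xZ|/negP xZ]; first exact: cvg_cst.
  by have [[c _] _] := ZP x (fun xz => xZ (mem_set xz)); exact: c.
exists h, m; split.
- move=> t; have [q hq] := rational_seq t.
  apply: (@measurable_fun_cvg _ _ _ _ (fun k => h ^~ (ratr (q k)))) => // x _.
  exact: (cvg_comp _ _ hq (@ch x t)).
- exact: ch.
- move=> s; set k := Num.truncn `|s|.
  have mm : measurable_fun setT (m s).
    rewrite (_ : m s = fun x => \1_(~` Z) x * (if x \in Zs k then 0 else fine (S k x))).
      by apply: measurable_funM; [apply: measurable_indic; exact: measurableC|case: (hZs k)].
    apply/funext => x; rewrite /m indZ; case: (boolP (x \in Z)) => [xZ|/negP xZ].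
      by rewrite indicE in_setC xZ /= !mul0r.
    by congr (_ * _); rewrite memNset//; apply ZP; move=> /mem_set.
  have S0 x : (0 <= S k x)%E.
    apply: le_trans (ereal_sup_ubound _); last by exists 0 => //=; rewrite normr0.
    by rewrite lee_fin.
  have m0 x : 0 <= m s x by rewrite /m; case: ifP => // _; exact: fine_ge0.
  apply: intb_ge0 => //; rewrite -ge0_integral_lebesgue_borel; last first.
  + by move=> x; rewrite lee_fin.
  + exact: measurableT_comp.
  have := iS k => /integrableP[mSk Sk].
  apply: le_lt_trans Sk; apply: ge0_le_integralT.
  + by apply/measurable_EFinP; exact: measurable_fun_borel_lebesgue.
  + exact: measurableT_comp.
  + by move=> x; rewrite lee_fin.
  move=> x; rewrite /m; case: (boolP (x \in Z)) => [xZ|/negP xZ]; first exact: abse_ge0.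
  have [[_ h1] _] := ZP x (fun xz => xZ (mem_set xz)).
  by rewrite fineK// gee0_abs.
- move=> s x t ts; rewrite /h /m; case: (boolP (x \in Z)) => [xZ|/negP xZ]; first by rewrite normr0.
  have [[_ h1] _] := ZP x (fun xz => xZ (mem_set xz)).
  rewrite -lee_fin fineK//; apply: ereal_sup_ubound; exists t => //=.
  apply: (le_trans ts); apply: (le_trans (ler_norm _)); exact: ltW (truncnS_gt _).
apply: ae_mono (null_set_ae mZ Z0) => x xZ; apply/funext => t.
by rewrite /h memNset.
Qed.

End caratheodory_data.

Lemma near_segment (R : realType) (c t d : R) : 0 < c -> `|t| <= c -> 0 < d ->
  Num.max (- c) (t - d) < Num.min c (t + d).
Proof.
move=> c0; rewrite ler_norml lt_min !gt_max => /andP[t1 t2] d0.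
by apply/andP; split; apply/andP; split; lra.
Qed.

(** * Truncation below zero and the maximal primitive *)

Section truncation.
Context (R : realType) (n : nat).
Local Notation lam := (@lebesgue_borel R n).
Local Notation intb f := (lam.-integrable setT (EFin \o f)).
Variables (h : 'rV[R]_n -> R -> R) (m : R -> 'rV[R]_n -> R).
Hypotheses (mh : forall t, measurable_fun setT (h ^~ t)) (ch : forall x, continuous (h x))
  (im : forall s, intb (m s)) (hm : forall (s : R) x (t : R), `|t| <= s -> `|h x t| <= m s x).

(* Solutions of the problem truncated below 0 turn out to be nonnegative, hence
   solve the original one. *)
Definition truncate x t := h x (Num.max t 0).

Lemma measurable_truncate t : measurable_fun setT (truncate ^~ t).
Proof. exact: mh. Qed.

Lemma continuous_truncate x : continuous (truncate x).
Proof.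
move=> t; apply: (@continuous_comp _ _ _ (fun t : R => Num.max t 0) (h x)); last exact: ch.
by apply: (@continuous_max R _ id (fun=> 0)); [exact: cvg_id|exact: cvg_cst].
Qed.

Lemma truncate_le (s : R) x (t : R) : `|t| <= s -> `|truncate x t| <= m s x.
Proof.
move=> ts; apply: hm; apply: le_trans ts.
by rewrite /Num.max; case: ifP => // _; rewrite normr0.
Qed.

Lemma primitive_truncate_ge0 x t : 0 <= t -> primitive truncate x t = primitive h x t.
Proof.
move=> t0; rewrite /primitive t0; apply: eq_Rintegral => xi; rewrite inE /= in_itv /=.
by move=> /andP[xi0 _]; rewrite /truncate max_l.
Qed.

(** Below 0 the truncated nonlinearity is frozen at [h x 0], so its primitive is linear there, and
    nonpositive once h x 0 >= 0. Then truncation raises neither the maximum over |t| <= c nor the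
    growth at infinity. *)
Lemma primitive_truncate_le0 x t : t <= 0 -> primitive truncate x t = h x 0 * t.
Proof.
rewrite le_eqVlt => /predU1P[->|t0]; first by rewrite mulr0; exact: (primitive0 (truncate x)).
rewrite /primitive leNgt t0 /=.
rewrite (@eq_Rintegral _ _ _ _ _ (fun=> h x 0)); last first.
  move=> xi; rewrite inE /= in_itv /= => /andP[_ xi0]; by rewrite /truncate max_r.
rewrite Rintegral_cst; last exact: measurable_itv.
rewrite [X in h x 0 * X](_ : _ = - t) ?mulrN ?opprK//.
rewrite [X in fine X](_ : _ = (- t)%:E)//; by rewrite [LHS]lebesgue_measure_itv/= lte_fin t0 -EFinB sub0r.
Qed.

Variable c : R.
Hypothesis c0 : 0 < c.

Lemma primitive_ubound x : has_ubound [set primitive h x t | t in [set t : R | `|t| <= c]].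
Proof.
exists (m c x * c) => _ [t /= tc <-]; apply: (le_trans (ler_norm _)).
apply: (le_trans (primitive_le ch hm x tc)); apply: ler_wpM2l => //.
exact: le_trans (normr_ge0 _) (hm x tc).
Qed.

Lemma primitive_le_max x t : `|t| <= c -> primitive h x t <= max_primitive h c x.
Proof. by move=> tc; apply: (ub_le_sup (primitive_ubound x)); exists t. Qed.

Lemma max_primitive_ge0 x : 0 <= max_primitive h c x.
Proof.
rewrite -(primitive0 (h x)); apply: primitive_le_max.
by rewrite normr0 ltW.
Qed.

Lemma max_primitive_le x : max_primitive h c x <= m c x * c.
Proof.
apply: ge_sup; first by exists (primitive h x 0); exists 0 => //=; rewrite normr0 ltW.
move=> _ [t /= tc <-]; apply: (le_trans (ler_norm _)).
apply: (le_trans (primitive_le ch hm x tc)); apply: ler_wpM2l => //.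
exact: le_trans (normr_ge0 _) (hm x tc).
Qed.

Let ratc (k : nat) : R :=
  if unpickle k is Some q then if `|ratr (q : rat) : R| <= c then ratr q else 0 else 0.

Let ratc_le k : `|ratc k| <= c.
Proof.
rewrite /ratc; case: (unpickle k) => [q|]; last by rewrite normr0 ltW.
by case: ifP => // _; rewrite normr0 ltW.
Qed.

(** By continuity the supremum may be taken over the rationals in [-c, c], which [ratc] lists with 0
    as filler; a countable supremum is measurable. *)
Let max_primitiveE x : max_primitive h c x = sups (fun k => primitive h x (ratc k)) 0.
Proof.
have ub : has_ubound (range (fun k => primitive h x (ratc k))).
  by exists (max_primitive h c x) => _ [k _ <-]; exact: primitive_le_max.
apply/eqP; rewrite eq_le; apply/andP; split; last first.
  apply: ge_sup; first by exists (primitive h x (ratc 0)); exists 0%N.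
  by move=> _ [k _ <-]; exact: primitive_le_max.
apply: ge_sup; first by exists (primitive h x 0); exists 0 => //=; rewrite normr0 ltW.
move=> _ [t /= tc <-]; apply/ler_addgt0Pr => e e0.
have /cvgrPdist_le/(_ _ e0) := @continuous_primitive _ _ _ _ ch hm x t.
case=> d /= d0 hd.
have [q] := rat_in_itvoo (near_segment c0 tc d0); rewrite in_itv /= gt_max lt_min => /andP[/andP[q1 q2] /andP[q3 q4]].
have qc : `|ratr q : R| <= c by rewrite ler_norml !ltW.
have qE : ratc (pickle q) = ratr q by rewrite /ratc pickleK qc.
have hdq : `|primitive h x t - primitive h x (ratr q)| <= e.
  by apply: hd; rewrite /ball_ /= ltr_norml; lra.
have : primitive h x (ratr q) <= sups (fun k => primitive h x (ratc k)) 0.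
  apply: ub_le_sup; first by move: ub; apply: subset_has_ubound => _ [k _ <-]; exists k.
  by exists (pickle q) => //; rewrite qE.
by move: hdq; rewrite ler_norml => /andP[]; lra.
Qed.

Lemma measurable_max_primitive : measurable_fun setT (max_primitive h c).
Proof.
rewrite (_ : max_primitive h c = fun x => sups (fun k => primitive h x (ratc k)) 0); last first.
  by apply/funext => x; exact: max_primitiveE.
apply: (measurable_fun_sups (h := fun k x => primitive h x (ratc k))).
  move=> x _; exists (max_primitive h c x) => _ [k _ <-]; exact: primitive_le_max.
by move=> k; exact: measurable_primitive.
Qed.

Lemma integrable_max_primitive : intb (max_primitive h c).
Proof.
apply: (@intb_le _ _ _ _ _ (fun x => c * m c x)); first exact: measurable_max_primitive.
  exact: intbZ.
by move=> x; rewrite ger0_norm ?max_primitive_ge0// mulrC max_primitive_le.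
Qed.

End truncation.

(** * The Euler equation *)

Section powR_limits.
Context (R : realType).
Implicit Types (A D H p q : R).

Lemma cvg_powR0 (A_ : nat -> R) q : 0 < q -> (forall k, 0 <= A_ k) -> A_ k @[k --> \oo] --> (0 : R) ->
  A_ k `^ q @[k --> \oo] --> (0 : R).
Proof.
move=> q0 A0 /cvgrPdist_le Ac; apply/cvgrPdist_le => e e0.
have := Ac _ (powR_gt0 q^-1 e0); apply: filterS => k.
rewrite !sub0r !normrN ger0_norm// ger0_norm ?powR_ge0// => h.
rewrite -[leRHS]powRr1 ?(ltW e0)// -(mulVf (lt0r_neq0 q0)) powRrM.
by apply: ge0_ler_powR; rewrite ?nnegrE ?(ltW q0)// powR_ge0.
Qed.

Lemma powR_sub2M (t p : R) : 1 < p -> 0 <= t -> t `^ (p - 2) * t = t `^ (p - 1).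
Proof.
move=> p1; rewrite le_eqVlt => /predU1P[<-|t0].
  by rewrite mulr0 powR0// gt_eqF// subr_gt0.
rewrite -{2}(powRr1 (ltW t0)) -powRD; last by rewrite (gt_eqF t0) implybT.
by congr (_ `^ _); ring.
Qed.

(** For p < 2 the power is singular at A = 0, but |D| <= A H bounds the product by A^(p-1) H, which
    tends to 0; the limit is then 0 too, because D = 0. *)
Lemma cvg_powR_duality (A_ D_ : nat -> R) A D H p : 1 < p -> (forall k, 0 <= A_ k) -> 0 <= A -> 0 <= H ->
  A_ k @[k --> \oo] --> A -> D_ k @[k --> \oo] --> D -> (forall k, `|D_ k| <= A_ k * H) ->
  A_ k `^ (p - 2) * D_ k @[k --> \oo] --> A `^ (p - 2) * D.
Proof.
move=> p1 A_0 + H0 cA cD DH; rewrite le_eqVlt => /predU1P[A0|A0]; last first.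
  have h := @powR_continuous R (p - 2) A A0.
  by apply: cvgM => //; exact: (cvg_comp A_ (fun y => y `^ (p - 2)) cA h).
have q0 : 0 < p - 1 by rewrite subr_gt0.
have D0 : D = 0.
  have h : A_ k * H @[k --> \oo] --> (0 : R).
    by rewrite -(mul0r H) A0; apply: cvgM => //; exact: cvg_cst.
  apply: (cvg_unique _ cD) => //; apply/norm_cvg0P.
  apply: (@squeeze_cvgr _ _ _ _ (fun=> 0) (fun k => A_ k * H)) => //; last exact: cvg_cst.
  by apply: nearW => k; rewrite normr_ge0 DH.
rewrite D0 mulr0; apply/norm_cvg0P.
have h : A_ k `^ (p - 1) * H @[k --> \oo] --> (0 : R).
  by rewrite -(mul0r H); apply: cvgM; [apply: cvg_powR0 => //; rewrite A0|exact: cvg_cst].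
apply: (@squeeze_cvgr _ _ _ _ (fun=> 0) (fun k => A_ k `^ (p - 1) * H)) => //; last exact: cvg_cst.
apply: nearW => k; rewrite normr_ge0 /= normrM ger0_norm ?powR_ge0//.
by rewrite -(powR_sub2M p1 (A_0 k)) -mulrA ler_wpM2l ?powR_ge0.
Qed.

Lemma powR_duality_le A D H p : 1 < p -> 0 <= A -> 0 <= H -> `|D| <= A * H ->
  `|A `^ (p - 2) * D| <= (A + H) `^ p.
Proof.
move=> p1 A0 H0 DH; have q0 : 0 <= p - 1 by rewrite subr_ge0 ltW.
rewrite normrM ger0_norm ?powR_ge0//.
apply: (@le_trans _ _ (A `^ (p - 1) * H)).
  by rewrite -(powR_sub2M p1 A0) -mulrA ler_wpM2l ?powR_ge0.
have AH : 0 <= A + H by rewrite addr_ge0.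
apply: (@le_trans _ _ ((A + H) `^ (p - 1) * (A + H))).
  apply: ler_pM => //; [exact: powR_ge0| |by rewrite lerDr].
  by apply: ge0_ler_powR; rewrite ?nnegrE// lerDl.
have [->|AH0] := eqVneq (A + H) 0; first by rewrite mulr0 powR_ge0.
rewrite -{2}(powRr1 AH) -powRD; last by rewrite AH0 implybT.
by rewrite subrK.
Qed.

End powR_limits.

Section euler.
Context (R : realType) (n : nat) (p : R) (p1 : 1 < p).
Let p0 : 0 < p. Proof. exact: lt_trans p1. Qed.
Implicit Types (G H : 'rV[R]_n) (u v b : R).

Definition energy_derivative b G u H v : R :=
  enorm G `^ (p - 2) * dotv G H + b * `|u| `^ (p - 2) * u * v.

(** The tangent inequality for t^p at |G| and at |u|, combined with Cauchy-Schwarz: convexity of the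
    energy density in differential form. *)
Lemma energy_tangent b G u G' u' : 0 <= b ->
  energy p b G u + p * energy_derivative b G u (G' - G) (u' - u) <= energy p b G' u'.
Proof.
have tangent (A B D : R) : 0 <= A -> 0 <= B -> D <= A * B ->
    A `^ p + p * (A `^ (p - 2) * (D - A ^+ 2)) <= B `^ p.
  move=> A0 B0 DAB; apply: le_trans (powR_tangent (ltW p1) A0 B0).
  rewrite lerD2l -mulrA ler_wpM2l ?(ltW p0)// -(powR_sub2M p1 A0) -mulrA ler_wpM2l ?powR_ge0//.
  by rewrite expr2 mulrBr lerD2r.
move=> b0; rewrite /energy /energy_derivative mulrDr addrACA lerD//.
  have -> : dotv G (G' - G) = dotv G G' - enorm G ^+ 2.
    by rewrite enorm_sqr -scaleN1r dotvDr dotvZr mulN1r.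
  by apply: tangent; rewrite ?enorm_ge0// dotv_le.
have -> : b * `|u| `^ p + p * (b * `|u| `^ (p - 2) * u * (u' - u)) =
  b * (`|u| `^ p + p * (`|u| `^ (p - 2) * (u * u' - `|u| ^+ 2))).
  by rewrite real_normK ?num_real//; ring.
rewrite ler_wpM2l//; apply: tangent => //.
by rewrite -normrM ler_norm.
Qed.

Lemma energy_derivative_le b G u H v : 0 <= b ->
  `|energy_derivative b G u H v| <=
  (enorm G + enorm H) `^ p + b * (`|u| + `|v|) `^ p.
Proof.
move=> b0; rewrite /energy_derivative (le_trans (ler_normD _ _))// lerD//.
  by apply: powR_duality_le; rewrite ?enorm_ge0// dotv_CS.
rewrite -2!mulrA normrM ger0_norm// ler_wpM2l//.
by apply: powR_duality_le => //; rewrite normrM.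
Qed.

Lemma cvg_energy_derivative b G u H v (t : nat -> R) : t k @[k --> \oo] --> (0 : R) ->
  energy_derivative b (G + t k *: H) (u + t k * v) H v @[k --> \oo] -->
  energy_derivative b G u H v.
Proof.
move=> ct; have cG i : (G + t k *: H) ord0 i @[k --> \oo] --> G ord0 i.
  rewrite -[X in _ --> X]addr0 -(mul0r (H ord0 i)).
  rewrite (_ : (fun k => _) = fun k => G ord0 i + t k * H ord0 i).
    by apply: cvgD; [exact: cvg_cst|apply: cvgM => //; exact: cvg_cst].
  by apply/funext => k; rewrite !mxE.
have cu : u + t k * v @[k --> \oo] --> u.
  rewrite -[X in _ --> X]addr0 -(mul0r v).
  by apply: cvgD; [exact: cvg_cst|apply: cvgM => //; exact: cvg_cst].
apply: cvgD.
  apply: (@cvg_powR_duality _ _ _ _ _ (enorm H)) => //; rewrite ?enorm_ge0//.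
  - by move=> k; exact: enorm_ge0.
  - exact: cvg_enorm.
  - rewrite /dotv; apply: (@cvg_sum_seq _ _ _ (fun k i => (G + t k *: H) ord0 i * H ord0 i)) => i.
    by apply: cvgM => //; exact: cvg_cst.
  - by move=> k; exact: dotv_CS.
rewrite -[X in _ --> X]mulrA -[X in _ --> X]mulrA.
rewrite (_ : (fun k => _) = fun k => b * (`|u + t k * v| `^ (p - 2) * ((u + t k * v) * v))).
  apply: cvgM; first exact: cvg_cst.
  apply: (@cvg_powR_duality _ _ _ _ _ `|v|) => //; first exact: cvg_norm.
  - by apply: cvgM => //; exact: cvg_cst.
  - by move=> k; rewrite normrM.
by apply/funext => k; rewrite !mulrA.
Qed.

End euler.

Lemma critical_algebra (R : realFieldType) (y z s w I : R) :
  y - z <= w - (z + s) -> w - I <= y -> s <= I.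
Proof. lra. Qed.

Section euler_equation.
Context (R : realType) (n : nat) (p : R) (n0 : (0 < n)%N) (np : n%:R < p).
Local Notation lam := (@lebesgue_borel R n).
Local Notation intb f := (lam.-integrable setT (EFin \o f)).
Local Notation V := (sobolev_space n0 np).
Variables (b : 'rV[R]_n -> R) (am an : R).
Hypotheses (mb : measurable_fun setT b) (am0 : 0 < am) (b_bnd : forall x, am <= b x <= an).
Let p1 : 1 < p.
Proof. by rewrite (le_lt_trans _ np)// ler1n. Qed.
Let p0 : 0 < p. Proof. exact: lt_trans p1. Qed.
Let b0 x : 0 <= b x.
Proof. by case/andP: (b_bnd x) => h _; exact: le_trans (ltW am0) h. Qed.

Local Notation ed u v x := (energy_derivative p (b x) (sobolev_grad u x) (sobolev_fun u x)
  (sobolev_grad v x) (sobolev_fun v x)).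
Local Notation Phi := (sobolev_energy (n0 := n0) (np := np) b).

Let measurable_ed (u v : V) : measurable_fun setT (fun x => ed u v x).
Proof.
have [mu mG _ _ _] := sobolev_spaceP u; have [mv mH _ _ _] := sobolev_spaceP v.
apply: measurable_funD.
  apply: measurable_funM; last exact: measurable_dotv.
  by apply: (measurableT_comp (measurable_powR _)); exact: measurable_enorm.
apply: measurable_funM => //; apply: measurable_funM => //; apply: measurable_funM => //.
by apply: (measurableT_comp (measurable_powR _)); exact: measurableT_comp.
Qed.

Let intb_dominator (u v : V) :
  intb (fun x => (enorm (sobolev_grad u x) + 2 * enorm (sobolev_grad v x)) `^ p +
    an * (`|sobolev_fun u x| + 2 * `|sobolev_fun v x|) `^ p).
Proof.
have [mu mG iu iG _] := sobolev_spaceP u; have [mv mH iv iH _] := sobolev_spaceP v.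
apply: intbD; last apply: intbZ.
  apply: integrable_powRD => //; [exact: ltW|exact: measurable_enorm| | | |].
  - by apply: measurable_funM => //; exact: measurable_enorm.
  - by move=> x; exact: enorm_ge0.
  - by move=> x; rewrite mulr_ge0 ?enorm_ge0.
  rewrite (_ : (fun x => _) = fun x => 2 `^ p * enorm (sobolev_grad v x) `^ p); first exact: intbZ.
  by apply/funext => x; rewrite powRM ?enorm_ge0.
apply: integrable_powRD => //; [exact: ltW|exact: measurableT_comp| |].
  by apply: measurable_funM => //; exact: measurableT_comp.
rewrite (_ : (fun x => _) = fun x => 2 `^ p * `|sobolev_fun v x| `^ p); first exact: intbZ.
by apply/funext => x; rewrite powRM.
Qed.

Let ed_dominated (u v : V) (t : R) x : 0 <= t <= 1 ->
  `|ed (u + t *: v) v x| <= (enorm (sobolev_grad u x) + 2 * enorm (sobolev_grad v x)) `^ p +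
    an * (`|sobolev_fun u x| + 2 * `|sobolev_fun v x|) `^ p.
Proof.
move=> /andP[t0 t1]; apply: (le_trans (energy_derivative_le p1 _ _ _ _ (b0 x))).
have h1 : enorm (sobolev_grad (u + t *: v) x) <= enorm (sobolev_grad u x) + enorm (sobolev_grad v x).
  rewrite sobolev_gradD sobolev_gradZ; apply: (le_trans (enormD _ _)); rewrite lerD2l enormZ ger0_norm//.
  by rewrite ler_piMl ?enorm_ge0.
have h2 : `|sobolev_fun (u + t *: v) x| <= `|sobolev_fun u x| + `|sobolev_fun v x|.
  by rewrite sobolev_funD sobolev_funZ; apply: (le_trans (ler_normD _ _)); rewrite lerD2l normrM ger0_norm// ler_piMl.
apply: lerD.
  apply: (ge0_ler_powR (ltW p0)); rewrite ?nnegrE ?addr_ge0 ?mulr_ge0 ?enorm_ge0//.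
  by rewrite mulr2n mulrDl !mul1r addrA lerD2r.
case/andP: (b_bnd x) => _ b2; apply: ler_pM; rewrite ?powR_ge0//.
apply: (ge0_ler_powR (ltW p0)); rewrite ?nnegrE ?addr_ge0 ?mulr_ge0//.
by rewrite mulr2n mulrDl !mul1r addrA lerD2r.
Qed.

Lemma integrable_energy_derivative (u v : V) : intb (fun x => ed u v x).
Proof.
apply: (intb_le (measurable_ed u v) (intb_dominator u v)) => x.
have := @ed_dominated u v 0 x; rewrite scale0r addr0; apply.
by rewrite lexx ler01.
Qed.

Variable (B : V -> V -> R).
Hypotheses (BD : forall u x y, B u (x + y) = B u x + B u y)
  (BZ : forall u t x, B u (t *: x) = t * B u x).

(** The tangent inequality is used at the moved point u + t v, so that the increase of Phi is at
    most t times the derivative there; dividing by t and passing to the limit under the integral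
    gives the bound. Applied to v and to - v it yields the equation. *)
Lemma critical_derivative_ge (u v : V) : (forall w, Phi u - B u u <= Phi w - B u w) ->
  B u v <= \int[lam]_x ed u v x.
Proof.
move=> cu; pose t k : R := k.+1%:R^-1.
have ct : t k @[k --> \oo] --> (0 : R) by exact: cvg_harmonic.
have t0 k : 0 < t k by rewrite invr_gt0.
have t1 k : 0 <= t k <= 1 by rewrite (ltW (t0 k)) invf_le1 ?ler1n.
have [||||_ cI _] := @rint_dominated _ _ _ lam (fun k x => ed (u + t k *: v) v x)
    (fun x => ed u v x) _ _ _ _ (intb_dominator u v).
- by move=> k; exact: measurable_ed.
- exact: measurable_ed.
- apply: aeW => x.
  rewrite (_ : (fun k => _) = fun k => energy_derivative p (b x) (sobolev_grad u x + t k *: sobolev_grad v x)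
    (sobolev_fun u x + t k * sobolev_fun v x) (sobolev_grad v x) (sobolev_fun v x)).
    have := @cvg_energy_derivative R n p p1 (b x) (sobolev_grad u x) (sobolev_fun u x) (sobolev_grad v x) (sobolev_fun v x) t ct; exact.
  by apply/funext => k; rewrite sobolev_gradD sobolev_gradZ sobolev_funD sobolev_funZ.
- by apply: aeW => x k; exact: ed_dominated.
rewrite -(cvg_lim _ cI)//; apply: limr_ge; first by apply: cvgP cI.
apply: nearW => k; rewrite -(ler_pM2l (t0 k)).
have h := cu (u + t k *: v); rewrite BD BZ in h.
apply: (critical_algebra h).
have alg (y w s : R) : w <= y + p * s -> p^-1 * w - s <= p^-1 * y.
  by move=> ?; rewrite lerBlDr -(ler_pM2l p0) mulrDr !(mulrA p) mulfV ?gt_eqF// !mul1r.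
apply: alg; rewrite mulrA.
have iE w := integrable_energy mb am0 b_bnd (sobolev_spaceP w).
rewrite -rintZ; last exact: integrable_energy_derivative.
rewrite -rintD//; last by apply: intbZ; exact: integrable_energy_derivative.
apply: le_rint => [||x]; first exact: iE.
  by apply: intbD; [exact: iE|apply: intbZ; exact: integrable_energy_derivative].
have := energy_tangent p1 (sobolev_grad (u + t k *: v) x) (sobolev_fun (u + t k *: v) x)
  (sobolev_grad u x) (sobolev_fun u x) (b0 x).
have -> : sobolev_grad u x - sobolev_grad (u + t k *: v) x = (- t k) *: sobolev_grad v x.
  by rewrite sobolev_gradD sobolev_gradZ opprD addNKr scaleNr.
have -> : sobolev_fun u x - sobolev_fun (u + t k *: v) x = (- t k) * sobolev_fun v x.
  by rewrite sobolev_funD sobolev_funZ opprD addNKr mulNr.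
have -> : energy_derivative p (b x) (sobolev_grad (u + t k *: v) x) (sobolev_fun (u + t k *: v) x)
  (- t k *: sobolev_grad v x) (- t k * sobolev_fun v x) = - t k * ed (u + t k *: v) v x.
  by rewrite /energy_derivative dotvZr; ring.
rewrite /energy_of mulrA; move: (energy _ _ _ _) (energy _ _ _ _) (energy_derivative _ _ _ _ _ _) => e1 e2 e3.
by rewrite mulrN mulNr lerBlDr.
Qed.

Theorem euler_equation (u v : V) : (forall w, Phi u - B u u <= Phi w - B u w) ->
  \int[lam]_x ed u v x = B u v.
Proof.
move=> cu; apply/eqP; rewrite eq_le (critical_derivative_ge v cu) andbT.
have := critical_derivative_ge (-1 *: v) cu; rewrite BZ mulN1r.
rewrite (_ : (fun x => _) = fun x => - ed u v x) ?rintN ?lerN2//.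
apply/funext => x; rewrite /energy_derivative.
rewrite sobolev_gradZ dotvZr sobolev_funZ.
by ring.
Qed.

End euler_equation.

(** * Difference quotients *)

Section difference_quotients.
Context (R : realType) (n : nat).
Local Notation lam := (@lebesgue_borel R n).
Local Notation leb := (@lebesgue_measure R).
Local Notation intb f := (lam.-integrable setT (EFin \o f)).
Local Notation RM := (measurableTypeR R).
Local Notation I01 := (`[0%R, 1%R]%classic : set RM).
Implicit Types (i : 'I_n) (phi : 'rV[R]_n -> R) (v : 'rV[R]_n -> R).

Definition axis_step i (k : nat) : 'rV[R]_n := k.+1%:R^-1 *: basis_rV R i.

Lemma axis_step_coor i j k : axis_step i k ord0 j = k.+1%:R^-1 * (i == j)%:R.
Proof. by rewrite !mxE eqxx /= eq_sym. Qed.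

Lemma normr_axis_step i k : `|axis_step i k| <= 1.
Proof.
apply: mx_norm_le => // j; rewrite axis_step_coor normrM (ger0_norm (ler0n _ _)) ger0_norm//.
by case: (i == j); rewrite ?mulr0// mulr1 invf_le1 ?ler1n.
Qed.

Lemma enorm_axis_step i k : enorm (axis_step i k) = k.+1%:R^-1.
Proof.
rewrite enormZ ger0_norm// /enorm /dotv (bigD1 i)//= big1 => [|j ji].
  by rewrite !mxE eqxx /= !eqxx mulr1 addr0 sqrtr1 mulr1.
by rewrite !mxE eqxx /= (negbTE ji) mulr0.
Qed.

Lemma test_is_derive phi i k x : test_function phi ->
  is_derive x (axis_step i k) phi (k.+1%:R^-1 * 'D_(basis_rV R i) phi x).
Proof.
move=> [/(_ 1%N)[_ /(_ i)[dphi _]] _]; set e := basis_rV R i; set t : R := k.+1%:R^-1.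
have d1 : is_derive ((0 : R) *: e + x) e phi ('D_e phi x).
  by rewrite scale0r add0r; apply: DeriveDef; [exact: dphi|].
have /is_derive_line d2 := d1.
have d3 : is_derive (t * 0 + 0) 1 (fun s : R => phi (s *: e + x)) ('D_e phi x).
  by rewrite mulr0 addr0.
have d4 := is_derive_affine d3.
have : is_derive ((0 : R) *: axis_step i k + x) (axis_step i k) phi ('D_e phi x * t).
  apply/is_derive_line; move: d4; congr is_derive.
  by apply/funext => s; rewrite addr0 /axis_step scalerA mulrC.
by rewrite scale0r add0r mulrC.
Qed.

Definition quotient phi i k x : R := k.+1%:R * (phi (x + axis_step i k) - phi x).

Lemma quotientE phi i k x : test_function phi ->
  quotient phi i k x =
  \int[leb]_s (\1_I01 s * 'D_(basis_rV R i) phi (x + s *: axis_step i k)).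
Proof.
move=> tphi; have [cC _] := tphi.
have [_ /(_ i)[_ [cD _]]] := cC 1%N.
have H := @line_FTC R n phi (fun x => k.+1%:R^-1 * 'D_(basis_rV R i) phi x) (axis_step i k) x
  (fun y => test_is_derive i k y tphi) _.
rewrite /quotient H; last by move=> y; exact: (cvgMl_tmp (cD y)).
rewrite (_ : (fun s => _) = fun s => k.+1%:R^-1 * (\1_I01 s * 'D_(basis_rV R i) phi (x + s *: axis_step i k))); last first.
  by apply/funext => s; rewrite mulrCA.
rewrite rintZ_measurable ?mulrA ?mulfV ?mul1r//.
have := integrable_line x (- axis_step i k) (test_derive_measurable i tphi) (test_derive_bounded_support i tphi).
move=> /intb_measurable; congr (measurable_fun _ _); apply/funext => s.
by rewrite scalerN opprK.
Qed.

Lemma quotient_bounded phi i : test_function phi -> exists2 C, 0 <= C & exists M,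
  forall k x, `|quotient phi i k x| <= C * \1_(cube M) x.
Proof.
move=> tphi; have bD := test_derive_bounded_support i tphi; have [C C0 [M hM]] := bD.
exists C => //; exists (M + 1) => k x; rewrite quotientE//.
have il := integrable_line x (- axis_step i k) (test_derive_measurable i tphi) bD.
have E : (fun s : RM => \1_I01 s * 'D_(basis_rV R i) phi (x + s *: axis_step i k)) =
   fun s : RM => \1_I01 s * 'D_(basis_rV R i) phi (x - s *: (- axis_step i k)).
  by apply/funext => s; rewrite scalerN opprK.
rewrite E; apply: (le_trans (le_norm_rint il)).
have lI : (leb I01 < +oo)%E by rewrite lebesgue_I01 ltry.
have [iI II] := @rint_cst_indic _ _ _ leb I01 (C * \1_(cube (M + 1)) x) (measurable_itv _) lI.
apply: (@le_trans _ _ (\int[leb]_s (C * \1_(cube (M + 1)) x * \1_I01 s))).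
  apply: le_rint => //; first exact: intb_norm.
  move=> s; rewrite normrM mulrC (ger0_norm (_ : 0 <= \1_I01 s))//.
  have [sI|sI] := boolP (s \in I01); last by rewrite [\1_I01 s]indicE (negbTE sI) !mulr0.
  rewrite [\1_I01 s]indicE sI !mulr1; apply: (le_trans (hM _)); rewrite ler_wpM2l// !indicE ler_nat.
  have [h|//] := boolP (_ \in cube M).
  rewrite (_ : x \in cube (M + 1))//; apply/mem_set.
  move: sI; rewrite inE /= in_itv /= => s01.
  have := cube_line s01 (set_mem h).
  by apply: subset_cube; rewrite lerD2l normrN normr_axis_step.
by rewrite II [X in fine X](_ : _ = 1%E) ?mulr1//; exact: lebesgue_I01.
Qed.

Lemma quotient_cvg phi i x : test_function phi ->
  quotient phi i k x @[k --> \oo] --> 'D_(basis_rV R i) phi x.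
Proof.
move=> [/(_ 1%N)[_ /(_ i)[dphi _]] _].
have := dphi x => /cvg_ex[l hl].
have E : 'D_(basis_rV R i) phi x = l by exact: cvg_lim hl.
rewrite E; have ct : k.+1%:R^-1 @[k --> \oo] --> (0 : R)^'.
  move=> A hA; have [N _ hN] := @cvg_harmonic R _ hA; exists N => // k /hN; apply.
  by rewrite /= invr_eq0 pnatr_eq0.
rewrite (_ : quotient phi i ^~ x = (fun h : R => h^-1 *: ((phi \o shift x) (h *: basis_rV R i) - phi x)) \o (fun k => k.+1%:R^-1)).
  exact: cvg_comp ct hl.
apply/funext => k; by rewrite /= invrK (addrC _ x).
Qed.

(** Discrete integration by parts: translation invariance moves the backward quotient of v to a
    forward quotient of phi, which converges with bounded support. A weak derivative is thus
    recognized from a limit of difference quotients. *)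
Lemma weak_gradient_of_quotients v (h : 'rV[R]_n -> R) i phi : measurable_fun setT v ->
  locally_integrable v -> test_function phi ->
  \int[lam]_x (k.+1%:R * (v (x - axis_step i k) - v x) * phi x) @[k --> \oo] -->
    (- \int[lam]_x (h x * phi x)) ->
  \int[lam]_x (v x * 'D_(basis_rV R i) phi x) = - \int[lam]_x (h x * phi x).
Proof.
move=> mv lv tphi hh; apply: cvg_unique hh => //.
have mphi := test_measurable tphi; have bphi := test_function_bounded_support tphi.
have mq k : measurable_fun setT (quotient phi i k).
  by apply: measurable_funM => //; apply: measurable_funB => //; exact: measurable_funshift.
have [C C0 [M hM]] := quotient_bounded i tphi.
have iC : intb (fun x => C * `|\1_(cube M) x * v x|) by apply: intbZ; apply: intb_norm; exact: lv.
have [||||_ cI _] := @rint_dominated _ _ _ lam (fun k x => v x * quotient phi i k x)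
    (fun x => v x * 'D_(basis_rV R i) phi x) _ _ _ _ iC.
- by move=> k; exact: measurable_funM.
- by apply: measurable_funM => //; exact: test_derive_measurable.
- by apply: aeW => x; apply: cvgM; [exact: cvg_cst|exact: quotient_cvg].
- apply: aeW => x k; rewrite !normrM mulrC mulrA ler_wpM2r//.
  by rewrite -normrM (ger0_norm (_ : 0 <= \1_(cube M) x))//; exact: hM.
rewrite (_ : (fun k => _) = fun k => \int[lam]_x (v x * quotient phi i k x)) ; first exact: cI.
apply/funext => k.
have i0 : intb (fun x => v x * phi x) by exact: locally_integrable_mul.
have i1 : intb (fun x => v (x - axis_step i k) * phi x).
  by apply: locally_integrable_mul => //; [exact: measurable_funshift|exact: locally_integrable_shift].
have i2 : intb (fun x => v x * phi (x + axis_step i k)).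
  have := intb_shift (axis_step i k) i1; congr (_.-integrable _ _); apply/funext => x /=.
  by rewrite addrK.
have E2 : \int[lam]_x (v x * phi (x + axis_step i k)) = \int[lam]_x (v (x - axis_step i k) * phi x).
  rewrite -(rint_shift (axis_step i k) (intb_measurable i1)); congr Rintegral.
  by apply/funext => x; rewrite addrK.
transitivity (k.+1%:R * (\int[lam]_x (v x * phi (x + axis_step i k)) - \int[lam]_x (v x * phi x))).
  rewrite E2 -rintB// -rintZ; last exact: intbB.
  by congr Rintegral; apply/funext => x; rewrite -mulrA mulrBl.
rewrite -rintB// -rintZ; last exact: intbB.
by congr Rintegral; apply/funext => x; rewrite /quotient [RHS]mulrCA -mulrBr.
Qed.

End difference_quotients.

Arguments axis_step {R n} i k.

(** * The square of the negative part *)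

Section negative_square.
Context (R : realType).
Implicit Types a b c : R.

(* The square makes the negative part C^1, so that its divided difference
   converges to the derivative and no chain rule for Lipschitz maps is needed. *)
Definition negsq a : R := Num.min a 0 ^+ 2.

(** The value on the diagonal is the derivative of [negsq], which makes the slope continuous
    there. *)
Definition negsq_slope a b : R :=
  if a == b then 2 * Num.min b 0 else (negsq a - negsq b) / (a - b).

Lemma negsq_slopeE a b : negsq a - negsq b = negsq_slope a b * (a - b).
Proof.
rewrite /negsq_slope; case: eqVneq => [->|ab]; first by rewrite !subrr mulr0.
by rewrite mulfVK// subr_eq0.
Qed.

Let slope_between a b : a < b -> 2 * Num.min a 0 <= (negsq a - negsq b) / (a - b) <= 2 * Num.min b 0.
Proof.
move=> ab; have ba : 0 < b - a by rewrite subr_gt0.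
have -> : (negsq a - negsq b) / (a - b) = (negsq b - negsq a) / (b - a).
  by rewrite -(opprB b a) invrN mulrN -mulNr opprB.
rewrite ler_pdivlMr// ler_pdivrMr// /negsq !expr2.
by case: (leP a 0) => ha; case: (leP b 0) => hb; apply/andP; split; nra.
Qed.

Let min0_lipschitz a b : `|Num.min a 0 - Num.min b 0| <= `|a - b|.
Proof.
have := ler_norm (a - b); have := ler_norm (b - a); rewrite distrC => h1 h2.
by rewrite ler_norml; case: (leP a 0) => ha; case: (leP b 0) => hb; apply/andP; split; lra.
Qed.

Lemma negsq_slope_near a b c : `|negsq_slope a b - 2 * Num.min c 0| <= 2 * `|a - c| + 2 * `|b - c|.
Proof.
have := min0_lipschitz a c; have := min0_lipschitz b c.
rewrite /negsq_slope; case: eqVneq => [->|ab].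
  rewrite -mulrBr normrM ger0_norm// => h _; have := normr_ge0 (b - c); lra.
have q : 2 * Num.min (Num.min a 0) (Num.min b 0) <= (negsq a - negsq b) / (a - b) <=
    2 * Num.max (Num.min a 0) (Num.min b 0).
  have [lt|gt|E] := ltgtP a b; last by rewrite E eqxx in ab.
    have /andP[h1 h2] := slope_between lt; apply/andP; split.
      by apply: le_trans h1; rewrite ler_wpM2l// ge_min lexx.
    by apply: (le_trans h2); rewrite ler_wpM2l// le_max lexx orbT.
  have /andP[h1 h2] := slope_between gt.
  have E : (negsq b - negsq a) / (b - a) = (negsq a - negsq b) / (a - b).
    by rewrite -(opprB b a) invrN mulrN -mulNr opprB.
  rewrite E in h1 h2; apply/andP; split.
    by apply: le_trans h1; rewrite ler_wpM2l// ge_min lexx orbT.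
  by apply: (le_trans h2); rewrite ler_wpM2l// le_max lexx.
move: q; move: ((negsq a - negsq b) / (a - b)) (Num.min a 0) (Num.min b 0) (Num.min c 0) => q A B C.
rewrite !ler_norml; have [h|h] := leP A B => /andP[q1 q2] /andP[h1 h2] /andP[h3 h4];
  by apply/andP; split; lra.
Qed.

Lemma negsq_slope_le a b : `|negsq_slope a b| <= 2 * `|a| + 2 * `|b|.
Proof. by have := negsq_slope_near a b 0; rewrite minxx mulr0 !subr0. Qed.

Lemma measurable_invr d (T : measurableType d) (f : T -> R) :
  measurable_fun setT f -> measurable_fun setT (fun x => (f x)^-1).
Proof.
(* The inverse of f is f times the square of |f|^(-1), a real power; both sides are 0 where f
   vanishes. *)
move=> mf; rewrite (_ : (fun x => _) = fun x => f x * (`|f x| `^ (-1)) ^+ 2).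
  apply: measurable_funM => //; apply: measurable_funX.
  by apply: (measurableT_comp (measurable_powR _)); exact: measurableT_comp.
apply/funext => x; have [->|f0] := eqVneq (f x) 0; first by rewrite invr0 mul0r.
rewrite powR_inv1// exprVn real_normK ?num_real// expr2 invfM mulrA mulfV// mul1r.
by [].
Qed.

Lemma measurable_negsq : measurable_fun setT negsq.
Proof. by apply: measurable_funX; exact: measurable_minr. Qed.

Lemma measurable_negsq_slope d (T : measurableType d) (f g : T -> R) :
  measurable_fun setT f -> measurable_fun setT g ->
  measurable_fun setT (fun x => negsq_slope (f x) (g x)).
Proof.
move=> mf mg; apply: measurable_fun_ifT.
- exact: measurable_fun_eqr.
- by apply: measurable_funM => //; exact: measurable_minr.
apply: measurable_funM.
  by apply: measurable_funB; exact: (measurableT_comp measurable_negsq).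
by apply: measurable_invr; exact: measurable_funB.
Qed.

End negative_square.

(** * Weak gradient of the square of the negative part *)

Section chain_rule.
Context (R : realType) (n : nat) (p : R) (n0 : (0 < n)%N) (np : n%:R < p).
Local Notation lam := (@lebesgue_borel R n).
Local Notation leb := (@lebesgue_measure R).
Local Notation intb f := (lam.-integrable setT (EFin \o f)).
Local Notation RM := (measurableTypeR R).
Local Notation I01 := (`[0%R, 1%R]%classic : set RM).
Let p0 : 0 < p. Proof. by rewrite (le_lt_trans _ np). Qed.

Variables (u : 'rV[R]_n -> R) (G : 'rV[R]_n -> 'rV[R]_n) (M : R).
Hypotheses (uG : borel_sobolev p u G) (uM : forall x, `|u x| <= M).

Let M0 : 0 <= M. Proof. exact: le_trans (normr_ge0 _) (uM 0). Qed.
Let mu : measurable_fun setT u. Proof. by case: uG. Qed.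
Let mG i : measurable_fun setT (fun x => G x ord0 i). Proof. by case: uG. Qed.
Let lu : locally_integrable u.
Proof. by case: uG => _ _ iu _ _; exact: (locally_integrable_powR n0 np). Qed.
Let lG i : locally_integrable (fun x => G x ord0 i).
Proof.
case: uG => _ _ _ iG _; apply: (locally_integrable_powR n0 np) => //.
by apply: (integrable_powR_norm (ltW p0)) iG => // x; exact: coor_le_enorm.
Qed.

(** [ae_hoelder] is applied to countably many shifts, with one constant, so a common null set can be
    discarded. *)
Lemma ae_cvg_translate (h : nat -> 'rV[R]_n) : (forall k, enorm (h k) <= k.+1%:R^-1) ->
  {ae lam, forall x, u (x + h k) @[k --> \oo] --> u x}.
Proof.
move=> hh; case: uG => _ _ iu iG wG.
have [C C0 H] := ae_hoelder n0 np mu mG iu iG lG (borel_weak_gradient_bump wG).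
have al0 := hoelder_exponent_gt0 n0 np.
have : {ae lam, forall x k, `|u (x + h k) - u x| <= C * k.+1%:R^-1 `^ hoelder_exponent n p}.
  apply: ae_countable => k; have [->|hk] := eqVneq (h k) 0.
    by apply: aeW => x; rewrite addr0 subrr normr0 mulr_ge0 ?powR_ge0.
  apply: ae_mono (H _ hk) => x; move/le_trans; apply; rewrite ler_wpM2l//.
  by apply: ge0_ler_powR; rewrite ?nnegrE ?(ltW al0) ?enorm_ge0.
apply: ae_mono => x hx; apply/subr_cvg0/norm_cvg0P.
apply: (@squeeze_cvgr _ _ _ _ (fun=> 0) (fun k => C * k.+1%:R^-1 `^ hoelder_exponent n p)).
- by apply: nearW => k; rewrite normr_ge0 hx.
- exact: cvg_cst.
rewrite -(mulr0 C); apply: cvgMl_tmp; apply: cvg_powR0 => //.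
exact: cvg_harmonic.
Qed.

Let slope i k x := negsq_slope (u (x - axis_step i k)) (u x).

Let slope_le i k x : `|slope i k x| <= 4 * M.
Proof.
apply: (le_trans (negsq_slope_le _ _)).
by have := uM x; have := uM (x - axis_step i k); lra.
Qed.

Let measurable_slope i k : measurable_fun setT (slope i k).
Proof. by apply: measurable_negsq_slope => //; exact: measurable_funshift. Qed.

Let enorm_line (s : R) (i : 'I_n) k : 0 <= s <= 1 -> enorm (s *: axis_step i k) <= k.+1%:R^-1.
Proof. by move=> /andP[s0 s1]; rewrite enormZ enorm_axis_step ger0_norm// ler_piMl. Qed.

(** At the point x + s e, with e the step, the slope compares the values of u at x - (1 - s) e and x
    + s e, and both converge to u x by [ae_cvg_translate]. *)
Let slope_cvg i s : 0 <= s <= 1 ->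
  {ae lam, forall x, slope i k (x + s *: axis_step i k) @[k --> \oo] --> 2 * Num.min (u x) 0}.
Proof.
move=> s01; have s01' : 0 <= 1 - s <= 1 by move: s01; lra.
have h1 := ae_cvg_translate (fun k => enorm_line i k s01).
have h2 : {ae lam, forall x, u (x - (1 - s) *: axis_step i k) @[k --> \oo] --> u x}.
  by apply: (@ae_cvg_translate (fun k => - ((1 - s) *: axis_step i k))) => k; rewrite enormN enorm_line.
apply: ae_mono (ae_and h1 h2) => x [c1 c2].
apply/subr_cvg0/norm_cvg0P.
apply: (@squeeze_cvgr _ _ _ _ (fun=> 0) (fun k => 2 * `|u (x - (1 - s) *: axis_step i k) - u x| + 2 * `|u (x + s *: axis_step i k) - u x|)).
- apply: nearW => k; rewrite normr_ge0 /= /slope.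
  have -> : x + s *: axis_step i k - axis_step i k = x - (1 - s) *: axis_step i k.
    by rewrite scalerBl scale1r opprB addrA.
  exact: negsq_slope_near.
- exact: cvg_cst.
rewrite -[X in _ --> X]addr0 -[in X in _ --> X](mulr0 2).
by apply: cvgD; apply: cvgMl_tmp; apply/norm_cvg0P/subr_cvg0.
Qed.

Let phi_bound (phi : 'rV[R]_n -> R) : bounded_support phi -> exists2 C, 0 <= C & exists K,
  forall i k s x, 0 <= s <= 1 -> `|phi (x + s *: axis_step i k)| <= C * \1_(cube K) x.
Proof.
move=> [C C0 [K hK]]; exists C => //; exists (K + 1) => i k s x s01.
apply: (le_trans (hK _)); rewrite ler_wpM2l// !indicE ler_nat.
have [h|//] := boolP (_ \in cube K); rewrite (_ : x \in _)//; apply/mem_set.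
have := @cube_line _ _ K s x (- axis_step i k) s01; rewrite scalerN opprK => /(_ (set_mem h)).
by apply: subset_cube; rewrite lerD2l normrN normr_axis_step.
Qed.

Let J (phi : 'rV[R]_n -> R) i k (s : R) :=
  \int[lam]_x (G x ord0 i * (slope i k (x + s *: axis_step i k) * phi (x + s *: axis_step i k))).

Let J_cvg phi i s : test_function phi -> 0 <= s <= 1 ->
  J phi i k s @[k --> \oo] --> \int[lam]_x (G x ord0 i * (2 * Num.min (u x) 0 * phi x)).
Proof.
move=> tphi s01; have [C C0 [K hK]] := phi_bound (test_function_bounded_support tphi).
have mphi := test_measurable tphi.
have iC : intb (fun x => 4 * M * C * `|\1_(cube K) x * G x ord0 i|).
  by apply: intbZ; apply: intb_norm; exact: lG.
have [||||_ cI _] := @rint_dominated _ _ _ lam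
  (fun k x => G x ord0 i * (slope i k (x + s *: axis_step i k) * phi (x + s *: axis_step i k)))
  (fun x => G x ord0 i * (2 * Num.min (u x) 0 * phi x)) _ _ _ _ iC; last exact: cI.
- move=> k; apply: measurable_funM => //; apply: measurable_funM; last exact: measurable_funshift.
  exact: (measurable_funshift _ (measurable_slope i k)).
- apply: measurable_funM => //; apply: measurable_funM => //; apply: measurable_funM => //.
  exact: measurable_minr.
- apply: ae_mono (slope_cvg i s01) => x hx; apply: cvgMl_tmp; apply: cvgM => //.
  have [/(_ 0%N)[cphi _] _] := tphi.
  have ch : x + s *: axis_step i k @[k --> \oo] --> x.
    rewrite -[X in _ --> X]addr0; apply: cvgD; first exact: cvg_cst.
    rewrite -(scaler0 _ s); apply: cvgZl_tmp; rewrite -(scale0r (basis_rV R i)).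
    by apply: cvgZr_tmp; exact: cvg_harmonic.
  exact: (cvg_comp _ _ ch (@cphi x)).
- apply: aeW => x k; rewrite !normrM.
  have h1 := slope_le i k (x + s *: axis_step i k); have h2 := hK i k s x s01.
  rewrite mulrA mulrC (ger0_norm (_ : 0 <= \1_(cube K) x))//.
  have -> : 4 * M * C * (\1_(cube K) x * `|G x ord0 i|) = (4 * M) * (C * \1_(cube K) x) * `|G x ord0 i| by ring.
  have -> : `|phi (x + s *: axis_step i k)| * (`|G x ord0 i| * `|slope i k (x + s *: axis_step i k)|) =
    `|slope i k (x + s *: axis_step i k)| * `|phi (x + s *: axis_step i k)| * `|G x ord0 i| by ring.
  by rewrite ler_wpM2r//; apply: ler_pM.
Qed.

(** The quotient of negsq(u) is the slope times the quotient of u, and [ae_FTC] writes the latter as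
    minus a mean of the i-th component of G along the segment; a translation moves the segment onto
    the slope and phi, leaving G fixed while k varies. *)
Let J_int phi i k : test_function phi ->
  \int[lam]_x (k.+1%:R * (negsq (u (x - axis_step i k)) - negsq (u x)) * phi x) =
  - \int[leb]_s (\1_I01 s * J phi i k s).
Proof.
move=> tphi; have mphi := test_measurable tphi.
have [C C0 [K hK]] := test_function_bounded_support tphi.
pose psi x := slope i k x * phi x.
have mpsi : measurable_fun setT psi by exact: measurable_funM.
have bpsi : bounded_support psi.
  exists (4 * M * C); first by rewrite !mulr_ge0.
  by exists K => x; rewrite normrM -(mulrA (4 * M)); apply: ler_pM.
case: uG => _ _ iu iG wG.
have ftc := ae_FTC mu lu mG lG (borel_weak_gradient_bump wG) (- axis_step i k).
have [iL EL] := rint_line_shift (- axis_step i k) (mG i) (lG i) mpsi bpsi.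
have -> : \int[leb]_s (\1_I01 s * J phi i k s) =
  \int[leb]_s (\1_I01 s * \int[lam]_x (G x ord0 i * psi (x - s *: (- axis_step i k)))).
  congr Rintegral; apply/funext => s; congr (_ * _); congr Rintegral; apply/funext => x.
  by rewrite scalerN opprK.
rewrite -EL -rintN; apply: ae_eq_rint.
- apply: measurable_funM => //; apply: measurable_funM => //; apply: measurable_funB.
    by apply: (measurableT_comp (@measurable_negsq R)); exact: measurable_funshift.
  exact: (measurableT_comp (@measurable_negsq R)).
- exact: intb_measurable (intbN iL).
apply: ae_mono ftc => x hx; rewrite negsq_slopeE hx (bigD1 i)//= big1 => [|j ji].
  rewrite addr0 mxE axis_step_coor eqxx mulr1 /psi /slope.
  move: (negsq_slope _ _) (phi x) (\int[leb]_s _) => a b c.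
  have : k.+1%:R != 0 :> R by rewrite pnatr_eq0.
  by move: (k.+1%:R : R) => t t0; field.
by rewrite mxE axis_step_coor eq_sym (negbTE ji) mulr0 oppr0 mul0r.
Qed.

Let J_measurable phi i k : test_function phi ->
  measurable_fun (setT : set RM) (fun s : RM => \1_I01 s * J phi i k s).
Proof.
move=> tphi; have mphi := test_measurable tphi.
apply: measurable_funM; first by apply: measurable_indic; exact: measurable_itv.
apply: (measurable_rint2 lam (f := fun (s : RM) x =>
  G x ord0 i * (slope i k (x + s *: axis_step i k) * phi (x + s *: axis_step i k)))).
have ml : measurable_fun setT (fun w : RM * 'rV[R]_n => w.2 + w.1 *: axis_step i k).
  apply: (measurableT_comp (measurable_line (axis_step i k)) (_ : measurable_fun setT (fun w : RM * 'rV[R]_n => (w.2, w.1)))).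
  by apply: measurable_fun_pair; [exact: measurable_snd|exact: measurable_fst].
apply: measurable_funM; first exact: (measurableT_comp (mG i) measurable_snd).
apply: measurable_funM; first exact: (measurableT_comp (measurable_slope i k) ml).
exact: (measurableT_comp mphi ml).
Qed.

Let J_bound phi i : test_function phi -> exists2 D, 0 <= D &
  forall k s, 0 <= s <= 1 -> `|J phi i k s| <= D.
Proof.
move=> tphi; have [C C0 [K hK]] := phi_bound (test_function_bounded_support tphi).
have mphi := test_measurable tphi.
have iC : intb (fun x => 4 * M * C * `|\1_(cube K) x * G x ord0 i|).
  by apply: intbZ; apply: intb_norm; exact: lG.
exists (\int[lam]_x (4 * M * C * `|\1_(cube K) x * G x ord0 i|)).
  by apply: rint_ge0 => x; rewrite !mulr_ge0.
move=> k s s01.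
have dom x : `|G x ord0 i * (slope i k (x + s *: axis_step i k) * phi (x + s *: axis_step i k))| <=
    4 * M * C * `|\1_(cube K) x * G x ord0 i|.
  rewrite !normrM.
  have h1 := slope_le i k (x + s *: axis_step i k); have h2 := hK i k s x s01.
  rewrite (ger0_norm (_ : 0 <= \1_(cube K) x))//.
  have -> : 4 * M * C * (\1_(cube K) x * `|G x ord0 i|) = `|G x ord0 i| * ((4 * M) * (C * \1_(cube K) x)) by ring.
  by rewrite ler_wpM2l//; apply: ler_pM.
have iJ : intb (fun x => G x ord0 i * (slope i k (x + s *: axis_step i k) * phi (x + s *: axis_step i k))).
  apply: intb_le iC dom; apply: measurable_funM => //; apply: measurable_funM; last exact: measurable_funshift.
  exact: (measurable_funshift _ (measurable_slope i k)).
by apply: (le_trans (le_norm_rint iJ)); apply: le_rint => //; exact: intb_norm.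
Qed.

(** By [J_int] the tested quotients are integrals over s of [J]. The slope stays below 4 M and tends
    to 2 min(u, 0), so dominated convergence, in x and then in s, identifies the gradient. *)
Lemma borel_sobolev_negsq :
  borel_sobolev p (fun x => negsq (u x)) (fun x => (2 * Num.min (u x) 0) *: G x).
Proof.
have [_ _ iu iG _] := uG.
have mv : measurable_fun setT (fun x => negsq (u x)) by exact: (measurableT_comp (@measurable_negsq R)).
have minM x : `|Num.min (u x) 0| <= M.
  by case: (leP (u x) 0) => _; rewrite ?normr0.
have mm : measurable_fun setT (fun x => 2 * Num.min (u x) 0).
  by apply: measurable_funM => //; exact: measurable_minr.
have iv : intb (fun x => `|negsq (u x)| `^ p).
  apply: (@integrable_powR_norm _ _ _ _ (fun x => M * `|u x|) (ltW p0) mv).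
    move=> x; rewrite /negsq expr2 normrM ler_pM//.
    by case: (leP (u x) 0) => _; rewrite ?normr0.
  rewrite (_ : (fun x => _) = fun x => M `^ p * `|u x| `^ p); first exact: intbZ.
  by apply/funext => x; rewrite powRM.
split => //.
- by move=> i; under eq_fun do rewrite mxE; exact: measurable_funM.
- apply: (@intb_le _ _ _ _ _ (fun x => (2 * M) `^ p * enorm (G x) `^ p)).
  + apply: (measurableT_comp (measurable_powR _)); apply: measurable_enorm => i.
    by under eq_fun do rewrite mxE; exact: measurable_funM.
  + exact: intbZ.
  + move=> x; rewrite ger0_norm ?powR_ge0// -powRM ?enorm_ge0 ?mulr_ge0//.
    apply: (ge0_ler_powR (ltW p0)); rewrite ?nnegrE ?mulr_ge0 ?enorm_ge0//.
    by rewrite enormZ ler_wpM2r ?enorm_ge0// normrM ger0_norm// ler_wpM2l.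
move=> phi tphi i.
have lv : locally_integrable (fun x => negsq (u x)) by exact: (locally_integrable_powR n0 np).
have E : \int[lam]_x (((2 * Num.min (u x) 0) *: G x) ord0 i * phi x) =
    \int[lam]_x (G x ord0 i * (2 * Num.min (u x) 0 * phi x)).
  by congr Rintegral; apply/funext => x; rewrite mxE mulrAC mulrC mulrA.
rewrite E (_ : (fun x => _ * (_ * phi x)) = fun x => G x ord0 i * (2 * Num.min (u x) 0) * phi x); last first.
  by apply/funext => x; rewrite mulrA.
apply: (@weak_gradient_of_quotients _ _ _ (fun x => G x ord0 i * (2 * Num.min (u x) 0))) => //.
  have [D D0 hD] := J_bound i tphi.
  have lI : (leb I01 < +oo)%E by rewrite lebesgue_I01 ltry.
  have [iI _] := @rint_cst_indic _ _ _ leb I01 D (measurable_itv _) lI.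
  set L := \int[lam]_x (G x ord0 i * (2 * Num.min (u x) 0 * phi x)).
  have [||||_ cI _] := @rint_dominated _ _ _ leb (fun k (s : RM) => \1_I01 s * J phi i k s)
    (fun s : RM => L * \1_I01 s) _ _ _ _ iI.
  - by move=> k; exact: J_measurable.
  - by apply: measurable_funM => //; apply: measurable_indic; exact: measurable_itv.
  - apply: aeW => s; rewrite mulrC indicE; have [sI|_] := boolP (s \in I01).
      apply: cvgMl_tmp; apply: J_cvg => //.
      by move: sI; rewrite inE /= in_itv.
    by rewrite mul0r; under eq_fun do rewrite mul0r; exact: cvg_cst.
  - apply: aeW => s k; rewrite normrM mulrC (ger0_norm (_ : 0 <= \1_I01 s))//.
    rewrite [\1_I01 s]indicE; have [sI|_] := boolP (s \in I01); last by rewrite !mulr0.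
    rewrite !mulr1; apply: hD.
    by move: sI; rewrite inE /= in_itv.
  have [_ II] := @rint_cst_indic _ _ _ leb I01 L (measurable_itv _) lI.
  rewrite II [X in fine X](_ : _ = 1%E) ?mulr1 in cI; last exact: lebesgue_I01.
  rewrite (_ : (fun k => _) = fun k => - \int[leb]_s (\1_I01 s * J phi i k s)).
    rewrite (_ : \int[lam]_x (_ * phi x) = L); first exact: cvgN.
    by rewrite /L; congr Rintegral; apply/funext => x; rewrite -mulrA.
  by apply/funext => k; exact: J_int.
Qed.

End chain_rule.

(** * The cone function *)

(** The sphere lies in the shells between radii rho and rho + 1/(k+1), whose volumes tend to 0. The
    cone has its kinks on two spheres. *)
Lemma sphere_null (R : realType) (n : nat) (n0 : (0 < n)%N) (x0 : 'rV[R]_n) (rho : R) : 0 < rho ->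
  {ae @lebesgue_borel R n, forall x, enorm (x - x0) != rho}.
Proof.
move=> rho0; set lam := @lebesgue_borel R n; set om := ball_volume R n.
pose A := [set x : 'rV[R]_n | enorm (x - x0) = rho].
have mA : measurable A.
  have := measurable_enormB x0 (measurableT) (@measurable_set1 R rho); rewrite setTI.
  by congr measurable; apply/seteqP; split => x.
exists A; split => //; last by move=> x /= /negP/negPn/eqP.
have bound k : (lam A <= (om * ((rho + k.+1%:R^-1) ^+ n - rho ^+ n))%:E)%E.
  have rk : 0 <= rho + k.+1%:R^-1 by rewrite addr_ge0// ltW.
  have sub : eball x0 rho `<=` eball x0 (rho + k.+1%:R^-1).
    by move=> x /= h; apply: (lt_trans h); rewrite ltrDl invr_gt0.
  have fin : (lam (eball x0 rho) < +oo)%E by rewrite [X in (X < _)%E](lam_eball x0 (ltW rho0) n0) ltry.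
  have fin' : (lam (eball x0 (rho + k.+1%:R^-1)) < +oo)%E.
    by rewrite [X in (X < _)%E](lam_eball x0 rk n0) ltry.
  have E := measureD (mu := lam) (measurable_eball x0 (rho + k.+1%:R^-1)) (measurable_eball x0 rho) fin'.
  rewrite (setIidr sub) in E.
  apply: (@le_trans _ _ (lam (eball x0 (rho + k.+1%:R^-1) `\` eball x0 rho))).
    apply: le_measure; rewrite ?inE//; first by apply: measurableD; exact: measurable_eball.
    by move=> x /= Ax; split; rewrite /eball /= Ax ?ltrDl ?invr_gt0 ?ltxx.
  rewrite E [X in (X - _)%E](lam_eball x0 rk n0) [X in (_ - X)%E](lam_eball x0 (ltW rho0) n0).
  by rewrite -EFinB lee_fin mulrBr.
have lAfin : lam A \is a fin_num.
  by rewrite ge0_fin_numE ?measure_ge0//; apply: le_lt_trans (bound 0%N) _; rewrite ltry.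
apply/eqP; rewrite eq_le measure_ge0 andbT -(fineK lAfin) lee_fin.
have cb : om * ((rho + k.+1%:R^-1) ^+ n - rho ^+ n) @[k --> \oo] --> (0 : R).
  rewrite -(mulr0 om) -(subrr (rho ^+ n)); apply: cvgMl_tmp; apply: cvgB; last exact: cvg_cst.
  have h : rho + k.+1%:R^-1 @[k --> \oo] --> rho.
    by rewrite -[X in _ --> X]addr0; apply: cvgD; [exact: cvg_cst|exact: cvg_harmonic].
  exact: (cvg_comp _ _ h (@exprn_continuous R n rho)).
rewrite -(cvg_lim _ cb)//; apply: limr_ge; first exact: cvgP cb.
by apply: nearW => k; rewrite -lee_fin fineK.
Qed.

Section cone.
Context (R : realType) (n : nat) (p : R) (n0 : (0 < n)%N) (np : n%:R < p).
Local Notation lam := (@lebesgue_borel R n).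
Local Notation intb f := (lam.-integrable setT (EFin \o f)).
Local Notation om := (ball_volume R n).
Variables (x0 : 'rV[R]_n) (r d : R).
Hypotheses (r0 : 0 < r) (d0 : 0 < d).
Let p0 : 0 < p. Proof. by rewrite (le_lt_trans _ np). Qed.

Definition tent (t : R) : R := d * Num.min 1 (Num.max 0 (2 * (1 - t / r))).

Lemma tent_lipschitz s t : `|tent s - tent t| <= 2 * d / r * `|s - t|.
Proof.
have lipmax (a b : R) : `|Num.max 0 a - Num.max 0 b| <= `|a - b|.
  have := ler_norm (a - b); have := ler_norm (b - a); rewrite distrC => h1 h2.
  by rewrite ler_norml; case: (leP 0 a) => ha; case: (leP 0 b) => hb; apply/andP; split; lra.
have lipmin (a b : R) : `|Num.min 1 a - Num.min 1 b| <= `|a - b|.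
  have := ler_norm (a - b); have := ler_norm (b - a); rewrite distrC => h1 h2.
  by rewrite ler_norml; case: (leP 1 a) => ha; case: (leP 1 b) => hb; apply/andP; split; lra.
rewrite /tent -mulrBr normrM gtr0_norm//.
apply: (@le_trans _ _ (d * `|2 * (1 - s / r) - 2 * (1 - t / r)|)).
  by rewrite ler_wpM2l ?(ltW d0)//; exact: le_trans (lipmin _ _) (lipmax _ _).
have -> : 2 * (1 - s / r) - 2 * (1 - t / r) = - (2 / r * (s - t)) by field; rewrite gt_eqF.
rewrite normrN normrM gtr0_norm ?divr_gt0//.
by rewrite !mulrA (mulrC d 2).
Qed.

Lemma tent_inner t : t <= r / 2 -> tent t = d.
Proof.
move=> h; rewrite /tent min_l ?mulr1// le_max; apply/orP; right.
have : t / r <= 2^-1 by rewrite ler_pdivrMr// mulrC.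
lra.
Qed.

Lemma tent_outer t : r <= t -> tent t = 0.
Proof.
move=> h; have : 1 <= t / r by rewrite ler_pdivlMr// mul1r.
by move=> h1; rewrite /tent max_l; [rewrite min_r ?mulr0|lra].
Qed.

Lemma tent_middle t : r / 2 <= t <= r -> tent t = 2 * d * (1 - t / r).
Proof.
move=> /andP[h1 h2]; have : t / r <= 1 by rewrite ler_pdivrMr// mul1r.
have : 2^-1 <= t / r by rewrite ler_pdivlMr// mulrC.
move=> h3 h4; rewrite /tent max_r; last by lra.
by rewrite min_r; [rewrite mulrA (mulrC d)|lra].
Qed.

Lemma tent_bounds t : 0 <= tent t <= d.
Proof.
rewrite /tent mulr_ge0 ?(ltW d0)//=; last by rewrite le_min ler01 le_max lexx.
by rewrite ler_piMr ?(ltW d0)// ge_min lexx.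
Qed.

Local Notation N x := (enorm (x - x0)).

Definition cone (x : 'rV[R]_n) : R := tent (N x).

Definition cone_grad (x : 'rV[R]_n) : 'rV[R]_n :=
  if (r / 2 < N x) && (N x < r) then (- (2 * d / r) / N x) *: (x - x0) else 0.

Lemma measurable_cone : measurable_fun setT cone.
Proof.
apply: measurable_funM => //; apply: measurable_minr => //; apply: measurable_maxr => //.
apply: measurable_funM => //; apply: measurable_funB => //; apply: measurable_funM => //.
exact: measurable_enormB.
Qed.

Lemma measurable_cone_grad i : measurable_fun setT (fun x => cone_grad x ord0 i).
Proof.
rewrite (_ : (fun x => _) = fun x => if (r / 2 < N x) && (N x < r) then
  (- (2 * d / r) * (N x)^-1) * (x - x0) ord0 i else 0); last first.
  by apply/funext => x; rewrite /cone_grad; case: ifP; rewrite mxE.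
have mN := measurable_enormB x0.
apply: measurable_fun_ifT => //.
  by apply: measurable_and; apply: measurable_fun_ltr.
apply: measurable_funM; first by apply: measurable_funM => //; exact: measurable_invr.
exact: (measurable_funshift (- x0) (measurable_coor i)).
Qed.

Lemma enorm_cone_grad x : enorm (cone_grad x) =
  if (r / 2 < N x) && (N x < r) then 2 * d / r else 0.
Proof.
rewrite /cone_grad; case: ifP => [/andP[h1 _]|_]; last by rewrite enorm0.
have N0 : 0 < N x by rewrite (lt_trans _ h1)// divr_gt0.
rewrite enormZ mulNr normrN ger0_norm ?divr_ge0 ?mulr_ge0 ?(ltW d0) ?(ltW r0) ?(ltW N0)//.
by rewrite mulfVK// gt_eqF.
Qed.

Let norm_axis_step (y : 'rV[R]_n) i k :
  enorm (y - axis_step i k) ^+ 2 = enorm y ^+ 2 - 2 * k.+1%:R^-1 * y ord0 i + k.+1%:R^-1 ^+ 2.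
Proof.
have expand (z : 'rV[R]_n) : enorm (y - z) ^+ 2 = enorm y ^+ 2 - 2 * dotv y z + enorm z ^+ 2.
  by rewrite !enorm_sqr -scaleN1r dotvDl !dotvDr !dotvZl !dotvZr (dotvC z y); ring.
have e1 : dotv y (axis_step i k) = k.+1%:R^-1 * y ord0 i.
  rewrite /dotv (bigD1 i)//= big1 => [|j ji].
    by rewrite axis_step_coor eqxx mulr1 addr0 mulrC.
  by rewrite axis_step_coor eq_sym (negbTE ji) !mulr0.
by rewrite expand e1 enorm_axis_step mulrA.
Qed.

Let N_cvg x i : N (x - axis_step i k) @[k --> \oo] --> N x.
Proof.
apply/subr_cvg0/norm_cvg0P.
apply: (@squeeze_cvgr _ _ _ _ (fun=> 0) (fun k => k.+1%:R^-1)).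
- apply: nearW => k; rewrite normr_ge0 /=; apply: (le_trans (enorm_lipschitz _ _)).
  rewrite [X in enorm X](_ : _ = - axis_step i k) ?enormN ?enorm_axis_step//.
  by rewrite opprB addrA subrK addrAC subrr sub0r.
- exact: cvg_cst.
- exact: cvg_harmonic.
Qed.

Let N_quotient x i : 0 < N x ->
  k.+1%:R * (N (x - axis_step i k) - N x) @[k --> \oo] --> - ((x - x0) ord0 i / N x).
Proof.
(* Multiplying by the sum of the two norms turns their difference into a difference of squares,
   which is polynomial in the step. *)
move=> N0; rewrite (_ : (fun k => _) = fun k =>
  (- 2 * (x - x0) ord0 i + k.+1%:R^-1) * (N (x - axis_step i k) + N x)^-1).
  have -> : - ((x - x0) ord0 i / N x) = (- 2 * (x - x0) ord0 i + 0) * (N x + N x)^-1.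
    have -> : N x + N x = 2 * N x by ring.
    by rewrite addr0 !mulNr invfM mulrACA mulfV// mul1r.
  apply: cvgM; first by apply: cvgD; [exact: cvg_cst|exact: cvg_harmonic].
  apply: cvgV; first by rewrite gt_eqF// addr_gt0.
  by apply: cvgD; [exact: N_cvg|exact: cvg_cst].
apply/funext => k; have k0 : k.+1%:R != 0 :> R by rewrite pnatr_eq0.
have S0 : N (x - axis_step i k) + N x != 0 by rewrite gt_eqF// ltr_wpDl// enorm_ge0.
apply: (mulIf S0); rewrite mulfVK// -mulrA -subr_sqr.
have -> : x - axis_step i k - x0 = x - x0 - axis_step i k by rewrite addrAC.
by rewrite norm_axis_step; move: (k.+1%:R : R) k0 => t t0; field.
Qed.

Let near_gt (f : nat -> R) (l a : R) : f k @[k --> \oo] --> l -> a < l -> \forall k \near \oo, a < f k.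
Proof. by move=> fl al; exact: (cvgr_gt l). Qed.

Let near_lt (f : nat -> R) (l a : R) : f k @[k --> \oo] --> l -> l < a -> \forall k \near \oo, f k < a.
Proof. by move=> fl al; exact: (cvgr_lt l). Qed.

Lemma cone_quotient_cvg x i : N x != r -> N x != r / 2 ->
  k.+1%:R * (cone (x - axis_step i k) - cone x) @[k --> \oo] --> - cone_grad x ord0 i.
Proof.
move=> Nr Nr2; have cN := @N_cvg x i.
have eventually0 : (\forall k \near \oo, cone (x - axis_step i k) = cone x) ->
    k.+1%:R * (cone (x - axis_step i k) - cone x) @[k --> \oo] --> (0 : R).
  move=> ev; apply: cvg_near_cst.
  by apply: filterS ev => k ->; rewrite subrr mulr0.
rewrite /cone_grad; have [h1|h1|E] := ltgtP (r / 2) (N x); last by rewrite E eqxx in Nr2.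
  have [h2|h2|E] := ltgtP (N x) r; last by rewrite E eqxx in Nr.
    rewrite /= mxE.
    have N0 : 0 < N x by rewrite (lt_trans _ h1)// divr_gt0.
    have -> : - (- (2 * d / r) / N x * (x - x0) ord0 i) = - (2 * d / r) * - ((x - x0) ord0 i / N x).
      by field; rewrite !gt_eqF.
    have h : - (2 * d / r) * (k.+1%:R * (N (x - axis_step i k) - N x)) @[k --> \oo] --> - (2 * d / r) * - ((x - x0) ord0 i / N x).
      by apply: cvgMl_tmp; exact: (@N_quotient x i N0).
    apply: cvg_trans h; apply: near_eq_cvg.
    apply: filterS2 (near_gt cN h1) (near_lt cN h2) => k k1 k2.
    by rewrite /cone !tent_middle ?(ltW h1) ?(ltW h2) ?(ltW k1) ?(ltW k2)//; field; rewrite gt_eqF.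
  rewrite /= mxE oppr0; apply: eventually0; apply: filterS (near_gt cN h2) => k k2.
  by rewrite /cone !tent_outer// ltW.
rewrite /= mxE oppr0; apply: eventually0; apply: filterS (near_lt cN h1) => k k2.
by rewrite /cone !tent_inner// ltW.
Qed.

Lemma cone_quotient_le x i k : `|k.+1%:R * (cone (x - axis_step i k) - cone x)| <= 2 * d / r.
Proof.
rewrite normrM ger0_norm// -ler_pdivlMl ?ltr0n//; apply: (le_trans (tent_lipschitz _ _)).
rewrite mulrC ler_wpM2r ?divr_ge0 ?mulr_ge0 ?(ltW d0) ?(ltW r0)//.
apply: (le_trans (enorm_lipschitz _ _)).
rewrite [X in enorm X](_ : _ = - axis_step i k) ?enormN ?enorm_axis_step//.
  by rewrite opprB addrA subrK addrAC subrr sub0r.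
Qed.

Let ball_indic rho : 0 < rho -> intb (fun x => \1_(eball x0 rho) x) /\
  \int[lam]_x \1_(eball x0 rho) x = om * rho ^+ n.
Proof.
move=> rho0; have E := lam_eball x0 (ltW rho0) n0.
have fin : (lam (eball x0 rho) < +oo)%E by rewrite [X in (X < _)%E]E ltry.
have [h1 h2] := @rint_cst_indic _ _ _ lam _ 1 (measurable_eball x0 rho) fin.
have F : (fun x => 1 * \1_(eball x0 rho) x) = \1_(eball x0 rho) :> ('rV[R]_n -> R).
  by apply/funext => x; rewrite mul1r.
by move: h1 h2; rewrite F mul1r [X in fine X]E.
Qed.

Let annulus x : R := \1_(eball x0 r) x - \1_(eball x0 (r / 2)) x.

Let indic_eball rho x : \1_(eball x0 rho) x = (N x < rho)%R%:R :> R.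
Proof. by rewrite indicE; have [h|h] := boolP (N x < rho); [rewrite mem_set|rewrite memNset//; exact/negP]. Qed.

Let annulus_ge x : ((r / 2 < N x) && (N x < r))%R%:R <= annulus x.
Proof.
rewrite /annulus !indic_eball.
have [h1|h1] := ltP (r / 2) (N x); first by rewrite (ltNge (N x) (r / 2)) (ltW h1) subr0.
rewrite /= subr_ge0 ler_nat; have : N x < r.
  by apply: (le_lt_trans h1); rewrite ltr_pdivrMr// ltr_pMr// ltr1n.
by move=> ->; case: (_ < _).
Qed.

Let grad_powR x : enorm (cone_grad x) `^ p <= (2 * d / r) `^ p * annulus x.
Proof.
apply: (@le_trans _ _ ((2 * d / r) `^ p * ((r / 2 < N x) && (N x < r))%R%:R)).
  by rewrite enorm_cone_grad; case: ifP => _; rewrite ?mulr1// mulr0 powR0// gt_eqF.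
by rewrite ler_wpM2l ?powR_ge0.
Qed.

Let fun_powR x : `|cone x| `^ p <= d `^ p * \1_(eball x0 r) x.
Proof.
rewrite indic_eball; have [h|h] := ltP (N x) r.
  rewrite mulr1; have /andP[t0 t1] := tent_bounds (N x).
  by apply: (ge0_ler_powR (ltW p0)); rewrite ?nnegrE ?(ltW d0) ?ger0_norm.
by rewrite /cone tent_outer// normr0 powR0 ?mulr0// gt_eqF.
Qed.

Let intb_annulus : intb annulus /\ \int[lam]_x annulus x = om * r ^+ n - om * (r / 2) ^+ n.
Proof.
have [i1 e1] := ball_indic r0; have [i2 e2] := ball_indic (divr_gt0 r0 (ltr0Sn _ 1)).
by split; [exact: intbB|rewrite rintB// e1 e2].
Qed.

Lemma borel_sobolev_cone : borel_sobolev p cone cone_grad.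
Proof.
have [ia _] := intb_annulus; have [ib _] := ball_indic r0.
have iv : intb (fun x => `|cone x| `^ p).
  apply: (@intb_le _ _ _ _ _ (fun x => d `^ p * \1_(eball x0 r) x)); last 1 first.
  - by move=> x; rewrite ger0_norm ?powR_ge0.
  - by apply: (measurableT_comp (measurable_powR _)); apply: measurableT_comp => //; exact: measurable_cone.
  - exact: intbZ.
split.
- exact: measurable_cone.
- exact: measurable_cone_grad.
- exact: iv.
- apply: (@intb_le _ _ _ _ _ (fun x => (2 * d / r) `^ p * annulus x)).
  + by apply: (measurableT_comp (measurable_powR _)); apply: measurable_enorm; exact: measurable_cone_grad.
  + exact: intbZ.
  + by move=> x; rewrite ger0_norm ?powR_ge0.
move=> phi tphi i; have mphi := test_measurable tphi.
have lv : locally_integrable cone by apply: (locally_integrable_powR n0 np) => //; exact: measurable_cone.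
apply: (weak_gradient_of_quotients measurable_cone lv tphi).
have iphi : intb phi.
  have [C C0 [K hK]] := test_function_bounded_support tphi.
  have [iK _] := @rint_cst_indic _ _ _ lam (cube K) C (measurable_box _ _) (lebesgue_box_lty n0 _ _).
  exact: intb_le iK hK.
have iC : intb (fun x => 2 * d / r * `|phi x|) by apply: intbZ; exact: intb_norm.
rewrite -rintN; have [||||_ cI _] := @rint_dominated _ _ _ lam
  (fun k x => k.+1%:R * (cone (x - axis_step i k) - cone x) * phi x)
  (fun x => - (cone_grad x ord0 i * phi x)) _ _ _ _ iC; last exact: cI.
- move=> k; apply: measurable_funM => //; apply: measurable_funM => //; apply: measurable_funB.
    exact: measurable_funshift measurable_cone.
  exact: measurable_cone.
- by apply: measurableT_comp => //; apply: measurable_funM => //; exact: measurable_cone_grad.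
- apply: ae_mono (ae_and (sphere_null n0 x0 r0) (sphere_null n0 x0 (divr_gt0 r0 (ltr0Sn _ 1)))) => x [h1 h2].
  by rewrite -[X in _ --> X]mulNr; have h := @cone_quotient_cvg x i h1 h2; exact: (cvgM h (cvg_cst (phi x))).
- apply: aeW => x k; rewrite normrM ler_wpM2r//; exact: cone_quotient_le.
Qed.

Variables (b : 'rV[R]_n -> R) (am an : R).
Hypotheses (mb : measurable_fun setT b) (am0 : 0 < am) (b_bnd : forall x, am <= b x <= an).

(** The gradient has length 2 d / r on an annulus of volume om r^n (1 - 2^(-n)), and the cone is at
    most d on a ball of volume om r^n. The sum is d^p om r^(n-p) (2^p - 2^(p-n) + r^p an), which is
    where the last factor of K_R comes from. *)
Lemma cone_energy_le : \int[lam]_x energy_of p b cone cone_grad x <=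
  d `^ p / (const_k n p am `^ p * const_K n p am an r).
Proof.
have [ia ea] := intb_annulus; have [ib eb] := ball_indic r0.
have an0 : 0 < an by case/andP: (b_bnd 0) => h1 h2; apply: lt_le_trans am0 (le_trans h1 h2).
apply: (@le_trans _ _ (\int[lam]_x ((2 * d / r) `^ p * annulus x + an * (d `^ p * \1_(eball x0 r) x)))).
  apply: le_rint; first exact: (integrable_energy mb am0 b_bnd borel_sobolev_cone).
    by apply: intbD; apply: intbZ => //; exact: intbZ.
  move=> x; rewrite /energy_of /energy lerD//.
  case/andP: (b_bnd x) => b1 b2; apply: ler_pM => //; rewrite ?powR_ge0//.
  exact: le_trans (ltW am0) b1.
rewrite rintD; [|exact: intbZ|by apply: intbZ; exact: intbZ].
rewrite (rintZ _ ia) ea (rintZ _ (intbZ _ ib)) (rintZ _ ib) eb.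
rewrite /const_K (gamma_ratioE _ n0).
have k0 : 0 < const_k n p am `^ p by rewrite powR_gt0// (const_k_gt0 n0 np am0).
have om0 := ball_volume_gt0 R n0.
have -> : (2 * d / r) `^ p = 2 `^ p * d `^ p / r `^ p.
  by rewrite !powRM ?mulr_ge0 ?invr_ge0 ?(ltW d0) ?(ltW r0)// powRV// ltW.
have powRBn (x : R) : 0 < x -> x `^ (p - n%:R) = x `^ p / x ^+ n.
  by move=> x0'; rewrite powRD ?(gt_eqF x0') ?implybT// powRN powR_mulrn// ltW.
rewrite !powRBn// expr_div_n.
have := powR_gt0 p r0; have := powR_gt0 p d0; have : 0 < 2 `^ p :> R by rewrite powR_gt0.
have rn0 : 0 < r ^+ n by rewrite exprn_gt0.
have t1 : 1 < 2 ^+ n :> R by rewrite exprn_egt1 ?ltr1n// -lt0n.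
move: k0 om0 rn0 t1; rewrite -/om; move: (const_k n p am `^ p) om (r ^+ n) (2 ^+ n : R) (2 `^ p : R) (d `^ p) (r `^ p).
move=> k w rn tn tp dp rp k0 w0 rn0 t1 tp0 dp0 rp0.
have tn0 : 0 < tn by exact: lt_trans t1.
have S0 : tp - tp / tn + rp * an != 0.
  rewrite gt_eqF// addr_gt0 ?mulr_gt0// subr_gt0 ltr_pdivrMr// ltr_pMr//.
rewrite le_eqVlt; apply/orP; left; apply/eqP; field.
have S1 : tp * tn - tp + rp * an * tn != 0.
  have -> : tp * tn - tp + rp * an * tn = tn * (tp - tp / tn + rp * an) by field; rewrite gt_eqF.
  by rewrite mulf_neq0// gt_eqF.
by rewrite S1 !gt_eqF.
Qed.

End cone.

(** * Nonnegative weak solutions *)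

Section lebesgue_transfer.
Context (R : realType) (n : nat).
Local Notation mu := (lebesgue_rV R n).
Local Notation lam := (@lebesgue_borel R n).

(** Completeness of the Lebesgue measure makes f measurable, being equal to g almost everywhere; so
    integrands built from arbitrary representatives can be exchanged for Borel ones. *)
Lemma ae_rint_lebesgue_borel (f g : 'rV[R]_n -> R) : measurable_fun setT g ->
  {ae mu, forall x, f x = g x} -> \int[mu]_x f x = \int[lam]_x g x.
Proof.
move=> mg fg; have mg' := measurable_fun_borel_lebesgue mg.
have cmu : measure_is_complete mu by exact: measure_is_complete_caratheodory.
have gf : ae_eq mu setT (EFin \o g) (EFin \o f).
  by apply: ae_mono fg => x E _ /=; rewrite E.
have mgE : measurable_fun (setT : set (lebesgue_type R n)) (EFin \o g) by exact/measurable_EFinP.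
have mfE := ae_measurable_fun cmu gf mgE.
rewrite /Rintegral -(ae_eq_integral _ _ measurableT mgE mfE gf).
by congr fine; apply: integral_lebesgue_borel; exact/measurable_EFinP.
Qed.

Lemma borel_sobolev_ae p (u v : 'rV[R]_n -> R) (G : 'rV[R]_n -> 'rV[R]_n) :
  measurable_fun setT v -> {ae lam, forall x, u x = v x} ->
  borel_sobolev p u G -> borel_sobolev p v G.
Proof.
move=> mv uv [mu_ mG iu iG wG]; split => //.
  apply: (ae_eq_intb iu); last by apply: ae_mono uv => x ->.
  by apply: (measurableT_comp (measurable_powR _)); exact: measurableT_comp.
move=> phi tphi i; rewrite -(wG phi tphi i); apply: ae_eq_rint.
- by apply: measurable_funM => //; exact: test_derive_measurable.
- by apply: measurable_funM => //; exact: test_derive_measurable.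
- by apply: ae_mono uv => x ->.
Qed.

End lebesgue_transfer.

(** * Critical points of the truncated problem solve the original one *)

Section critical_points_are_solutions.
Context (R : realType) (n : nat) (p : R) (n0 : (0 < n)%N) (np : n%:R < p).
Local Notation mu := (lebesgue_rV R n).
Local Notation lam := (@lebesgue_borel R n).
Local Notation intb f := (lam.-integrable setT (EFin \o f)).
Local Notation V := (sobolev_space n0 np).
Variables (b : 'rV[R]_n -> R) (am an : R).
Hypotheses (mb : measurable_fun setT b) (am0 : 0 < am) (b_bnd : forall x, am <= b x <= an).
Variables (h : 'rV[R]_n -> R -> R) (m : R -> 'rV[R]_n -> R) (lambda : R).
Hypotheses (mh : forall t, measurable_fun setT (h ^~ t)) (ch : forall x, continuous (h x))
  (im : forall s, intb (m s)) (hm : forall (s : R) x (t : R), `|t| <= s -> `|h x t| <= m s x)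
  (lambda0 : 0 < lambda) (h0 : {ae lam, forall x, 0 <= h x 0}).
Local Notation g := (truncate h).
Local Notation Phi := (sobolev_energy (n0 := n0) (np := np) b).
Local Notation B := (nonlinear_form (n0 := n0) (np := np) g lambda).

Let p1 : 1 < p.
Proof. by rewrite (le_lt_trans _ np)// ler1n. Qed.
Let p0 : 0 < p. Proof. exact: lt_trans p1. Qed.
Let mg := measurable_truncate mh.
Let cg := continuous_truncate ch.
Let gm := truncate_le hm.

Variable u : V.
Hypothesis crit : forall v, Phi u - B u u <= Phi v - B u v.

Lemma critical_euler (v : V) :
  \int[lam]_x energy_derivative p (b x) (sobolev_grad u x) (sobolev_fun u x)
      (sobolev_grad v x) (sobolev_fun v x) =
  lambda * \int[lam]_x (g x (sobolev_fun u x) * sobolev_fun v x).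
Proof.
exact: (euler_equation mb am0 b_bnd (nonlinear_formD mb am0 b_bnd lambda mg cg im gm)
  (nonlinear_formZ mb am0 b_bnd lambda mg cg im gm) v crit).
Qed.

Lemma critical_ge0 : {ae lam, forall x, 0 <= sobolev_fun u x}.
Proof.
pose M := sup_constant n p am * Phi u `^ p^-1.
have uM := sobolev_norm_bound mb am0 b_bnd u.
have uG := sobolev_spaceP u; have [mu_ mG iu iG wG] := uG.
(* u is bounded by M almost everywhere; resetting it to 0 elsewhere gives the everywhere bound of
   the chain rule and changes u on a null set only. *)
pose v x := if `|sobolev_fun u x| <= M then sobolev_fun u x else 0.
have M0 : 0 <= M by rewrite mulr_ge0 ?powR_ge0// ltW// (sup_constant_gt0 n0 np am0).
have mv : measurable_fun setT v.
  apply: measurable_fun_ifT => //; apply: measurable_fun_ler => //.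
  exact: measurableT_comp.
have uv : {ae lam, forall x, sobolev_fun u x = v x}.
  by apply: ae_mono uM => x ux; rewrite /v ux.
have vM x : `|v x| <= M by rewrite /v; case: ifP => // _; rewrite normr0.
have sw := borel_sobolev_negsq n0 np (borel_sobolev_ae mv uv uG) vM.
have wP : ((fun x => negsq (v x)), (fun x => (2 * Num.min (v x) 0) *: sobolev_grad u x)) \in sobolev_pair n0 np.
  exact/asboolP.
pose w := SobolevSpace wP; have := critical_euler w.
set D := fun x => energy_derivative p (b x) (sobolev_grad u x) (sobolev_fun u x) (sobolev_grad w x) (sobolev_fun w x).
have iD : intb D := integrable_energy_derivative mb am0 b_bnd u w.
move=> euler.
have rhs : 0 <= \int[lam]_x (g x (sobolev_fun u x) * sobolev_fun w x).
  have mgu : measurable_fun setT (fun x => g x (sobolev_fun u x) * sobolev_fun w x).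
    apply: measurable_funM; first exact: measurable_superposition.
    exact: (measurableT_comp (@measurable_negsq R)).
  rewrite (@ae_eq_rint _ _ _ _ _ (fun x => `|g x (sobolev_fun u x) * sobolev_fun w x|)).
  - by apply: rint_ge0.
  - exact: mgu.
  - exact: measurableT_comp.
  apply: ae_mono (ae_and uv h0) => x [ux h0x]; rewrite ger0_norm//.
  have -> : sobolev_fun w x = Num.min (sobolev_fun u x) 0 ^+ 2 by rewrite ux.
  have [u0|] := boolP (0 <= sobolev_fun u x); first by rewrite min_r// expr0n /= mulr0.
  rewrite -ltNge => u0.
  by rewrite mulr_ge0 ?sqr_ge0// /truncate max_r// ltW.
(* Tested with w, both terms of the derivative are nonpositive: 2 min(u, 0) times |grad u|^p, and b
   |u|^(p-2) u min(u, 0)^2. *)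
have Dle : {ae lam, forall x, D x <= b x * `|sobolev_fun u x| `^ (p - 2) * sobolev_fun u x * negsq (sobolev_fun u x) /\
    b x * `|sobolev_fun u x| `^ (p - 2) * sobolev_fun u x * negsq (sobolev_fun u x) <= 0}.
  apply: ae_mono uv => x ux.
  have b0 : 0 <= b x by case/andP: (b_bnd x) => b1 _; exact: le_trans (ltW am0) b1.
  have m0 : Num.min (sobolev_fun u x) 0 <= 0 by rewrite ge_min lexx orbT.
  split.
    rewrite /D /energy_derivative.
    have -> : sobolev_grad w x = (2 * Num.min (sobolev_fun u x) 0) *: sobolev_grad u x by rewrite ux.
    have -> : sobolev_fun w x = negsq (sobolev_fun u x) by rewrite ux.
    rewrite gerDr dotvZr mulrCA mulr_le0_ge0//; first by rewrite mulr_ge0_le0.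
    by rewrite mulr_ge0 ?powR_ge0 ?dotvv_ge0.
  have [u0|] := boolP (0 <= sobolev_fun u x); first by rewrite /negsq min_r// expr0n /= mulr0.
  rewrite -ltNge => u0.
  by rewrite mulr_le0_ge0 ?sqr_ge0// mulr_ge0_le0 ?(ltW u0)// mulr_ge0 ?powR_ge0.
(* D is nonpositive, while by the equation its integral is nonnegative: where w is nonzero the
   truncated nonlinearity equals h x 0 >= 0. Hence D vanishes almost everywhere. *)
have D0 : {ae lam, forall x, D x = 0}.
  have iN : intb (fun x => `|D x|) by exact: intb_norm.
  have : \int[lam]_x `|D x| = 0.
    apply/eqP; rewrite eq_le rint_ge0// andbT.
    rewrite (@ae_eq_rint _ _ _ _ _ (fun x => - D x)).
    - by rewrite rintN oppr_le0 euler mulr_ge0// ltW.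
    - exact: intb_measurable iN.
    - exact: intb_measurable (intbN iD).
    by apply: ae_mono Dle => x [d1 d2]; rewrite ler0_norm// (le_trans d1).
  move=> E; have E' : (\int[lam]_x `|D x|%:E = 0)%E by rewrite -rint_EFin// E.
  have mN : measurable_fun setT (fun x => `|D x|%:E) by apply/measurable_EFinP; exact: intb_measurable iN.
  have [A [mA A0 AD]] := ge0_integral_eq0_ae mN (fun x => normr_ge0 (D x) : (0 <= `|D x|%:E)%E) E'.
  exists A; split => //; apply: subset_trans AD => x /= nD [] /eqP.
  by rewrite normr_eq0 => /eqP.
apply: ae_mono (ae_and Dle D0) => x [[d1 d2] d3].
rewrite leNgt; apply/negP => u0; rewrite d3 in d1.
suff : b x * `|sobolev_fun u x| `^ (p - 2) * sobolev_fun u x * negsq (sobolev_fun u x) < 0 by rewrite ltNge d1.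
have b0 : 0 < b x by case/andP: (b_bnd x) => b1 _; exact: lt_le_trans b1.
rewrite nmulr_rlt0; last by rewrite pmulr_rlt0// mulr_gt0// powR_gt0// normr_gt0 lt_eqF.
by rewrite /negsq min_l ?(ltW u0)// expr2 nmulr_rgt0.
Qed.

Variables (a : 'rV[R]_n -> R) (f : 'rV[R]_n -> R -> R).
Hypotheses (ab : {ae mu, forall x, a x = b x}) (fh : {ae mu, forall x, f x = h x}).

(** Test functions are replaced by Borel representatives. Since u >= 0 almost everywhere, the
    truncation does not alter f(x, u). *)
Lemma critical_weak_solution : weak_solution p a f lambda (sobolev_fun u).
Proof.
have uG := sobolev_spaceP u; have [mu_ mG iu iG wG] := uG.
exists (sobolev_grad u); first exact: borel_sobolevP.
move=> v H /(sobolev_representative p0)[v' [H' [sv vv' HH']]].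
have wP : (v', H') \in sobolev_pair n0 np by exact/asboolP.
pose w := SobolevSpace wP; have [mv _ _ _ _] := sv.
have u0 := ae_borel_lebesgue critical_ge0.
have -> : \int[mu]_x (f x (sobolev_fun u x) * v x) = \int[lam]_x (g x (sobolev_fun u x) * sobolev_fun w x).
  apply: ae_rint_lebesgue_borel.
    by apply: measurable_funM; [exact: measurable_superposition|exact: mv].
  by apply: ae_mono (ae_and (ae_and u0 fh) vv') => x [[ux -> ->]]; rewrite /truncate max_l.
rewrite -critical_euler; apply: ae_rint_lebesgue_borel.
  exact: intb_measurable (integrable_energy_derivative mb am0 b_bnd u w).
by apply: ae_mono (ae_and (ae_and vv' HH') ab) => x [[-> ->] ->].
Qed.

End critical_points_are_solutions.

Lemma const_K_gt0 (R : realType) n (p am an r : R) : (0 < n)%N -> n%:R < p -> 0 < am ->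
  0 < an -> 0 < r -> 0 < const_K n p am an r.
Proof.
move=> n0 np am0 an0 r0; have om0 := ball_volume_gt0 R n0.
rewrite /const_K (gamma_ratioE _ n0).
have k0 : 0 < const_k n p am `^ p by rewrite powR_gt0// (const_k_gt0 n0 np am0).
have g0 : 0 < 1 / const_k n p am `^ p * (ball_volume R n)^-1 by rewrite mulr_gt0 ?divr_gt0 ?invr_gt0.
apply: mulr_gt0 g0 _; apply: divr_gt0; first exact: powR_gt0.
rewrite ltr_wpDl ?mulr_gt0 ?powR_gt0// subr_ge0; apply: ler_powR; first by rewrite ler1n.
by rewrite gerBl.
Qed.

Theorem corollary3p1 (R : realType) (N : nat) (p : R)
    (a : 'rV[R]_N -> R) (f : 'rV[R]_N -> R -> R)
    (x0 : 'rV[R]_N) (r c d : R) :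
  let mu := lebesgue_rV R N in
  let F := primitive f in
  let am := fine (ess_inf mu (EFin \o a)) in
  let an := fine (Lnorm mu +oo%E (EFin \o a)) in
  let S := eball x0 r `\` eball x0 (r / 2) in
  let IF := \int[mu]_(x in eball x0 (r / 2)) F x d in
  let Imax := \int[mu]_x max_primitive f c x in
  (1 <= N)%N -> N%:R < p ->
  a \in Lfun mu +oo%E -> 0 < am ->
  L1_caratheodory f ->
  0 < r ->
  0 < c < d ->
  {ae mu, forall x, S x -> forall t, 0 <= t <= d -> 0 <= F x t} ->
  Imax / c `^ p < const_K N p am an r * (IF / d `^ p) ->
  (forall e : R, 0 < e -> exists2 delta : R, 0 < delta &
     {ae mu, forall x, forall t, delta < `|t| -> `|F x t| <= e * `|t| `^ p}) ->
  {ae mu, forall x, 0 <= f x 0} ->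
  forall lambda : R,
    lambda1 N p am an r d IF < lambda ->
    (lambda%:E < lambda2 N p am c Imax)%E ->
  exists u1 u2 u3 : 'rV[R]_N -> R,
    [/\ weak_solution p a f lambda u1,
        weak_solution p a f lambda u2
      & weak_solution p a f lambda u3] /\
    [/\ {ae mu, forall x, 0 <= u1 x},
        {ae mu, forall x, 0 <= u2 x}
      & {ae mu, forall x, 0 <= u3 x}] /\
    [/\ ~ ae_eq mu setT u1 u2,
        ~ ae_eq mu setT u1 u3
      & ~ ae_eq mu setT u2 u3].
Proof.
move=> mu F am an S IF Imax n0 np aL am0 cf r0 /andP[c0 cd] Fge0 ineq Finf f0 lambda l1 l2.
have [b [mb b_bnd ab]] := bounded_coefficient n0 aL am0.
have [h [m [mh ch im hm fh]]] := caratheodory_data cf.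
rewrite -/am -/an in b_bnd.
set lam := @lebesgue_borel R N.
have d0 : 0 < d by exact: lt_trans cd.
have p1 : 1 < p by rewrite (le_lt_trans _ np)// ler1n.
have p0 : 0 < p by exact: lt_trans p1.
have an0 : 0 < an by case/andP: (b_bnd 0) => h1 h2; apply: lt_le_trans am0 (le_trans h1 h2).
have primE x t : f x = h x -> F x t = primitive h x t by move=> E; rewrite /F /primitive E.
have mF := measurable_primitive mh ch.
pose inner : set 'rV[R]_N := eball x0 (r / 2).
have IFE : IF = \int[lam]_x (\1_inner x * primitive h x d).
  rewrite /IF Rintegral_mkcond; apply: ae_rint_lebesgue_borel.
    by apply: measurable_funM => //; apply: measurable_indic; exact: measurable_eball.
  by apply: ae_mono fh => x fx; rewrite patch_indic /= (primE _ _ fx) mulrC.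
have ImaxE : Imax = \int[lam]_x max_primitive h c x.
  apply: ae_rint_lebesgue_borel; first exact: (measurable_max_primitive mh ch hm c0).
  by apply: ae_mono fh => x fx; rewrite /max_primitive /primitive fx.
have Imax0 : 0 <= Imax by rewrite ImaxE; apply: rint_ge0 => x; exact: (max_primitive_ge0 ch hm c0).
set K := const_K N p am an r in ineq.
have K0 : 0 < K by exact: const_K_gt0.
set kp := const_k N p am `^ p.
have kp0 : 0 < kp by rewrite powR_gt0// (const_k_gt0 n0 np am0).
have cp0 : 0 < c `^ p by rewrite powR_gt0.
have dp0 : 0 < d `^ p by rewrite powR_gt0.
(* The left side of (iii) is nonnegative, because t = 0 competes in the maximum; strictness then
   forces IF > 0. *)
have IF0 : 0 < IF.
  have : 0 < K * (IF / d `^ p) by apply: le_lt_trans ineq; rewrite divr_ge0// ltW.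
  by rewrite pmulr_rgt0// pmulr_lgt0// invr_gt0.
have lambda0 : 0 < lambda.
  apply: lt_trans l1; rewrite /lambda1 mulr_gt0 ?divr_gt0//.
  exact: mulr_gt0 (mulr_gt0 p0 kp0) K0.
have l1' : d `^ p / (p * (kp * K)) < lambda * IF.
  rewrite -ltr_pdivrMr//; apply: le_lt_trans l1; rewrite /lambda1 -/kp -/K le_eqVlt.
  by apply/orP; left; apply/eqP; field; rewrite !gt_eqF.
have l2' : lambda * Imax < c `^ p / (p * kp).
  (* When Imax = 0 the bound lambda2 is infinite, but then the left side is 0. *)
  move: l2; rewrite /lambda2 -/kp; case: eqVneq => [-> _|I0].
    by rewrite mulr0 divr_gt0// mulr_gt0.
  have I00 : 0 < Imax by rewrite lt_def I0.
  rewrite lte_fin -(ltr_pM2r I00) => /lt_le_trans; apply.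
  by rewrite le_eqVlt; apply/orP; left; apply/eqP; field; rewrite !gt_eqF.
pose g := truncate h.
have mg := measurable_truncate mh; have cg := continuous_truncate ch; have gm := truncate_le hm.
have h0 : {ae lam, forall x, 0 <= h x 0}.
  by apply: ae_lebesgue_borel; apply: ae_mono (ae_and fh f0) => x [<-].
have gneg : {ae lam, forall x t, t <= 0 -> primitive g x t <= 0}.
  apply: ae_mono h0 => x hx t t0; rewrite primitive_truncate_le0//.
  by rewrite mulr_ge0_le0.
have Fcoer (e : R) : 0 < e -> exists2 delta : R, 0 < delta &
    {ae lam, forall x, forall t, delta < `|t| -> primitive g x t <= e * `|t| `^ p}.
  move=> e0; have [delta delta0 hd] := Finf e e0; exists delta => //.
  have hd' : {ae lam, forall x t, delta < `|t| -> `|primitive h x t| <= e * `|t| `^ p}.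
    apply: ae_lebesgue_borel; apply: ae_mono (ae_and fh hd) => x [fx hx] t dt.
    by rewrite -(primE _ _ fx); exact: hx.
  apply: ae_mono (ae_and hd' gneg) => x [hx hn] t dt; have [t0|t0] := leP 0 t.
    by rewrite (primitive_truncate_ge0 _ _ t0); apply: (le_trans (ler_norm _)); exact: hx.
  by apply: (le_trans (hn t (ltW t0))); rewrite mulr_ge0 ?powR_ge0// ltW.
have gmax : {ae lam, forall x, forall t, `|t| <= c -> primitive g x t <= max_primitive h c x}.
  apply: ae_mono gneg => x hn t tc; have [t0|t0] := leP 0 t.
    by rewrite (primitive_truncate_ge0 _ _ t0); exact: (primitive_le_max ch hm).
  by apply: (le_trans (hn t (ltW t0))); exact: (max_primitive_ge0 ch hm c0).
have coneP : (cone x0 r d, cone_grad x0 r d) \in sobolev_pair n0 np.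
  by apply/asboolP; exact: borel_sobolev_cone.
pose ub := SobolevSpace coneP.
have ub_le : sobolev_energy b ub <= d `^ p / (p * (kp * K)).
  rewrite /sobolev_energy invfM mulrCA ler_wpM2l ?invr_ge0 ?(ltW p0)//.
  exact: cone_energy_le.
have ub_c : c `^ p / (p * kp) <= sobolev_energy b ub.
  (* The sup bound holds almost everywhere and the inner ball has positive measure, so it holds at
     some point where the cone equals d > c. *)
  have [x [xin hx]] : exists x, inner x /\
      `|sobolev_fun ub x| `^ p <= kp * (p * sobolev_energy b ub).
    apply: contrapT => nex; have [A [mA A0 AP]] := sobolev_sup_bound mb am0 b_bnd ub.
    have sub : inner `<=` A.
      by move=> x xin; apply: AP => /= hx; apply: nex; exists x.
    have r20 : 0 <= r / 2 by rewrite divr_ge0// ltW.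
    have : (lam inner <= lam A)%E by apply: le_measure; rewrite ?inE//; exact: measurable_eball.
    rewrite [X in (_ <= X)%E]A0 [X in (X <= _)%E](lam_eball x0 r20 n0) lee_fin leNgt.
    by rewrite mulr_gt0 ?exprn_gt0 ?divr_gt0// ball_volume_gt0.
  have E : sobolev_fun ub x = d by apply: tent_inner => //; exact: ltW.
  rewrite E gtr0_norm// in hx.
  rewrite ler_pdivrMr ?mulr_gt0//; apply: (@le_trans _ _ (d `^ p)).
    by apply: (ge0_ler_powR (ltW p0)); rewrite ?nnegrE ?(ltW c0) ?(ltW d0) ?(ltW cd).
  by apply: (le_trans hx); rewrite mulrA mulrC (mulrC kp).
have ub_J : sobolev_energy b ub < nonlinear_energy g lambda ub.
  apply: (le_lt_trans ub_le); apply: (lt_le_trans l1').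
  rewrite /nonlinear_energy ler_wpM2l ?(ltW lambda0)// IFE.
  have ubM : {ae lam, forall x, `|sobolev_fun ub x| <= d}.
    apply: aeW => x; have /andP[t0 t1] := tent_bounds r d0 (enorm (x - x0)).
    by rewrite ger0_norm.
  have [mub _ _ _ _] := sobolev_spaceP ub.
  have [_ _ iF _] := integrable_superposition mg cg im gm mub ubM.
  have iI : lam.-integrable setT (EFin \o (fun x => \1_inner x * primitive h x d)).
    apply: (@intb_le _ _ _ _ _ (fun x => d * m d x)); last 1 first.
    - move=> x; rewrite normrM (ger0_norm (_ : 0 <= \1_inner x))//.
      have hb := primitive_le ch hm x (_ : `|d| <= d).
      rewrite gtr0_norm// in hb; have {}hb := hb (lexx d).
      rewrite mulrC; apply: le_trans (_ : `|primitive h x d| <= _); last by rewrite mulrC.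
      by rewrite ler_piMr// indicE lern1 leq_b1.
    - by apply: measurable_funM => //; apply: measurable_indic; exact: measurable_eball.
    - exact: intbZ.
  apply: ae_le_rint => //.
  (* On the inner ball the cone equals d; on the annulus its values lie in [0, d] and (ii) applies;
     elsewhere it vanishes. *)
  apply: ae_mono (ae_lebesgue_borel (ae_and fh Fge0)) => x [fx hx].
  have /andP[t0 t1] := tent_bounds r d0 (enorm (x - x0)).
  rewrite (primitive_truncate_ge0 _ _ (t0 : 0 <= sobolev_fun ub x)).
  have [xin|xout] := ltP (enorm (x - x0)) (r / 2).
    rewrite indicE mem_set// mul1r.
    by have -> : sobolev_fun ub x = d by apply: tent_inner => //; exact: ltW.
  rewrite indicE memNset ?mul0r; last by move=> /= hlt; move: hlt; rewrite /inner /eball /= ltNge xout.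
  have [xr|xr] := ltP (enorm (x - x0)) r.
    rewrite -(primE _ _ fx); apply: hx; last by rewrite t0.
    by split => //=; rewrite /eball /= => hlt; move: hlt; rewrite ltNge xout.
  have -> : sobolev_fun ub x = 0 by exact: tent_outer.
  by have -> : primitive h x 0 = 0 := primitive0 (h x).
have lMx : lambda * \int[lam]_x max_primitive h c x < c `^ p / (p * kp) by rewrite -ImaxE.
have [u1 [u2 [u3 [[c1 c2 c3] [n12 n13 n23]]]]] := three_distinct_critical_points mb am0 b_bnd mg cg im gm
  lambda0 Fcoer c0 (integrable_max_primitive mh ch im hm c0) gmax lMx ub_c ub_J.
exists (sobolev_fun u1), (sobolev_fun u2), (sobolev_fun u3); split; [|split].
- by split; apply: (critical_weak_solution mb am0 b_bnd mh ch im hm lambda0 h0).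
- by split; apply: ae_borel_lebesgue; apply: (critical_ge0 mb am0 b_bnd mh ch im hm lambda0 h0).
by split => E; [apply: n12|apply: n13|apply: n23]; apply: ae_lebesgue_borel;
  apply: ae_mono E => x; exact.
Qed.
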